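(* Fix $\gamma>-1$. (a) The operator $(I_0^Hx^{2+2\gamma})^*\colon L^2_+(\mathcal G_H,\mu_H^{-2\gamma}d\beta\,da)\to L^2(\mathbb D_H,x^{2\gamma+3}dV_H)$ has kernel $$\ker(I_0^Hx^{2+2\gamma})^*=\overline{\mathrm{span}}\{\psi^{\gamma,H}_{n,k}:\ n\ge0,\ k<0\text{ or }k>n\}.$$ (b) The singular value decomposition of $I_0^Hx^{2+2\gamma}\colon L^2(\mathbb D_H,x^{2\gamma+3}dV_H)\to L^2_+(\mathcal G_H,\mu_H^{-2\gamma}d\beta\,da)/\ker(I_0^Hx^{2+2\gamma})^*$ is given by $\big(\widehat{\Phi^*Z^\gamma_{n,k}},\ \psi^{\gamma,H}_{n,k},\ \sigma^\gamma_{n,k}\big)_{n\ge0,\,0\le k\le n}$, where $\widehat{\Phi^*Z^\gamma_{n,k}}$ is $\Phi^*Z^\gamma_{n,k}$ normalized in $L^2(\mathbb D_H,x^{2\gamma+3}dV_H)$ and $\sigma^\gamma_{n,k}>0$ satisfies $$(\sigma^\gamma_{n,k})^2=\frac{2^{2\gamma+2}\pi}{n+1}\,\frac{B(n-k+1+\gamma,\,k+1+\gamma)}{B(n-k+1,\,k+1)},$$ with $B(x,y)=\Gamma(x)\Gamma(y)/\Gamma(x+y)$ the Beta function.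
   Context: Hyperbolic side: $\mathbb D_H=\{|z|\le1\}$, interior with Poincaré metric $g_H=c^{-2}|dz|^2$, $c=(1-|z|^2)/2$, volume $dV_H$, $x=\frac{1-|z|^2}{1+|z|^2}$; $\mathcal G_H=\mathbb S^1_\beta\times\mathbb R_a$, $\gamma_{\beta,a}(t)=e^{i\beta}\frac{(2+ia)\tanh(t/2)+ia}{ia\tanh(t/2)-2+ia}$, $I_0^Hf(\beta,a)=\int_{\mathbb R}f(\gamma_{\beta,a}(t))dt$, $\mu_H(a)=(1+a^2)^{-1/2}$, $\mathcal S^H_A(\beta,a)=(\beta+\pi+2\tan^{-1}a,-a)$, and $L^2_+(\mathcal G_H,\mu_H^{-2\gamma}d\beta da)$ is the subspace of $\mathcal S^H_A$-invariant functions in $L^2(\mathcal G_H,\mu_H^{-2\gamma}d\beta da)$. The operator $I_0^Hx^{2+2\gamma}$ is bounded between these spaces. Euclidean side: $\mathbb D_E=\{|z|\le1\}$ with Euclidean volume $dV_E$, $\partial_+S\mathbb D_E=\mathbb S^1_\beta\times[-\pi/2,\pi/2]_\alpha$ (point $e^{i\beta}$, direction $e^{i(\beta+\pi+\alpha)}$), $\mu(\beta,\alpha)=\cos\alpha$. For a function $h$ on $\partial_+S\mathbb D_E$ define the Euclidean backprojection $(I_0^E)^\sharp h(z)=\int_0^{2\pi}h(\beta(z,\theta),\alpha(z,\theta))\,d\theta$, where $(\beta(z,\theta),\alpha(z,\theta))$ is the point of $\partial_+S\mathbb D_E$ from which the oriented line through $z$ with direction $e^{i\theta}$ enters the disk (so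 $\theta\equiv\beta+\pi+\alpha$). Let $p_n^\gamma$ be the degree-$n$ polynomial on $[-1,1]$, a multiple of the Jacobi polynomial $P_n^{(\gamma+1/2,\gamma+1/2)}$, normalized by $\int_{-1}^1(p_n^\gamma(y))^2(1-y^2)^{\gamma+1/2}dy=(2\pi)^{-1}$. Set $\psi^\gamma_{n,k}(\beta,\alpha)=(\cos\alpha)^{2\gamma+1}e^{i(n-2k)(\beta+\alpha+\pi/2)}p_n^\gamma(\sin\alpha)$, $Z^\gamma_{n,k}=(I_0^E)^\sharp(\mu^{-2\gamma-1}\psi^\gamma_{n,k})$ ($n\ge0$, $0\le k\le n$), and $\psi^{\gamma,H}_{n,k}(\beta,a)=\mu_H(a)\,\psi^\gamma_{n,k}(\beta,\tan^{-1}a)$ ($n\ge0$, $k\in\mathbb Z$). Finally $\Phi\colon\mathbb D_H\to\mathbb D_E$, $\Phi(z)=\frac{2z}{1+|z|^2}$. *)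

(* Defs.v *)
(* R : realType, complex numbers R[i] from
   mathcomp-real-closed (realType is a real closed field). *)
From HB Require Import structures.
From mathcomp Require Import all_boot all_order all_algebra.
From mathcomp Require Import all_classical all_reals all_analysis.
From mathcomp Require Import complex.
Set Implicit Arguments. Unset Strict Implicit. Unset Printing Implicit Defensive.
Import Order.TTheory GRing.Theory Num.Theory.
Import numFieldNormedType.Exports.
Local Open Scope classical_set_scope.
Local Open Scope ring_scope.
Local Open Scope complex_scope.

Section Defs.
Variable R : realType.
Local Notation C := R[i].
Local Notation mu := (@lebesgue_measure R).

(* Lebesgue measure on R x R = C (points z = (Re z, Im z), or (beta, a)) *)
Definition mu2 := (mu \x mu)%E.

(* ---------- complex helpers ---------- *)
Definition cRe (z : C) : R := complex.Re z.
Definition cIm (z : C) : R := complex.Im z.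
Definition expi (t : R) : C := cos t +i* sin t.          (* e^{it} *)
Definition sqn (z : C) : R := cRe z ^+ 2 + cIm z ^+ 2.    (* |z|^2 *)
Definition ofC (z : C) : R * R := (cRe z, cIm z).
Definition toC (z : R * R) : C := z.1 +i* z.2.
(* integral over D of a complex-valued function (real and imaginary parts) *)
Definition cint (D : set R) (h : R -> C) : C :=
  Rintegral mu D (cRe \o h) +i* Rintegral mu D (cIm \o h).

(* ---------- weighted L^2 spaces of complex functions on subsets of R^2 ------ *)
Definition L2mem (D : set (R * R)) (w : R * R -> R) (f : R * R -> C) : Prop :=
  [/\ measurable_fun D (cRe \o f), measurable_fun D (cIm \o f) &
      mu2.-integrable D (fun z => (sqn (f z) * w z)%:E)].
Definition l2norm (D : set (R * R)) (w : R * R -> R) (f : R * R -> C) : R :=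
  Num.sqrt (Rintegral mu2 D (fun z => sqn (f z) * w z)).
(* <f, g> = int_D f conj(g) w *)
Definition l2inner (D : set (R * R)) (w : R * R -> R) (f g : R * R -> C) : C :=
  Rintegral mu2 D (fun z => cRe (f z * (g z)^*) * w z) +i*
  Rintegral mu2 D (fun z => cIm (f z * (g z)^*) * w z).

(* ---------- hyperbolic disk ---------- *)
Definition nsq (z : R * R) : R := z.1 ^+ 2 + z.2 ^+ 2.      (* |z|^2 *)
Definition DH : set (R * R) := [set z | nsq z < 1].          (* interior *)
Definition cH (z : R * R) : R := (1 - nsq z) / 2.
Definition xH (z : R * R) : R := (1 - nsq z) / (1 + nsq z).
(* dV_H = c^{-2} dx dy ; weight of L^2(D_H, x^{2 gam + 3} dV_H) *)
Definition volH (z : R * R) : R := (cH z) ^- 2.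
Definition w1 (gam : R) (z : R * R) : R := xH z `^ (2 * gam + 3) * volH z.
Definition H1 (gam : R) (f : R * R -> C) : Prop := L2mem DH (w1 gam) f.

(* ---------- space of hyperbolic geodesics G_H = S^1_beta x R_a ---------- *)
(* S^1 is represented by 2 pi - periodic functions, integrated over [0, 2pi[ *)
Definition GH : set (R * R) := [set q | 0 <= q.1 < 2 * pi].
Definition muH (a : R) : R := (1 + a ^+ 2) `^ (- 2^-1).
Definition w2 (gam : R) (q : R * R) : R := muH q.2 `^ (- (2 * gam)).
Definition SAH (q : R * R) : R * R := (q.1 + pi + 2 * atan q.2, - q.2).
(* L^2_+(G_H, mu_H^{-2 gam} dbeta da) : S_A^H-invariant elements *)
Definition H2 (gam : R) (g : R * R -> C) : Prop :=
  [/\ (forall b a, g (b + 2 * pi, a) = g (b, a)),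
      L2mem GH (w2 gam) g &
      {ae mu2, forall q, GH q -> g (SAH q) = g q}].

Definition tanh (t : R) : R := (expR t - expR (- t)) / (expR t + expR (- t)).
(* gamma_{beta,a}(t) *)
Definition geodH (b a t : R) : C :=
  expi b * (((2%:C + 'i * a%:C) * (tanh (t / 2))%:C + 'i * a%:C) /
            ('i * a%:C * (tanh (t / 2))%:C - 2%:C + 'i * a%:C)).
(* (I_0^H x^{2+2gam}) f (beta, a) = int_R x^{2+2gam}(gamma(t)) f(gamma(t)) dt *)
Definition IH (gam : R) (f : R * R -> C) (q : R * R) : C :=
  cint setT (fun t => (xH (ofC (geodH q.1 q.2 t)) `^ (2 + 2 * gam))%:C *
                      f (ofC (geodH q.1 q.2 t))).

(* kernel of the adjoint (I_0^H x^{2+2gam})^* on L^2_+ :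
   g with <(I_0^H x^{2+2 gam}) f, g> = <f, (I_0^H x^{2+2gam})^* g> = 0 for all f *)
Definition kerAdj (gam : R) : set (R * R -> C) :=
  [set g | H2 gam g /\
     forall f, H1 gam f -> l2inner GH (w2 gam) (IH gam f) g = 0].

(* quotient norm and inner product of L^2_+ / ker (I_0^H x^{2+2gam})^* *)
Definition qnorm (gam : R) (h : R * R -> C) : R :=
  inf [set l2norm GH (w2 gam) (fun q => h q - k q) | k in kerAdj gam].
Definition qinner (gam : R) (h1 h2 : R * R -> C) : C :=
  (4^-1)%:C * \sum_(m < 4) 'i ^+ m *
     ((qnorm gam (fun q => h1 q + 'i ^+ m * h2 q)) ^+ 2)%:C.

(* ---------- Jacobi polynomials ---------- *)
Definition gbinom (r : R) (m : nat) : R :=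
  (\prod_(j < m) (r - j%:R)) / (m`!)%:R.
(* P_n^{(a,b)}(y) = sum_s C(n+a, n-s) C(n+b, s) ((y-1)/2)^s ((y+1)/2)^(n-s) *)
Definition jacobi (a b : R) (n : nat) : {poly R} :=
  \sum_(s < n.+1) (gbinom (n%:R + a) (n - s) * gbinom (n%:R + b) s) *:
     ((('X - 1) * (2^-1)%:P) ^+ s * (('X + 1) * (2^-1)%:P) ^+ (n - s)).
(* p is an admissible choice of the family p_n^gam *)
Definition is_pgam (gam : R) (p : nat -> {poly R}) : Prop :=
  forall n : nat,
    [/\ size (p n) = n.+1,
        exists c : R, p n = c *: jacobi (gam + 2^-1) (gam + 2^-1) n &
        (\int[mu]_(y in `[(-1)%R, 1%R]) ((p n).[y] ^+ 2 * (1 - y ^+ 2) `^ (gam + 2^-1))%:E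
           = ((2 * pi)^-1)%:E)%E].

(* ---------- the functions psi ---------- *)
Definition psiE (gam : R) (p : nat -> {poly R}) (n : nat) (k : int) (b al : R) : C :=
  ((cos al) `^ (2 * gam + 1))%:C * expi ((n%:R - 2 * k%:~R) * (b + al + pi / 2)) *
  ((p n).[sin al])%:C.
Definition psiH (gam : R) (p : nat -> {poly R}) (n : nat) (k : int) (q : R * R) : C :=
  (muH q.2)%:C * psiE gam p n k q.1 (atan q.2).

(* ---------- Euclidean backprojection ---------- *)
(* entry point of the oriented line through z with direction e^{i th} *)
Definition entryPt (z : R * R) (th : R) : C :=
  let d := expi th in
  let s := cRe (toC z * d^*) + Num.sqrt (cRe (toC z * d^*) ^+ 2 + 1 - nsq z) in
  toC z - s%:C * d.
(* alpha in [-pi/2, pi/2] with e^{i th} = e^{i(beta + pi + alpha)}, e^{i beta} = entry pt *)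
Definition alE (z : R * R) (th : R) : R := asin (cIm (- expi th * (entryPt z th)^*)).
Definition beE (z : R * R) (th : R) : R := th - pi - alE z th.
Definition backprojE (h : R -> R -> C) (z : R * R) : C :=
  cint `[0, 2 * pi] (fun th => h (beE z th) (alE z th)).
(* mu(beta, alpha) = cos alpha ;  Z = (I_0^E)^# (mu^{-2gam-1} psi) *)
Definition ZE (gam : R) (p : nat -> {poly R}) (n k : nat) : R * R -> C :=
  backprojE (fun b al => ((cos al) `^ (- (2 * gam + 1)))%:C * psiE gam p n k b al).

Definition PhiHE (z : R * R) : R * R :=
  ((2 / (1 + nsq z)) * z.1, (2 / (1 + nsq z)) * z.2).
Definition PhiZ (gam : R) (p : nat -> {poly R}) (n k : nat) : R * R -> C :=
  ZE gam p n k \o PhiHE.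
(* normalized in L^2(D_H, x^{2gam+3} dV_H) *)
Definition PhiZhat (gam : R) (p : nat -> {poly R}) (n k : nat) (z : R * R) : C :=
  ((l2norm DH (w1 gam) (PhiZ gam p n k))^-1)%:C * PhiZ gam p n k z.

(* ---------- Gamma and Beta functions ---------- *)
Definition GammaF (x : R) : R :=
  Rintegral mu `]0, +oo[ (fun t => t `^ (x - 1) * expR (- t)).
Definition BetaF (x y : R) : R := GammaF x * GammaF y / GammaF (x + y).
Definition sigma2 (gam : R) (n k : nat) : R :=
  2 `^ (2 * gam + 2) * pi / (n%:R + 1) *
  (BetaF (n%:R - k%:R + 1 + gam) (k%:R + 1 + gam) / BetaF (n%:R - k%:R + 1) (k%:R + 1)).

(* closed span in L^2(G_H, mu_H^{-2gam}) of psi^H_{n,k} with (n,k) in S *)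
Definition inClosedSpanH (gam : R) (p : nat -> {poly R}) (S : nat -> int -> bool)
    (g : R * R -> C) : Prop :=
  forall eps : R, 0 < eps -> exists s : seq (nat * int * C),
    all (fun x => S x.1.1 x.1.2) s /\
    l2norm GH (w2 gam) (fun q => g q - \sum_(x <- s) x.2 * psiH gam p x.1.1 x.1.2 q) < eps.

End Defs.

(* Main.v *)
(* The map [Phi] carries hyperbolic geodesics to chords of the Euclidean disc.  With
   [phi = beta + atan a - pi/2] and [y = sin (atan a)] the angle and the height of the chord,
   [I_0^H x^(2+2gam) f] is [cos (atan a)] times the integral of [f o Phi^-1] against
   [(1 - |z|^2)^gam] along the chord, and the transpose of this chord transform is the Euclidean
   backprojection; hence [<I f, psi_nk> = <f, Phi^* Z_nk>] for all [f].

   In the coordinates [(phi, y)] the [psi_nk] are products of exponentials in [phi] and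
   orthogonal polynomials in [y].  They form an orthonormal basis of [L^2_+]: trigonometric
   polynomials are dense because the functions [(1 - u^N)^(N 2^N)], with [u] in the algebra,
   converge to indicators of quadrants, and the invariance under [S_A^H] leaves the exponentials
   of frequency [m] with [n - m] even.

   The chord transform of [z^i conj(z)^j] is [e^(i(i-j)phi) (1 - y^2)^(gam+1/2)] times a
   polynomial of degree at most [i + j] in [y] whose top coefficient is a Beta integral.  So
   [Z_nk], a polynomial of degree [n] in [z] and [conj z], is orthogonal to all polynomials of
   lower degree, the [Z_nk] are pairwise orthogonal, and [|Z_nk|^2 = sigma_nk^2] is read off from
   the leading coefficients.  For [k < 0] or [k > n] the backprojection of the corresponding
   function vanishes.  Therefore [I (Phi^* Z_nk) = sigma_nk^2 psi_nk], and the kernel of the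
   adjoint and the singular value decomposition follow by approximation in the basis. *)
Require Import Defs.
From HB Require Import structures.
From mathcomp Require Import all_boot all_order all_algebra.
From mathcomp Require Import all_classical all_reals all_analysis.
From mathcomp Require Import measurable_realfun measurable_fun_approximation.
From mathcomp Require Import complex.
From mathcomp Require Import zify ring lra.
Import Order.TTheory GRing.Theory Num.Theory.
Import numFieldNormedType.Exports.
Local Open Scope classical_set_scope.
Local Open Scope ring_scope.
Local Open Scope complex_scope.
Set Implicit Arguments. Unset Strict Implicit. Unset Printing Implicit Defensive.


(** * Changes of variables *)

(** For [-1 < gam < 0] the weight [(1 - |z|^2)^gam] is unbounded and [f] is merely measurable, so no
    substitution may assume a continuous integrand. Changes of variables are therefore equalities of
    measures, tested on nonnegative measurable functions and then transferred to signed and complex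
    ones. The resulting identities hold at every geodesic, even where the chord integral diverges
    and has only a default value. The weight on chords is forced: a chord at height [y] has
    half-length [(1 - y^2)^(1/2)] and mass proportional to [(1 - y^2)^(gam + 1/2)]. By
    Cauchy-Schwarz on each chord, the transform divided by that mass lies in the L2 space where the
    [p n] are orthogonal. The top coefficient in [y] of a chord integral arises by replacing
    [c^2 = 1 - y^2] with [- y^2], which leaves the integral of [(1 - u)^i (1 + u)^j] against
    [(1 - u^2)^gam]; this is the source of the Beta quotient. The adjoint is never constructed: its
    kernel is described by orthogonality, and images are identified by comparing coefficients in a
    complete system. *)

Definition dens d (T : measurableType d) (R : realType)
    (m : {measure set T -> \bar R}) (J : T -> R) (A : set T) : \bar R :=
  (\int[m]_(x in A) (`|J x|)%:E)%E.

Section density.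
Context d (T : measurableType d) (R : realType) (m : {measure set T -> \bar R}).
Variables (J : {mfun T >-> R}).
Local Open Scope ereal_scope.
Import HBNNSimple.

Let mJ (A : set T) : measurable_fun A (fun x => (`|J x|%R)%:E).
Proof. by apply/measurable_EFinP; apply: measurableT_comp => //; apply: measurable_funTS. Qed.

Let dens0 : dens m J set0 = 0. Proof. exact: integral_set0. Qed.
Let dens_ge0 A : 0 <= dens m J A.
Proof. by apply: integral_ge0 => x _; rewrite lee_fin. Qed.

Let dens_sigma_additive : semi_sigma_additive (dens m J).
Proof.
move=> A mA tA mUA; rewrite /dens ge0_integral_bigcup//.
by apply: is_cvg_ereal_nneg_natsum_cond => n _ _; exact: dens_ge0.
Qed.

(** The absolute value in [dens] makes this a measure for every measurable [J]. *)
HB.instance Definition _ := isMeasure.Build _ _ _ (dens m J)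
  dens0 dens_ge0 dens_sigma_additive.

(** Both sides pass to the limit along increasing simple functions; on an indicator the identity is
    the definition of [dens]. *)
Lemma ge0_integral_dens (G : T -> \bar R) :
  measurable_fun setT G -> (forall x, 0 <= G x) ->
  \int[dens m J]_x G x = \int[m]_x (G x * (`|J x|)%:E).
Proof.
move=> mG G0; pose g := nnsfun_approx measurableT mG.
transitivity (limn (fun n => \int[dens m J]_x (g n x)%:E)).
  rewrite -monotone_convergence//.
  - apply: eq_integral => x _; apply/esym/cvg_lim => //.
    exact: cvg_nnsfun_approx.
  - by move=> n; exact/measurable_EFinP/measurable_funTS.
  - by move=> n x _; rewrite lee_fin.
  - by move=> x _ p q pq; rewrite lee_fin; exact/lefP/nd_nnsfun_approx.
transitivity (limn (fun n => \int[m]_x ((g n x)%:E * (`|J x|)%:E))); last first.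
  rewrite -monotone_convergence//.
  - apply: eq_integral => x _; apply/cvg_lim => //.
    apply: cvgeMr => //; exact: cvg_nnsfun_approx.
  - move=> n; apply: emeasurable_funM => //.
    exact/measurable_EFinP/measurable_funTS.
  - by move=> n x _; rewrite mule_ge0// lee_fin.
  - move=> x _ p q pq; apply: lee_wpmul2r; first by rewrite lee_fin.
    by rewrite lee_fin; exact/lefP/nd_nnsfun_approx.
congr (limn _); apply/funext => n.
under [LHS]eq_integral do rewrite fimfunE -fsumEFin//.
rewrite ge0_integral_fsum//; last 2 first.
- by move=> y; apply/measurable_EFinP; apply: measurable_funM => //.
- by move=> y x _; rewrite nnfun_muleindic_ge0.
transitivity (\sum_(k \in range (g n))
    \int[m]_x ((k * \1_(g n @^-1` [set k]) x)%:E * (`|J x|)%:E)).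
  apply: eq_fsbigr => k _.
  have [k0|k0] := leP 0%R k; last first.
    rewrite preimage_nnfun0// indic0 !integral0_eq// => x _.
    - by rewrite mulr0 mul0e.
    - by rewrite mulr0.
  rewrite integralZl_indic_nnsfun// integral_indic// setIT [in LHS]/= /dens.
  under [RHS]eq_integral do rewrite EFinM -muleA.
  rewrite ge0_integralZl//.
  - congr (_ * _); rewrite integral_mkcond; apply: eq_integral => x _.
    by rewrite patchE indicE; case: ifPn => _; rewrite ?mul1e ?mul0e.
  - by apply: emeasurable_funM => //; exact/measurable_EFinP.
rewrite -ge0_integral_fsum//; last 2 first.
- by move=> y; apply: emeasurable_funM => //; apply/measurable_EFinP; apply: measurable_funM.
- by move=> y x _; rewrite mule_ge0 ?nnfun_muleindic_ge0.
apply: eq_integral => x _; rewrite [in RHS]fimfunE -fsumEFin// ge0_mule_fsuml// => y.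
exact: nnfun_muleindic_ge0.
Qed.

End density.


(** The existential hides the packaging of [J] and [phi] as bundled measurable functions. Of [nu],
    the image of the measure with density [J], only the values and the integrals are used later. *)
Lemma exists_pushforward_density d d' (T : measurableType d) (T' : measurableType d')
    (R : realType) (m : {measure set T -> \bar R}) (J : T -> R) (phi : T -> T') :
  measurable_fun setT J -> (forall x, 0 <= J x) -> measurable_fun setT phi ->
  exists nu : {measure set T' -> \bar R},
    (forall A, nu A = \int[m]_(x in phi @^-1` A) (J x)%:E)%E /\
    (forall G : T' -> \bar R, measurable_fun setT G -> (forall x, 0 <= G x)%E ->
      (\int[nu]_y G y = \int[m]_x (G (phi x) * (J x)%:E))%E).
Proof.
move=> mJ J0 mphi.
pose J_mixin := isMeasurableFun.Build _ _ _ _ J mJ.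
pose Jm : {mfun T >-> R} := HB.pack J J_mixin.
pose phi_mixin := isMeasurableFun.Build _ _ _ _ phi mphi.
pose phim : {mfun T >-> T'} := HB.pack phi phi_mixin.
exists (pushforward (dens m Jm) phim); split.
  move=> A; rewrite /= /pushforward /dens; apply: eq_integral => x _.
  by rewrite /= ger0_norm.
move=> G mG G0.
have mGphi : measurable_fun setT (G \o phi) := measurableT_comp mG mphi.
transitivity (\int[dens m Jm]_x (G (phi x)))%E.
  exact: (@ge0_integral_pushforward _ _ _ _ _ phi mphi (dens m Jm) setT G
    measurableT mG (fun y _ => G0 y)).
rewrite (@ge0_integral_dens _ _ _ m Jm (G \o phi) mGphi (fun x => G0 _)).
by apply: eq_integral => x _; rewrite /= ger0_norm.
Unshelve. exact: mphi.
Qed.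

(** * Increasing substitutions on the line *)

Section integration_by_substitution.
Variable R : realType.
Local Notation mu := (@lebesgue_measure R).
Variables (phi dphi : R -> R).
Hypotheses (mphi : measurable_fun setT phi) (mdphi : measurable_fun setT dphi).

Section compact.
Variables (a b : R).
Hypothesis (ab : a < b).
Hypothesis dphiE : forall x, a <= x <= b -> is_derive x 1 phi (dphi x).
Hypothesis cdphi : forall x, a <= x <= b -> {for x, continuous dphi}.
Hypothesis dphi_gt0 : forall x, a <= x <= b -> 0 < dphi x.

Let dphiD x : a <= x <= b -> derivable phi x 1. Proof. by move=> /dphiE[]. Qed.

Let cphi : {within `[a, b], continuous phi}.
Proof.
apply/continuous_in_subspaceT => x; rewrite inE/= in_itv/= => xab.
by apply: differentiable_continuous; apply/derivable1_diffP; exact: dphiD.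
Qed.

Let incr : {in `[a, b] &, {homo phi : x y / x < y}}.
Proof.
apply: gtr0_derive1_lt_cc => // x /=.
  rewrite in_itv/= => /andP[ax xb].
  by apply: dphiD; rewrite !ltW.
rewrite in_itv/= => /andP[ax xb]; have xab : a <= x <= b by rewrite !ltW.
by have dx := dphiE xab; rewrite derive1E derive_val dphi_gt0.
Qed.

Let leincr x y : a <= x -> x <= y -> y <= b -> phi x <= phi y.
Proof.
move=> ax; rewrite le_eqVlt => /predU1P[->//|xy] yb.
by apply: ltW; apply: incr => //; rewrite in_itv/= ?ax ?yb ?(ltW (le_lt_trans ax xy)) ?(ltW (lt_le_trans xy yb)).
Qed.

Let ltphi x y : x \in `[a, b] -> y \in `[a, b] -> (phi x < phi y) = (x < y).
Proof.
move=> xab yab; apply/idP/idP; last exact: incr.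
apply: contraTT; rewrite -!leNgt le_eqVlt => /predU1P[->//|yx].
by apply: ltW; apply: incr.
Qed.

Let FTC x y : a <= x -> x < y -> y <= b ->
  (\int[mu]_(z in `]x, y]) (dphi z)%:E = (phi y - phi x)%:E)%E.
Proof.
move=> ax xy yb.
have sub z : x <= z <= y -> a <= z <= b.
  by move=> /andP[xz zy]; rewrite (le_trans ax xz) (le_trans zy yb).
rewrite integral_itv_obnd_cbnd; last first.
  by apply/measurable_EFinP/measurable_funTS.
rewrite (@continuous_FTC2 _ dphi phi x y xy) ?EFinB//.
- apply/continuous_in_subspaceT => z; rewrite inE/= in_itv/= => /sub zab.
  exact: cdphi.
- have cphix z : a <= z <= b -> {for z, continuous phi}.
    move=> zab; apply: differentiable_continuous; apply/derivable1_diffP.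
    exact: dphiD.
  split.
  + move=> z; rewrite in_itv/= => /andP[xz zy].
    by apply: dphiD; apply: sub; rewrite !ltW.
  + by apply: cvg_at_right_filter; apply: cphix; rewrite sub// lexx ltW.
  + by apply: cvg_at_left_filter; apply: cphix; rewrite sub// lexx ltW.
- move=> z; rewrite in_itv/= => /andP[xz zy]; rewrite derive1E.
  have zxy : a <= z <= b by apply: sub; rewrite !ltW.
  by have dz := dphiE zxy; rewrite derive_val.
Qed.

Let J := dphi \_ `]a, b].
Let mJ : measurable_fun setT J.
Proof. by apply/(measurable_restrictT dphi) => //; exact: measurable_funTS. Qed.
Let J_ge0 x : 0 <= J x.
Proof.
rewrite /J patchE; case: ifPn => //; rewrite inE/= in_itv/= => /andP[ax xb].
by rewrite ltW// dphi_gt0// xb ltW.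
Qed.

Let I : set (measurableTypeR R) := `]phi a, phi b]%classic.
Let mI : measurable I. Proof. exact: measurable_itv. Qed.

(** Lebesgue measure on []phi a, phi b]] and the image under [phi] of [dphi dx] on []a, b]] agree on
    half-open intervals by the fundamental theorem of calculus. These form a generating family
    closed under intersection, so the two measures coincide and the formula holds for every
    measurable [G >= 0]. *)
Lemma ge0_integration_by_substitution_oc (G : R -> \bar R) :
  measurable_fun setT G -> (forall x, (0 <= G x)%E) ->
  (\int[mu]_(y in `]phi a, phi b]) G y = \int[mu]_(x in `]a, b]) (G (phi x) * (dphi x)%:E))%E.
Proof.
move=> mG G0.
have [nu [nuE nuI]] := @exists_pushforward_density _ _ (measurableTypeR R)
  (measurableTypeR R) R mu J phi mJ J_ge0 mphi.
transitivity (\int[mrestr mu mI]_y G y)%E.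
  have mIT : mrestr mu mI (~` I) = 0%E by rewrite /mrestr setICl measure0.
  rewrite [RHS](@ge0_negligible_integral _ _ _ _ _ (~` I))//; last exact: measurableC.
  rewrite setTD setCK; apply: eq_measure_integral => A mA AI.
  by rewrite /= /mrestr setIidl.
rewrite (eq_measure_integral nu); last first.
  move=> A mA _.
  pose g n : set (measurableTypeR R) := `](- n%:R), n%:R]%classic.
  have trunc_itv (x : R) : - (Num.truncn `|x|).+1%:R < x <= (Num.truncn `|x|).+1%:R.
    by have := truncnS_gt `|x|; rewrite ltr_norml => /andP[-> /ltW ->].
  apply: (@measure_unique _ R (measurableTypeR R) (@ocitv R) g _ _ _ _ (mrestr mu mI) nu) => //.
  - exact: ocitvI.
  - by move=> n; exists (- n%:R, n%:R).
  - rewrite eqEsubset; split => // x _; exists (Num.truncn `|x|).+1 => //.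
    by rewrite /g /= in_itv; exact: trunc_itv.
  - move=> _ [[u v] _ <-].
    rewrite nuE /mrestr.
    transitivity (\int[mu]_(x in phi @^-1` `]u, v]) (((EFin \o dphi) \_ `]a, b]) x))%E; last first.
      by apply: eq_integral => x _; rewrite /J !patchE; case: ifP.
    rewrite -integral_mkcondr.
    have pab : phi a < phi b by apply: incr; rewrite ?in_itv/= ?lexx ?ltW.
    transitivity (mu `](Num.max u (phi a)), (Num.min v (phi b))]%classic).
      congr (mu _); apply/seteqP; split => x /=; rewrite !in_itv/= gt_max le_min.
        by rewrite /I /= in_itv/= => -[/andP[-> ->] /andP[-> ->]].
      by rewrite /I /= in_itv/= => /andP[/andP[-> ->] /andP[-> ->]].
    rewrite lebesgue_measure_itv/= lte_fin.
    (* Monotonicity and the intermediate value theorem make the preimage of a half-open interval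
       another half-open interval, over which the fundamental theorem integrates [dphi]. *)
    have IVT' w : phi a <= w <= phi b -> exists2 c, c \in `[a, b] & phi c = w.
      move=> wab; apply: IVT => //; first exact: ltW.
      by rewrite min_l ?max_r// ltW.
    case: ifPn => [uv|]; last first.
      rewrite -leNgt => vu; rewrite [X in (\int[_]_(_ in X) _)%E](_ : _ = set0) ?integral_set0//.
      apply/seteqP; split => // x /=; rewrite !in_itv/= => -[/andP[ux xv] /andP[ax xb]].
      have aab : a \in `[a, b] by rewrite in_itv/= lexx ltW.
      have xab : (x : R) \in `[a, b] by rewrite in_itv/= xb ltW.
      have h1 : phi a < v := lt_le_trans (incr aab xab ax) xv.
      have h2 : u < phi b := lt_le_trans ux (leincr (ltW ax) xb (lexx b)).
      move: vu; apply/negP; rewrite -ltNge gt_max !lt_min (lt_le_trans ux xv).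
      by rewrite h1 h2 pab.
    have [|al alab alE] := IVT' (Num.max u (phi a)).
      by rewrite le_max lexx orbT/= (le_trans (ltW uv))// ge_min lexx orbT.
    have [|be beab beE] := IVT' (Num.min v (phi b)).
      by rewrite (le_trans _ (ltW uv)) ?le_max ?lexx ?orbT//= ge_min lexx orbT.
    have albe : al < be by rewrite -ltphi// alE beE.
    rewrite [X in (\int[_]_(_ in X) _)%E](_ : _ = `]al, be]%classic).
      rewrite FTC// ?alE ?beE//.
        by move: alab; rewrite in_itv/= => /andP[].
      by move: beab; rewrite in_itv/= => /andP[].
    apply/seteqP; split => x /=; rewrite !in_itv/=.
      move=> [/andP[ux xv] /andP[ax xb]].
      have xab : x \in `[a, b] by rewrite in_itv/= xb ltW.
      rewrite -(ltphi alab xab) alE [x <= be]leNgt -(ltphi beab xab) beE -leNgt le_min gt_max ux xv/=.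
      have aab : a \in `[a, b] by rewrite in_itv/= lexx ltW.
      have -> : phi a < phi x by exact: incr aab xab ax.
      by rewrite (leincr (ltW ax) xb)// lexx.
    move=> /andP[alx xbe].
    move: (alab) (beab); rewrite !in_itv/= => /andP[aal alb] /andP[abe beb].
    have xab : x \in `[a, b].
      by rewrite in_itv/= (le_trans xbe beb) (le_trans aal) ?ltW.
    rewrite (le_lt_trans aal alx) (le_trans xbe beb); split => //.
    have : phi al < phi x by rewrite ltphi.
    rewrite alE gt_max => /andP[-> _] /=.
    have : phi x <= phi be by rewrite leNgt ltphi// -leNgt.
    by rewrite beE le_min => /andP[].
  - move=> k; apply: (@le_lt_trans _ _ (mu I)).
      have H : (mu (g k `&` I) <= mu I)%E.
        have mg : measurable (g k) by exact: measurable_itv.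
        by apply: le_measure; rewrite ?inE//; apply: measurableI.
      exact: H.
    by rewrite lebesgue_measure_itv/=; case: ifP => // _; rewrite -EFinB ltry.
rewrite nuI//.
rewrite [RHS]integral_mkcond; apply: eq_integral => x _ /=.
by rewrite /J !patchE; case: ifPn => //; rewrite mule0.
Qed.

End compact.

(** The intervals []c n, d n]] exhaust [J] and their preimages exhaust [I], so the formula passes to
    the union by monotone convergence. [psi] serves to name the preimages of the end points. *)
Lemma ge0_integration_by_substitution (I J : set R) (psi : R -> R) (c d : R^nat) :
  (forall x y z : R, I x -> I y -> x <= z <= y -> I z) ->
  (forall x, I x -> is_derive x 1 phi (dphi x)) ->
  (forall x, I x -> {for x, continuous dphi}) ->
  (forall x, I x -> 0 < dphi x) ->
  (forall x, I x -> J (phi x)) ->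
  (forall y, J y -> I (psi y) /\ phi (psi y) = y) ->
  (forall n, [/\ J (c n), J (d n) & c n < d n]) ->
  nonincreasing_seq c -> nondecreasing_seq d ->
  J = \bigcup_n `]c n, d n]%classic ->
  forall G : R -> \bar R,
  measurable_fun setT G -> (forall x, (0 <= G x)%E) ->
  (\int[mu]_(y in J) G y = \int[mu]_(x in I) (G (phi x) * (dphi x)%:E))%E.
Proof.
move=> Icvx Id Ic Ip IJ JI cd nc nd JE G mG G0.
have incr x y : I x -> I y -> x < y -> phi x < phi y.
  move=> Ix Iy xy; have H z : x <= z <= y -> I z by exact: Icvx.
  apply: (@gtr0_derive1_lt_cc _ phi x y) => //; rewrite ?in_itv/= ?lexx ?ltW//.
  - move=> z; rewrite in_itv/= => /andP[xz zy].
    by have [] := Id z (H _ _); rewrite ?(ltW xz) ?ltW.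
  - move=> z; rewrite in_itv/= => /andP[xz zy].
    have Iz : I z by apply: H; rewrite !ltW.
    by have dz := Id z Iz; rewrite derive1E derive_val Ip.
  - apply/continuous_in_subspaceT => z; rewrite inE/= in_itv/= => /H Iz.
    apply: differentiable_continuous; apply/derivable1_diffP.
    by have [] := Id z Iz.
have ltphi x y : I x -> I y -> (phi x < phi y) = (x < y).
  move=> Ix Iy; apply/idP/idP; last exact: incr.
  apply: contraTT; rewrite -!leNgt le_eqVlt => /predU1P[->//|yx].
  by apply: ltW; apply: incr.
have ltpsi x y : J x -> J y -> (psi x < psi y) = (x < y).
  by move=> /JI[Ix xE] /JI[Iy yE]; rewrite -ltphi// xE yE.
have IE : I = \bigcup_n `]psi (c n), psi (d n)]%classic.
  apply/seteqP; split => x.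
    move=> Ix; have := IJ _ Ix; rewrite {1}JE => -[n _] /=; rewrite in_itv/= => /andP[cx xd].
    have [Jc Jd _] := cd n; have [Ic' cE] := JI _ Jc; have [Id' dE] := JI _ Jd.
    by exists n => //=; rewrite in_itv/= -ltphi// cE cx leNgt -ltphi// dE -leNgt.
  move=> [n _] /=; rewrite in_itv/= => /andP[cx xd].
  have [Jc Jd _] := cd n; have [Ic' cE] := JI _ Jc; have [Id' dE] := JI _ Jd.
  by apply: (Icvx (psi (c n)) (psi (d n))) => //; rewrite xd ltW.
pose F n := (\int[mu]_(y in `](c n), (d n)]) G y)%E.
have FJ : F @ \oo --> (\int[mu]_(y in J) G y)%E.
  rewrite JE; apply: ge0_nondecreasing_set_cvg_integral => //.
  - move=> m n mn; rewrite subsetEset => x /=; rewrite !in_itv/= => /andP[cx xd].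
    by rewrite (le_lt_trans (nc _ _ mn) cx) (le_trans xd (nd _ _ mn)).
  - by move=> n; exact: measurable_funTS.
rewrite -(cvg_lim _ FJ)//; apply/cvg_lim => //.
rewrite IE [X in X @ _ --> _](_ : _ = (fun n => (\int[mu]_(x in `]psi (c n), psi (d n)]) (G (phi x) * (dphi x)%:E))%E)).
  apply: ge0_nondecreasing_set_cvg_integral => //.
  - apply/nondecreasing_seqP => m; rewrite subsetEset => x /=; rewrite !in_itv/= => /andP[cx xd].
    have [Jc Jd _] := cd m; have [Jc' Jd' _] := cd m.+1.
    rewrite (le_lt_trans _ cx) ?(le_trans xd)//.
      by rewrite leNgt ltpsi// -leNgt nd.
    by rewrite leNgt ltpsi// -leNgt nc.
  - move=> n; apply: measurable_funTS; apply: emeasurable_funM.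
      exact: (measurableT_comp mG mphi).
    exact/measurable_EFinP.
  - move=> n x xcd; rewrite mule_ge0// lee_fin ltW// Ip//.
    by rewrite IE; exists n.
apply/funext => n; rewrite /F.
have [Jc Jd cdn] := cd n; have [Ic' cE] := JI _ Jc; have [Id' dE] := JI _ Jd.
have sub z : psi (c n) <= z <= psi (d n) -> I z by apply: Icvx.
have ab : psi (c n) < psi (d n) by rewrite ltpsi.
have := ge0_integration_by_substitution_oc ab (fun x h => Id x (sub x h))
  (fun x h => Ic x (sub x h)) (fun x h => Ip x (sub x h)) mG G0.
by rewrite cE dE.
Qed.


Lemma open_itv_approx (h : R) : 0 < h ->
  exists c : R^nat, [/\ (forall n, 0 <= c n < h), nondecreasing_seq c,
    (forall n, - c n.+1 < c n.+1) &
    `]-h, h[%classic = \bigcup_n `](- c n.+1), (c n.+1)]%classic].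
Proof.
move=> h0; exists (fun n => h * (1 - n.+1%:R^-1)).
have lt1 n : (1 - n.+1%:R^-1 < 1 :> R) by rewrite ltrBlDl ltrDr invr_gt0.
have ge0 n : (0 <= 1 - n.+1%:R^-1 :> R) by rewrite subr_ge0 invf_le1// ler1n.
have gt0 n : (0 < 1 - n.+2%:R^-1 :> R) by rewrite subr_gt0 invf_lt1// ltr1n.
split.
- by move=> n; rewrite mulr_ge0 ?(ltW h0)//= -[ltRHS]mulr1 ltr_pM2l.
- move=> m n mn; rewrite ler_pM2l// lerD2l lerN2 lef_pV2 ?posrE//.
  by rewrite ler_nat.
- by move=> n; rewrite gtrN// mulr_gt0.
apply/seteqP; split => x /=; last first.
  move=> [n _] /=; rewrite !in_itv/= => /andP[cx xc].
  have cnh : h * (1 - n.+2%:R^-1) < h by rewrite -[ltRHS]mulr1 ltr_pM2l.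
  by rewrite (le_lt_trans xc)// andbT (lt_trans _ cx)// ltrN2.
rewrite in_itv/= => xh; have {}xh : `|x| < h by rewrite ltr_norml.
pose n := Num.truncn (h / (h - `|x|)).
have nh : h / (h - `|x|) < n.+1%:R by exact: truncnS_gt.
have : `|x| < h * (1 - n.+2%:R^-1).
  have d0 : 0 < h - `|x| by rewrite subr_gt0.
  rewrite mulrBr mulr1 ltrBrDr -ltrBrDl.
  rewrite ltr_pdivrMr// mulrC -ltr_pdivrMr// (lt_trans nh)// ltr_nat//.
rewrite ltr_norml => /andP[xl xr]; exists n => //=.
by rewrite in_itv/= xl ltW.
Qed.

Lemma ge0_integration_by_substitutionT (psi : R -> R) :
  (forall x : R, is_derive x 1 phi (dphi x)) ->
  (forall x : R, {for x, continuous dphi}) ->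
  (forall x, 0 < dphi x) -> (forall y, phi (psi y) = y) ->
  forall G : R -> \bar R,
  measurable_fun setT G -> (forall x, (0 <= G x)%E) ->
  (\int[mu]_y G y = \int[mu]_x (G (phi x) * (dphi x)%:E))%E.
Proof.
move=> Id Ic Ip pK; apply: (@ge0_integration_by_substitution _ _ psi (fun n => - n.+1%:R) (fun n => n.+1%:R)) => //.
- by move=> n; split => //; rewrite gtrN.
- by move=> m n mn; rewrite lerN2 ler_nat.
- by move=> m n mn; rewrite ler_nat.
- apply/seteqP; split => // x _.
  exists (Num.truncn `|x|) => //=; rewrite in_itv/=.
  by have := truncnS_gt `|x|; rewrite ltr_norml => /andP[-> /ltW ->].
Qed.

Lemma ge0_integration_by_substitution_oo (I : set R) (psi : R -> R) (h : R) :
  0 < h ->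
  (forall x y z : R, I x -> I y -> x <= z <= y -> I z) ->
  (forall x : R, I x -> is_derive x 1 phi (dphi x)) ->
  (forall x : R, I x -> {for x, continuous dphi}) ->
  (forall x : R, I x -> 0 < dphi x) ->
  (forall x : R, I x -> - h < phi x < h) ->
  (forall y : R, - h < y < h -> I (psi y) /\ phi (psi y) = y) ->
  forall G : R -> \bar R,
  measurable_fun setT G -> (forall x, (0 <= G x)%E) ->
  (\int[mu]_(y in `](- h)%R, h%R[) G y = \int[mu]_(x in I) (G (phi x) * (dphi x)%:E))%E.
Proof.
move=> h0 Icvx Id Ic Ip IJ JI.
have [c [ch cnd cgt JE]] := open_itv_approx h0.
apply: (@ge0_integration_by_substitution I _ psi (fun n => - c n.+1) (fun n => c n.+1)) => //.
- move=> n; split => //=; rewrite in_itv/=.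
  + have /andP[c0 cnh] := ch n.+1; rewrite ltrN2 cnh/= (le_lt_trans _ h0)//.
    by rewrite oppr_le0.
  + have /andP[c0 cnh] := ch n.+1; rewrite cnh andbT (lt_le_trans _ c0)//.
    by rewrite oppr_lt0.
- by move=> m n mn; rewrite lerN2 cnd.
- by move=> m n mn; rewrite cnd.
Qed.

End integration_by_substitution.

(** * Substitutions in the plane: reflections, slope coordinates and the map [PhiHE] *)

Section plane_substitutions.
Variable R : realType.
Local Notation mu := (@lebesgue_measure R).
Local Notation mu2 := (mu \x mu)%E.
Local Open Scope ereal_scope.

Lemma tonelli1 (G : R * R -> \bar R) : measurable_fun setT G ->
  (forall z, 0 <= G z) -> \int[mu2]_z G z = \int[mu]_x \int[mu]_y G (x, y).
Proof. by move=> mG G0; exact: (@fubini_tonelli1 _ _ _ _ R mu mu G mG G0). Qed.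

Lemma tonelli2 (G : R * R -> \bar R) : measurable_fun setT G ->
  (forall z, 0 <= G z) -> \int[mu2]_z G z = \int[mu]_y \int[mu]_x G (x, y).
Proof. by move=> mG G0; exact: (@fubini_tonelli2 _ _ _ _ R mu mu G mG G0). Qed.

Lemma measurable_tonelli1 (G : R * R -> \bar R) : measurable_fun setT G ->
  (forall z, 0 <= G z) -> measurable_fun setT (fun x : R => \int[mu]_y G (x, y)).
Proof. by move=> mG G0; exact: (@measurable_fun_fubini_tonelli_F _ _ _ _ R mu G mG G0). Qed.

Lemma measurable_tonelli2 (G : R * R -> \bar R) : measurable_fun setT G ->
  (forall z, 0 <= G z) -> measurable_fun setT (fun y : R => \int[mu]_x G (x, y)).
Proof. by move=> mG G0; exact: (@measurable_fun_fubini_tonelli_G _ _ _ _ R mu G mG G0). Qed.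

Lemma measurable_section1 (G : R * R -> \bar R) : measurable_fun setT G ->
  forall x, measurable_fun setT (fun y : R => G (x, y)).
Proof. by move=> mG x; apply: (measurableT_comp mG); exact: measurable_pair1. Qed.

Lemma measurable_section2 (G : R * R -> \bar R) : measurable_fun setT G ->
  forall y, measurable_fun setT (fun x : R => G (x, y)).
Proof. by move=> mG y; apply: (measurableT_comp mG); exact: measurable_pair2. Qed.

Lemma ge0_integral_opp (G : R -> \bar R) : measurable_fun setT G ->
  (forall x, 0 <= G x) -> \int[mu]_x G x = \int[mu]_x G (- x)%R.
Proof.
move=> mG G0.
have mN : measurable_fun [set: measurableTypeR R] (-%R : _ -> measurableTypeR R).
  exact: oppr_measurable.
have := @ge0_integral_pushforward _ _ _ _ _ _ mN mu setT G measurableT mG (fun y _ => G0 y).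
move=> <-; apply: eq_measure_integral => A mA _.
by rewrite /=; apply/esym; exact: lebesgue_measureN.
Qed.

Lemma ge0_integral_affine (l c : R) (G : R -> \bar R) : l != 0%R ->
  measurable_fun setT G -> (forall x, 0 <= G x) ->
  \int[mu]_x G (l * x + c)%R = (`|l|^-1)%:E * \int[mu]_x G x.
Proof.
move=> l0 mG G0.
have pos (k : R) (H : R -> \bar R) : (0 < k)%R -> measurable_fun setT H ->
    (forall x, 0 <= H x) ->
    \int[mu]_x H (k * x + c)%R = (k^-1)%:E * \int[mu]_x H x.
  move=> k0 mH H0.
  have mk : measurable_fun setT (fun x : R => k * x + c)%R.
    by apply: measurable_funD => //; exact: mulrl_measurable.
  rewrite (@ge0_integration_by_substitutionT R (fun x => k * x + c)%R (fun=> k) mk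
    (@measurable_cst _ _ _ _ setT k) (fun y => (y - c) / k)%R _ _ _ _ H mH H0) //=.
  - rewrite ge0_integralZr ?lee_fin ?(ltW k0)//; last exact: (measurableT_comp mH).
    by rewrite muleC -muleA -EFinM mulfV ?gt_eqF// mule1.
  - move=> x; have -> : (fun x => k * x + c)%R = (k *: id + cst c)%R by apply/funext.
    by apply: is_derive_eq; rewrite addr0 /GRing.scale/= mulr1.
  - by move=> x; exact: cvg_cst.
  - by move=> y; rewrite mulrCA mulfV ?gt_eqF// mulr1 subrK.
have [lt0|l0'|] := ltgtP l 0%R; last by move=> /eqP; rewrite (negbTE l0).
  rewrite ltr0_norm// -(pos _ G)// ?oppr_gt0//.
  have mk : measurable_fun setT (fun x : R => l * x + c)%R.
    by apply: measurable_funD => //; exact: mulrl_measurable.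
  rewrite ge0_integral_opp//; last exact: (measurableT_comp mG mk).
  by apply: eq_integral => x _; rewrite mulrN mulNr.
by rewrite gtr0_norm// pos.
Qed.

(** Invariance under a reflection, reduced by Tonelli to affine substitutions in one variable at a
    time. This requires dividing by [p]; for [p = 0] the map only swaps the coordinates up to a
    sign. *)
Lemma ge0_integral_reflection (p q : R) (G : R * R -> \bar R) :
  (p ^+ 2 + q ^+ 2 = 1)%R -> measurable_fun setT G -> (forall z, 0 <= G z) ->
  \int[mu2]_z G z = \int[mu2]_w G (w.1 * p + w.2 * q, w.1 * q - w.2 * p)%R.
Proof.
move=> pq1 mG G0.
pose T (w : R * R) := (w.1 * p + w.2 * q, w.1 * q - w.2 * p)%R.
have mT : measurable_fun setT T.
  by apply: measurable_fun_pair; [apply: measurable_funD|apply: measurable_funB];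
    apply: measurable_funM.
have mGT := measurableT_comp mG mT.
have GT0 z : 0 <= (G \o T) z by exact: G0.
have [p0|p0] := eqVneq p 0%R.
  have q1 : `|q|%R = 1%R.
    by apply/eqP; rewrite -sqrp_eq1// real_normK ?num_real// -pq1 p0 expr0n add0r.
  have q0 : q != 0%R by rewrite -normr_eq0 q1 oner_eq0.
  rewrite tonelli1// (tonelli2 mGT GT0).
  rewrite -[LHS]mul1e -[in LHS](invr1 R) -q1.
  rewrite -(@ge0_integral_affine q 0)//; last 2 first.
    exact: measurable_tonelli1.
    by move=> x; exact: integral_ge0.
  apply: eq_integral => s _; rewrite /=.
  rewrite -[LHS]mul1e -[in LHS](invr1 R) -q1.
  rewrite -(@ge0_integral_affine q 0)//; last exact: measurable_section1.
  by apply: eq_integral => y _; rewrite /T/= p0 !mulr0 add0r subr0 !addr0 mulrC [in X in _ = G (_, X)]mulrC.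
rewrite [RHS](tonelli2 mGT GT0).
(* With [u = p y + q s], the second coordinate [q y - p s] equals [(q u - s) / p]. *)
pose H (us : R * R) := G (us.1, - p^-1 * us.2 + us.1 * q / p)%R.
have mH : measurable_fun setT H.
  apply: (measurableT_comp mG); apply: measurable_fun_pair => //=.
  apply: measurable_funD; apply: measurable_funM => //; exact: measurable_funM.
have H0 us : 0 <= H us by exact: G0.
transitivity (\int[mu]_s ((`|p|^-1)%:E * \int[mu]_u H (u, s))).
  rewrite ge0_integralZl//; last 2 first.
  - exact: measurable_tonelli2.
  - by move=> s _; exact: integral_ge0.
  - rewrite -tonelli2// !tonelli1// -ge0_integralZl//; last 2 first.
      exact: measurable_tonelli1.
      by move=> u _; exact: integral_ge0.
    apply: eq_integral => u _ /=.
    rewrite (@ge0_integral_affine (- p^-1) (u * q / p) (fun v => G (u, v)))//.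
    + by rewrite normrN normfV invrK muleA -EFinM mulVf ?normr_eq0// mul1e.
    + by rewrite oppr_eq0 invr_eq0.
    + exact: measurable_section1.
apply: eq_integral => s _ /=.
rewrite -(@ge0_integral_affine p (s * q) (fun u => H (u, s)))//.
  apply: eq_integral => y _; congr (G (_, _)) => /=; first by rewrite mulrC.
  have -> : ((p * y + s * q) * q / p = y * q + s * q ^+ 2 / p)%R by field.
  have -> : (q ^+ 2 = 1 - p ^+ 2)%R by rewrite -pq1 addrC addKr.
  by field.
exact: measurable_section2.
Qed.

(* Coordinates [(x, t)] with [y = x t]; the locus [x = 0] is negligible. *)
Lemma ge0_integral_slope (G : R * R -> \bar R) : measurable_fun setT G ->
  (forall z, 0 <= G z) ->
  \int[mu2]_z G z = \int[mu]_t \int[mu]_x (G (x, (x * t)%R) * (`|x|%R)%:E).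
Proof.
move=> mG G0.
pose H (z : R * R) := G (z.1, z.1 * z.2)%R * `|z.1|%:E.
have mH : measurable_fun setT H.
  apply: emeasurable_funM; last by apply/measurable_EFinP; exact: measurableT_comp.
  apply: (measurableT_comp mG); apply: measurable_fun_pair => //=.
  exact: measurable_funM.
have H0 z : 0 <= H z by rewrite mule_ge0// lee_fin.
rewrite -[RHS](tonelli2 mH H0) !tonelli1//.
have mF := measurable_tonelli1 mG G0; have mF' := measurable_tonelli1 mH H0.
apply: ge0_ae_eq_integral => //.
- by move=> x _; exact: integral_ge0.
- by move=> x _; exact: integral_ge0.
exists [set 0%R]; split => //; first exact: lebesgue_measure_set1.
move=> x /= => Hx; apply: contrapT => x0; apply: Hx => _.
have {}x0 : x != 0%R by apply/eqP.
rewrite /H /= ge0_integralZr//; last first.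
  exact: (measurableT_comp (measurable_section1 mG x) (mulrl_measurable x)).
have := @ge0_integral_affine x 0 (fun y => G (x, y)) x0 (measurable_section1 mG x) (fun y => G0 _).
have -> : \int[mu]_y G (x, (x * y + 0)%R) = \int[mu]_y G (x, (x * y)%R).
  by apply: eq_integral => y _; rewrite addr0.
move=> ->; rewrite muleAC -EFinM mulVf ?normr_eq0// mul1e.
by [].
Qed.

Lemma is_derive_quot (f g : R -> R) (x df dg : R) : g x != 0%R ->
  is_derive x 1%R f df -> is_derive x 1%R g dg ->
  is_derive x 1%R (fun y => f y / g y)%R ((df * g x - f x * dg) / g x ^+ 2)%R.
Proof.
move=> g0 hf hg.
have hV : is_derive x 1%R (fun y => (g y)^-1)%R (- (g x)^-2 *: dg)%R by exact: is_deriveV.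
have -> : (fun y => f y / g y)%R = (f * (fun y => (g y)^-1))%R by [].
by apply: is_derive_eq; rewrite /GRing.scale/=; field.
Qed.

Lemma continuous_quot (f g : R -> R) (x : R) : g x != 0%R ->
  {for x, continuous f} -> {for x, continuous g} ->
  {for x, continuous (fun y => f y / g y)%R}.
Proof. by move=> g0 cf cg; apply: cvgM => //; exact: cvgV. Qed.

Lemma measurable_fun_ge0_inv d (T : measurableType d) (D : set T) (f : T -> R) :
  measurable_fun D f -> (forall x, 0 <= f x)%R -> measurable_fun D (fun x => (f x)^-1)%R.
Proof.
move=> mf f0; rewrite (_ : (fun _ => _) = (@powR R ^~ (-1)%R) \o f).
  exact: (measurableT_comp (@measurable_powR R (-1)%R) mf).
by apply/funext => x /=; rewrite powR_inv1.
Qed.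

Lemma measurable_nsq : measurable_fun setT (@nsq R).
Proof. by apply: measurable_funD; apply: measurable_funX. Qed.

Lemma measurable_DH : measurable (@DH R).
Proof.
have -> : @DH R = setT `&` @nsq R @^-1` `]-oo, 1%R[.
  by rewrite setTI; apply/seteqP; split => z; rewrite /= in_itv.
exact: measurable_nsq.
Qed.

(** The Jacobian of [PhiHE]: the radial derivative [2 (1 - r^2) / (1 + r^2)^2] times the tangential
    dilation [2 / (1 + r^2)], with [r^2 = nsq z]. *)
Definition jacPhi (z : R * R) : R := 4 * (1 - nsq z) / (1 + nsq z) ^+ 3.

Lemma nsq_ge0 (z : R * R) : (0 <= nsq z)%R.
Proof. by rewrite addr_ge0 ?sqr_ge0. Qed.

Lemma measurable_jacPhi : measurable_fun setT jacPhi.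
Proof.
apply: measurable_funM.
  by apply: measurable_funM => //; apply: measurable_funB => //; exact: measurable_nsq.
apply: measurable_fun_ge0_inv; last by move=> z; rewrite exprn_ge0// addr_ge0// nsq_ge0.
by apply: measurable_funX; apply: measurable_funD => //; exact: measurable_nsq.
Qed.

Lemma measurable_PhiHE : measurable_fun setT (@PhiHE R).
Proof.
have m : measurable_fun setT (fun z : R * R => 2 / (1 + nsq z))%R.
  apply: measurable_funM => //; apply: measurable_fun_ge0_inv.
    by apply: measurable_funD => //; exact: measurable_nsq.
  by move=> z; rewrite addr_ge0// nsq_ge0.
by apply: measurable_fun_pair; apply: measurable_funM.
Qed.

(** The abscissa of the image under [PhiHE] of the point of abscissa [x] on the line of slope [t],
    with [k = 1 + t^2]. *)
Let kphi (k x : R) : R := 2 * x / (1 + k * x ^+ 2).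
Let dkphi (k x : R) : R := 2 * (1 - k * x ^+ 2) / (1 + k * x ^+ 2) ^+ 2.

Let den (k x : R) : (0 < k)%R -> (1 + k * x ^+ 2 != 0)%R.
Proof. by move=> k0; rewrite gt_eqF// ltr_wpDr// mulr_ge0 ?(ltW k0) ?sqr_ge0. Qed.

Let is_derive_kphi (k x : R) : (0 < k)%R -> is_derive x 1%R (kphi k) (dkphi k x).
Proof.
move=> k0; have d0 := den x k0.
have h1 : is_derive x 1%R (fun y => 2 * y)%R 2%R.
  have -> : (fun y => 2 * y)%R = (2 \*: id)%R :> (R -> R) by [].
  by apply: is_derive_eq; rewrite /GRing.scale/= mulr1.
have h2 : is_derive x 1%R (fun y => 1 + k * y ^+ 2)%R (2 * k * x)%R.
  have -> : (fun y => 1 + k * y ^+ 2)%R = (cst 1 + (k \*: (id ^+ 2)))%R :> (R -> R) by [].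
  by apply: is_derive_eq; rewrite /GRing.scale/=; ring.
have := @is_derive_quot (fun y => 2 * y)%R (fun y => 1 + k * y ^+ 2)%R x _ _ d0 h1 h2.
by congr is_derive; rewrite /dkphi; field.
Qed.

(** [PhiHE] preserves every line through the origin, so in slope coordinates the substitution is
    one-dimensional on each line. *)
Lemma ge0_integral_PhiHE (G : R * R -> \bar R) : measurable_fun setT G ->
  (forall z, 0 <= G z) ->
  \int[mu2]_(z in @DH R) G z = \int[mu2]_(z in @DH R) (G (PhiHE z) * (jacPhi z)%:E).
Proof.
move=> mG G0.
rewrite integral_mkcond [RHS]integral_mkcond.
set G1 := G \_ _; set G2 := (fun z => _) \_ _.
have mG1 : measurable_fun setT G1.
  by apply/(measurable_restrictT G measurable_DH); exact: measurable_funTS.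
have mG2 : measurable_fun setT G2.
  apply/(measurable_restrictT _ measurable_DH); apply: measurable_funTS.
  apply: emeasurable_funM; first exact: (measurableT_comp mG measurable_PhiHE).
  by apply/measurable_EFinP; exact: measurable_jacPhi.
have G10 z : 0 <= G1 z by rewrite /G1 patchE; case: ifP.
have G20 z : 0 <= G2 z.
  rewrite /G2 patchE; case: ifPn => //; rewrite inE => /= zD.
  rewrite mule_ge0// lee_fin; apply: divr_ge0; last by rewrite exprn_ge0// addr_ge0// nsq_ge0.
  by rewrite mulr_ge0// subr_ge0 ltW.
rewrite (ge0_integral_slope mG1 G10) (ge0_integral_slope mG2 G20); apply: eq_integral => t _.
pose k : R := (1 + t ^+ 2)%R.
have k0 : (0 < k)%R by rewrite ltr_wpDr// sqr_ge0.
(* The line of slope [t] meets the open disc in the abscissae of modulus below [h], since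
   [k h^2 = 1]. *)
pose h : R := (Num.sqrt k)^-1%R.
have h0 : (0 < h)%R by rewrite invr_gt0 sqrtr_gt0.
have hk : (k * h ^+ 2 = 1)%R.
  by rewrite exprVn sqr_sqrtr ?(ltW k0)// mulfV// gt_eqF.
have hP (x : R) : (- h < x < h)%R = (k * x ^+ 2 < 1)%R.
  rewrite -ltr_norml -[RHS](@ltr_pM2l _ (h ^+ 2)) ?exprn_gt0//.
  by rewrite mulrA [(h ^+ 2 * k)%R]mulrC hk mul1r mulr1 -[in RHS](real_normK (num_real x)) ltr_pXn2r ?nnegrE ?normr_ge0 ?(ltW h0).
have DP (x : R) : @DH R (x, x * t)%R = (- h < x < h)%R.
  by rewrite hP /DH /nsq /= /k exprMn mulrDl mul1r [(t ^+ 2 * _)%R]mulrC.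
have patchD (H : R -> \bar R) (K : R * R -> \bar R) :
    (forall x : R, (- h < x < h)%R -> K (x, x * t)%R * `|x|%:E = H x) ->
    \int[mu]_x ((K \_ (@DH R)) (x, (x * t)%R) * (`|x|%R)%:E) = \int[mu]_(x in `](- h)%R, h%R[) H x.
  move=> KH; rewrite [RHS]integral_mkcond; apply: eq_integral => x _.
  rewrite !patchE; have -> : ((x, (x * t)%R) \in @DH R) = (x \in `](- h)%R, h%R[%classic).
    by apply/idP/idP; rewrite !inE /= in_itv/= DP.
  case: ifPn; last by rewrite mul0e.
  by rewrite inE /= in_itv/= => xh; rewrite KH.
rewrite (patchD (fun x => G (x, x * t)%R * `|x|%:E))//.
rewrite (patchD (fun x => (G (kphi k x, kphi k x * t)%R * `|kphi k x|%:E) * (dkphi k x)%:E)); last first.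
  move=> x xh; rewrite -!muleA -!EFinM.
  have nsqE : nsq (x, x * t)%R = (k * x ^+ 2)%R by rewrite /nsq/= /k; ring.
  congr (G _ * _%:E).
    rewrite /PhiHE nsqE /kphi/=; congr pair; last by rewrite mulrA; congr (_ * _)%R; rewrite mulrAC.
    by rewrite mulrAC.
  have d0 : (0 <= 1 + k * x ^+ 2)%R by rewrite addr_ge0// mulr_ge0 ?sqr_ge0// ltW.
  have -> : (`|kphi k x| = 2 * `|x| / (1 + k * x ^+ 2))%R.
    by rewrite /kphi normrM normfV normrM (ger0_norm d0) (@ger0_norm _ 2%R).
  by rewrite /jacPhi nsqE /dkphi; have := den x k0; move=> dn0; field.
have mH : measurable_fun setT (fun x : R => G (x, x * t)%R * `|x|%:E).
  apply: emeasurable_funM; last by apply/measurable_EFinP; exact: normr_measurable.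
  by apply: (measurableT_comp mG); apply: measurable_fun_pair => //; exact: measurable_funM.
have ck (x : R) : {for x, continuous (fun y : R => k * y ^+ 2)%R}.
  by apply: cvgM; [exact: cvg_cst|exact: exprn_continuous].
have cdk : forall x : R, {for x, continuous (dkphi k)}.
  move=> x; apply: continuous_quot.
  - by rewrite expf_neq0// den.
  - by apply: cvgM; [exact: cvg_cst|apply: cvgB; [exact: cvg_cst|exact: ck]].
  - apply: (@continuous_comp _ _ _ (fun y : R => 1 + k * y ^+ 2)%R (fun z => z ^+ 2)%R).
      by apply: cvgD; [exact: cvg_cst|exact: ck].
    exact: exprn_continuous.
(* The inverse is the root of smaller modulus of [k y x^2 - 2 x + y = 0], rationalised so that
   [y = 0] is included. *)
apply: (@ge0_integration_by_substitution_oo R (kphi k) (dkphi k) _ _ `](- h)%R, h%R[ (fun y => y / (1 + Num.sqrt (1 - k * y ^+ 2)))%R h h0 _ _ _ _ _ _ (fun x => G (x, x * t)%R * `|x|%:E)) => //.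
- apply: continuous_measurable_fun => x.
  by apply: differentiable_continuous; apply/derivable1_diffP; have [] := is_derive_kphi x k0.
- exact: continuous_measurable_fun.
- move=> x y z /=; rewrite !in_itv/= => /andP[hx _] /andP[_ yh] /andP[xz zy].
  by rewrite (lt_le_trans hx xz) (le_lt_trans zy yh).
- by move=> x _; exact: is_derive_kphi.
- move=> x /=; rewrite in_itv/= hP => kx; rewrite divr_gt0//.
    by rewrite mulr_gt0// subr_gt0.
  by rewrite exprn_gt0// ltr_wpDr// mulr_ge0 ?sqr_ge0// ltW.
- move=> x /=; rewrite in_itv/= !hP => kx; rewrite /kphi.
  have d0 := den x k0; have kx0 : (0 <= k * x ^+ 2)%R by rewrite mulr_ge0 ?sqr_ge0 ?ltW.
  rewrite expr_div_n mulrA ltr_pdivrMr ?exprn_gt0 ?ltr_wpDr// mul1r.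
  rewrite -subr_gt0 (_ : (_ - _ = (1 - k * x ^+ 2) ^+ 2)%R); last by ring.
  by rewrite exprn_gt0// subr_gt0.
- move=> y yh /=; rewrite in_itv/= hP.
  rewrite hP in yh; set w := Num.sqrt _.
  have w2 : (w ^+ 2 = 1 - k * y ^+ 2)%R by rewrite sqr_sqrtr// subr_ge0 ltW.
  have w0 : (0 < w)%R by rewrite sqrtr_gt0 subr_gt0.
  have w1 : (1 + w != 0)%R by rewrite gt_eqF// addr_gt0.
  have ky : (k * y ^+ 2 = (1 - w) * (1 + w))%R by rewrite -[LHS](subKr 1%R) -w2; ring.
  have E : (k * (y / (1 + w)) ^+ 2 = (1 - w) / (1 + w))%R.
    by rewrite expr_div_n mulrA ky; field.
  split; first by rewrite E ltr_pdivrMr ?addr_gt0// mul1r; lra.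
  rewrite /kphi E; have -> : (1 + (1 - w) / (1 + w) = 2 / (1 + w))%R by field.
  by field; rewrite w1.
- by move=> x; rewrite mule_ge0// lee_fin.
Qed.

End plane_substitutions.

(** * The Gamma and Beta functions *)

Section gamma_beta.
Variable R : realType.
Local Notation mu := (@lebesgue_measure R).
Local Open Scope ereal_scope.

Lemma ge0_integral_Zl (f : R -> \bar R) (k : \bar R) : measurable_fun setT f ->
  (forall x, 0 <= f x) -> 0 <= k -> \int[mu]_x (k * f x) = k * \int[mu]_x f x.
Proof. by move=> mf f0 k0; rewrite ge0_integralZl. Qed.

Lemma ge0_integral_Zr (f : R -> \bar R) (k : \bar R) : measurable_fun setT f ->
  (forall x, 0 <= f x) -> 0 <= k -> \int[mu]_x (f x * k) = \int[mu]_x f x * k.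
Proof. by move=> mf f0 k0; rewrite ge0_integralZr. Qed.

Let cont_expRk (k : R) (x : R) : {for x, continuous (fun t : R => k * expR (k * t))%R}.
Proof.
apply: cvgM; first exact: cvg_cst.
apply: (@continuous_comp _ _ _ (fun t : R => k * t)%R expR); last exact: continuous_expR.
by apply: cvgM; [exact: cvg_cst|exact: cvg_id].
Qed.

Let is_derive_expRk (k : R) (x : R) : is_derive x 1%R (fun t => expR (k * t))%R (k * expR (k * x))%R.
Proof.
have h : is_derive x 1%R (k \*: id)%R k.
  by apply: is_derive_eq; rewrite /GRing.scale/= mulr1.
have := is_derive1_comp (is_derive_expR (k * x)) h.
by rewrite mulrC.
Qed.

Lemma ge0_integral_expR_subst (k : R) (G : R -> \bar R) : (0 < k)%R ->
  measurable_fun setT G -> (forall x, 0 <= G x) ->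
  \int[mu]_(y in `]0%R, +oo[) G y = \int[mu]_t (G (expR (k * t))%R * (k * expR (k * t))%:E).
Proof.
move=> k0 mG G0.
apply: (@ge0_integration_by_substitution R (fun t => expR (k * t))%R (fun t => k * expR (k * t))%R _ _ setT `]0%R, +oo[ (fun y => ln y / k)%R (fun n => n.+2%:R^-1%R) (fun n => n.+2%:R)) => //.
- by apply: measurableT_comp => //; exact: mulrl_measurable.
- by apply: measurable_funM => //; apply: measurableT_comp => //; exact: mulrl_measurable.
- by move=> x _; rewrite mulr_gt0// expR_gt0.
- by move=> x _ /=; rewrite in_itv/= andbT expR_gt0.
- by move=> y /=; rewrite in_itv/= andbT => y0; split => //; rewrite mulrC divfK ?gt_eqF// lnK.
- move=> n; split => /=; rewrite ?in_itv/= ?andbT ?invr_gt0//.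
  by rewrite (@lt_trans _ _ 1%R)// ?invf_lt1// ltr1n.
- by move=> m n mn; rewrite lef_pV2 ?posrE// ler_nat.
- by move=> m n mn; rewrite ler_nat.
- apply/seteqP; split => y /=; last first.
    by move=> [n _] /=; rewrite !in_itv/= andbT => /andP[+ _]; apply: lt_trans; rewrite invr_gt0.
  rewrite in_itv/= andbT => y0.
  pose m := Num.truncn y; pose n := Num.truncn y^-1.
  exists (maxn m n) => //=; rewrite in_itv/=; apply/andP; split.
    rewrite invf_plt ?posrE//; apply: (lt_trans (truncnS_gt _)).
    by rewrite ltr_nat !ltnS leq_maxr.
  apply/ltW/(lt_trans (truncnS_gt _)).
  by rewrite ltr_nat !ltnS leq_maxl.
Qed.

(* The substitution [exp t] in Euler's integral. *)
Definition eGamma (x : R) : \bar R := \int[mu]_t (expR (x * t - expR t))%:E.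

Let measurable_eGamma (x : R) : measurable_fun setT (fun t : R => expR (x * t - expR t)).
Proof.
by apply: measurableT_comp => //; apply: measurable_funB => //; exact: mulrl_measurable.
Qed.

Lemma eGamma_ge0 (x : R) : 0 <= eGamma x.
Proof. by apply: integral_ge0 => t _; rewrite lee_fin expR_ge0. Qed.

Lemma eGammaE (x : R) : \int[mu]_(t in `]0%R, +oo[) (t `^ (x - 1) * expR (- t))%:E = eGamma x.
Proof.
rewrite (@ge0_integral_expR_subst 1)//.
- apply: eq_integral => t _; rewrite -EFinM !mul1r -expRM -!expRD; congr (expR _)%:E.
  by ring.
- apply/measurable_EFinP; apply: measurable_funM; first exact: measurable_powR.
  by apply: measurableT_comp => //; exact: oppr_measurable.
- by move=> t; rewrite lee_fin mulr_ge0 ?powR_ge0 ?expR_ge0.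
Qed.

Lemma GammaFE (x : R) : GammaF x = fine (eGamma x).
Proof. by rewrite -eGammaE. Qed.

(** On [[0, 1]] the integrand is at least [e^(-e)]. *)
Lemma eGamma_gt0 (x : R) : (0 < x)%R -> 0 < eGamma x.
Proof.
move=> x0; apply: (@lt_le_trans _ _ (\int[mu]_(t in `[0%R, 1%R]) (expR (- expR 1))%:E)).
  rewrite integral_cst//= lebesgue_measure_itv/= lte_fin ltr01 oppr0 adde0 mule1.
  by rewrite lte_fin expR_gt0.
apply: (@le_trans _ _ (\int[mu]_(t in `[0%R, 1%R]) (expR (x * t - expR t))%:E)).
  apply: ge0_le_integral => //.
  - by apply/measurable_EFinP/measurable_funTS; exact: measurable_eGamma.
  - move=> t /=; rewrite in_itv/= => /andP[t0 t1]; rewrite lee_fin ler_expR.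
    by rewrite lerBrDr -lerBrDl opprK ler_wpDl ?mulr_ge0 ?(ltW x0)// ler_expR.
apply: ge0_subset_integral => //.
- by apply/measurable_EFinP; exact: measurable_eGamma.
Qed.

Lemma eGamma1 : eGamma 1 = 1.
Proof.
rewrite -eGammaE -(@integral_exponential_pdf R 1 ltr01) integral_mkcond.
transitivity (\int[mu]_t (((EFin \o (fun t : R => expR (- t))) \_ `[0%R, +oo[) t)).
  rewrite -[RHS]integral_mkcond -[LHS]integral_mkcond integral_itv_obnd_cbnd.
    by apply: eq_integral => t _; rewrite subrr powRr0 mul1r.
  apply/measurable_EFinP; apply: measurable_funTS; apply: measurable_funM; first exact: measurable_powR.
  by apply: measurableT_comp => //; exact: oppr_measurable.
by apply: eq_integral => t _; rewrite /exponential_pdf !patchE; case: ifP => // _; rewrite /= mul1r mulN1r.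
Qed.

Lemma integral_expRN_gt (c : R) :
  \int[mu]_t (\1_(`]c, +oo[%classic) t * expR (- t))%:E = (expR (- c))%:E.
Proof.
pose F (t : R) : \bar R := (\1_(`]c, +oo[%classic : set R) t * expR (- t))%:E.
have mF : measurable_fun setT F.
  apply/measurable_EFinP; apply: measurable_funM; first exact: measurable_indic.
  by apply: measurableT_comp => //; exact: oppr_measurable.
have F0 t : 0 <= F t by rewrite lee_fin mulr_ge0 ?expR_ge0.
have shiftE (t : R) : (t + c \in `]c, +oo[%classic)%R = (t \in `]0%R, +oo[%classic).
  by apply/idP/idP; rewrite !inE/= !in_itv/= !andbT ltrDr.
transitivity (\int[mu]_t F (1 * t + c)%R).
  by rewrite ge0_integral_affine ?oner_eq0// normr1 invr1 mul1e.
transitivity (\int[mu]_t ((expR (- c))%:E * ((EFin \o (fun t : R => t `^ (1 - 1) * expR (- t))%R) \_ `]0%R, +oo[) t)).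
  apply: eq_integral => t _; rewrite /F mul1r indicE patchE.
  rewrite shiftE.
  case: ifPn => _; last by rewrite mul0r mule0.
  by rewrite mul1r /= subrr powRr0 mul1r -EFinM -expRD opprD addrC.
have mE : measurable_fun setT (fun t : R => t `^ (1 - 1) * expR (- t))%R.
  apply: measurable_funM; first exact: measurable_powR.
  by apply: measurableT_comp => //; exact: oppr_measurable.
rewrite ge0_integral_Zl.
- by rewrite -integral_mkcond eGammaE eGamma1 mule1.
- apply/(measurable_restrictT _ (measurable_itv _)); apply: measurable_funTS.
  exact/measurable_EFinP.
- by move=> t; rewrite patchE; case: ifP => // _; rewrite lee_fin mulr_ge0 ?powR_ge0 ?expR_ge0.
- by rewrite lee_fin expR_ge0.
Qed.

(** Integration by parts in the form of Tonelli: both sides are the integral of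
    [x e^(x s) e^(t - e^t)] over [s < t], taken first in [s] or first in [t]. In this form infinite
    values and boundary terms cause no trouble. *)
Lemma eGammaS (x : R) : (0 < x)%R -> eGamma (x + 1) = x%:E * eGamma x.
Proof.
move=> x0.
pose L : set (R * R) := [set z | z.1 < z.2]%R.
have mL : measurable L.
  have -> : L = setT `&` (fun z : R * R => z.2 - z.1)%R @^-1` `]0%R, +oo[.
    by rewrite setTI; apply/seteqP; split => z; rewrite /= in_itv/= andbT subr_gt0.
  by apply: measurable_funB.
pose H (z : R * R) : \bar R := (\1_L z * (x * expR (x * z.1) * expR (z.2 - expR z.2)))%:E.
have mH : measurable_fun setT H.
  apply/measurable_EFinP; apply: measurable_funM; first exact: measurable_indic.
  apply: measurable_funM; [apply: measurable_funM => //|]; apply: measurableT_comp => //.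
    exact: measurable_funM.
  by apply: measurable_funB => //; exact: measurableT_comp.
have H0 z : 0 <= H z.
  by rewrite lee_fin mulr_ge0// !mulr_ge0 ?expR_ge0// ltW.
transitivity (\int[mu]_t \int[mu]_s H (s, t)).
  apply: eq_integral => t _.
  pose G (y : R) : \bar R := (\1_(`]0%R, expR (x * t)[%classic : set R) y)%:E.
  have mG : measurable_fun setT G by apply/measurable_EFinP; exact: measurable_indic.
  have G0 y : 0 <= G y by rewrite lee_fin.
  have GE : \int[mu]_(y in `]0%R, +oo[) G y = (expR (x * t))%:E.
    rewrite integral_indic// setIidl.
      have := lebesgue_measure_itv (`]0%R, expR (x * t)[); rewrite /= lte_fin expR_gt0 oppr0 adde0.
      exact.
    by move=> y /=; rewrite !in_itv/= andbT => /andP[].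
  rewrite (ge0_integral_expR_subst x0 mG G0) in GE.
  transitivity ((expR (t - expR t))%:E * (expR (x * t))%:E).
    by rewrite -EFinM -expRD; congr (expR _)%:E; ring.
  rewrite -GE -ge0_integral_Zl; last 3 first.
  - apply: emeasurable_funM.
      apply: (measurableT_comp mG); apply: measurableT_comp => //; exact: mulrl_measurable.
    by apply/measurable_EFinP; apply: measurable_funM => //; apply: measurableT_comp.
  - by move=> s; rewrite mule_ge0// lee_fin mulr_ge0 ?expR_ge0// ltW.
  - by rewrite lee_fin expR_ge0.
  apply: eq_integral => s _; rewrite /H /G -!EFinM; congr (_%:E); rewrite /= !indicE.
  have -> : (expR (x * s) \in `]0%R, expR (x * t)[%classic) = ((s, t) \in L).
    by apply/idP/idP; rewrite !inE /L/= in_itv/= expR_gt0 ltr_expR ltr_pM2l.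
  by ring.
rewrite -tonelli2// tonelli1// -ge0_integral_Zl; last 3 first.
- by apply/measurable_EFinP; exact: measurable_eGamma.
- by move=> t; rewrite lee_fin expR_ge0.
- by rewrite lee_fin ltW.
apply: eq_integral => s _.
pose G (y : R) : \bar R := (\1_(`]expR s, +oo[%classic : set R) y * expR (- y))%:E.
have mG : measurable_fun setT G.
  apply/measurable_EFinP; apply: measurable_funM; first exact: measurable_indic.
  by apply: measurableT_comp => //; exact: oppr_measurable.
have G0 y : 0 <= G y by rewrite lee_fin mulr_ge0 ?expR_ge0.
have GE : \int[mu]_(y in `]0%R, +oo[) G y = (expR (- expR s))%:E.
  rewrite -integral_expRN_gt integral_mkcond; apply: eq_integral => y _.
  rewrite patchE; case: ifPn => //; rewrite notin_setE/= in_itv/= andbT => /negP.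
  rewrite -leNgt => y0; rewrite indicE memNset ?mul0r//=.
  by rewrite in_itv/= andbT; apply/negP; rewrite -leNgt (le_trans y0) ?expR_ge0.
rewrite (@ge0_integral_expR_subst 1 G ltr01 mG G0) in GE.
transitivity ((x * expR (x * s))%:E * (expR (- expR s))%:E); last first.
  by rewrite -!EFinM expRD; congr (_%:E); ring.
rewrite -GE -ge0_integral_Zl; last 3 first.
- apply: emeasurable_funM.
    apply: (measurableT_comp mG); apply: measurableT_comp => //; exact: mulrl_measurable.
  by apply/measurable_EFinP; apply: measurable_funM => //; apply: measurableT_comp.
- by move=> t; rewrite mule_ge0// lee_fin mulr_ge0 ?expR_ge0.
- by rewrite lee_fin mulr_ge0 ?expR_ge0// ltW.
apply: eq_integral => t _; rewrite /H /G -!EFinM; congr (_%:E); rewrite /= !indicE !mul1r.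
have -> : (expR t \in `]expR s, +oo[%classic) = ((s, t) \in L).
  by apply/idP/idP; rewrite !inE /L/= in_itv/= andbT ltr_expR.
by rewrite expRD; ring.
Qed.

(** On [[1, 2]] the integrand is at most the sum of those at 1 and 2, according to the sign of [t];
    the functional equation carries finiteness to all other positive arguments. *)
Lemma eGamma_lty (x : R) : (0 < x)%R -> eGamma x < +oo.
Proof.
have [n] : exists n : nat, (x <= n.+2%:R)%R.
  exists (Num.truncn x); apply/ltW/(lt_trans (truncnS_gt _)).
  by rewrite ltr_nat.
elim: n x => [|n IH] x.
  have h12 (y : R) : (1 <= y <= 2)%R -> eGamma y < +oo.
    move=> /andP[y1 y2].
    apply: (@le_lt_trans _ _ (eGamma 1 + eGamma 2)).
      rewrite /eGamma -ge0_integralD//; last 2 first.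
      - by apply/measurable_EFinP; exact: measurable_eGamma.
      - by apply/measurable_EFinP; exact: measurable_eGamma.
      apply: ge0_le_integral => //.
      - by apply/measurable_EFinP; exact: measurable_eGamma.
      - by apply: emeasurable_funD; apply/measurable_EFinP; exact: measurable_eGamma.
      - move=> t _; rewrite -EFinD lee_fin.
        have [t0|t0] := leP 0%R t.
          by rewrite ler_wpDl ?expR_ge0// ler_expR lerD2r ler_wpM2r.
        by rewrite ler_wpDr ?expR_ge0// ler_expR lerD2r ler_wnM2r// ltW.
    have -> : (2 = 1 + 1 :> R)%R by [].
    by rewrite eGammaS// eGamma1 mule1 -EFinD ltry.
  move=> x2 x0; have [x1|x1] := leP 1%R x; first by rewrite h12// x1.
  have : eGamma (x + 1) < +oo by rewrite h12//; apply/andP; split; lra.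
  by rewrite eGammaS// => h; rewrite ltey; apply: contraTN h => /eqP ->; rewrite gt0_muley ?lte_fin// ltxx.
move=> xn x0; have [x2|x2] := leP x n.+2%:R; first exact: IH.
have x1 : (0 < x - 1)%R by rewrite subr_gt0 (lt_trans _ x2)// ltr1n.
have := eGammaS x1; rewrite subrK => ->.
have : eGamma (x - 1) < +oo.
  by apply: IH => //; rewrite lerBlDr natr1.
have := eGamma_ge0 (x - 1).
by case: (eGamma (x - 1)) => [r _ _| |]//; rewrite -EFinM ltry.
Qed.

Lemma eGamma_fin (x : R) : (0 < x)%R -> eGamma x = (GammaF x)%:E.
Proof.
move=> x0; rewrite GammaFE fineK// ge0_fin_numE ?eGamma_ge0//.
exact: eGamma_lty.
Qed.

Lemma GammaF_gt0 (x : R) : (0 < x)%R -> (0 < GammaF x)%R.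
Proof. by move=> x0; have := eGamma_gt0 x0; rewrite eGamma_fin. Qed.

Lemma GammaFS (x : R) : (0 < x)%R -> GammaF (x + 1) = (x * GammaF x)%R.
Proof.
move=> x0; have := eGammaS x0; rewrite !eGamma_fin ?addr_gt0//.
by rewrite -EFinM => -[].
Qed.

Lemma GammaF_fact (n : nat) : GammaF (n%:R + 1 : R) = n`!%:R.
Proof.
elim: n => [|n IH].
  by have := eGamma1; rewrite add0r eGamma_fin// => -[].
rewrite GammaFS ?ltr_wpDl// -[in n.+1%:R](addn1 n) natrD IH factS natrM.
by rewrite natr1.
Qed.

(** The Beta integrand [e^(p rho) / (1 + e^rho)^(p + q)] in the variable
    [rho = ln ((1 + u) / (1 - u))]. *)
Let Beta1 (p q rho : R) := expR (p * rho - (p + q) * ln (1 + expR rho)).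

(** In logarithmic variables the classical substitution for a product of two Gamma integrals
    consists of translations: [s = r + t] in the inner integral, then [t] shifted by
    [ln (1 + e^r)]. *)
Lemma eGammaM (p q : R) : (0 < p)%R -> (0 < q)%R ->
  eGamma p * eGamma q = eGamma (p + q) * \int[mu]_r (Beta1 p q r)%:E.
Proof.
move=> p0 q0.
pose H (z : R * R) : \bar R := (expR (p * z.1 + (p + q) * z.2 - expR z.2 * (1 + expR z.1)))%:E.
have mH : measurable_fun setT H.
  apply/measurable_EFinP; apply: measurableT_comp => //; apply: measurable_funB.
    by apply: measurable_funD; exact: measurable_funM.
  by apply: measurable_funM; [|apply: measurable_funD => //]; exact: measurableT_comp.
have H0 z : 0 <= H z by rewrite lee_fin expR_ge0.
have mB : measurable_fun setT (Beta1 p q).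
  apply: measurableT_comp => //; apply: measurable_funB; first exact: mulrl_measurable.
  apply: measurable_funM => //; apply: (measurableT_comp (@measurable_ln R)).
  by apply: measurable_funD.
transitivity (\int[mu]_t \int[mu]_r H (r, t)).
  rewrite {2}/eGamma -ge0_integral_Zl; last 3 first.
  - by apply/measurable_EFinP; exact: measurable_eGamma.
  - by move=> t; rewrite lee_fin expR_ge0.
  - exact: eGamma_ge0.
  apply: eq_integral => t _.
  have := @ge0_integral_affine R 1 t (fun s => (expR (p * s - expR s))%:E) (oner_neq0 _).
  rewrite normr1 invr1 mul1e -/(eGamma p) => <-; last 2 first.
  - by apply/measurable_EFinP; exact: measurable_eGamma.
  - by move=> s; rewrite lee_fin expR_ge0.
  rewrite -ge0_integral_Zr; last 3 first.
  - apply/measurable_EFinP; apply: (measurableT_comp (measurable_eGamma p)).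
    by apply: measurable_funD => //; exact: mulrl_measurable.
  - by move=> s; rewrite lee_fin expR_ge0.
  - by rewrite lee_fin expR_ge0.
  apply: eq_integral => r _; rewrite /H -EFinM -expRD; congr (expR _)%:E => /=.
  by rewrite mul1r expRD; ring.
rewrite -tonelli2// tonelli1// -ge0_integral_Zl; last 3 first.
- by apply/measurable_EFinP; exact: mB.
- by move=> r; rewrite lee_fin expR_ge0.
- exact: eGamma_ge0.
apply: eq_integral => r _.
pose L := ln (1 + expR r).
have LE : (expR L = 1 + expR r)%R by rewrite lnK// posrE addr_gt0 ?expR_gt0.
have := @ge0_integral_affine R 1 L (fun s => (expR ((p + q) * s - expR s))%:E) (oner_neq0 _).
rewrite normr1 invr1 mul1e -/(eGamma (p + q)) => <-; last 2 first.
- by apply/measurable_EFinP; exact: measurable_eGamma.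
- by move=> s; rewrite lee_fin expR_ge0.
rewrite -ge0_integral_Zr; last 3 first.
- apply/measurable_EFinP; apply: (measurableT_comp (measurable_eGamma (p + q))).
  by apply: measurable_funD => //; exact: mulrl_measurable.
- by move=> s; rewrite lee_fin expR_ge0.
- by rewrite lee_fin expR_ge0.
apply: eq_integral => t _; rewrite /H /Beta1 -EFinM -expRD; congr (expR _)%:E => /=.
by rewrite mul1r -/L expRD LE; ring.
Qed.

(** This is [tanh (r / 2)], the inverse of [r = ln ((1 + u) / (1 - u))]. *)
Let phi (r : R) := ((expR r - 1) / (expR r + 1))%R.
Let dphi (r : R) := (2 * expR r / (expR r + 1) ^+ 2)%R.

Let den (r : R) : (0 < expR r + 1)%R. Proof. by rewrite addr_gt0 ?expR_gt0. Qed.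

Let is_derive_phi (r : R) : is_derive r 1%R phi (dphi r).
Proof.
have h1 : is_derive r 1%R (fun t => expR t - 1)%R (expR r).
  have -> : (fun t => expR t - 1)%R = (expR - cst 1)%R :> (R -> R) by [].
  by apply: is_derive_eq; rewrite subr0.
have h2 : is_derive r 1%R (fun t => expR t + 1)%R (expR r).
  have -> : (fun t => expR t + 1)%R = (expR + cst 1)%R :> (R -> R) by [].
  by apply: is_derive_eq; rewrite addr0.
have d0 : (expR r + 1)%R != 0%R by rewrite gt_eqF.
have := @is_derive_quot R (fun t => expR t - 1)%R (fun t => expR t + 1)%R r _ _ d0 h1 h2.
by congr is_derive; rewrite /dphi; field.
Qed.

Let cont_dphi (r : R) : {for r, continuous dphi}.
Proof.
apply: continuous_quot; first by rewrite expf_neq0// gt_eqF.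
  by apply: cvgM; [exact: cvg_cst|exact: continuous_expR].
apply: (@continuous_comp _ _ _ (fun t : R => expR t + 1)%R (fun z => z ^+ 2)%R).
  by apply: cvgD; [exact: continuous_expR|exact: cvg_cst].
exact: exprn_continuous.
Qed.

Lemma ge0_integral_beta (p q : R) : (0 < p)%R -> (0 < q)%R ->
  \int[mu]_(u in `](- 1)%R, 1%R[) ((1 + u) `^ (p - 1) * (1 - u) `^ (q - 1))%:E =
  (2 `^ (p + q - 1) * BetaF p q)%:E.
Proof.
move=> p0 q0.
have mB : measurable_fun setT (Beta1 p q).
  apply: measurableT_comp => //; apply: measurable_funB; first exact: mulrl_measurable.
  apply: measurable_funM => //; apply: (measurableT_comp (@measurable_ln R)).
  by apply: measurable_funD.
have B0 r : (0 <= Beta1 p q r)%R by exact: expR_ge0.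
have -> : \int[mu]_(u in `](- 1)%R, 1%R[) ((1 + u) `^ (p - 1) * (1 - u) `^ (q - 1))%:E =
    (2 `^ (p + q - 1))%:E * \int[mu]_r (Beta1 p q r)%:E.
  rewrite (@ge0_integration_by_substitution_oo R phi dphi _ _ setT (fun u => ln ((1 + u) / (1 - u))) 1 ltr01 _ _ _ _ _ _ (fun u => ((1 + u) `^ (p - 1) * (1 - u) `^ (q - 1))%:E))//.
  - rewrite -ge0_integral_Zl; last 3 first.
    + by apply/measurable_EFinP; exact: mB.
    + by move=> r; rewrite lee_fin.
    + by rewrite lee_fin powR_ge0.
    apply: eq_integral => r _; rewrite -!EFinM; congr (_%:E).
    pose L := ln (1 + expR r).
    have LE : (expR L = 1 + expR r)%R by rewrite lnK// posrE addr_gt0 ?expR_gt0.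
    have d0 := den r; have d1 : (expR r + 1)%R != 0%R by rewrite gt_eqF.
    have E2 : (2 = expR (ln 2) :> R)%R by rewrite lnK// posrE.
    have -> : (1 + phi r = expR (ln 2 + r - L))%R.
      by rewrite !expRD expRN LE -E2 /phi [(1 + expR r)%R]addrC; field.
    have -> : (1 - phi r = expR (ln 2 - L))%R.
      by rewrite !expRD expRN LE -E2 /phi [(1 + expR r)%R]addrC; field.
    have -> : (dphi r = expR (ln 2 + r - L - L))%R.
      by rewrite !expRD !expRN LE -E2 /dphi [(1 + expR r)%R]addrC; field.
    rewrite [in RHS]E2 /Beta1 -/L -!expRM -!expRD; congr expR; ring.
  - apply: continuous_measurable_fun => r.
    by apply: differentiable_continuous; apply/derivable1_diffP; have [] := is_derive_phi r.
  - exact: continuous_measurable_fun.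
  - by move=> r _; rewrite divr_gt0 ?exprn_gt0// mulr_gt0 ?expR_gt0.
  - move=> r _; have d0 := den r; have e0 := expR_gt0 r.
    rewrite /phi ltr_pdivlMr// ltr_pdivrMr//; apply/andP; split; lra.
  - move=> u /andP[u1 u2]; split => //; rewrite /phi lnK; last by rewrite posrE divr_gt0; lra.
    have : (1 - u != 0)%R by rewrite gt_eqF// subr_gt0.
    by move=> h; field; rewrite h/=; lra.
  - apply/measurable_EFinP; apply: measurable_funM.
      apply: (measurableT_comp (@measurable_powR R (p - 1))); exact: measurable_funD.
    apply: (measurableT_comp (@measurable_powR R (q - 1))); exact: measurable_funB.
  - by move=> u; rewrite lee_fin mulr_ge0 ?powR_ge0.
(* The product formula also yields finiteness: were the Beta integral infinite, so would be the
   product of two finite Gamma values. *)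
have := eGammaM p0 q0.
rewrite !eGamma_fin ?addr_gt0//.
have I0 : 0 <= \int[mu]_r (Beta1 p q r)%:E by apply: integral_ge0 => r _; rewrite lee_fin.
have g0 := GammaF_gt0 (addr_gt0 p0 q0).
case: (\int[mu]_r _) I0 => [r| |]//=.
- move=> _; rewrite -!EFinM => -[E]; congr (_%:E)%R; congr (_ * _)%R.
  by rewrite /BetaF E mulrAC divff ?mul1r// gt_eqF.
- by move=> _; rewrite gt0_muley// lte_fin.
Qed.

End gamma_beta.

(** * Jacobi polynomials *)

Section jacobi_integrals.
Variable R : realType.
Local Notation mu := (@lebesgue_measure R).

(** The Pochhammer symbol, equal to [GammaF (x + m) / GammaF x] for [x > 0]. *)
Definition ris (x : R) (m : nat) : R := \prod_(j < m) (x + j%:R).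

Lemma ris0 x : ris x 0 = 1. Proof. by rewrite /ris big_ord0. Qed.
Lemma risS x m : ris x m.+1 = ris x m * (x + m%:R).
Proof. by rewrite /ris big_ord_recr. Qed.
Lemma risS_l x m : ris x m.+1 = x * ris (x + 1) m.
Proof.
rewrite /ris big_ord_recl addr0; congr (_ * _); apply: eq_bigr => i _.
by rewrite lift0 -addrA nat1r.
Qed.
Lemma risD x m l : ris x (m + l) = ris x m * ris (x + m%:R) l.
Proof.
elim: l => [|l IH]; first by rewrite addn0 ris0 mulr1.
by rewrite addnS !risS IH natrD -!mulrA addrA.
Qed.
Lemma ris_gt0 x m : 0 < x -> 0 < ris x m.
Proof. by move=> x0; apply: prodr_gt0 => i _; rewrite ltr_wpDr. Qed.

Lemma GammaF_ris x m : 0 < x -> GammaF (x + m%:R) = ris x m * GammaF x.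
Proof.
move=> x0; elim: m => [|m IH]; first by rewrite addr0 ris0 mul1r.
rewrite -natr1 addrA GammaFS; last by rewrite ltr_wpDr.
by rewrite IH risS mulrCA mulrA.
Qed.

(** An [n]-th finite difference of a polynomial of degree [l < n]. One difference turns [ris z l.+1]
    into [l.+1] times [ris (z + 1) l], which drives the induction on [n]. *)
Lemma alternating_ris (n l : nat) (x : R) : (l < n)%N ->
  \sum_(s < n.+1) (-1) ^+ s * 'C(n, s)%:R * ris (x + (n - s)%:R) l = 0.
Proof.
elim: n l x => // n IH l x ln.
have E : \sum_(s < n.+2) (-1) ^+ s * 'C(n.+1, s)%:R * ris (x + (n.+1 - s)%:R) l =
   \sum_(s < n.+1) (-1) ^+ s * 'C(n, s)%:R *
     (ris (x + (n.+1 - s)%:R) l - ris (x + (n - s)%:R) l).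
  under [RHS]eq_bigr do rewrite mulrBr.
  rewrite [RHS]sumrB big_ord_recl /= bin0 mulr1 expr0 mul1r subn0.
  under eq_bigr => i _ do rewrite /bump leq0n add1n subSS binS natrD mulrDr mulrDl exprS mulN1r !mulNr.
  rewrite big_split/= addrA !sumrN; congr (_ - _).
  rewrite [in RHS]big_ord_recl /= bin0 mulr1 expr0 mul1r subn0; congr (_ + _).
  rewrite big_ord_recr /= bin_small// mulr0 mul0r addr0 -sumrN.
  by apply: eq_bigr => i _; rewrite /bump leq0n add1n subSS exprS mulN1r !mulNr.
rewrite E; case: l ln {E} => [|l] ln.
  by rewrite big1// => s _; rewrite !ris0 subrr mulr0.
transitivity (l.+1%:R * \sum_(s < n.+1) (-1) ^+ s * 'C(n, s)%:R * ris ((x + 1) + (n - s)%:R) l).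
  rewrite mulr_sumr; apply: eq_bigr => s _.
  have sn : (s <= n)%N by rewrite -ltnS.
  have -> : (n.+1 - s)%:R = (n - s)%:R + 1 :> R by rewrite subSn// -natr1.
  rewrite addrA (addrAC x 1); set z := x + _.
  by rewrite risS [ris z _]risS_l -natr1; ring.
by rewrite IH// mulr0.
Qed.

Lemma gbinom_ris (a : R) (n s : nat) : 0 < a + 1 -> (s <= n)%N ->
  gbinom (n%:R + a) s = ris (a + 1) n / (ris (a + 1) (n - s) * s`!%:R).
Proof.
move=> a0 sn; rewrite /gbinom.
have -> : \prod_(j < s) (n%:R + a - j%:R) = ris (a + 1 + (n - s)%:R) s.
  rewrite /ris (reindex_inj rev_ord_inj) /=; apply: eq_bigr => i _.
  rewrite natrB// [(n - s)%:R]natrB// -natr1; ring.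
have -> : ris (a + 1) n = ris (a + 1) (n - s) * ris (a + 1 + (n - s)%:R) s.
  by rewrite -risD subnK.
have h := ris_gt0 (n - s) a0; have f0 : (s`!%:R : R) != 0 by rewrite pnatr_eq0 -lt0n fact_gt0.
have h' : ris (a + 1) (n - s) != 0 by rewrite gt_eqF.
by field; rewrite f0 h'.
Qed.

(** With equal parameters, reversing the sum exchanges the roles of [(y - 1) / 2] and [(y + 1) / 2],
    as [y -> - y] does up to sign. *)
Lemma jacobiN (a : R) (n : nat) (y : R) :
  (jacobi a a n).[- y] = (-1) ^+ n * (jacobi a a n).[y].
Proof.
rewrite /jacobi !horner_sum mulr_sumr (reindex_inj rev_ord_inj) /=.
apply: eq_bigr => s _; rewrite subSS.
have sn : (s <= n)%N by rewrite -ltnS.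
have H (c : R) (i j : nat) (x : R) :
    (c *: ((('X - 1) * (2^-1)%:P) ^+ i * (('X + 1) * (2^-1)%:P) ^+ j)).[x] =
    c * (((x - 1) / 2) ^+ i * ((x + 1) / 2) ^+ j).
  by rewrite hornerZ hornerM !horner_exp !hornerE.
rewrite !H subKn// [in RHS]mulrCA; congr (_ * _); first exact: mulrC.
have -> : (- y - 1) / 2 = - ((y + 1) / 2) by field.
have -> : (- y + 1) / 2 = - ((y - 1) / 2) by field.
set u := (y + 1) / 2; set v := (y - 1) / 2.
have -> : (-1) ^+ n = (-1) ^+ (n - s) * (-1) ^+ s :> R by rewrite -exprD subnK.
by rewrite (exprNn u) (exprNn v); ring.
Qed.

Section weight.
Variable a : R.
Hypothesis a1 : -1 < a.

Definition jw (y : R) : R := (1 - y ^+ 2) `^ a.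
Definition jint (q : {poly R}) : R := Rintegral mu `]-1, 1[ (fun y => q.[y] * jw y).

Lemma measurable_jw : measurable_fun setT jw.
Proof.
apply: (measurableT_comp (@measurable_powR R a)).
by apply: measurable_funB => //; exact: measurable_funX.
Qed.

Lemma measurable_poly (q : {poly R}) : measurable_fun setT (fun y : R => q.[y]).
Proof.
by apply: continuous_measurable_fun; exact: continuous_horner.
Qed.

Let a10 : 0 < a + 1. Proof. by rewrite -ltrBlDr sub0r. Qed.

Let beta_integrand (i j : nat) (u : R) : -1 < u < 1 ->
  ((1 + 'X) ^+ i * (1 - 'X) ^+ j : {poly R}).[u] * jw u =
  (1 + u) `^ (a + 1 + i%:R - 1) * (1 - u) `^ (a + 1 + j%:R - 1).
Proof.
move=> /andP[u1 u2].
have p1 : 0 < 1 + u by rewrite -ltrBlDl sub0r.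
have p2 : 0 < 1 - u by rewrite subr_gt0.
rewrite !hornerM !horner_exp !hornerE /jw.
have -> : 1 - u ^+ 2 = (1 + u) * (1 - u) by ring.
rewrite powRM ?ltW//.
have E (z : R) k : 0 < z -> z `^ (a + 1 + k%:R - 1) = z ^+ k * z `^ a.
  move=> z0; have -> : a + 1 + k%:R - 1 = k%:R + a by ring.
  by rewrite powRD ?(gt_eqF z0) ?implybT// powR_mulrn// ltW.
by rewrite !E//; ring.
Qed.

Lemma integral_beta_poly (i j : nat) :
  (\int[mu]_(u in `](-1)%R, 1%R[) (((1 + 'X) ^+ i * (1 - 'X) ^+ j : {poly R}).[u] * jw u)%:E =
   (2 `^ (2 * a + 1 + (i + j)%:R) * BetaF (a + 1 + i%:R) (a + 1 + j%:R))%:E)%E.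
Proof.
have := @ge0_integral_beta R (a + 1 + i%:R) (a + 1 + j%:R).
have -> : a + 1 + i%:R + (a + 1 + j%:R) - 1 = 2 * a + 1 + (i + j)%:R.
  by rewrite natrD; ring.
move=> <-; [|by rewrite ltr_wpDr..].
by apply: eq_integral => u; rewrite inE/= in_itv/= => /beta_integrand ->.
Qed.

Lemma jint_beta (i j : nat) :
  jint ((1 + 'X) ^+ i * (1 - 'X) ^+ j) =
  2 `^ (2 * a + 1 + (i + j)%:R) * BetaF (a + 1 + i%:R) (a + 1 + j%:R).
Proof. by rewrite /jint /Rintegral integral_beta_poly. Qed.

Lemma integrable_jw : mu.-integrable `]-1, 1[ (EFin \o jw).
Proof.
apply/integrableP; split.
  by apply/measurable_EFinP; apply: measurable_funTS; exact: measurable_jw.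
have := integral_beta_poly 0 0.
under eq_integral do rewrite !expr0 mul1r hornerE mul1r.
under [X in _ -> (X < _)%E]eq_integral do rewrite /= ger0_norm ?powR_ge0//.
by move=> ->; rewrite ltry.
Qed.

Lemma integrable_poly_jw (q : {poly R}) :
  mu.-integrable `]-1, 1[ (EFin \o (fun y => q.[y] * jw y)).
Proof.
apply: (@le_integrable _ _ _ mu `]-1, 1[ _ _ (fun y => (\sum_(i < size q) `|q`_i|)%:E * (jw y)%:E)%E) => //.
- apply/measurable_EFinP; apply: measurable_funTS; apply: measurable_funM.
    exact: measurable_poly.
  exact: measurable_jw.
- move=> y /=; rewrite in_itv/= => /andP[y1 y2].
  rewrite lee_fin normrM [leRHS]ger0_norm; last first.
    by rewrite mulr_ge0 ?powR_ge0// sumr_ge0.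
  rewrite (ger0_norm (powR_ge0 _ _)) ler_wpM2r ?powR_ge0//.
  rewrite horner_coef (le_trans (ler_norm_sum _ _ _))// ler_sum// => i _.
  rewrite normrM ler_piMr// normrX exprn_ile1// ler_norml.
  by rewrite !ltW.
- by apply: integrableZl => //; exact: integrable_jw.
Qed.

Lemma jintD p q : jint (p + q) = jint p + jint q.
Proof.
rewrite /jint -RintegralD//; try exact: integrable_poly_jw.
by apply: eq_Rintegral => y _; rewrite hornerD mulrDl.
Qed.

Lemma jintZ c q : jint (c *: q) = c * jint q.
Proof.
rewrite /jint -RintegralZl//; last exact: integrable_poly_jw.
by apply: eq_Rintegral => y _; rewrite hornerZ mulrA.
Qed.

Lemma jint_sum (I : Type) (r : seq I) (F : I -> {poly R}) :
  jint (\sum_(i <- r) F i) = \sum_(i <- r) jint (F i).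
Proof.
elim: r => [|i r IH]; last by rewrite !big_cons jintD IH.
by rewrite !big_nil -(scale0r (0 : {poly R})) jintZ mul0r.
Qed.

(** Each term of the Jacobi sum times [(1 + X)^l] is a Beta integral. Its Gamma factors cancel
    against the generalised binomials, leaving the alternating sum that vanishes for [l < n]. *)
Lemma jacobi_orth_pow (n l : nat) : (l < n)%N ->
  jint (jacobi a a n * (1 + 'X) ^+ l) = 0.
Proof.
move=> ln; rewrite /jacobi mulr_suml jint_sum.
pose A := a + 1.
(* All factors independent of the summation index [s]. *)
pose K := 2 `^ (2 * a + 1 + (n + l)%:R) * (GammaF A ^+ 2 / GammaF (A + A + (n + l)%:R))
  * (2^-1 ^+ n * ris A n ^+ 2 / n`!%:R).
transitivity (K * \sum_(s < n.+1) (-1) ^+ s * 'C(n, s)%:R * ris (A + (n - s)%:R) l); last first.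
  by rewrite alternating_ris ?mulr0.
rewrite mulr_sumr; apply: eq_bigr => -[s /=]; rewrite ltnS => sn _.
rewrite -scalerAl jintZ.
have -> : (('X - 1) * (2^-1)%:P) ^+ s * (('X + 1) * (2^-1)%:P) ^+ (n - s) * (1 + 'X) ^+ l =
    ((-1) ^+ s * 2^-1 ^+ n) *: ((1 + 'X) ^+ (n - s + l) * (1 - 'X) ^+ s) :> {poly R}.
  have -> : ('X - 1) * (2^-1)%:P = (- 2^-1)%:P * (1 - 'X) :> {poly R} by rewrite polyCN; ring.
  have -> : ('X + 1) * (2^-1)%:P = (2^-1)%:P * (1 + 'X) :> {poly R} by ring.
  rewrite !exprMn -!polyC_exp exprD -mul_polyC.
  have <- : (- 2^-1) ^+ s * 2^-1 ^+ (n - s) = (-1) ^+ s * 2^-1 ^+ n :> R.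
    by rewrite [in LHS]exprNn -mulrA -exprD subnKC.
  by rewrite polyCM; ring.
rewrite jintZ jint_beta.
have -> : (n - s + l + s = n + l)%N by lia.
rewrite /BetaF -/A.
have -> : A + (n - s + l)%:R + (A + s%:R) = A + A + (n + l)%:R.
  by rewrite !natrD natrB//; ring.
have g1 := gbinom_ris a10 sn.
have g2 := gbinom_ris a10 (leq_subr s n).
rewrite subKn// in g2.
have A0 : 0 < A by exact: a10.
rewrite (GammaF_ris (n - s + l) A0) (GammaF_ris s A0) risD.
set G1 := gbinom _ s; have -> : G1 = ris (a + 1) n / (ris (a + 1) (n - s) * s`!%:R) by exact: g1.
set G2 := gbinom _ (n - s); have -> : G2 = ris (a + 1) n / (ris (a + 1) s * (n - s)`!%:R) by exact: g2.
rewrite -/A.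
have C0 : 'C(n, s)%:R * (s`!%:R * (n - s)`!%:R) = n`!%:R :> R.
  by rewrite -!natrM bin_fact.
have h1 : s`!%:R != 0 :> R by rewrite pnatr_eq0 -lt0n fact_gt0.
have h2 : (n - s)`!%:R != 0 :> R by rewrite pnatr_eq0 -lt0n fact_gt0.
have h3 : n`!%:R != 0 :> R by rewrite pnatr_eq0 -lt0n fact_gt0.
have h4 : 'C(n, s)%:R = n`!%:R / (s`!%:R * (n - s)`!%:R) :> R.
  by rewrite -C0 mulfK// mulf_neq0.
have h5 : ris A s != 0 by rewrite gt_eqF// ris_gt0.
have h6 : ris A (n - s) != 0 by rewrite gt_eqF// ris_gt0.
have h7 : GammaF (A + A + (n + l)%:R) != 0.
  by rewrite gt_eqF// GammaF_gt0// ltr_wpDr// addr_gt0.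
rewrite h4 /K; set g := GammaF (A + A + _) in h7 *; field.
by rewrite h1 h2 h3 h5 h6 h7.
Qed.

(** Taylor expansion at -1 writes [q] in powers of [1 + X], where each integral is already known to
    vanish. *)
Lemma jacobi_orth (n : nat) (q : {poly R}) : (size q <= n)%N ->
  jint (jacobi a a n * q) = 0.
Proof.
move=> qn.
have -> : q = \sum_(l < size q) (q \Po ('X - 1))`_l *: (1 + 'X) ^+ l.
  rewrite -[LHS](comp_polyXaddC_K q (-1)) polyCN [in LHS]comp_polyE.
  have sq : size (q \Po ('X - 1)) = size q by rewrite size_comp_poly2// size_XsubC.
  rewrite polyC1 -[in RHS]sq; apply: eq_bigr => i _.
  by congr (_ *: _ ^+ _); rewrite opprK addrC.
rewrite mulr_sumr jint_sum big1// => i _.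
by rewrite -scalerAr jintZ jacobi_orth_pow ?mulr0// (leq_trans _ qn).
Qed.

End weight.
End jacobi_integrals.

(** * Complex integrals and weighted L2 spaces *)

Section complex_aux.
Variable R : realType.
Local Notation C := R[i].

Lemma cReD (x y : C) : cRe (x + y) = cRe x + cRe y. Proof. by case: x; case: y. Qed.
Lemma cImD (x y : C) : cIm (x + y) = cIm x + cIm y. Proof. by case: x; case: y. Qed.
Lemma cReN (x : C) : cRe (- x) = - cRe x. Proof. by case: x. Qed.
Lemma cImN (x : C) : cIm (- x) = - cIm x. Proof. by case: x. Qed.
Lemma cReB (x y : C) : cRe (x - y) = cRe x - cRe y. Proof. by case: x; case: y. Qed.
Lemma cImB (x y : C) : cIm (x - y) = cIm x - cIm y. Proof. by case: x; case: y. Qed.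
Lemma cReM (x y : C) : cRe (x * y) = cRe x * cRe y - cIm x * cIm y.
Proof. by case: x; case: y. Qed.
Lemma cImM (x y : C) : cIm (x * y) = cRe x * cIm y + cIm x * cRe y.
Proof. by case: x => a b; case: y. Qed.
Lemma cRe_conj (x : C) : cRe x^* = cRe x. Proof. by case: x. Qed.
Lemma cIm_conj (x : C) : cIm x^* = - cIm x. Proof. by case: x. Qed.
Lemma cReC (r : R) : cRe r%:C = r. Proof. by []. Qed.
Lemma cImC (r : R) : cIm r%:C = 0. Proof. by []. Qed.
Lemma cRe0 : cRe (0 : C) = 0. Proof. by []. Qed.
Lemma cIm0 : cIm (0 : C) = 0. Proof. by []. Qed.
Definition cE := (cReD, cImD, cReB, cImB, cReN, cImN, cReM, cImM, cRe_conj, cIm_conj,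
  cReC, cImC, cRe0, cIm0).

Lemma cP (x y : C) : cRe x = cRe y -> cIm x = cIm y -> x = y.
Proof. by case: x => a b; case: y => c d /= -> ->. Qed.

Lemma sqn_ge0 (x : C) : 0 <= sqn x. Proof. by rewrite addr_ge0 ?sqr_ge0. Qed.
Lemma sqnM (x y : C) : sqn (x * y) = sqn x * sqn y.
Proof. by rewrite /sqn !cE; ring. Qed.
Lemma sqnN (x : C) : sqn (- x) = sqn x.
Proof. by rewrite /sqn !cE !sqrrN. Qed.
Lemma sqn_conj (x : C) : sqn x^* = sqn x.
Proof. by rewrite /sqn !cE sqrrN. Qed.
Lemma sqnC (r : R) : sqn r%:C = r ^+ 2.
Proof. by rewrite /sqn !cE expr0n addr0. Qed.
Lemma sqn0 : sqn (0 : C) = 0. Proof. by rewrite sqnC expr0n. Qed.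
Lemma sqn1 : sqn (1 : C) = 1. Proof. by rewrite sqnC expr1n. Qed.
Lemma sqn_eq0 (x : C) : sqn x = 0 -> x = 0.
Proof.
move/eqP; rewrite paddr_eq0 ?sqr_ge0// !sqrf_eq0 => /andP[/eqP a /eqP b].
exact: cP.
Qed.
Lemma mul_conj (x : C) : x * x^* = (sqn x)%:C.
Proof. by apply: cP; rewrite /sqn !cE; ring. Qed.
Lemma sqnD_le (x y : C) : sqn (x + y) <= 2 * sqn x + 2 * sqn y.
Proof.
rewrite -subr_ge0 /sqn !cE.
have -> : 2 * (cRe x ^+ 2 + cIm x ^+ 2) + 2 * (cRe y ^+ 2 + cIm y ^+ 2) -
   ((cRe x + cRe y) ^+ 2 + (cIm x + cIm y) ^+ 2) =
   (cRe x - cRe y) ^+ 2 + (cIm x - cIm y) ^+ 2 by ring.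
by rewrite addr_ge0 ?sqr_ge0.
Qed.
Lemma expiD (s t : R) : expi (s + t) = expi s * expi t.
Proof. by apply: cP; rewrite !cE /expi /= ?cosD ?sinD; ring. Qed.
Lemma expi0 : expi (0 : R) = 1.
Proof. by rewrite /expi cos0 sin0. Qed.
Lemma sqn_expi (t : R) : sqn (expi t) = 1. Proof. exact: cos2Dsin2. Qed.
Lemma expi_conj (t : R) : (expi t)^* = expi (- t).
Proof. by apply: cP; rewrite !cE /expi /= ?cosN ?sinN. Qed.
Lemma expiX (t : R) (n : nat) : expi t ^+ n = expi (n%:R * t).
Proof.
elim: n => [|n IH]; first by rewrite mul0r expi0.
by rewrite exprS IH -expiD -natr1 mulrDl mul1r addrC.
Qed.

End complex_aux.

Section cintegral.
Context d (T : measurableType d) (R : realType) (m : {measure set T -> \bar R}).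
Local Notation C := R[i].

Definition cmeas (D : set T) (h : T -> C) :=
  measurable_fun D (@cRe R \o h) /\ measurable_fun D (@cIm R \o h).
Definition cintegrable (D : set T) (h : T -> C) :=
  m.-integrable D (EFin \o (@cRe R \o h)) /\ m.-integrable D (EFin \o (@cIm R \o h)).
Definition cintegral (D : set T) (h : T -> C) : C :=
  Rintegral m D (@cRe R \o h) +i* Rintegral m D (@cIm R \o h).

Lemma cmeasD (D : set T) f g : cmeas D f -> cmeas D g -> cmeas D (fun x => f x + g x).
Proof.
move=> [f1 f2] [g1 g2]; split.
  by apply: eq_measurable_fun (measurable_funD f1 g1) => x _; rewrite /= cReD.
by apply: eq_measurable_fun (measurable_funD f2 g2) => x _; rewrite /= cImD.
Qed.

Lemma cmeasM (D : set T) f g : cmeas D f -> cmeas D g -> cmeas D (fun x => f x * g x).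
Proof.
move=> [f1 f2] [g1 g2]; split.
  apply: eq_measurable_fun (measurable_funB (measurable_funM f1 g1) (measurable_funM f2 g2)) => x _.
  by rewrite /= cReM.
apply: eq_measurable_fun (measurable_funD (measurable_funM f1 g2) (measurable_funM f2 g1)) => x _.
by rewrite /= cImM.
Qed.

Lemma cmeas_cst (D : set T) (c : C) : cmeas D (fun=> c).
Proof. by split; exact: measurable_cst. Qed.

Lemma cmeas_conj (D : set T) f : cmeas D f -> cmeas D (fun x => (f x)^*).
Proof.
move=> [f1 f2]; split; first by apply: eq_measurable_fun f1 => x _; rewrite /= cRe_conj.
by apply: eq_measurable_fun (measurable_funN f2) => x _; rewrite /= cIm_conj.
Qed.

Lemma cmeasC (D : set T) (f : T -> R) : measurable_fun D f -> cmeas D (fun x => (f x)%:C).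
Proof. by move=> mf; split => //; exact: measurable_cst. Qed.

Lemma cmeas_sum (D : set T) (I : Type) (s : seq I) (F : I -> T -> C) :
  (forall i, cmeas D (F i)) -> cmeas D (fun x => \sum_(i <- s) F i x).
Proof.
move=> mF; elim: s => [|i s IH].
  by under [X in cmeas _ X]eq_fun do rewrite big_nil; exact: cmeas_cst.
by under [X in cmeas _ X]eq_fun do rewrite big_cons; exact: cmeasD.
Qed.

Lemma measurable_sqn (D : set T) f : cmeas D f -> measurable_fun D (fun x => sqn (f x)).
Proof. by move=> [f1 f2]; apply: measurable_funD; apply: measurable_funX. Qed.

Lemma cmeas_expi (D : set T) (f : T -> R) : measurable_fun D f -> cmeas D (fun x => expi (f x)).
Proof.
move=> mf; split.
  apply: (measurableT_comp _ mf); apply: continuous_measurable_fun; exact: continuous_cos.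
apply: (measurableT_comp _ mf); apply: continuous_measurable_fun; exact: continuous_sin.
Qed.

Section fixed_domain.
Variables (D : set T).
Hypothesis (mD : measurable D).

Lemma cintegrable_le f (g : T -> R) : cmeas D f -> m.-integrable D (EFin \o g) ->
  (forall x, D x -> `|cRe (f x)| <= g x /\ `|cIm (f x)| <= g x) -> cintegrable D f.
Proof.
move=> [f1 f2] ig fg; split; apply: le_integrable ig => //.
- exact/measurable_EFinP.
- by move=> x Dx; rewrite /= lee_fin (le_trans (fg x Dx).1)// ler_norm.
- exact/measurable_EFinP.
- by move=> x Dx; rewrite /= lee_fin (le_trans (fg x Dx).2)// ler_norm.
Qed.

Lemma eq_cintegral f g : (forall x, D x -> f x = g x) -> cintegral D f = cintegral D g.
Proof.
move=> fg; congr (_ +i* _); apply: eq_Rintegral => x; rewrite inE => Dx /=; by rewrite fg.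
Qed.

Lemma eq_cintegrable f g : (forall x, D x -> f x = g x) -> cintegrable D f -> cintegrable D g.
Proof.
move=> fg [f1 f2]; split.
  by apply: eq_integrable f1 => // x; rewrite inE => Dx /=; rewrite fg.
by apply: eq_integrable f2 => // x; rewrite inE => Dx /=; rewrite fg.
Qed.

Lemma cintegrableD f g : cintegrable D f -> cintegrable D g ->
  cintegrable D (fun x => f x + g x).
Proof.
move=> [f1 f2] [g1 g2]; split.
  by apply: eq_integrable (integrableD mD f1 g1) => // x _; rewrite /= cReD.
by apply: eq_integrable (integrableD mD f2 g2) => // x _; rewrite /= cImD.
Qed.

Lemma cintegralD f g : cintegrable D f -> cintegrable D g ->
  cintegral D (fun x => f x + g x) = cintegral D f + cintegral D g.
Proof.
move=> [f1 f2] [g1 g2]; apply: cP; rewrite cE /cintegral /=.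
  by rewrite -RintegralD//; apply: eq_Rintegral => x _; rewrite /= cReD.
by rewrite -RintegralD//; apply: eq_Rintegral => x _; rewrite /= cImD.
Qed.

Let integrableZ (k : R) (f : T -> R) : m.-integrable D (EFin \o f) ->
  m.-integrable D (EFin \o (fun x => k * f x)).
Proof. by move=> ff; apply: eq_integrable (integrableZl mD k ff). Qed.

Lemma cintegrableZ (c : C) f : cintegrable D f -> cintegrable D (fun x => c * f x).
Proof.
move=> [f1 f2]; split.
  apply: eq_integrable (integrableB mD (integrableZ (cRe c) f1) (integrableZ (cIm c) f2)) => //.
  by move=> x _; rewrite /= cReM.
apply: eq_integrable (integrableD mD (integrableZ (cRe c) f2) (integrableZ (cIm c) f1)) => //.
by move=> x _; rewrite /= cImM.
Qed.

Lemma cintegralZ (c : C) f : cintegrable D f ->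
  cintegral D (fun x => c * f x) = c * cintegral D f.
Proof.
move=> [f1 f2]; apply: cP; rewrite cE /cintegral /=.
  rewrite -!RintegralZl// -RintegralB//; try exact: integrableZ.
  by apply: eq_Rintegral => x _; rewrite /= cReM.
rewrite -!RintegralZl// -RintegralD//; try exact: integrableZ.
by apply: eq_Rintegral => x _; rewrite /= cImM.
Qed.

Lemma cintegrable0 : cintegrable D (fun=> 0).
Proof. by split; apply: eq_integrable (integrable0 _ D). Qed.

Lemma cintegral0 : cintegral D (fun=> 0) = 0.
Proof.
transitivity (0 * cintegral D (fun=> 0)); last by rewrite mul0r.
rewrite -cintegralZ; last exact: cintegrable0.
by apply: eq_cintegral => x _; rewrite mul0r.
Qed.

Lemma cintegrable_sum (I : Type) (s : seq I) (F : I -> T -> C) :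
  (forall i, cintegrable D (F i)) -> cintegrable D (fun x => \sum_(i <- s) F i x).
Proof.
move=> iF; elim: s => [|i s IH].
  by apply: eq_cintegrable cintegrable0 => x _; rewrite big_nil.
by apply: eq_cintegrable (cintegrableD (iF i) IH) => x _; rewrite big_cons.
Qed.

Lemma cintegral_sum (I : Type) (s : seq I) (F : I -> T -> C) :
  (forall i, cintegrable D (F i)) ->
  cintegral D (fun x => \sum_(i <- s) F i x) = \sum_(i <- s) cintegral D (F i).
Proof.
move=> iF; elim: s => [|i s IH].
  by rewrite big_nil -[RHS]cintegral0; apply: eq_cintegral => x _; rewrite big_nil.
rewrite big_cons -IH -cintegralD//; last exact: cintegrable_sum.
by apply: eq_cintegral => x _; rewrite big_cons.
Qed.

Lemma cintegral_conj f : cintegrable D f ->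
  cintegral D (fun x => (f x)^*) = (cintegral D f)^*.
Proof.
move=> [f1 f2]; apply: cP; rewrite cE /cintegral /=.
  by apply: eq_Rintegral => x _; rewrite /= cRe_conj.
rewrite -mulN1r -RintegralZl//; apply: eq_Rintegral => x _.
by rewrite /= cIm_conj mulN1r.
Qed.

Lemma cintegralC (f : T -> R) : cintegral D (fun x => (f x)%:C) = (Rintegral m D f)%:C.
Proof.
apply: cP; rewrite !cE /cintegral //=.
transitivity (Rintegral m D (fun=> 0)); first exact: eq_Rintegral.
by rewrite Rintegral_cst// mul0r.
Qed.

End fixed_domain.
End cintegral.

(** * Weighted L2 spaces, Cauchy-Schwarz and orthonormal systems *)

Section weighted_L2.
Variable R : realType.
Local Notation C := R[i].
Variables (D : set (R * R)) (w : R * R -> R).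
Hypotheses (mD : measurable D) (mw : measurable_fun D w) (w0 : forall z, D z -> 0 <= w z).

Let mD2 : measurable (D : set (measurableTypeR R * measurableTypeR R)%type) := mD.

Definition n2 (f : R * R -> C) : R := Rintegral (@mu2 R) D (fun z => sqn (f z) * w z).

Lemma l2normE f : l2norm D w f = Num.sqrt (n2 f). Proof. by []. Qed.

Lemma n2_ge0 f : 0 <= n2 f.
Proof. by apply: Rintegral_ge0 => z Dz; rewrite mulr_ge0 ?sqn_ge0 ?w0. Qed.

Lemma l2norm_sqr f : l2norm D w f ^+ 2 = n2 f.
Proof. by rewrite sqr_sqrtr// n2_ge0. Qed.

Lemma L2mem_cmeas f : L2mem D w f -> cmeas D f. Proof. by case. Qed.

Lemma eq_L2mem f g : (forall z, D z -> f z = g z) -> L2mem D w f -> L2mem D w g.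
Proof.
move=> fg [f1 f2 f3]; split.
- by apply: eq_measurable_fun f1 => z; rewrite inE => Dz /=; rewrite fg.
- by apply: eq_measurable_fun f2 => z; rewrite inE => Dz /=; rewrite fg.
- by apply: eq_integrable f3 => // z; rewrite inE => Dz; rewrite fg.
Qed.

Lemma eq_n2 f g : (forall z, D z -> f z = g z) -> n2 f = n2 g.
Proof. by move=> fg; apply: eq_Rintegral => z; rewrite inE => Dz; rewrite fg. Qed.

Lemma L2mem_dom f (g : R * R -> R) : cmeas D f -> (@mu2 R).-integrable D (EFin \o g) ->
  (forall z, D z -> sqn (f z) * w z <= g z) -> L2mem D w f.
Proof.
move=> mf ig fg; split; [exact: mf.1|exact: mf.2|].
apply: le_integrable ig => //.
  by apply/measurable_EFinP; apply: measurable_funM => //; exact: measurable_sqn.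
move=> z Dz; rewrite lee_fin ger0_norm ?mulr_ge0 ?sqn_ge0 ?w0//.
by rewrite (le_trans (fg z Dz))// ler_norm.
Qed.

Lemma L2memD f g : L2mem D w f -> L2mem D w g -> L2mem D w (fun z => f z + g z).
Proof.
move=> Lf Lg; have [_ _ f3] := Lf; have [_ _ g3] := Lg.
apply: (@L2mem_dom _ (fun z => 2 * (sqn (f z) * w z) + 2 * (sqn (g z) * w z))).
- by apply: cmeasD; exact: L2mem_cmeas.
- have := integrableD mD2 (integrableZl mD2 2 f3) (integrableZl mD2 2 g3).
  by apply: eq_integrable.
- by move=> z Dz; rewrite !mulrA -mulrDl ler_wpM2r ?w0// sqnD_le.
Qed.

Lemma L2memZ (c : C) f : L2mem D w f -> L2mem D w (fun z => c * f z).
Proof.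
move=> Lf; have [_ _ f3] := Lf.
apply: (@L2mem_dom _ (fun z => sqn c * (sqn (f z) * w z))).
- by apply: cmeasM; [exact: cmeas_cst|exact: L2mem_cmeas].
- by have := integrableZl mD2 (sqn c) f3; apply: eq_integrable.
- by move=> z Dz; rewrite sqnM mulrA.
Qed.

Lemma L2mem0 : L2mem D w (fun=> 0).
Proof.
apply: (@L2mem_dom _ (fun=> 0)); first exact: cmeas_cst.
  by have := integrable0 (@mu2 R) (D : set (measurableTypeR R * measurableTypeR R)%type); apply: eq_integrable.
by move=> z _; rewrite sqn0 mul0r.
Qed.

Lemma L2memB f g : L2mem D w f -> L2mem D w g -> L2mem D w (fun z => f z - g z).
Proof.
move=> Lf Lg; apply: eq_L2mem (L2memD Lf (L2memZ (-1) Lg)) => z _.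
by rewrite mulN1r.
Qed.

Lemma L2mem_sum (I : Type) (s : seq I) (F : I -> R * R -> C) :
  (forall i, L2mem D w (F i)) -> L2mem D w (fun z => \sum_(i <- s) F i z).
Proof.
move=> LF; elim: s => [|i s IH].
  by apply: eq_L2mem L2mem0 => z _; rewrite big_nil.
by apply: eq_L2mem (L2memD (LF i) IH) => z _; rewrite big_cons.
Qed.

(** The integrand is dominated by [(|f|^2 + |g|^2) w], so inner products of L2 functions are genuine
    integrals and not default values. *)
Lemma L2_cintegrable f g : L2mem D w f -> L2mem D w g ->
  cintegrable (@mu2 R) D (fun z => f z * (g z)^* * (w z)%:C).
Proof.
move=> Lf Lg; have [_ _ f3] := Lf; have [_ _ g3] := Lg.
apply: (@cintegrable_le _ _ _ _ _ mD2 _ (fun z => sqn (f z) * w z + sqn (g z) * w z)).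
- apply: cmeasM; last exact: cmeasC.
  by apply: cmeasM; [|apply: cmeas_conj]; exact: L2mem_cmeas.
- by have := integrableD mD2 f3 g3; apply: eq_integrable.
- move=> z Dz; rewrite -mulrDl.
  suff H : forall x : C, sqn x <= (sqn (f z) + sqn (g z)) ^+ 2 -> 
     `|cRe (x * (w z)%:C)| <= (sqn (f z) + sqn (g z)) * w z /\
     `|cIm (x * (w z)%:C)| <= (sqn (f z) + sqn (g z)) * w z.
    apply: H; rewrite sqnM sqn_conj -subr_ge0.
    have -> : (sqn (f z) + sqn (g z)) ^+ 2 - sqn (f z) * sqn (g z) =
      sqn (f z) ^+ 2 + sqn (g z) ^+ 2 + sqn (f z) * sqn (g z) by ring.
    by rewrite !addr_ge0 ?sqr_ge0// mulr_ge0 ?sqn_ge0.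
  move=> x xs; rewrite !cE !mulr0 subr0 add0r !normrM (ger0_norm (w0 Dz)).
  have s0 : 0 <= sqn (f z) + sqn (g z) by rewrite addr_ge0 ?sqn_ge0.
  split; rewrite ler_wpM2r ?w0// -ler_sqr ?nnegrE// real_normK ?num_real//;
    apply: le_trans xs; by rewrite /sqn ?lerDl ?lerDr sqr_ge0.
Qed.

Lemma l2innerE f g :
  l2inner D w f g = cintegral (@mu2 R) D (fun z => f z * (g z)^* * (w z)%:C).
Proof.
by congr (_ +i* _); apply: eq_Rintegral => z _; rewrite /= !cE !mulr0 ?subr0 ?add0r.
Qed.

Lemma eq_l2inner f g f' g' : (forall z, D z -> f z = f' z) -> (forall z, D z -> g z = g' z) ->
  l2inner D w f g = l2inner D w f' g'.
Proof.
by move=> ff gg; rewrite !l2innerE; apply: eq_cintegral => z Dz; rewrite ff ?gg.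
Qed.

Lemma l2innerDl f g h : L2mem D w f -> L2mem D w g -> L2mem D w h ->
  l2inner D w (fun z => f z + g z) h = l2inner D w f h + l2inner D w g h.
Proof.
move=> Lf Lg Lh; rewrite !l2innerE -cintegralD//; try exact: L2_cintegrable.
by apply: eq_cintegral => z _; rewrite !mulrDl.
Qed.

Lemma l2innerZl c f h : L2mem D w f -> L2mem D w h ->
  l2inner D w (fun z => c * f z) h = c * l2inner D w f h.
Proof.
move=> Lf Lh; rewrite !l2innerE -cintegralZ//; last exact: L2_cintegrable.
by apply: eq_cintegral => z _; rewrite !mulrA.
Qed.

Lemma l2inner_conj f g : L2mem D w f -> L2mem D w g ->
  l2inner D w g f = (l2inner D w f g)^*.
Proof.
move=> Lf Lg; rewrite !l2innerE -cintegral_conj//; last exact: L2_cintegrable.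
apply: eq_cintegral => z _; apply: cP; rewrite !cE; ring.
Qed.

Lemma l2innerBl f g h : L2mem D w f -> L2mem D w g -> L2mem D w h ->
  l2inner D w (fun z => f z - g z) h = l2inner D w f h - l2inner D w g h.
Proof.
move=> Lf Lg Lh; rewrite (@eq_l2inner _ h (fun z => f z + (-1) * g z) h)//; last first.
  by move=> z _; rewrite mulN1r.
by rewrite l2innerDl ?l2innerZl ?mulN1r//; exact: L2memZ.
Qed.

Lemma l2inner0l h : l2inner D w (fun=> 0) h = 0.
Proof.
rewrite l2innerE -[RHS](cintegral0 (@mu2 R) mD2); apply: eq_cintegral => z _.
by rewrite !mul0r.
Qed.

Lemma l2inner_suml (I : Type) (s : seq I) (F : I -> R * R -> C) h :
  (forall i, L2mem D w (F i)) -> L2mem D w h ->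
  l2inner D w (fun z => \sum_(i <- s) F i z) h = \sum_(i <- s) l2inner D w (F i) h.
Proof.
move=> LF Lh; elim: s => [|i s IH].
  by rewrite big_nil -[RHS](l2inner0l h); apply: eq_l2inner => // z _; rewrite big_nil.
rewrite big_cons -IH -l2innerDl//; last exact: L2mem_sum.
by apply: eq_l2inner => // z _; rewrite big_cons.
Qed.

Lemma l2inner_n2 f : l2inner D w f f = (n2 f)%:C.
Proof.
rewrite l2innerE -cintegralC//; apply: eq_cintegral => z _.
by rewrite mul_conj; apply: cP; rewrite !cE; ring.
Qed.

Lemma n2D f g : L2mem D w f -> L2mem D w g ->
  n2 (fun z => f z + g z) = n2 f + n2 g + 2 * cRe (l2inner D w f g).
Proof.
move=> Lf Lg; have Lfg := L2memD Lf Lg.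
have E : l2inner D w (fun z => f z + g z) (fun z => f z + g z) =
  l2inner D w f f + (l2inner D w f g)^* + (l2inner D w f g + l2inner D w g g).
  rewrite l2innerDl// (l2inner_conj Lfg Lf) (l2inner_conj Lfg Lg) !l2innerDl//.
  rewrite (l2inner_conj Lf Lg).
  by apply: cP; rewrite !cE ?l2inner_n2 ?cE; ring.
have := congr1 (@cRe R) E; rewrite !l2inner_n2 !cE => ->; ring.
Qed.

Lemma n2Z c f : L2mem D w f -> n2 (fun z => c * f z) = sqn c * n2 f.
Proof.
move=> [_ _ f3]; rewrite /n2 -RintegralZl//.
by apply: eq_Rintegral => z _; rewrite sqnM mulrA.
Qed.

Lemma l2inner_CS f g : L2mem D w f -> L2mem D w g ->
  sqn (l2inner D w f g) <= n2 f * n2 g.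
Proof.
move=> Lf Lg; set c := l2inner D w f g.
have H (t : R) : 0 <= n2 f + t ^+ 2 * (sqn c * n2 g) - 2 * t * sqn c.
  have := n2_ge0 (fun z => f z + (- t%:C * c) * g z).
  rewrite n2D//; last exact: L2memZ.
  rewrite n2Z// (l2inner_conj (L2memZ _ Lg) Lf) l2innerZl// (l2inner_conj Lf Lg) -/c.
  rewrite sqnM sqnN sqnC !cE /sqn; congr (_ <= _); ring.
have f0 := n2_ge0 f; have g0 := n2_ge0 g; have c0 := sqn_ge0 c.
have [->|cn] := eqVneq (sqn c) 0; first by rewrite mulr_ge0.
have cp : 0 < sqn c by rewrite lt_neqAle eq_sym cn.
have [g00|gn] := eqVneq (n2 g) 0.
  (* When [n2 g = 0] the quadratic in [t] is affine; this value of [t] makes it equal to -1. *)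
  have := H ((n2 f + 1) / (2 * sqn c)); rewrite g00 !mulr0 addr0.
  have -> : 2 * ((n2 f + 1) / (2 * sqn c)) * sqn c = n2 f + 1 by field.
  by rewrite opprD addNKr oppr_ge0 ler10.
have gp : 0 < n2 g by rewrite lt_neqAle eq_sym gn.
(* The minimiser of the quadratic in [t]. *)
have := H (n2 g)^-1.
have -> : n2 f + (n2 g)^-1 ^+ 2 * (sqn c * n2 g) - 2 * (n2 g)^-1 * sqn c = n2 f - sqn c / n2 g.
  by field.
by rewrite subr_ge0 ler_pdivrMr.
Qed.

Section orthonormal.
Variables (I : eqType) (e : I -> R * R -> C) (P : pred I).
Hypothesis Le : forall i, P i -> L2mem D w (e i).
Hypothesis one : forall i j, P i -> P j -> l2inner D w (e i) (e j) = (i == j)%:R.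

(** Extension by zero outside [P] makes every index admissible, so that the lemmas on unrestricted
    sums apply. *)
Let eP i z := if P i then e i z else 0.
Let LeP i : L2mem D w (eP i).
Proof.
rewrite /eP; case: (boolP (P i)) => Pi.
  by apply: eq_L2mem (Le Pi) => z _.
by apply: eq_L2mem L2mem0 => z _.
Qed.

Definition comb (s : seq I) (c : I -> C) (z : R * R) : C := \sum_(i <- s | P i) c i * e i z.

Let combE s c z : comb s c z = \sum_(i <- s) c i * eP i z.
Proof.
rewrite /comb big_mkcond; apply: eq_bigr => i _; rewrite /eP.
by case: ifP => //; rewrite mulr0.
Qed.

Lemma L2mem_comb s c : L2mem D w (comb s c).
Proof.
by apply: eq_L2mem (L2mem_sum s (fun i => L2memZ (c i) (LeP i))) => z _; rewrite combE.
Qed.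

Lemma l2inner_comb s c g : L2mem D w g ->
  l2inner D w (comb s c) g = \sum_(i <- s | P i) c i * l2inner D w (e i) g.
Proof.
move=> Lg; rewrite (eq_l2inner (fun z _ => combE s c z) (fun z _ => erefl (g z))).
rewrite l2inner_suml//; last by move=> i; exact: L2memZ.
rewrite [RHS]big_mkcond; apply: eq_bigr => i _; rewrite l2innerZl// /eP.
case: ifP => // _; by rewrite l2inner0l mulr0.
Qed.

Lemma comb_coef s c j : uniq s -> j \in s -> P j -> l2inner D w (comb s c) (e j) = c j.
Proof.
move=> us js Pj; rewrite l2inner_comb; last exact: Le.
rewrite big_mkcond (bigD1_seq j)//= Pj one// eqxx mulr1.
rewrite big1 ?addr0// => i ij; case: ifP => // Pi; by rewrite one// (negbTE ij) mulr0.
Qed.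

(** The remainder of the Fourier sum is orthogonal to the span, so any other coefficients only add a
    squared norm. This serves to replace arbitrary approximating coefficients by Fourier ones, and
    to enlarge the index set at no cost. *)
Lemma n2_best f s c : uniq s -> L2mem D w f ->
  n2 (fun z => f z - comb s (fun i => l2inner D w f (e i)) z) <= n2 (fun z => f z - comb s c z).
Proof.
move=> us Lf; set a := fun i => l2inner D w f (e i).
pose h z := f z - comb s a z; pose k z := comb s (fun i => a i - c i) z.
have Lh : L2mem D w h by apply: L2memB => //; exact: L2mem_comb.
have Lk : L2mem D w k by exact: L2mem_comb.
have -> : n2 (fun z => f z - comb s c z) = n2 (fun z => h z + k z).
  apply: eq_n2 => z _; rewrite /h /k /comb -addrA; congr (_ + _).
  under [X in _ = _ + X]eq_bigr do rewrite mulrBl.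
  by rewrite sumrB addKr.
rewrite (n2D Lh Lk).
have -> : l2inner D w h k = 0.
  rewrite (l2inner_conj Lk Lh) l2inner_comb// big_seq_cond big1 ?conjc0// => i /andP[is_ Pi].
  rewrite (l2inner_conj Lh (Le Pi)) (l2innerBl Lf (L2mem_comb _ _) (Le Pi)).
  by rewrite comb_coef// subrr conjc0 mulr0.
by rewrite cE mulr0 addr0 lerDl n2_ge0.
Qed.

End orthonormal.
End weighted_L2.

(** * Density of an algebra of functions in L2 *)

Section sharp_polynomials.
Variable R : realType.

(* The factor [N] in the exponent makes the limit at [u = 1/2] equal to [0]. *)
Definition qN (N : nat) (u : R) : R := (1 - u ^+ N) ^+ (N * 2 ^ N).

Lemma bernoulli_ge (x : R) (n : nat) : 0 <= x <= 1 -> 1 - n%:R * x <= (1 - x) ^+ n.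
Proof.
move=> /andP[x0 x1]; elim: n => [|n IH]; first by rewrite mul0r subr0 expr0.
rewrite exprS; apply: (@le_trans _ _ ((1 - x) * (1 - n%:R * x))).
  rewrite -natr1 -subr_ge0.
  have -> : (1 - x) * (1 - n%:R * x) - (1 - (n%:R + 1) * x) = n%:R * x ^+ 2 by ring.
  by rewrite mulr_ge0 ?sqr_ge0.
by rewrite ler_wpM2l// subr_ge0.
Qed.

Lemma bernoulli_le (x : R) (n : nat) : 0 <= x <= 1 -> (1 - x) ^+ n * (1 + n%:R * x) <= 1.
Proof.
move=> /andP[x0 x1].
have H : 1 + n%:R * x <= (1 + x) ^+ n.
  elim: n => [|n IH]; first by rewrite mul0r addr0 expr0.
  rewrite exprS; apply: (@le_trans _ _ ((1 + x) * (1 + n%:R * x))).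
    rewrite -natr1 -subr_ge0.
    have -> : (1 + x) * (1 + n%:R * x) - (1 + (n%:R + 1) * x) = n%:R * x ^+ 2 by ring.
    by rewrite mulr_ge0 ?sqr_ge0.
  by rewrite ler_wpM2l// addr_ge0.
apply: (@le_trans _ _ ((1 - x) ^+ n * (1 + x) ^+ n)).
  by rewrite ler_wpM2l// exprn_ge0// subr_ge0.
have E : (1 - x) * (1 + x) = 1 - x ^+ 2 by ring.
rewrite -exprMn E exprn_ile1//.
  by rewrite subr_ge0 exprn_ile1.
by rewrite gerBl sqr_ge0.
Qed.

Lemma qN_01 N (u : R) : 0 <= u <= 1 -> 0 <= qN N u <= 1.
Proof.
move=> /andP[u0 u1]; have h0 : 0 <= u ^+ N by rewrite exprn_ge0.
have h1 : u ^+ N <= 1 by rewrite exprn_ile1.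
by rewrite exprn_ge0 ?subr_ge0//= exprn_ile1 ?subr_ge0// gerBl.
Qed.

Lemma cvg_natM_geometric (r : R) : 0 <= r < 1 -> (fun n => n%:R * r ^+ n) @ \oo --> (0 : R).
Proof.
(* Since [r^n = s^n s^n] and [n s^n] is at most the geometric sum, hence at most [1 / (1 - s)], one
   factor [s^n] is left to force the limit. *)
move=> /andP[r0 r1]; pose s := Num.sqrt r.
have s0 : 0 <= s by rewrite sqrtr_ge0.
have s1 : s < 1 by rewrite -sqrtr1 ltr_sqrt.
have rE : r = s ^+ 2 by rewrite sqr_sqrtr.
have H n : n%:R * r ^+ n <= (1 - s)^-1 * s ^+ n.
  have -> : n%:R * r ^+ n = (n%:R * s ^+ n) * s ^+ n by rewrite rE -exprM mulnC exprM expr2 mulrA.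
  rewrite ler_wpM2r ?exprn_ge0// -[leRHS]mul1r ler_pdivlMr ?subr_gt0//.
  apply: (@le_trans _ _ ((\sum_(i < n) s ^+ i) * (1 - s))).
    rewrite ler_wpM2r ?subr_ge0 ?(ltW s1)//.
    have -> : n%:R * s ^+ n = \sum_(i < n) s ^+ n by rewrite mulr_natl sumr_const card_ord.
    by apply: ler_sum => i _; rewrite ler_wiXn2l// ?(ltW s1)// ltnW.
  rewrite mulrC -opprB mulNr -subrX1 opprB gerBl exprn_ge0//.
apply: (@squeeze_cvgr _ _ _ _ (fun=> 0) (fun n => (1 - s)^-1 * s ^+ n)).
- by apply: nearW => n; rewrite H mulr_ge0 ?exprn_ge0.
- exact: cvg_cst.
- rewrite -[X in _ --> X](mulr0 (1 - s)^-1); apply: cvgM; first exact: cvg_cst.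
  by apply: cvg_expr; rewrite ger0_norm.
Qed.

(** The product of exponent and perturbation is [N (2 u)^N]. It tends to 0 for [u < 1/2], where
    Bernoulli's inequality gives the limit 1, and it is at least [N] for [u >= 1/2], where the
    reverse bound gives at most [1 / (N + 1)]. *)
Lemma qN_cvg (u : R) : 0 <= u <= 1 -> (fun N => qN N u) @ \oo --> ((u < 2^-1)%R%:R : R).
Proof.
move=> u01; have /andP[u0 u1] := u01.
have hN N : 0 <= u ^+ N <= 1 by rewrite exprn_ge0// exprn_ile1.
have EN N : (N * 2 ^ N)%:R * u ^+ N = N%:R * (2 * u) ^+ N.
  by rewrite natrM natrX exprMn; ring.
case: ltP => [ult|uge].
  apply: (@squeeze_cvgr _ _ _ _ (fun N => 1 - N%:R * (2 * u) ^+ N) (fun=> 1)).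
  - apply: nearW => N; rewrite -EN bernoulli_ge//=.
    by have /andP[] := qN_01 N u01.
  - rewrite -[X in _ --> X]subr0; apply: cvgB; first exact: cvg_cst.
    by apply: cvg_natM_geometric; lra.
  - exact: cvg_cst.
apply: (@squeeze_cvgr _ _ _ _ (fun=> 0) (fun N => N.+1%:R^-1)).
- apply: nearW => N; have /andP[-> _]/= := qN_01 N u01.
  have := bernoulli_le (N * 2 ^ N) (hN N); rewrite EN => H.
  rewrite -[leRHS]mul1r ler_pdivlMr//; apply: le_trans H.
  rewrite ler_wpM2l ?exprn_ge0 ?subr_ge0//; first by have /andP[] := hN N.
  rewrite -natr1 addrC lerD2l ler_peMr// exprn_ege1//.
  by move: uge; lra.
- exact: cvg_cst.
- exact: cvg_harmonic.
Qed.

End sharp_polynomials.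

Section L2_density.
Context d (T : measurableType d) (R : realType) (m : {measure set T -> \bar R}).
Variables (S : set T) (w : T -> R).
Hypotheses (mS : measurable S) (mw : measurable_fun S w) (w0 : forall x, S x -> 0 <= w x).
Hypothesis iw : m.-integrable S (EFin \o w).

Variable A : (T -> R) -> Prop.
Hypothesis Am : forall u, A u -> measurable_fun S u.
Hypothesis A1 : A (fun=> 1).
Hypothesis AD : forall u v, A u -> A v -> A (fun x => u x + v x).
Hypothesis AZ : forall c u, A u -> A (fun x => c * u x).
Hypothesis AM : forall u v, A u -> A v -> A (fun x => u x * v x).

(** Extended-valued, so that errors are defined before any integrability is known. *)
Definition E2 (g : T -> R) : \bar R := (\int[m]_(x in S) (g x ^+ 2 * w x)%:E)%E.

Definition L2_limit_of (g : T -> R) := measurable_fun S g /\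
  forall eps : R, 0 < eps -> exists2 u, A u & (E2 (fun x => (g x - u x)%R) < eps%:E)%E.

Let mE2 (g : T -> R) : measurable_fun S g -> measurable_fun S (fun x => (g x ^+ 2 * w x)%:E).
Proof. by move=> mg; apply/measurable_EFinP; apply: measurable_funM => //; exact: measurable_funX. Qed.

Lemma E2_ge0 (g : T -> R) : (0 <= E2 g)%E.
Proof. by apply: integral_ge0 => x Sx; rewrite lee_fin mulr_ge0 ?sqr_ge0 ?w0. Qed.

Lemma eq_E2 (f g : T -> R) : (forall x, S x -> f x = g x) -> E2 f = E2 g.
Proof. by move=> fg; apply: eq_integral => x; rewrite inE => Sx; rewrite fg. Qed.

Lemma E2_add (f g : T -> R) : measurable_fun S f -> measurable_fun S g ->
  (E2 (fun x => (f x + g x)%R) <= 2%:E * E2 f + 2%:E * E2 g)%E.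
Proof.
move=> mf mg; rewrite /E2 -!ge0_integralZl//; try exact: mE2;
  try by move=> x Sx; rewrite lee_fin mulr_ge0 ?sqr_ge0 ?w0.
rewrite -ge0_integralD//; try by move=> x Sx; rewrite mule_ge0// lee_fin mulr_ge0 ?sqr_ge0 ?w0.
- apply: ge0_le_integral => //.
  + by move=> x Sx; rewrite lee_fin mulr_ge0 ?sqr_ge0 ?w0.
  + by apply: mE2; exact: measurable_funD.
  + by apply: emeasurable_funD; apply: emeasurable_funM => //; exact: mE2.
  + move=> x Sx; rewrite -!EFinM -EFinD lee_fin !mulrA -mulrDl ler_wpM2r ?w0//.
    have := sqr_ge0 (f x - g x); nra.
- by apply: emeasurable_funM => //; exact: mE2.
- by apply: emeasurable_funM => //; exact: mE2.
Qed.

Let quarter_ltD (a b : \bar R) (e : R) : (a < (e / 4)%:E -> b < (e / 4)%:E ->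
  2%:E * a + 2%:E * b < e%:E)%E.
Proof.
move=> ae be.
have h1 : (2%:E * a < (2 * (e / 4))%:E)%E by rewrite EFinM lte_pmul2l.
have h2 : (2%:E * b < (2 * (e / 4))%:E)%E by rewrite EFinM lte_pmul2l.
by apply: lt_le_trans (lteD h1 h2) _; rewrite -EFinD lee_fin; lra.
Qed.

Lemma L2_limit_A (u : T -> R) : A u -> L2_limit_of u.
Proof.
move=> Au; split; first exact: Am.
move=> e e0; exists u => //; rewrite /E2.
under eq_integral do rewrite subrr expr0n mul0r.
by rewrite integral0 lte_fin.
Qed.

Lemma L2_limit_trans (g : T -> R) : measurable_fun S g ->
  (forall eps : R, 0 < eps -> exists2 h, L2_limit_of h & (E2 (fun x => (g x - h x)%R) < eps%:E)%E) ->
  L2_limit_of g.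
Proof.
move=> mg H; split => // e e0.
have e4 : 0 < e / 4 by rewrite divr_gt0.
have [h [mh hV] gh] := H _ e4; have [u Au hu] := hV _ e4.
exists u => //; apply: (@le_lt_trans _ _ (2%:E * E2 (fun x => (g x - h x)%R) + 2%:E * E2 (fun x => (h x - u x)%R))%E).
  rewrite (@eq_E2 _ (fun x => (g x - h x) + (h x - u x))); last by move=> x _; ring.
  by apply: E2_add; apply: measurable_funB => //; exact: Am.
exact: quarter_ltD.
Qed.

Lemma L2_limitD (f g : T -> R) : L2_limit_of f -> L2_limit_of g -> L2_limit_of (fun x => f x + g x).
Proof.
move=> [mf Vf] [mg Vg]; split; first exact: measurable_funD.
move=> e e0; have e4 : 0 < e / 4 by rewrite divr_gt0.
have [u Au fu] := Vf _ e4; have [v Av gv] := Vg _ e4.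
exists (fun x => u x + v x); first exact: AD.
apply: (@le_lt_trans _ _ (2%:E * E2 (fun x => (f x - u x)%R) + 2%:E * E2 (fun x => (g x - v x)%R))%E).
  rewrite (@eq_E2 _ (fun x => (f x - u x) + (g x - v x))); last by move=> x _; ring.
  by apply: E2_add; apply: measurable_funB => //; exact: Am.
exact: quarter_ltD.
Qed.

Lemma L2_limitZ (c : R) (f : T -> R) : L2_limit_of f -> L2_limit_of (fun x => c * f x).
Proof.
move=> [mf Vf]; split; first exact: measurable_funM.
(* The bound [c^2 + 1] in place of [c^2] keeps the divisor positive when [c = 0]. *)
move=> e e0; have k0 : 0 < c ^+ 2 + 1 by rewrite ltr_wpDl ?sqr_ge0.
have ek : 0 < e / (c ^+ 2 + 1) by rewrite divr_gt0.
have [u Au fu] := Vf _ ek.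
exists (fun x => c * u x); first exact: AZ.
rewrite (@eq_E2 _ (fun x => c * (f x - u x))); last by move=> x _; ring.
apply: (@le_lt_trans _ _ ((c ^+ 2 + 1)%:E * E2 (fun x => (f x - u x)%R))%E).
  have mfu : measurable_fun S (fun x => f x - u x) by apply: measurable_funB => //; exact: Am.
  rewrite /E2 -ge0_integralZl//; last 3 first.
  - exact: mE2.
  - by move=> x Sx; rewrite lee_fin mulr_ge0 ?sqr_ge0 ?w0.
  - by rewrite lee_fin ltW.
  apply: ge0_le_integral => //.
  - by move=> x Sx; rewrite lee_fin mulr_ge0 ?sqr_ge0 ?w0.
  - by apply: mE2; exact: measurable_funM.
  - by apply: emeasurable_funM => //; exact: mE2.
  - move=> x Sx; rewrite -EFinM lee_fin mulrA ler_wpM2r ?w0// exprMn ler_wpM2r ?sqr_ge0//.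
    by rewrite lerDl.
by rewrite (_ : e = (c ^+ 2 + 1) * (e / (c ^+ 2 + 1))) ?EFinM ?lte_pmul2l// mulrC divfK// gt_eqF.
Qed.

Lemma eq_L2_limit (f g : T -> R) : (forall x, S x -> f x = g x) -> L2_limit_of f -> L2_limit_of g.
Proof.
move=> fg [mf Vf]; split; first by apply: eq_measurable_fun mf => x; rewrite inE => /fg.
move=> e e0; have [u Au fu] := Vf _ e0; exists u => //.
by rewrite -(@eq_E2 (fun x => f x - u x))// => x Sx; rewrite fg.
Qed.

Lemma L2_limit_sum (I : Type) (s : seq I) (F : I -> T -> R) :
  (forall i, L2_limit_of (F i)) -> L2_limit_of (fun x => \sum_(i <- s) F i x).
Proof.
move=> VF; elim: s => [|i s IH].
  by apply: eq_L2_limit (L2_limitZ 0 (L2_limit_A A1)) => x _; rewrite big_nil mul0r.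
by apply: eq_L2_limit (L2_limitD (VF i) IH) => x _; rewrite big_cons.
Qed.

(** By dominated convergence the errors tend to 0; the majorant [h] bounds the squared error and not
    the functions themselves. *)
Lemma L2_limit_cvg (g_ : (T -> R)^nat) (g h : T -> R) :
  (forall n, L2_limit_of (g_ n)) -> measurable_fun S g ->
  m.-integrable S (EFin \o (fun x => h x * w x)) ->
  (forall n x, S x -> (g x - g_ n x) ^+ 2 <= h x) ->
  (forall x, S x -> g_ ^~ x @ \oo --> g x) -> L2_limit_of g.
Proof.
move=> Vg mg ih gh gg; apply: L2_limit_trans => // e e0.
have mgn n : measurable_fun S (fun x => g x - g_ n x).
  by apply: measurable_funB => //; exact: (Vg n).1.
have : (fun n => E2 (fun x => (g x - g_ n x)%R)) @ \oo --> (0%R%:E : \bar R).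
  have -> : (0%R%:E : \bar R) = (\int[m]_(x in S) (cst 0%E x))%E by rewrite integral0.
  have := @dominated_convergence _ _ _ m S mS (fun n x => ((g x - g_ n x) ^+ 2 * w x)%:E)
    (cst 0%E) (fun x => (h x * w x)%:E).
  case=> //.
  - by move=> n; exact: mE2.
  - apply: aeW => x Sx; apply: cvg_EFin; first exact: nearW.
    have -> : (0 : R) = (g x - g x) ^+ 2 * w x by rewrite subrr expr0n mul0r.
    apply: cvgM; last exact: cvg_cst.
    rewrite expr2; under eq_fun do rewrite expr2.
    by apply: cvgM; (apply: cvgB; [exact: cvg_cst|exact: gg]).
  - apply: aeW => x n Sx; rewrite abse_EFin lee_fin ger0_norm; last by apply: mulr_ge0; [exact: sqr_ge0|exact: w0].
    by apply: ler_wpM2r; [exact: w0|exact: gh].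
move=> /fine_cvgP[[N _ Hfin] Hcvg].
have [M _ HM] := (@cvgrPdist_lt _ _ _ _ _ _ _).1 Hcvg _ e0.
(* Beyond [N] the errors are finite, beyond [M] their real values are below [e]. *)
exists (g_ (maxn N M)) => //.
have := HM (maxn N M) (leq_maxr _ _); have /fineK := Hfin (maxn N M) (leq_maxl _ _).
move=> /= <-; rewrite lte_fin sub0r normrN; apply: le_lt_trans; exact: ler_norm.
Qed.

Let A_exp (u : T -> R) N : A u -> A (fun x => u x ^+ N).
Proof.
move=> Au; elim: N => [|N IH].
  by rewrite (_ : (fun x => u x ^+ 0) = fun=> 1)//; apply/funext => x; rewrite expr0.
rewrite (_ : (fun x => u x ^+ N.+1) = fun x => u x * u x ^+ N); first exact: AM.
by apply/funext => x; rewrite exprS.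
Qed.

Let A_qN (u : T -> R) N : A u -> A (fun x => qN N (u x)).
Proof.
move=> Au; apply: A_exp.
rewrite (_ : (fun x => 1 - u x ^+ N) = fun x => 1 + (-1) * u x ^+ N).
  by apply: AD => //; apply: AZ; exact: A_exp.
by apply/funext => x; rewrite mulN1r.
Qed.

(** The functions [qN N \o u] stay in the algebra and between 0 and 1, so dominated convergence
    applies to their products. Two functions are taken together because a quadrant is cut out by two
    inequalities. *)
Lemma L2_limit_sublevel2 (u v : T -> R) : A u -> A v ->
  (forall x, S x -> 0 <= u x <= 1) -> (forall x, S x -> 0 <= v x <= 1) ->
  L2_limit_of (fun x => (u x < 2^-1)%R%:R * (v x < 2^-1)%R%:R).
Proof.
move=> Au Av u01 v01.
have cv x : S x -> (fun N => qN N (u x) * qN N (v x)) @ \oo -->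
    ((u x < 2^-1)%R%:R * (v x < 2^-1)%R%:R : R).
  by move=> Sx; apply: cvgM; apply: qN_cvg; [exact: u01|exact: v01].
have mb (f : T -> R) : measurable_fun S f -> measurable_fun S (fun x => (f x < 2^-1)%R%:R : R).
  move=> mf; have mF := measurable_fun_ltr mf (measurable_cst (2^-1 : R)).
  apply: (measurableT_comp (f := fun b : bool => b%:R : R) _ mF).
  by [].
apply: (@L2_limit_cvg (fun N x => qN N (u x) * qN N (v x)) _ (fun=> 1)) => //.
- by move=> N; apply: L2_limit_A; apply: AM; exact: A_qN.
- by apply: measurable_funM; apply: mb; exact: Am.
- by apply: eq_integrable iw => // x _; rewrite /= mul1r.
- move=> N x Sx; have /andP[a0 a1] := qN_01 N (u01 x Sx); have /andP[b0 b1] := qN_01 N (v01 x Sx).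
  set a := qN N (u x) in a0 a1 *; set b := qN N (v x) in b0 b1 *.
  have c0 : 0 <= a * b by rewrite mulr_ge0.
  have c1 : a * b <= 1 by rewrite mulr_ile1.
  by case: (u x < _)%R; case: (v x < _)%R; rewrite /= ?mul1r ?mul0r; nra.
Qed.

Variable G : set (set T).
Hypothesis measurableG : @measurable d T = <<s G >>.
Hypothesis GI : setI_closed G.
Hypothesis GA : forall E, G E -> L2_limit_of (\1_E : T -> R).

Let iS : m.-integrable S (EFin \o (fun x => 1 * w x)).
Proof. by apply: eq_integrable iw => // x _; rewrite /= mul1r. Qed.

(** The sets whose indicator is approximable form a Dynkin system: complements by linearity,
    disjoint unions by dominated convergence of the partial sums. It contains the generators [G],
    which are closed under intersection. *)
Lemma L2_limit_indic E : measurable E -> L2_limit_of (\1_E : T -> R).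
Proof.
rewrite measurableG; move: E; apply: (dynkin_induction measurableG GI) => //.
- by apply: eq_L2_limit (L2_limit_A A1) => x _; rewrite indicT.
- move=> E _ VE; apply: eq_L2_limit (L2_limitD (L2_limit_A A1) (L2_limitZ (-1) VE)) => x _.
  rewrite !indicE in_setC; case: (x \in E); rewrite /=; ring.
- move=> F mF tF VF.
  have FE x : (fun n => \sum_(i < n) (\1_(F i) x : R)) @ \oo --> (\1_(\bigcup_k F k) x : R).
    have := indic_bigcup x tF (R := R) => H.
    have : (fun n => (\sum_(0 <= i < n) (\1_(F i) x)%:E)%E) @ \oo --> ((\1_(\bigcup_k F k) x)%:E : \bar R).
      by rewrite H; apply: is_cvg_nneseries => n _ _; rewrite lee_fin.
    move=> /fine_cvgP[_]; apply: cvg_trans; apply: near_eq_cvg; apply: nearW => n /=.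
    by rewrite sumEFin big_mkord.
  apply: (@L2_limit_cvg (fun n x => \sum_(i < n) (\1_(F i) x : R)) _ (fun=> 1)) => //.
  - by move=> n; have := L2_limit_sum (index_enum 'I_n) (fun i : 'I_n => VF i).
  - by apply: measurable_indic; exact: bigcup_measurable.
  - move=> n x _; have nd : {homo (fun n => \sum_(i < n) (\1_(F i) x : R)) : p q / (p <= q)%N >-> p <= q}.
      move=> p q pq; rewrite -!(big_mkord xpredT (fun i => (\1_(F i) x : R))).
      by rewrite [leRHS](big_cat_nat (leq0n p) pq)/= lerDl sumr_ge0.
    have le : \sum_(i < n) (\1_(F i) x : R) <= \1_(\bigcup_k F k) x.
      have := nondecreasing_cvgn_le nd (cvgP _ (FE x)) n.
      by move/(cvg_lim (@Rhausdorff R)) : (FE x) => ->.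
    have ge : 0 <= \sum_(i < n) (\1_(F i) x : R) by exact: sumr_ge0.
    have l1 : (\1_(\bigcup_k F k) x : R) <= 1 by rewrite indicE; case: (_ \in _).
    rewrite exprn_ile1//; lra.
Qed.

Import HBNNSimple.

Lemma L2_limit_nnsfun (f : {nnsfun T >-> R}) : L2_limit_of (f : T -> R).
Proof.
have H : forall x, f x = \sum_(y <- finmap.enum_fset (fset_set (range (f : T -> R)))) (y * (\1_((f : T -> R) @^-1` [set y]) x : R)).
  by move=> x; rewrite {1}fimfunE fsbig_finite.
apply: eq_L2_limit (L2_limit_sum _ _) => [x _|y]; first by rewrite H.
by apply: L2_limitZ; exact: L2_limit_indic.
Qed.

Lemma L2_limit_ge0 (g : T -> R) : measurable_fun S g -> (forall x, S x -> 0 <= g x) ->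
  m.-integrable S (EFin \o (fun x => g x ^+ 2 * w x)) -> L2_limit_of g.
Proof.
move=> mg g0 ig; have mG : measurable_fun S (EFin \o g) by exact/measurable_EFinP.
have G0 x : S x -> (0 <= (EFin \o g) x)%E by move=> Sx; rewrite lee_fin g0.
have cvgG x : S x -> (fun n => nnsfun_approx mS mG n x) @ \oo --> g x.
  by move=> Sx; have /fine_cvgP[_] := cvg_nnsfun_approx mS mG G0 Sx.
apply: (L2_limit_cvg (g_ := fun n => nnsfun_approx mS mG n) _ mg ig) => // [n|n x Sx].
  exact: L2_limit_nnsfun.
have nd : {homo (fun n => nnsfun_approx mS mG n x) : p q / (p <= q)%N >-> p <= q}.
  by move=> p q pq; have /lefP := nd_nnsfun_approx mS mG pq; exact.
have le : nnsfun_approx mS mG n x <= g x.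
  have := nondecreasing_cvgn_le nd (cvgP _ (cvgG _ Sx)) n.
  by move/(cvg_lim (@Rhausdorff R)) : (cvgG _ Sx) => ->.
have ge : 0 <= nnsfun_approx mS mG n x by [].
by rewrite ler_sqr ?nnegrE ?g0 ?subr_ge0// gerBl.
Qed.

Lemma L2_limit_dense (g : T -> R) : measurable_fun S g ->
  m.-integrable S (EFin \o (fun x => g x ^+ 2 * w x)) -> L2_limit_of g.
Proof.
move=> mg ig.
have le1 (h : T -> R) : measurable_fun S h -> (forall x, S x -> h x ^+ 2 <= g x ^+ 2) ->
    m.-integrable S (EFin \o (fun x => h x ^+ 2 * w x)).
  move=> mh hg; apply: le_integrable ig => //.
    by apply/measurable_EFinP; apply: measurable_funM => //; exact: measurable_funX.
  move=> x Sx; rewrite !abse_EFin lee_fin !ger0_norm; last 2 first.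
  - by apply: mulr_ge0; [exact: sqr_ge0|exact: w0].
  - by apply: mulr_ge0; [exact: sqr_ge0|exact: w0].
  by apply: ler_wpM2r; [exact: w0|exact: hg].
pose gp : T -> R := fun x => Num.max (g x) 0; pose gn : T -> R := fun x => Num.max (- g x) 0.
have mp : measurable_fun S gp by exact: measurable_maxr.
have mn : measurable_fun S gn by apply: measurable_maxr => //; exact: measurable_funN.
have p0 y : 0 <= gp y by rewrite le_max lexx orbT.
have n0 y : 0 <= gn y by rewrite le_max lexx orbT.
have Vp : L2_limit_of gp.
  apply: L2_limit_ge0 => //; apply: le1 => // y _.
  by rewrite /gp maxEle; case: ifP => _; rewrite ?lexx// expr0n sqr_ge0.
have Vn : L2_limit_of gn.
  apply: L2_limit_ge0 => //; apply: le1 => // y _.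
  by rewrite /gn maxEle; case: ifP => _; rewrite ?sqrrN ?lexx// expr0n sqr_ge0.
apply: eq_L2_limit (L2_limitD Vp (L2_limitZ (-1) Vn)) => x _; rewrite /gp /gn.
by rewrite !maxEle; case: ifPn; case: ifPn; rewrite -?ltNge => ? ?; lra.
Qed.

End L2_density.

Section plane_quadrants.
Variable R : realType.
Local Notation mR := (measurableTypeR R).

Definition quadrants : set (set (mR * mR)) :=
  [set E | exists c d : R, E = (`]-oo, c[ `*` `]-oo, d[)%classic].

Lemma setI_closed_quadrants : setI_closed quadrants.
Proof.
move=> _ _ [a [b ->]] [c [d ->]]; exists (Num.min a c), (Num.min b d).
rewrite -setXI; congr (_ `*` _); apply/seteqP; split => x /=;
  rewrite !in_itv/= lt_min; by [move=> [-> ->]|move=> /andP[]].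
Qed.

(** Half-planes bounded on one coordinate are countable unions of quadrants, so both projections are
    measurable for the generated sigma-algebra, which thus contains all measurable rectangles. *)
Lemma measurable_quadrants : @measurable _ (mR * mR)%type = <<s quadrants >>.
Proof.
have ex_nat (x : R) : exists n : nat, x < n%:R.
  by exists (Num.truncn x).+1; rewrite truncnS_gt.
have mf : measurable_fun setT (fst : g_sigma_algebraType quadrants -> mR).
  apply: (measurability _ (RGenInftyO.measurableE R)) => // _ [_ [c ->] <-].
  rewrite setTI (_ : _ @^-1` _ = \bigcup_n (`]-oo, c[ `*` `]-oo, n%:R[)%classic); last first.
    apply/seteqP; split => [[x y]/= xc|[x y] [n _ []]//].
    by have [n yn] := ex_nat y; exists n => //; split => //=; rewrite in_itv.
  by apply: bigcup_measurable => n _; apply: sub_sigma_algebra; exists c, n%:R.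
have ms : measurable_fun setT (snd : g_sigma_algebraType quadrants -> mR).
  apply: (measurability _ (RGenInftyO.measurableE R)) => // _ [_ [c ->] <-].
  rewrite setTI (_ : _ @^-1` _ = \bigcup_n (`]-oo, n%:R[ `*` `]-oo, c[)%classic); last first.
    apply/seteqP; split => [[x y]/= xc|[x y] [n _ []]//].
    by have [n yn] := ex_nat x; exists n => //; split => //=; rewrite in_itv.
  by apply: bigcup_measurable => n _; apply: sub_sigma_algebra; exists n%:R, c.
apply/seteqP; split.
  rewrite measurable_prod_measurableType; apply: smallest_sub.
    exact: smallest_sigma_algebra.
  move=> _ [X mX [Y mY <-]].
  have := measurableI _ _ (mf measurableT _ mX) (ms measurableT _ mY); rewrite !setTI.
  by congr (@measurable _ (g_sigma_algebraType quadrants) _).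
apply: smallest_sub; first exact: sigma_algebra_measurable.
by move=> _ [c [d ->]]; apply: measurableX; exact: measurable_itv.
Qed.

End plane_quadrants.

(** * Transfer of a change of variables to signed and complex integrals *)

Section pullbacks.
Context d d' (T : measurableType d) (T' : measurableType d') (R : realType).
Variables (m : {measure set T -> \bar R}) (m' : {measure set T' -> \bar R}).
Variables (D : set T) (D' : set T') (phi : T -> T') (w : T -> R).
Hypothesis w0 : forall x, D x -> 0 <= w x.

(* The change of variables [y = phi x] with density [w], tested on nonnegative functions
   of [f], so that it also covers periodic or compactly supported integrands. *)
Definition pulls (f : T' -> R) := forall h : R -> R, measurable_fun setT h ->
  (forall r, 0 <= h r) -> h 0 = 0 ->
  (\int[m']_(y in D') (h (f y))%:E = \int[m]_(x in D) (h (f (phi x)) * w x)%:E)%E.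

(** The test functions [max r 0] and [max (- r) 0] match the positive and negative parts separately,
    so the signed integrals agree even when they are infinite or default values. *)
Lemma pulls_integral (f : T' -> R) : pulls f ->
  (\int[m']_(y in D') (f y)%:E = \int[m]_(x in D) (f (phi x) * w x)%:E)%E.
Proof.
move=> H.
have mp : measurable_fun setT (fun r : R => Num.max r 0) by exact: measurable_maxr.
have mn : measurable_fun setT (fun r : R => Num.max (- r) 0).
  by apply: measurable_maxr => //; exact: oppr_measurable.
have p0 (r : R) : 0 <= Num.max r 0 by rewrite le_max lexx orbT.
rewrite integralE [RHS]integralE; congr (_ - _)%E.
  rewrite [LHS](eq_integral (fun y => (Num.max (f y) 0)%:E)); last first.
    by move=> y _; rewrite (_ : (fun y => (f y)%:E) = EFin \o f)// funerpos.
  rewrite (H (fun r => Num.max r 0))//; last by rewrite maxxx.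
   apply: eq_integral => x; rewrite inE => Dx.
  rewrite (_ : (fun x => (f (phi x) * w x)%:E) = EFin \o (fun x => f (phi x) * w x))// funerpos.
  by rewrite /= /funrpos -[in RHS](mul0r (w x)) maxr_pMl ?w0.
rewrite [LHS](eq_integral (fun y => (Num.max (- f y) 0)%:E)); last first.
  by move=> y _; rewrite (_ : (fun y => (f y)%:E) = EFin \o f)// funerneg.
rewrite (H (fun r => Num.max (- r) 0))//; last by rewrite oppr0 maxxx.
 apply: eq_integral => x; rewrite inE => Dx.
rewrite (_ : (fun x => (f (phi x) * w x)%:E) = EFin \o (fun x => f (phi x) * w x))// funerneg.
by rewrite /= /funrneg -mulNr -[in RHS](mul0r (w x)) maxr_pMl ?w0.
Qed.

Lemma pulls_Rintegral (f : T' -> R) : pulls f ->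
  Rintegral m' D' f = Rintegral m D (fun x => f (phi x) * w x).
Proof. by move=> H; rewrite /Rintegral pulls_integral. Qed.

Lemma pulls_integrable (f : T' -> R) : measurable_fun D' f ->
  measurable_fun D (fun x => f (phi x) * w x) -> pulls f ->
  m'.-integrable D' (EFin \o f) <-> m.-integrable D (EFin \o (fun x => f (phi x) * w x)).
Proof.
move=> mf mg H.
have E : (\int[m']_(y in D') `|(f y)%:E| = \int[m]_(x in D) `|(f (phi x) * w x)%:E|)%E.
  transitivity (\int[m']_(y in D') (`|f y|)%:E)%E; first by [].
  rewrite (H (fun r => `|r|))//; last by rewrite normr0.
  by apply: eq_integral => x; rewrite inE => Dx; rewrite /= normrM (ger0_norm (w0 Dx)).
by split=> /integrableP[_ fi]; apply/integrableP; split => //;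
  [exact/measurable_EFinP|rewrite -E|exact/measurable_EFinP|rewrite /= E].
Qed.

Definition cpulls (f : T' -> R[i]) := pulls (@cRe R \o f) /\ pulls (@cIm R \o f).

Lemma cpulls_cintegral f : cpulls f ->
  cintegral m' D' f = cintegral m D (fun x => f (phi x) * (w x)%:C).
Proof.
move=> [H1 H2]; apply: cP; rewrite /cintegral /= pulls_Rintegral//;
  by apply: eq_Rintegral => x _; rewrite /= !cE mulr0 ?subr0 ?add0r.
Qed.

Lemma cpulls_cintegrable f : cmeas D' f -> cmeas D (fun x => f (phi x) * (w x)%:C) ->
  cpulls f -> cintegrable m' D' f <-> cintegrable m D (fun x => f (phi x) * (w x)%:C).
Proof.
move=> [f1 f2] [g1 g2] [H1 H2].
have E1 x : cRe (f (phi x) * (w x)%:C) = cRe (f (phi x)) * w x by rewrite !cE mulr0 subr0.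
have E2 x : cIm (f (phi x) * (w x)%:C) = cIm (f (phi x)) * w x by rewrite !cE mulr0 add0r.
rewrite /cintegrable.
have -> : @cRe R \o (fun x => f (phi x) * (w x)%:C) = fun x => cRe (f (phi x)) * w x.
  by apply/funext => x; exact: E1.
have -> : @cIm R \o (fun x => f (phi x) * (w x)%:C) = fun x => cIm (f (phi x)) * w x.
  by apply/funext => x; exact: E2.
have g1' : measurable_fun D (fun x => (@cRe R \o f) (phi x) * w x).
  by apply: eq_measurable_fun g1 => x _; exact: E1.
have g2' : measurable_fun D (fun x => (@cIm R \o f) (phi x) * w x).
  by apply: eq_measurable_fun g2 => x _; exact: E2.
have I1 := pulls_integrable f1 g1' H1; have I2 := pulls_integrable f2 g2' H2.
by split => -[/I1 a /I2 b].
Qed.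

End pullbacks.

(** * Fubini's theorem for complex functions *)

Section complex_fubini.
Context d1 d2 (T1 : measurableType d1) (T2 : measurableType d2) (R : realType).
Variables (m1 : {sigma_finite_measure set T1 -> \bar R})
  (m2 : {sigma_finite_measure set T2 -> \bar R}).

(** [J] is compared with the inner integral only almost everywhere: a factor can be moved across the
    inner integral only where the section is integrable. *)
Let fubini_R (h : T1 * T2 -> R) (J : T1 -> R) : (m1 \x m2)%E.-integrable setT (EFin \o h) ->
  measurable_fun setT J ->
  {ae m1, forall x, J x = Rintegral m2 setT (fun y => h (x, y))} ->
  m1.-integrable setT (EFin \o J) /\ Rintegral m1 setT J = Rintegral (m1 \x m2)%E setT h.
Proof.
move=> ih mJ JE.
have iF := integrable_fubini_F ih.
have iFae := ae_integrable1 ih.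
have H : {ae m1, forall x, setT x -> (EFin \o J) x = fubini_F m2 (EFin \o h) x}.
  apply: (filterS2 _ _ JE iFae) => x Jx ix _ /=.
  rewrite Jx /Rintegral fineK//.
  exact: integral_fune_fin_num.
split.
  apply/integrableP; split; first exact/measurable_EFinP.
  have /integrableP[_ iFy] := iF; apply: le_lt_trans iFy.
  rewrite (ae_eq_integral (fun x => `|fubini_F m2 (EFin \o h) x|%E))//.
  - by apply: measurableT_comp => //; exact/measurable_EFinP.
  - by apply: measurableT_comp => //; exact: measurable_int iF.
  - by apply: filterS H => x Hx xT; rewrite Hx.
rewrite /Rintegral -(integral12_prod_meas1 ih); congr fine.
apply: ae_eq_integral => //; first exact/measurable_EFinP.
exact: measurable_int iF.
Qed.

Let fubini_R2 (h : T1 * T2 -> R) : (m1 \x m2)%E.-integrable setT (EFin \o h) ->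
  Rintegral m2 setT (fun y => Rintegral m1 setT (fun x => h (x, y))) =
  Rintegral (m1 \x m2)%E setT h.
Proof.
move=> ih; have mG := measurable_fubini_G ih.
rewrite /Rintegral -(integral21_prod_meas1 ih); congr fine.
apply: ae_eq_integral => //.
  apply/measurable_EFinP; apply: measurableT_comp => //; exact: mG.
apply: filterS (ae_integrable2 ih) => y iy _ /=.
by rewrite fineK//; exact: integral_fune_fin_num.
Qed.

Lemma cintegral_fubini2 (f : T1 * T2 -> R[i]) : cintegrable (m1 \x m2)%E setT f ->
  cintegral m2 setT (fun y => cintegral m1 setT (fun x => f (x, y))) =
  cintegral (m1 \x m2)%E setT f.
Proof. by move=> [f1 f2]; apply: cP; [exact: (fubini_R2 f1)|exact: (fubini_R2 f2)]. Qed.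

(** Integrability of [f], besides that of the product, makes almost every section of [f] integrable,
    which lets the factor [g x] enter the inner integral. *)
Lemma cintegral_fubini (f : T1 * T2 -> R[i]) (g : T1 -> R[i]) :
  cmeas setT g -> cmeas setT (fun x => cintegral m2 setT (fun y => f (x, y))) ->
  cintegrable (m1 \x m2)%E setT f -> cintegrable (m1 \x m2)%E setT (fun z => g z.1 * f z) ->
  cintegrable m1 setT (fun x => g x * cintegral m2 setT (fun y => f (x, y))) /\
  cintegral m1 setT (fun x => g x * cintegral m2 setT (fun y => f (x, y))) =
  cintegral (m1 \x m2)%E setT (fun z => g z.1 * f z).
Proof.
move=> mg mJ [if1 if2] [ih1 ih2].
have H : {ae m1, forall x, g x * cintegral m2 setT (fun y => f (x, y)) =
    cintegral m2 setT (fun y => g x * f (x, y))}.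
  apply: (filterS2 _ _ (ae_integrable1 if1) (ae_integrable1 if2)) => x i1 i2.
  by rewrite cintegralZ.
have mgJ := cmeasM mg mJ.
have [I1 E1] := fubini_R (h := @cRe R \o (fun z => g z.1 * f z)) ih1 mgJ.1 (filterS (fun x Hx => congr1 (@cRe R) Hx) H).
have [I2 E2] := fubini_R (h := @cIm R \o (fun z => g z.1 * f z)) ih2 mgJ.2 (filterS (fun x Hx => congr1 (@cIm R) Hx) H).
by split; [split|apply: cP].
Qed.

Lemma cintegral_fubini1 (f : T1 * T2 -> R[i]) :
  cmeas setT (fun x => cintegral m2 setT (fun y => f (x, y))) ->
  cintegrable (m1 \x m2)%E setT f ->
  cintegral m1 setT (fun x => cintegral m2 setT (fun y => f (x, y))) =
  cintegral (m1 \x m2)%E setT f.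
Proof.
move=> mJ ff; have ff1 : cintegrable (m1 \x m2)%E setT (fun z => 1 * f z).
  by apply: eq_cintegrable ff => // z _; rewrite mul1r.
have [_ E] := cintegral_fubini (cmeas_cst _ 1) mJ ff ff1.
transitivity (cintegral m1 setT (fun x => 1 * cintegral m2 setT (fun y => f (x, y)))).
  by apply: eq_cintegral => x _; rewrite mul1r.
by rewrite E; apply: eq_cintegral => z _; rewrite mul1r.
Qed.

(** Tonelli is applied to positive and negative parts, so measurability includes the points where
    the section is not integrable and the integral is a default value. *)
Lemma cmeas_cintegral (f : T1 * T2 -> R[i]) : cmeas setT f ->
  cmeas setT (fun x => cintegral m2 setT (fun y => f (x, y))).
Proof.
have H (h : T1 * T2 -> R) : measurable_fun setT h ->
    measurable_fun setT (fun x => Rintegral m2 setT (fun y => h (x, y))).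
  move=> mh; have mh' : measurable_fun setT (EFin \o h) by exact/measurable_EFinP.
  rewrite /Rintegral; apply: measurableT_comp => //.
  rewrite [X in measurable_fun _ X](_ : _ = fun x =>
    (fubini_F m2 (EFin \o h)^\+ x - fubini_F m2 (EFin \o h)^\- x)%E); last first.
    apply/funext => x; rewrite integralE (funerpos h) (funerneg h); congr (_ - _)%E.
      by rewrite (funerpos (fun y => h (x, y))).
    by rewrite (funerneg (fun y => h (x, y))).
  apply: emeasurable_funB.
    by apply: measurable_fun_fubini_tonelli_F => //; exact: measurable_funepos.
  by apply: measurable_fun_fubini_tonelli_F => //; exact: measurable_funeneg.
by move=> [f1 f2]; split; [exact: (H (@cRe R \o f))|exact: (H (@cIm R \o f))].
Qed.

End complex_fubini.

(** * Coordinates on the space of geodesics *)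

Section geodesic_coordinates.
Variable R : realType.
Local Notation mu := (@lebesgue_measure R).

(* [a] is the tangent of the fan-beam angle of the geodesic. *)
Definition cA (a : R) : R := cos (atan a).
Definition sA (a : R) : R := sin (atan a).

Lemma cA_gt0 a : 0 < cA a.
Proof. by apply: cos_gt0_pihalf; rewrite atan_gtNpi2 atan_ltpi2. Qed.

Lemma cA2DsA2 a : cA a ^+ 2 + sA a ^+ 2 = 1.
Proof. exact: cos2Dsin2. Qed.

Lemma sAE a : sA a = a * cA a.
Proof.
transitivity (tan (atan a) * cA a); last by rewrite atanK.
by rewrite /tan divfK// gt_eqF//; exact: cA_gt0.
Qed.

Lemma cA_sqr a : (1 + a ^+ 2) * cA a ^+ 2 = 1.
Proof. by rewrite mulrDl mul1r -exprMn -sAE cA2DsA2. Qed.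

Lemma muHE a : muH a = cA a.
Proof.
have a2 : 0 < 1 + a ^+ 2 by rewrite ltr_wpDr ?sqr_ge0.
by rewrite /muH /cA cos_atan powRN -powR12_sqrt// ltW.
Qed.

Lemma sA_lt1 a : -1 < sA a < 1.
Proof.
have := cA2DsA2 a; have := cA_gt0 a; set c := cA a; set s := sA a => c0 E.
have s2 : s ^+ 2 < 1 by rewrite -E ltrDr exprn_gt0.
by apply/andP; split; nra.
Qed.

Lemma cAN a : cA (- a) = cA a. Proof. by rewrite /cA atanN cosN. Qed.
Lemma sAN a : sA (- a) = - sA a. Proof. by rewrite /sA atanN sinN. Qed.

Lemma is_derive_sA (a : R) : is_derive a 1 sA (cA a ^+ 3).
Proof.
have H : is_derive a 1 (@sin R \o @atan R) (cos (atan a) * (1 + a ^+ 2)^-1).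
  by apply: is_derive1_comp.
apply: is_derive_eq H _.
have E : (1 + a ^+ 2)^-1 = cA a ^+ 2.
  apply: (mulfI (_ : 1 + a ^+ 2 != 0)); first by rewrite gt_eqF// ltr_wpDr ?sqr_ge0.
  by rewrite cA_sqr mulfV// gt_eqF// ltr_wpDr ?sqr_ge0.
by rewrite E -/(cA a); ring.
Qed.

Lemma continuous_cA : continuous cA.
Proof.
move=> a; apply: (@continuous_comp _ _ _ (@atan R) (@cos R)).
  exact: continuous_atan.
exact: continuous_cos.
Qed.

Lemma measurable_atan : measurable_fun setT (@atan R).
Proof. by apply: continuous_measurable_fun => x; exact: continuous_atan. Qed.
Lemma measurable_cA : measurable_fun setT cA.
Proof. by apply: continuous_measurable_fun => x; exact: continuous_cA. Qed.
Lemma measurable_sA : measurable_fun setT sA.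
Proof.
apply: (measurableT_comp _ measurable_atan).
by apply: continuous_measurable_fun; exact: continuous_sin.
Qed.

Lemma ge0_integral_sA (G : R -> \bar R) : measurable_fun setT G -> (forall x, (0 <= G x)%E) ->
  (\int[mu]_(y in `](-1)%R, 1%R[) G y = \int[mu]_a (G (sA a) * (cA a ^+ 3)%:E))%E.
Proof.
apply: (@ge0_integration_by_substitution_oo _ sA (fun a => cA a ^+ 3) _ _ setT
  (fun y => tan (asin y)) 1) => //.
- exact: measurable_sA.
- by apply: measurable_funX; exact: measurable_cA.
- by move=> x _; exact: is_derive_sA.
- move=> x _; apply: (@continuous_comp _ _ _ cA (fun x : R => x ^+ 3)).
    exact: continuous_cA.
  exact: exprn_continuous.
- by move=> x _; rewrite exprn_gt0// cA_gt0.
- by move=> x _; exact: sA_lt1.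
- move=> y /andP[y1 y2]; split => //.
  rewrite /sA tanK ?asinK ?in_itv/= ?(ltW y1) ?(ltW y2)//.
  by rewrite asin_gtNpi2 ?asin_ltpi2// ?y1 ?y2 ?(ltW y1) ?(ltW y2).
Qed.

Definition periodic2 (T : Type) (H : R * R -> T) := forall x y, H (x + 2 * pi, y) = H (x, y).

Let twopi : 0 < 2 * pi :> R. Proof. by rewrite mulr_gt0// pi_gt0. Qed.

(** The shift is reduced modulo [2 pi]; the translated interval is then cut at [2 pi] and the
    overhanging piece moved back by one period. *)
Lemma ge0_integral_periodic (G : R -> \bar R) (c : R) : measurable_fun setT G ->
  (forall x, (0 <= G x)%E) -> (forall x, G (x + 2 * pi) = G x) ->
  (\int[mu]_(x in `[0%R, (2 * pi)%R[) G (x + c)%R = \int[mu]_(x in `[0%R, (2 * pi)%R[) G x)%E.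
Proof.
move=> mG G0 Gp.
have GpN x : G (x - 2 * pi) = G x by rewrite -[in RHS](subrK (2 * pi) x) Gp.
have Gpn n x : G (x + n%:R * (2 * pi)) = G x.
  elim: n x => [|n IH] x; first by rewrite mul0r addr0.
  by rewrite -natr1 mulrDl mul1r addrA Gp IH.
have Gpz (z : int) x : G (x + z%:~R * (2 * pi)) = G x.
  case: z => n; first by rewrite -pmulrn Gpn.
  rewrite NegzE mulrNz mulNr -[in RHS](subrK (n.+1%:R * (2 * pi)) x).
  by rewrite Gpn -pmulrn.
pose c' := c - (Num.floor (c / (2 * pi)))%:~R * (2 * pi).
have c'01 : 0 <= c' < 2 * pi.
  have /andP[h1 h2] := mem_rg1_floor (c / (2 * pi)).
  have -> : c' = (c / (2 * pi) - (Num.floor (c / (2 * pi)))%:~R) * (2 * pi).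
    by rewrite /c' mulrBl divfK// gt_eqF.
  rewrite mulr_ge0 ?subr_ge0 ?(ltW twopi)//= -[ltRHS]mul1r ltr_pM2r//.
  by rewrite ltrBlDl.
have {c'01} /andP[c0 c1] := c'01.
transitivity (\int[mu]_(x in `[0%R, (2 * pi)%R[) G (x + c')%R)%E.
  apply: eq_integral => x _.
  by rewrite -[RHS](Gpz (Num.floor (c / (2 * pi)))) /c' addrA subrK.
have mI (i : interval R) : measurable [set` i] by exact: measurable_itv.
have shift (p q r : R) : (\int[mu]_(x in `[p, q[) G (x + r)%R = \int[mu]_(x in `[(p + r)%R, (q + r)%R[) G x)%E.
  rewrite integral_mkcond [RHS]integral_mkcond.
  have := @ge0_integral_affine R 1 r (G \_ `[(p + r)%R, (q + r)%R[); rewrite oner_eq0 => /(_ isT) H.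
  rewrite [RHS](_ : _ = (`|1|^-1)%:E * \int[mu]_x (G \_ `[(p + r)%R, (q + r)%R[) x)%E; last first.
    by rewrite normr1 invr1 mul1e.
  rewrite -H.
  - apply: eq_integral => x _; rewrite mul1r /patch.
    by congr (if _ then _ else _); rewrite !mem_setE !in_itv/= lerD2r ltrD2r.
  - by apply/(measurable_restrictT _ _).1 => //; exact: measurable_funS mG.
  - by move=> x; rewrite /patch; case: ifP.
have split3 (p q r : R) : p <= q -> q <= r ->
    (\int[mu]_(x in `[p, r[) G x = \int[mu]_(x in `[p, q[) G x + \int[mu]_(x in `[q, r[) G x)%E.
  move=> pq qr; rewrite -ge0_integral_setU//.
  - by congr (integral _ _ _); rewrite -itv_bndbnd_setU// bnd_simp.
  - by apply: measurable_funS mG.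
  - by apply/disj_setPS => x /= []; rewrite !in_itv/= => /andP[_ /lt_le_trans h] /andP[/h]; rewrite ltxx.
rewrite shift add0r (split3 _ (2 * pi))//; [|exact: ltW|by rewrite lerDl].
rewrite [RHS](split3 0 c' _)//; last exact: ltW.
rewrite addeC; congr (_ + _)%E.
have := shift 0 c' (2 * pi); rewrite add0r addrC => <-.
by apply: eq_integral => x _; rewrite Gp.
Qed.

End geodesic_coordinates.

Section geodesic_integrals.
Variable R : realType.
Local Notation mu := (@lebesgue_measure R).
Local Notation mu2 := (@mu2 R).
Local Open Scope ereal_scope.

(** Chords of the disc as (normal angle, signed height). The angle 0, left out by the open interval,
    is negligible. *)
Definition Cyl : set (R * R) := [set z | (0 < z.1 < 2 * pi)%R /\ (-1 < z.2 < 1)%R].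
(* Angle and signed height of the chord that is the image under [PhiHE] of the geodesic [q]. *)
Definition tau (q : R * R) : R * R := (q.1 + atan q.2 - pi / 2, sA q.2)%R.

Lemma measurable_GH : measurable (@GH R).
Proof.
rewrite (_ : @GH R = (`[0%R, (2 * pi)%R[ `*` setT)%classic); last first.
  by apply/seteqP; split => -[x y]; rewrite /GH/= ?in_itv/=; [|move=> []].
by apply: measurableX => //; exact: measurable_itv.
Qed.

Lemma measurable_Cyl : measurable Cyl.
Proof.
rewrite (_ : Cyl = (`]0%R, (2 * pi)%R[ `*` `](-1)%R, 1%R[)%classic); last first.
  by apply/seteqP; split => -[x y]; rewrite /Cyl/= !in_itv/=.
by apply: measurableX; exact: measurable_itv.
Qed.

Lemma measurable_tau : measurable_fun setT tau.
Proof.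
apply: measurable_fun_pair.
  apply: measurable_funB => //; apply: measurable_funD => //.
  by apply: (measurableT_comp (@measurable_atan R)).
by apply: (measurableT_comp (@measurable_sA R)).
Qed.

Lemma measurable_SAH : measurable_fun setT (@SAH R).
Proof.
apply: measurable_fun_pair.
  apply: measurable_funD; first exact: measurable_funD.
  by apply: measurable_funM => //; apply: (measurableT_comp (@measurable_atan R)).
exact: measurable_funN.
Qed.

Lemma ge0_integral_rect (I J : set R) (G : R * R -> \bar R) : measurable I -> measurable J ->
  measurable_fun setT G -> (forall z, 0 <= G z) ->
  \int[mu2]_(z in I `*` J) G z = \int[mu]_(y in J) \int[mu]_(x in I) G (x, y) /\
  measurable_fun setT (fun y => \int[mu]_(x in I) G (x, y)).
Proof.
move=> mI mJ mG G0.
have mP (D : set (R * R)) : measurable D -> measurable_fun setT (G \_ D).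
  by move=> mD; apply/(measurable_restrictT _ _).1 => //; exact: measurable_funS mG.
have P0 (D : set (R * R)) z : 0 <= (G \_ D) z by rewrite /patch; case: ifP.
have mIJ : measurable (I `*` J : set (R * R)) by exact: measurableX.
have mIT : measurable (I `*` setT : set (R * R)) by exact: measurableX.
split.
  rewrite integral_mkcond (tonelli2 (mP _ mIJ) (P0 _)) [RHS]integral_mkcond.
  apply: eq_integral => y _; rewrite [RHS]/patch; case: ifPn => yJ.
    rewrite [RHS]integral_mkcond; apply: eq_integral => x _.
    by rewrite /patch in_setX yJ andbT.
  rewrite integral0_eq// => x _; rewrite /patch in_setX.
  by rewrite (negbTE yJ) andbF.
have := measurable_tonelli2 (mP _ mIT) (P0 _).
apply: eq_measurable_fun => y _; rewrite [RHS]integral_mkcond.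
by apply: eq_integral => x _; rewrite /patch in_setX [y \in setT]mem_set// andbT.
Qed.

Lemma ge0_integral_GH (G : R * R -> \bar R) : measurable_fun setT G -> (forall z, 0 <= G z) ->
  \int[mu2]_(q in @GH R) G q = \int[mu]_a \int[mu]_(b in `[0%R, (2 * pi)%R[) G (b, a).
Proof.
move=> mG G0; have [<- _] := ge0_integral_rect (measurable_itv `[0%R, (2 * pi)%R[) measurableT mG G0.
congr (integral _ _ _).
by apply/seteqP; split => -[x y]; rewrite /GH/= ?in_itv/=; [|move=> []].
Qed.

(** For fixed [a] the angle is merely shifted, which periodicity absorbs; the height
    [y = sin (atan a)] contributes [dy = cA a ^+ 3 da]. *)
Lemma ge0_integral_tau (G : R * R -> \bar R) : measurable_fun setT G ->
  (forall z, 0 <= G z) -> periodic2 G ->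
  \int[mu2]_(z in Cyl) G z = \int[mu2]_(q in @GH R) (G (tau q) * (cA q.2 ^+ 3)%:E).
Proof.
move=> mG G0 Gp.
have mI : measurable (`[0%R, (2 * pi)%R[ : set R) by exact: measurable_itv.
have [_ mK] := ge0_integral_rect mI measurableT mG G0.
have [E _] := ge0_integral_rect (measurable_itv `]0%R, (2 * pi)%R[) (measurable_itv `](-1)%R, 1%R[) mG G0.
rewrite (_ : Cyl = (`]0%R, (2 * pi)%R[ `*` `](-1)%R, 1%R[)%classic); last first.
  by apply/seteqP; split => -[x y]; rewrite /Cyl/= !in_itv/=.
rewrite E ge0_integral_GH; last 2 first.
- apply: emeasurable_funM; first exact: (measurableT_comp mG measurable_tau).
  apply/measurable_EFinP; apply: measurable_funX.
  by apply: (measurableT_comp (@measurable_cA R)).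
- by move=> q; rewrite mule_ge0// lee_fin exprn_ge0// ltW// cA_gt0.
have mS y : measurable_fun setT (fun x => G (x, y)) by exact: measurable_section2.
transitivity (\int[mu]_(y in `](-1)%R, 1%R[) \int[mu]_(x in `[0%R, (2 * pi)%R[) G (x, y)).
  apply: eq_integral => y _; apply: integral_itv_obnd_cbnd.
  by apply: measurable_funS (mS y).
rewrite ge0_integral_sA//; last by move=> y; exact: integral_ge0.
apply: eq_integral => a _.
rewrite -ge0_integralZr//; last 2 first.
- by apply: measurable_funS (mS _).
- by rewrite lee_fin exprn_ge0// ltW// cA_gt0.
pose H x := G (x, sA a) * (cA a ^+ 3)%:E.
have := @ge0_integral_periodic R H (atan a - pi / 2).
rewrite /H => <-.
- by apply: eq_integral => x _; rewrite /tau/= addrA.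
- by apply: emeasurable_funM.
- by move=> x; rewrite mule_ge0// lee_fin exprn_ge0// ltW// cA_gt0.
- by move=> x; rewrite Gp.
Qed.

(** The map shifts the angle by an amount depending on [a] and reverses the sign of [a]; both
    operations preserve Lebesgue measure. *)
Lemma ge0_integral_SAH (G : R * R -> \bar R) : measurable_fun setT G ->
  (forall z, 0 <= G z) -> periodic2 G ->
  \int[mu2]_(q in @GH R) G q = \int[mu2]_(q in @GH R) G (SAH q).
Proof.
move=> mG G0 Gp.
have [_ mK] := ge0_integral_rect (measurable_itv `[0%R, (2 * pi)%R[) measurableT mG G0.
rewrite !ge0_integral_GH//; last exact: (measurableT_comp mG measurable_SAH).
rewrite ge0_integral_opp//; last by move=> y; exact: integral_ge0.
apply: eq_integral => a _.
have := @ge0_integral_periodic R (fun x => G (x, - a))%R (pi + 2 * atan a) => <-//.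
- by apply: eq_integral => x _; rewrite /SAH/= addrA.
- exact: measurable_section2.
Qed.

End geodesic_integrals.

(** * Hyperbolic geodesics as Euclidean chords *)

Section geodesics.
Variable R : realType.
Local Notation C := R[i].
Local Notation mu := (@lebesgue_measure R).
Variable gam : R.
Hypothesis gam1 : -1 < gam.

(** [chord phi (y, s)] is [e^(i phi) (y - i s)]: the line with unit normal [e^(i phi)] at signed
    distance [y] from the origin, parametrised by arc length [s]. As a map of the plane it is a
    reflection, hence measure preserving. *)
Definition chord (phi : R) (z : R * R) : R * R :=
  (z.1 * cos phi + z.2 * sin phi, z.1 * sin phi - z.2 * cos phi).

Lemma toC_chord phi y s : toC (chord phi (y, s)) = expi phi * (y +i* (- s)).
Proof. by apply: cP; rewrite /toC /chord /expi !cE /=; ring. Qed.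

Lemma nsq_chord phi z : nsq (chord phi z) = nsq z.
Proof.
rewrite /nsq /chord /=; transitivity ((z.1 ^+ 2 + z.2 ^+ 2) * (cos phi ^+ 2 + sin phi ^+ 2)).
  by ring.
by rewrite cos2Dsin2 mulr1.
Qed.

Lemma toC_inj : injective (@toC R).
Proof. by move=> [a b] [c d] /= [-> ->]. Qed.

Definition PhiInv (z : R * R) : R * R :=
  let k := (1 + Num.sqrt (1 - nsq z))^-1 in (k * z.1, k * z.2).

(** This turns powers of [xH] into powers of [1 - |Z|^2], and so the hyperbolic weights into
    Euclidean ones. *)
Lemma nsq_PhiHE (z : R * R) : 1 - nsq (PhiHE z) = xH z ^+ 2.
Proof.
have z0 := nsq_ge0 z; have k0 : 1 + nsq z != 0 by rewrite gt_eqF// ltr_wpDr.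
rewrite /nsq /PhiHE /xH /=; move: k0; rewrite /nsq => k0; field.
exact: k0.
Qed.

Lemma xH_gt0 (z : R * R) : DH z -> 0 < xH z.
Proof.
by rewrite /DH/= => z1; rewrite divr_gt0 ?subr_gt0// ltr_wpDr ?nsq_ge0.
Qed.

Lemma DH_PhiHE (z : R * R) : DH z -> DH (PhiHE z).
Proof. by move=> /xH_gt0 x0; rewrite /DH/= -subr_gt0 nsq_PhiHE exprn_gt0. Qed.

Lemma PhiHEK (z : R * R) : DH z -> PhiInv (PhiHE z) = z.
Proof.
move=> zD; have x0 := xH_gt0 zD; have z0 := nsq_ge0 z.
have k0 : 1 + nsq z != 0 by rewrite gt_eqF// ltr_wpDr.
rewrite /PhiInv nsq_PhiHE sqrtr_sqr gtr0_norm// /PhiHE /xH.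
have -> : (1 + (1 - nsq z) / (1 + nsq z))^-1 = (1 + nsq z) / 2.
  field; rewrite k0 /=; apply/eqP; lra.
by case: z {zD x0 z0} k0 => a b k0 /=; congr pair; field; rewrite k0.
Qed.

Section one_geodesic.
Variables (b a : R).
Let c := cA a.
Let k (t : R) : R := (1 + a ^+ 2) * expR t ^+ 2.
(** Arc-length position at time [t] on the chord of half-length [c]: it is [c tanh (t + t0)] with
    [e^(2 t0) = 1 + a^2]. *)
Definition geodS (t : R) : R := c * (k t - 1) / (k t + 1).
Definition geodS' (t : R) : R := c * (4 * k t) / (k t + 1) ^+ 2.

Let c0 : 0 < c. Proof. exact: cA_gt0. Qed.
Let a0 : 0 < 1 + a ^+ 2. Proof. by rewrite ltr_wpDr ?sqr_ge0. Qed.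
Let k0 t : 0 < k t. Proof. by rewrite mulr_gt0// exprn_gt0// expR_gt0. Qed.

Lemma tanh_half (t : R) : tanh (t / 2) = (expR t - 1) / (expR t + 1).
Proof.
have e0 := expR_gt0 (t / 2); rewrite /tanh.
have -> : expR t = expR (t / 2) ^+ 2 by rewrite expr2 -expRD; congr expR; field.
rewrite expRN; set e := expR _ in e0 *; field.
by rewrite !gt_eqF// ?addr_gt0// ?exprn_gt0.
Qed.

(** The squared modulus of the denominator of the geodesic once [tanh (t / 2)] is written with
    [expR t]; [w] below is the point of the geodesic for [beta = 0]. *)
Let N (t : R) : R := (expR t + 1) ^+ 2 + (a * expR t) ^+ 2.
Let N0 t : 0 < N t.
Proof. by rewrite ltr_wpDr ?sqr_ge0// exprn_gt0// addr_gt0// expR_gt0. Qed.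

Let w (t : R) : C := ((1 - expR t ^+ 2 + a ^+ 2 * expR t ^+ 2) / N t) +i*
  (- (2 * a * expR t ^+ 2) / N t).

Let geodHE (t : R) : geodH b a t = expi b * w t.
Proof.
rewrite /geodH tanh_half; congr (_ * _).
have E0 := expR_gt0 t; have N0t := N0 t.
have n1 : ((expR t)%:C + 1 : C) != 0.
  by apply/eqP => /(congr1 (@cRe R)); rewrite !cE /= => h; move: E0 h; lra.
have n2 : ((expR t)%:C + 1 - 'i * a%:C * (expR t)%:C : C) != 0.
  by apply/eqP => /(congr1 (@cRe R)); rewrite !cE /= => h; move: E0 h; lra.
have h2 : (2 : R)%:C = 2 :> C by apply: cP; rewrite !cE /=; ring.
have wE : w t = - ((expR t)%:C - 1 + 'i * a%:C * (expR t)%:C) /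
    ((expR t)%:C + 1 - 'i * a%:C * (expR t)%:C).
  apply: (mulIf n2); rewrite divfK//.
  by apply: cP; rewrite !cE /= /N; field; rewrite -/(N t) gt_eqF.
rewrite wE; set E := expR t in E0 n1 n2 *.
have -> : ((E - 1) / (E + 1))%:C = (E%:C - 1) / (E%:C + 1) :> C.
  by rewrite rmorphM /= fmorphV /= rmorphB rmorphD /= rmorph1.
rewrite h2; field; apply/and3P; split; [exact: n2|exact: n1|].
suff : -2 * (E%:C + 1 - 'i * a%:C * E%:C) != 0 :> C by congr (_ != _); ring.
by rewrite mulf_neq0// oppr_eq0 pnatr_eq0.
Qed.

Let nsq_geod t : nsq (ofC (geodH b a t)) = ((expR t - 1) ^+ 2 + (a * expR t) ^+ 2) / N t.
Proof.
have -> : nsq (ofC (geodH b a t)) = sqn (geodH b a t) by [].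
rewrite geodHE sqnM sqn_expi mul1r /sqn /w /= /N; field.
by rewrite -/(N t) gt_eqF.
Qed.

Lemma DH_geodH t : DH (ofC (geodH b a t)).
Proof.
rewrite /DH/= nsq_geod ltr_pdivrMr// mul1r /N; have := expR_gt0 t.
set E := expR t => E0; rewrite ltrD2r; nra.
Qed.

(** After the rotation by [b] is removed, [e^(i (atan a - pi/2)) = sA a - i cA a]; the claim becomes
    an identity between rational functions of [a] and [expR t] once [c^2] is replaced by
    [1 / (1 + a^2)]. *)
Lemma PhiHE_geodH t :
  PhiHE (ofC (geodH b a t)) = chord (b + atan a - pi / 2) (sA a, geodS t).
Proof.
apply: toC_inj; rewrite toC_chord.
have kE : 1 + nsq (ofC (geodH b a t)) = 2 * (1 + k t) / N t.
  by rewrite nsq_geod /N /k; field; rewrite -/(N t) gt_eqF.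
have -> : toC (PhiHE (ofC (geodH b a t))) =
    (2 / (1 + nsq (ofC (geodH b a t))))%:C * geodH b a t.
  by case: (geodH b a t) => x y; apply: cP; rewrite /toC /PhiHE !cE /=; ring.
rewrite kE geodHE.
have -> : b + atan a - pi / 2 = b + (atan a - pi / 2) by ring.
rewrite expiD -[RHS]mulrA [LHS]mulrCA; congr (_ * _).
have -> : expi (atan a - pi / 2) = sA a +i* (- cA a).
  by apply: cP; rewrite /expi /= ?cosB ?sinB cos_pihalf sin_pihalf /sA /cA; ring.
have k1 : 1 + k t != 0 by rewrite gt_eqF// addr_gt0.
have an : 1 + a ^+ 2 != 0 by rewrite gt_eqF.
have Nn : N t != 0 by rewrite gt_eqF.
have cc : c ^+ 2 = (1 + a ^+ 2)^-1 by apply: (mulfI an); rewrite cA_sqr mulfV.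
have sE : sA a = a * c by exact: sAE.
rewrite -/c sE; apply: cP; rewrite !cE /= /geodS.
- have -> : a * c * (a * c) - - c * - (c * (k t - 1) / (k t + 1)) =
    c ^+ 2 * (a ^+ 2 - (k t - 1) / (k t + 1)) by ring.
  rewrite cc; move: k1; rewrite /k => k1; field.
  by rewrite an Nn addrC k1.
- have -> : a * c * - (c * (k t - 1) / (k t + 1)) + - c * (a * c) =
    - (c ^+ 2 * a * ((k t - 1) / (k t + 1) + 1)) by ring.
  rewrite cc; move: k1; rewrite /k => k1; field.
  by rewrite an Nn addrC k1.
Qed.

(** Two of the powers in [xH^(2 + 2 gam)] pay for the passage from time to arc length,
    [xH^2 dt = c ds]; what remains is [xH^(2 gam)], the Euclidean weight. *)
Lemma xH_geodH t : xH (ofC (geodH b a t)) ^+ 2 = c * geodS' t.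
Proof.
have k1 : k t + 1 != 0 by rewrite gt_eqF// addr_gt0.
have Nn : N t != 0 by rewrite gt_eqF.
have E0 := expR_gt0 t.
have -> : xH (ofC (geodH b a t)) = 2 * expR t / (k t + 1).
  rewrite /xH nsq_geod; move: k1 Nn; rewrite /k /N => k1 Nn; field.
  rewrite k1 Nn /=; apply/eqP => h; have := N0 t; have := k0 t; rewrite /N /k; nra.
have -> : c * geodS' t = c ^+ 2 * (1 + a ^+ 2) * (4 * expR t ^+ 2) / (k t + 1) ^+ 2.
  by rewrite /geodS' /k; ring.
by rewrite [c ^+ 2 * _]mulrC cA_sqr; field.
Qed.

Lemma geodS_lt t : - c < geodS t < c.
Proof.
have k1 := k0 t; have c1 := c0; have kp : 0 < k t + 1 by rewrite addr_gt0.
rewrite /geodS ltr_pdivlMr// ltr_pdivrMr//.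
by apply/andP; split; nra.
Qed.

Let derive_k (t : R) : is_derive t 1 k (2 * k t).
Proof.
have H : is_derive t 1 (fun t => expR t * expR t) (2 * expR t ^+ 2).
  have dE := is_derive_expR t; apply: is_derive_eq; rewrite /GRing.scale /=; ring.
have kE : k = (1 + a ^+ 2) \*: (fun t => expR t * expR t).
  by apply/funext => x; rewrite /k /= expr2.
have -> : 2 * k t = (1 + a ^+ 2) *: (2 * expR t ^+ 2 : R) by rewrite /k /GRing.scale /=; ring.
by rewrite kE; exact: is_deriveZ.
Qed.

Lemma is_derive_geodS (t : R) : is_derive t 1 geodS (geodS' t).
Proof.
have k1 := k0 t; have kp : k t + 1 != 0 by rewrite gt_eqF// addr_gt0.
have dk := derive_k t.
have d1 : is_derive t 1 (fun t => c * (k t - 1)) (c * (2 * k t)).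
  have -> : (fun t => c * (k t - 1)) = c \*: (k - cst 1) by [].
  by apply: is_derive_eq; rewrite /GRing.scale /= subr0.
have d2 : is_derive t 1 (fun t => k t + 1) (2 * k t).
  have -> : (fun t => k t + 1) = k + cst 1 by [].
  by apply: is_derive_eq; rewrite addr0.
have H := @is_derive_quot R (fun t => c * (k t - 1)) (fun t => k t + 1) t _ _ kp d1 d2.
apply: (is_derive_eq H).
by rewrite /geodS'; field.
Qed.

Let continuous_k : continuous k.
Proof. by move=> t; apply/differentiable_continuous/derivable1_diffP; case: (derive_k t). Qed.

Lemma continuous_geodS' : continuous geodS'.
Proof.
move=> t; apply: (@continuous_quot R (fun t => c * (4 * k t)) (fun t => (k t + 1) ^+ 2)).
- by rewrite expf_neq0// gt_eqF// addr_gt0.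
- apply: cvgM; first exact: cvg_cst.
  by apply: cvgM; [exact: cvg_cst|exact: continuous_k].
- apply: (@continuous_comp _ _ _ (fun t => k t + 1) (fun x : R => x ^+ 2)).
    by apply: cvgD; [exact: continuous_k|exact: cvg_cst].
  exact: exprn_continuous.
Qed.

Lemma ge0_integral_geodS (G : R -> \bar R) : measurable_fun setT G ->
  (forall x, (0 <= G x)%E) ->
  (\int[mu]_(s in `](- c)%R, c[) G s = \int[mu]_t (G (geodS t) * (geodS' t)%:E))%E.
Proof.
move=> mG G0.
(* The inverse solves [(1 + a^2) e^(2 t) = (c + s) / (c - s)]. *)
apply: (@ge0_integration_by_substitution_oo _ geodS geodS' _ _ setT
  (fun s => ln ((c + s) / (c - s) / (1 + a ^+ 2)) / 2) c c0 _ _ _ _ _ _ G mG G0).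
- apply: continuous_measurable_fun => x; apply/differentiable_continuous.
  by apply/derivable1_diffP; case: (is_derive_geodS x).
- by apply: continuous_measurable_fun; exact: continuous_geodS'.
- by [].
- by move=> x _; exact: is_derive_geodS.
- by move=> x _; exact: continuous_geodS'.
- move=> t _; have k1 := k0 t; rewrite /geodS' divr_gt0//; last by rewrite exprn_gt0// addr_gt0.
  by rewrite mulr_gt0// mulr_gt0.
- by move=> x _; exact: geodS_lt.
- move=> s /andP[s1 s2]; split => //.
  have p1 : 0 < c + s by move: s1; lra.
  have p2 : 0 < c - s by move: s2; lra.
  have kE : k (ln ((c + s) / (c - s) / (1 + a ^+ 2)) / 2) = (c + s) / (c - s).
    rewrite /k (expr2 (expR _)) -expRD -splitr lnK ?posrE ?divr_gt0//.
    by rewrite mulrC divfK// gt_eqF.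
  have c1 := c0; rewrite /geodS kE; field; rewrite gt_eqF//=; apply/eqP; move: c1; lra.
Qed.

End one_geodesic.
End geodesics.

(** * The weighted chord transform of the Euclidean disc *)

Section chord_transform.
Variable R : realType.
Local Notation mu := (@lebesgue_measure R).
Local Notation mu2 := (@mu2 R).
Variable gam : R.
Hypothesis gam1 : -1 < gam.
Let a0 := gam + 2^-1.

Let a01 : -1 < a0.
Proof. by rewrite /a0; move: gam1; lra. Qed.

(** Extended by zero outside the disc, so that chord integrals run over whole lines and Fubini is
    applied on the whole plane. *)
Definition wD (z : R * R) : R := if nsq z < 1 then (1 - nsq z) `^ gam else 0.

Lemma wDE z : nsq z < 1 -> wD z = (1 - nsq z) `^ gam. Proof. by rewrite /wD => ->. Qed.

Lemma wD_ge0 z : 0 <= wD z. Proof. by rewrite /wD; case: ifP; rewrite ?powR_ge0. Qed.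

Lemma wD_chord phi z : wD (chord phi z) = wD z.
Proof. by rewrite /wD nsq_chord. Qed.

Lemma wD_patch (g : R * R -> R) :
  (fun z => g z * wD z) = (fun z => g z * (1 - nsq z) `^ gam) \_ (@DH R).
Proof.
apply/funext => z; rewrite /patch /wD; have [zD|zD] := boolP (nsq z < 1).
  by rewrite mem_set.
by rewrite memNset ?mulr0//; exact/negP.
Qed.

Lemma measurable_mul_wD (g : R * R -> R) : measurable_fun (@DH R) g ->
  measurable_fun setT (fun z => g z * wD z).
Proof.
move=> mg; rewrite wD_patch.
have mp : measurable_fun setT (fun z : R * R => (1 - nsq z) `^ gam).
  apply: (measurableT_comp (@measurable_powR R gam)).
  by apply: measurable_funB => //; exact: measurable_nsq.
have mgp : measurable_fun (@DH R) (fun z => g z * (1 - nsq z) `^ gam).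
  by apply: measurable_funM => //; exact: measurable_funTS.
exact: ((measurable_restrictT _ (@measurable_DH R)).1 mgp).
Qed.

Lemma measurable_wD : measurable_fun setT wD.
Proof.
have -> : wD = (fun z => 1 * wD z) by apply/funext => z; rewrite mul1r.
exact: measurable_mul_wD.
Qed.

Lemma measurable_chord : measurable_fun setT (fun x : (R * R) * R => chord x.1.1 (x.1.2, x.2)).
Proof.
have mc : measurable_fun setT (fun x : (R * R) * R => cos x.1.1).
  apply: (@measurableT_comp _ _ _ _ _ _ (@cos R)).
    by apply: continuous_measurable_fun; exact: continuous_cos.
  exact: measurableT_comp.
have ms : measurable_fun setT (fun x : (R * R) * R => sin x.1.1).
  apply: (@measurableT_comp _ _ _ _ _ _ (@sin R)).
    by apply: continuous_measurable_fun; exact: continuous_sin.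
  exact: measurableT_comp.
have my : measurable_fun setT (fun x : (R * R) * R => x.1.2) by exact: measurableT_comp.
have m2 : measurable_fun setT (fun x : (R * R) * R => x.2) by exact: measurable_snd.
rewrite /chord /=; apply: measurable_fun_pair.
  by apply: measurable_funD; [exact: measurable_funM my mc|exact: measurable_funM m2 ms].
by apply: measurable_funB; [exact: measurable_funM my ms|exact: measurable_funM m2 mc].
Qed.

Lemma measurable_chord1 phi : measurable_fun setT (@chord R phi).
Proof.
by apply: measurable_fun_pair; [apply: measurable_funD|apply: measurable_funB];
  apply: measurable_funM.
Qed.

(** Since [f] vanishes off []-c, c[], the whole line reduces to []-1, 1[]; the condition [h 0 = 0]
    in [pulls] is what makes [h \o f] vanish there too. *)
Lemma pulls_scale (c : R) (f : R -> R) : 0 < c -> measurable_fun setT f ->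
  (forall s, ~ (- c < s < c) -> f s = 0) ->
  pulls mu mu `]-1, 1[ setT (fun u => c * u) (fun=> c) f.
Proof.
move=> c0 mf f0 h mh h0 h00.
have mhf : measurable_fun setT (fun x => (h (f x))%:E).
  by apply/measurable_EFinP; exact: (measurableT_comp mh mf).
have hf0 x : (0 <= (h (f x))%:E)%E by rewrite lee_fin.
have cn : c != 0 by rewrite gt_eqF.
have := ge0_integral_affine 0 cn mhf hf0.
have mhfc : measurable_fun setT (fun x => (h (f (c * x)))%:E).
  apply: (measurableT_comp mhf); exact: mulrl_measurable.
have -> : (\int[mu]_x (h (f (c * x + 0)))%:E = \int[mu]_x (h (f (c * x)))%:E)%E.
  by apply: eq_integral => x _; rewrite addr0.
rewrite gtr0_norm// => H.
have -> : (\int[mu]_x (h (f x))%:E = c%:E * \int[mu]_x (h (f (c * x)))%:E)%E.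
  by rewrite H muleA -EFinM mulfV// mul1e.
rewrite [in RHS]integral_mkcond -ge0_integralZl//; last exact: ltW.
apply: eq_integral => u _; rewrite /patch; case: ifPn => [_|].
  by rewrite -EFinM mulrC.
rewrite notin_setE/= in_itv/= => uI; rewrite f0 ?h00 ?mule0// => /andP[u1 u2].
by apply: uI; apply/andP; split; nra.
Qed.

Definition B0 : R := jint gam 1.

Let jint1E : (\int[mu]_(u in `](-1)%R, 1%R[) (jw gam u)%:E = B0%:E)%E.
Proof.
rewrite /B0 /jint /Rintegral fineK.
  by apply: eq_integral => u _; rewrite hornerE mul1r.
apply: integral_fune_fin_num => //.
by have := integrable_poly_jw gam1 1.
Qed.

Lemma B0_ge0 : 0 <= B0.
Proof.
rewrite /B0 /jint; apply: Rintegral_ge0 => y _.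
by rewrite hornerE mul1r powR_ge0.
Qed.

(* The substitution [s = c u] on the chord at distance [y], with [c^2 = 1 - y^2]. *)
Lemma wD_scale (y u : R) : -1 < y < 1 -> -1 < u < 1 ->
  wD (y, Num.sqrt (1 - y ^+ 2) * u) * Num.sqrt (1 - y ^+ 2) = jw a0 y * jw gam u.
Proof.
move=> /andP[y1 y2] /andP[u1 u2].
have p1 : 0 < 1 - y ^+ 2 by nra.
have p2 : 0 < 1 - u ^+ 2 by nra.
have E : 1 - nsq (y, Num.sqrt (1 - y ^+ 2) * u) = (1 - y ^+ 2) * (1 - u ^+ 2).
  by rewrite /nsq /= exprMn sqr_sqrtr ?ltW//; ring.
rewrite /wD -subr_gt0 E mulr_gt0// powRM ?ltW// /jw /a0 powRD; last first.
  by rewrite (gt_eqF p1) implybT.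
by rewrite powR12_sqrt ?ltW//; ring.
Qed.

Lemma wD0 (y s : R) : ~ (- Num.sqrt (1 - y ^+ 2) < s < Num.sqrt (1 - y ^+ 2)) -> wD (y, s) = 0.
Proof.
rewrite /wD /nsq /=; case: ifP => // ys H; exfalso; apply: H.
by rewrite -ltr_norml -sqrtr_sqr ltr_sqrt; move: ys (sqr_ge0 s); lra.
Qed.

Lemma wD_out (y s : R) : ~ (-1 < y < 1) -> wD (y, s) = 0.
Proof.
rewrite /wD /nsq /=; case: ifP => // ys H; exfalso; apply: H.
have := sqr_ge0 s => s2; apply/andP; split; nra.
Qed.

Lemma measurable_wD_slice y : measurable_fun setT (fun s => wD (y, s)).
Proof. by apply: (measurableT_comp measurable_wD); exact: measurable_pair1. Qed.

(** The mass of the weight on a chord, which is where the exponent [gam + 1/2] on the space of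
    chords comes from. *)
Lemma integral_wD_slice (y : R) : -1 < y < 1 ->
  (\int[mu]_s (wD (y, s))%:E = (jw a0 y * B0)%:E)%E.
Proof.
move=> y1; have p1 : 0 < Num.sqrt (1 - y ^+ 2).
  by rewrite sqrtr_gt0; move: y1 => /andP[? ?]; nra.
rewrite (pulls_integral _ (pulls_scale p1 (measurable_wD_slice y) (@wD0 y))); last first.
  by move=> _ _; exact: ltW.
rewrite EFinM -jint1E -ge0_integralZl//; last 3 first.
- by apply/measurable_EFinP; apply: measurable_funTS; exact: measurable_jw.
- by move=> u _; rewrite lee_fin powR_ge0.
- by rewrite lee_fin powR_ge0.
apply: eq_integral => u; rewrite inE/= in_itv/= => u1.
by rewrite wD_scale// EFinM.
Qed.

Lemma integrable_wD : mu2.-integrable setT (EFin \o wD).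
Proof.
have mw : measurable_fun setT (EFin \o wD) by apply/measurable_EFinP; exact: measurable_wD.
have w0 z : (0 <= (EFin \o wD) z)%E by rewrite lee_fin wD_ge0.
apply/integrableP; split => //.
under eq_integral do rewrite gee0_abs//.
rewrite (tonelli1 mw w0).
apply: (@le_lt_trans _ _ (\int[mu]_(y in `](-1)%R, 1%R[) (B0%:E * (jw a0 y)%:E))%E).
  rewrite [leRHS]integral_mkcond; apply: ge0_le_integral => //.
  - by move=> y _; apply: integral_ge0.
  - by apply: measurable_tonelli1.
  - apply/(measurable_restrictT _ _).1 => //; apply: measurable_funTS.
    by apply: emeasurable_funM => //; apply/measurable_EFinP; exact: measurable_jw.
  - move=> y _; rewrite /patch; case: ifPn.
      by rewrite inE/= in_itv/= => y1; rewrite integral_wD_slice// -EFinM mulrC.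
    rewrite notin_setE/= in_itv/= => y1; rewrite integral0_eq// => s _.
    by rewrite /= wD_out.
have iw := integrable_jw a01.
have /integrableP[_] := @integrableZl _ _ _ mu `]-1, 1[ (measurable_itv _) B0 _ iw.
apply: le_lt_trans; apply: ge0_le_integral => //.
- by move=> y _; rewrite mule_ge0// lee_fin ?powR_ge0 ?B0_ge0.
- apply: measurable_funTS; apply: emeasurable_funM => //.
  by apply/measurable_EFinP; exact: measurable_jw.
- apply: measurable_funTS; apply: measurableT_comp => //; apply: emeasurable_funM => //.
  by apply/measurable_EFinP; exact: measurable_jw.
- by move=> y _; exact: lee_abs.
Qed.

End chord_transform.

Section weighted_CS.
Context d (T : measurableType d) (R : realType) (m : {measure set T -> \bar R}).

Lemma ge0_integrable (D : set T) (f : T -> R) : measurable_fun D f ->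
  (forall x, D x -> 0 <= f x) -> (\int[m]_(x in D) (f x)%:E < +oo)%E ->
  m.-integrable D (EFin \o f).
Proof.
move=> mf f0 fy; apply/integrableP; split; first exact/measurable_EFinP.
apply: le_lt_trans fy; rewrite le_eqVlt; apply/orP; left; apply/eqP.
by apply: eq_integral => x; rewrite inE => Dx; rewrite /= ger0_norm ?f0.
Qed.

(** The right side is extended-valued, to serve chords on which [g] is not square integrable.
    Otherwise integrate [2 l g <= g^2 + l^2] against [w], with [l] the weighted mean of [g]. *)
Lemma Rintegral_CS (g w : T -> R) (B : R) : measurable_fun setT (fun x => g x * w x) ->
  measurable_fun setT (fun x => g x ^+ 2 * w x) -> measurable_fun setT w ->
  (forall x, 0 <= w x) -> 0 < B -> (\int[m]_x (w x)%:E = B%:E)%E ->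
  ((Rintegral m setT (fun x => g x * w x) ^+ 2)%:E <= B%:E * \int[m]_x (g x ^+ 2 * w x)%:E)%E.
Proof.
move=> mgw mg2w mw w0 B0 wB.
have g0 x : (0 <= (g x ^+ 2 * w x)%:E)%E by rewrite lee_fin mulr_ge0 ?sqr_ge0.
have A0 : (0 <= \int[m]_x (g x ^+ 2 * w x)%:E)%E by exact: integral_ge0.
have iw : m.-integrable setT (EFin \o w).
  by apply: ge0_integrable => //; rewrite wB ltry.
have [Afin|] := ltP (\int[m]_x (g x ^+ 2 * w x)%:E)%E +oo%E; last first.
  by rewrite leye_eq => /eqP ->; rewrite gt0_muley ?lte_fin// leey.
have ig2 : m.-integrable setT (EFin \o (fun x => g x ^+ 2 * w x)).
  by apply: ge0_integrable => // x _; rewrite -lee_fin.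
have igw : m.-integrable setT (EFin \o (fun x => g x * w x)).
  apply: (@le_integrable _ _ _ m setT _ _ (EFin \o (fun x => g x ^+ 2 * w x + w x))) => //.
  - exact/measurable_EFinP.
  - move=> x _; rewrite lee_fin normrM (ger0_norm (w0 x)) [leRHS]ger0_norm; last first.
      by rewrite addr_ge0// mulr_ge0 ?sqr_ge0.
    rewrite -[in leRHS](mul1r (w x)) mulrA mulr1 -mulrDl ler_wpM2r//.
    by rewrite ler_norml; apply/andP; split; nra.
  - by have := integrableD measurableT ig2 iw; apply: eq_integrable.
set X := Rintegral _ _ _.
have AE : (\int[m]_x (g x ^+ 2 * w x)%:E = (Rintegral m setT (fun x => g x ^+ 2 * w x))%:E)%E.
  by rewrite /Rintegral fineK//; exact: integral_fune_fin_num.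
rewrite AE -EFinM lee_fin.
have WE : Rintegral m setT w = B by rewrite /Rintegral wB.
pose l := X / B.
have : Rintegral m setT (fun x => (2 * l) * (g x * w x)) <=
    Rintegral m setT (fun x => g x ^+ 2 * w x + l ^+ 2 * w x).
  apply: le_Rintegral => //.
  - by have := integrableZl measurableT (2 * l) igw; apply: eq_integrable.
  - have := integrableD measurableT ig2 (integrableZl measurableT (l ^+ 2) iw).
    by apply: eq_integrable.
  - move=> x _; rewrite -mulrDl mulrA ler_wpM2r//; have := sqr_ge0 (g x - l); nra.
rewrite RintegralZl// RintegralD//; last by have := integrableZl measurableT (l ^+ 2) iw; apply: eq_integrable.
rewrite RintegralZl// WE -/X /l => H.
have {}H : X ^+ 2 / B <= Rintegral m setT (fun x => g x ^+ 2 * w x).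
  move: H; have -> : 2 * (X / B) * X = X ^+ 2 / B + X ^+ 2 / B by field; rewrite gt_eqF.
  have -> : (X / B) ^+ 2 * B = X ^+ 2 / B by field; rewrite gt_eqF.
  by rewrite lerD2r.
by rewrite -ler_pdivrMl// mulrC.
Qed.

End weighted_CS.

(** * The L2 bound for the chord transform *)

Section chord_transform_L2.
Variable R : realType.
Local Notation C := R[i].
Local Notation mu := (@lebesgue_measure R).
Local Notation mu2 := (@mu2 R).
Variable gam : R.
Hypothesis gam1 : -1 < gam.
Local Notation a0 := (gam + 2^-1).
Local Notation wD := (wD gam).
Local Notation B0 := (B0 gam).

Lemma B0_gt0 : 0 < B0.
Proof.
have := jint_beta gam1 0 0; rewrite !expr0 mulr1 /B0 => ->.
rewrite mulr_gt0 ?powR_gt0// /BetaF.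
have g1 : 0 < gam + 1 + 0%:R by rewrite addr0; move: gam1; lra.
by rewrite divr_gt0 ?mulr_gt0 ?GammaF_gt0// addr_gt0.
Qed.

Variable F : R * R -> C.
Hypothesis LF : L2mem (@DH R) wD F.

Definition cK (z : R * R) : C := F z * (wD z)%:C.
Definition aK (z : R * R) : R := sqn (F z) * wD z.
Definition chordT (z : R * R) : C := cintegral mu setT (fun s => cK (chord z.1 (z.2, s))).

Lemma cmeas_cK : cmeas setT cK.
Proof.
have [f1 f2 _] := LF; split.
  rewrite (_ : _ \o cK = fun z => (@cRe R \o F) z * wD z); first exact: measurable_mul_wD.
  by apply/funext => z; rewrite /cK /= !cE mulr0 subr0.
rewrite (_ : _ \o cK = fun z => (@cIm R \o F) z * wD z); first exact: measurable_mul_wD.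
by apply/funext => z; rewrite /cK /= !cE mulr0 add0r.
Qed.

Lemma measurable_aK : measurable_fun setT aK.
Proof.
by have [f1 f2 _] := LF; apply: measurable_mul_wD; apply: measurable_funD; apply: measurable_funX.
Qed.

Lemma aK_ge0 z : 0 <= aK z.
Proof. by rewrite mulr_ge0 ?sqn_ge0 ?wD_ge0. Qed.

Lemma integral_wD_DH (G : R * R -> R) :
  (\int[mu2]_z (G z * wD z)%:E = \int[mu2]_(z in @DH R) (G z * wD z)%:E)%E.
Proof.
rewrite [RHS]integral_mkcond; apply: eq_integral => z _; rewrite /patch; case: ifPn => //.
by rewrite notin_setE /DH/= => zD; rewrite /wD; case: ifP => // _; rewrite mulr0.
Qed.

Lemma integrable_aK : mu2.-integrable setT (EFin \o aK).
Proof.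
have [_ _ f3] := LF.
apply: (@ge0_integrable _ _ R mu2 setT aK measurable_aK) => [z _|]; first exact: aK_ge0.
have /integrableP[_] := f3; apply: le_lt_trans.
rewrite integral_wD_DH le_eqVlt; apply/orP; left; apply/eqP.
by apply: eq_integral => z _; rewrite gee0_abs// lee_fin aK_ge0.
Qed.

Lemma integrable_dom : mu2.-integrable setT (EFin \o (fun z => aK z + wD z)).
Proof.
by have := integrableD measurableT integrable_aK (integrable_wD gam1); apply: eq_integrable.
Qed.

(** The bound [|x| <= x^2 + 1] times the weight; as the weight has finite mass, the majorant
    [aK + wD] is integrable. *)
Lemma cK_dom z : `|cRe (cK z)| <= aK z + wD z /\ `|cIm (cK z)| <= aK z + wD z.
Proof.
have w0 := wD_ge0 gam z; rewrite /cK !cE !mulr0 subr0 add0r !normrM (ger0_norm w0).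
rewrite /aK -[in X in _ <= X /\ _](mul1r (wD z)) -[in X in _ /\ _ <= X](mul1r (wD z)).
rewrite !mulrA !mulr1 -!mulrDl /sqn.
have := sqr_ge0 (cRe (F z)); have := sqr_ge0 (cIm (F z)).
by split; apply: ler_wpM2r => //; rewrite ler_norml; apply/andP; split; nra.
Qed.

Lemma cintegrable_cK : cintegrable mu2 setT cK.
Proof.
exact: (@cintegrable_le _ _ R mu2 setT measurableT cK _ cmeas_cK integrable_dom (fun z _ => cK_dom z)).
Qed.

Lemma cmeas_chordT : cmeas setT chordT.
Proof.
have [m1 m2] := cmeas_cK.
pose f (x : (R * R) * R) := cK (chord x.1.1 (x.1.2, x.2)).
have f1 : measurable_fun setT (@cRe R \o f) := measurableT_comp m1 (@measurable_chord R).
have f2 : measurable_fun setT (@cIm R \o f) := measurableT_comp m2 (@measurable_chord R).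
have H := @cmeas_cintegral _ _ _ _ R mu f (conj f1 f2).
suff -> : chordT = fun z => cintegral mu setT (fun s => f (z, s)) by [].
by apply/funext => -[x y].
Qed.

Lemma chordT_out z : ~ (-1 < z.2 < 1) -> chordT z = 0.
Proof.
move=> z1; rewrite /chordT -[RHS](cintegral0 mu measurableT); apply: eq_cintegral => s _.
by rewrite /cK wD_chord wD_out// mulr0.
Qed.

Let msec (g : R * R -> R) z : measurable_fun setT g ->
  measurable_fun setT (fun s => g (chord z.1 (z.2, s))).
Proof.
move=> mg; apply: (measurableT_comp mg).
by apply: (measurableT_comp (measurable_chord1 z.1)); exact: measurable_pair1.
Qed.

Lemma sqn_chordT (z : R * R) : -1 < z.2 < 1 ->
  ((sqn (chordT z))%:E <=
   (jw a0 z.2 * B0)%:E * \int[mu]_s (aK (chord z.1 (z.2, s)))%:E)%E.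
Proof.
move=> z1; have [m1 m2 _] := LF.
have B1 : 0 < jw a0 z.2 * B0.
  rewrite mulr_gt0 ?B0_gt0// powR_gt0//; move: z1 => /andP[? ?]; nra.
have wE : (\int[mu]_s (wD (chord z.1 (z.2, s)))%:E = (jw a0 z.2 * B0)%:E)%E.
  transitivity (\int[mu]_s (wD (z.2, s))%:E)%E; last exact: integral_wD_slice.
  by apply: eq_integral => s _; rewrite wD_chord.
have CS (g : R * R -> R) : measurable_fun (@DH R) g ->
   ((Rintegral mu setT (fun s => g (chord z.1 (z.2, s)) * wD (chord z.1 (z.2, s))) ^+ 2)%:E <=
   (jw a0 z.2 * B0)%:E * \int[mu]_s (g (chord z.1 (z.2, s)) ^+ 2 * wD (chord z.1 (z.2, s)))%:E)%E.
  move=> mg; apply: (Rintegral_CS _ _ _ _ B1 wE) => //.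
  - by apply: (msec (g := fun z => g z * wD z)); exact: measurable_mul_wD.
  - apply: (msec (g := fun z => g z ^+ 2 * wD z)); apply: measurable_mul_wD.
    exact: measurable_funX.
  - by apply: msec; exact: measurable_wD.
  - by move=> s; rewrite wD_ge0.
have := leeD (CS _ m1) (CS _ m2); rewrite -EFinD.
rewrite -ge0_muleDr; last 2 first.
- by apply: integral_ge0 => s _; rewrite lee_fin mulr_ge0 ?sqr_ge0 ?wD_ge0.
- by apply: integral_ge0 => s _; rewrite lee_fin mulr_ge0 ?sqr_ge0 ?wD_ge0.
rewrite -ge0_integralD//; last 4 first.
- by move=> s _; rewrite lee_fin mulr_ge0 ?sqr_ge0 ?wD_ge0.
- apply/measurable_EFinP; apply: (msec (g := fun z => (@cRe R \o F) z ^+ 2 * wD z)).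
  by apply: measurable_mul_wD; exact: measurable_funX.
- by move=> s _; rewrite lee_fin mulr_ge0 ?sqr_ge0 ?wD_ge0.
- apply/measurable_EFinP; apply: (msec (g := fun z => (@cIm R \o F) z ^+ 2 * wD z)).
  by apply: measurable_mul_wD; exact: measurable_funX.
move=> H; apply: le_trans (le_trans H _).
- rewrite lee_fin /sqn /chordT /cintegral /= le_eqVlt; apply/orP; left; apply/eqP.
  by congr (_ ^+ 2 + _ ^+ 2); apply: eq_Rintegral => s _; rewrite /cK /= !cE mulr0 ?subr0 ?add0r.
- rewrite le_eqVlt; apply/orP; left; apply/eqP; congr (_ * _)%E.
  by apply: eq_integral => s _; rewrite /aK /sqn -EFinD -mulrDl.
Qed.

Let ge0_measurable_chordI (g : R * R -> R) : measurable_fun setT g -> (forall z, 0 <= g z) ->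
  measurable_fun setT (fun z : R * R => (\int[mu]_s (g (chord z.1 (z.2, s)))%:E)%E).
Proof.
move=> mg g0; pose f (x : (R * R) * R) := (g (chord x.1.1 (x.1.2, x.2)))%:E.
have mf : measurable_fun setT f.
  by apply/measurable_EFinP; exact: measurableT_comp mg (@measurable_chord R).
have := @measurable_fun_fubini_tonelli_F _ _ _ _ R mu f mf (fun x => g0 _).
by congr measurable_fun; apply/funext => -[x y].
Qed.

(** Cauchy-Schwarz on each chord bounds [|chordT|^2] by the chord mass [jw a0 y * B0] times the
    chord integral of [aK]. After division by [jw], integrating over the heights gives, for each
    angle, the integral of [aK] over the plane, because [chord phi] is an isometry; the total is at
    most [2 pi B0] times the squared norm of [F]. *)
Lemma chordT_L2 :
  (\int[mu2]_(z in @Cyl R) ((jw a0 z.2)^-1 * sqn (chordT z))%:E < +oo)%E.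
Proof.
pose I (z : R * R) : \bar R := (\int[mu]_s (aK (chord z.1 (z.2, s)))%:E)%E.
have I0 z : (0 <= I z)%E by apply: integral_ge0 => s _; rewrite lee_fin aK_ge0.
have mI : measurable_fun setT I.
  by apply: ge0_measurable_chordI; [exact: measurable_aK|exact: aK_ge0].
have B00 : 0 <= B0 := ltW B0_gt0.
(* Only the angle is restricted, so that for each angle the heights sweep the whole plane. *)
pose I' (z : R * R) : \bar R := (B0%:E * (I \_ [set z : R * R | (0 < z.1 < 2 * pi)%R]) z)%E.
have mS : measurable [set z : R * R | 0 < z.1 < 2 * pi].
  rewrite (_ : [set _ | _] = `]0, 2 * pi[ `*` setT)%classic; last first.
    apply/seteqP; split => -[x y] /=; rewrite in_itv/=; first by [].
    by move=> [].
  by apply: measurableX => //; exact: measurable_itv.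
have mIr : measurable_fun setT (I \_ [set z : R * R | (0 < z.1 < 2 * pi)%R]).
  exact: ((measurable_restrictT _ mS).1 (measurable_funTS mI)).
have mI' : measurable_fun setT I'.
  by apply: emeasurable_funM.
have I'0 z : (0 <= I' z)%E by rewrite mule_ge0// /patch; case: ifP.
have mjw : measurable_fun setT (fun z : R * R => (jw a0 z.2)^-1).
  apply: measurable_fun_ge0_inv; last by move=> z; exact: powR_ge0.
  exact: (measurableT_comp (measurable_jw a0)).
have mc : measurable_fun setT (fun z => ((jw a0 z.2)^-1 * sqn (chordT z))%:E).
  apply/measurable_EFinP; apply: measurable_funM => //.
  by apply: measurable_sqn; exact: cmeas_chordT.
apply: (@le_lt_trans _ _ (\int[mu2]_z I' z)%E).
  apply: (@le_trans _ _ (\int[mu2]_(z in @Cyl R) I' z)%E).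
    apply: ge0_le_integral => //.
    - exact: measurable_Cyl.
    - by move=> z _; rewrite lee_fin mulr_ge0 ?sqn_ge0// invr_ge0 powR_ge0.
    - exact: measurable_funTS.
    - exact: measurable_funTS.
    - move=> z [z1 z2].
      have jp : 0 < jw a0 z.2 by rewrite powR_gt0//; move: z2 => /andP[? ?]; nra.
      rewrite /I' /patch mem_set// EFinM.
      have := sqn_chordT z2; rewrite EFinM -muleA => H.
      by rewrite lee_pdivrMl.
  apply: ge0_subset_integral => //; exact: measurable_Cyl.
rewrite (tonelli1 mI' I'0).
pose A := (\int[mu2]_z (aK z)%:E)%E.
have AE phi : (\int[mu]_y I (phi, y) = A)%E.
  have mA : measurable_fun setT (EFin \o aK) by apply/measurable_EFinP; exact: measurable_aK.
  have A0 z : (0 <= (EFin \o aK) z)%E by rewrite lee_fin aK_ge0.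
  have mAc : measurable_fun setT (fun z => (aK (chord phi z))%:E).
    by apply: (measurableT_comp mA); exact: measurable_chord1.
  have := ge0_integral_reflection (cos2Dsin2 phi) mA A0; rewrite /A /= => ->.
  by rewrite (tonelli1 mAc)// => z; rewrite lee_fin aK_ge0.
have Afin : (A < +oo)%E.
  have /integrableP[_] := integrable_aK; apply: le_lt_trans.
  rewrite le_eqVlt; apply/orP; left; apply/eqP.
  by apply: eq_integral => z _; rewrite /= ger0_norm ?aK_ge0.
apply: (@le_lt_trans _ _ (\int[mu]_(x in `]0%R, (2 * pi)%R[) (B0%:E * A))%E).
  rewrite [leRHS]integral_mkcond; apply: ge0_le_integral => //.
  - by move=> x _; apply: integral_ge0.
  - exact: measurable_tonelli1.
  - by apply/(measurable_restrictT _ _).1.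
  - move=> x _; rewrite /I' ge0_integralZl//; last 2 first.
    + exact: (measurable_section1 mIr).
    + by move=> y _; rewrite /patch; case: ifP.
    rewrite /patch; case: ifPn => x1.
      rewrite lee_wpmul2l// -(AE x).
      rewrite le_eqVlt; apply/orP; left; apply/eqP; apply: eq_integral => y _.
      by rewrite mem_set//=; move: x1; rewrite inE/= in_itv.
    rewrite integral0_eq ?mule0// => y _; rewrite memNset//=.
    by move: x1; rewrite notin_setE/= in_itv.
rewrite integral_cst//= lebesgue_measure_itv/= lte_fin mulr_gt0 ?pi_gt0// sube0.
by rewrite -(fineK (_ : A \is a fin_num)) ?ge0_fin_numE -?EFinM ?ltry//; apply: integral_ge0 => z _; rewrite lee_fin aK_ge0.
Qed.

End chord_transform_L2.

Section cintegral_more.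
Context d (T : measurableType d) (R : realType) (m : {measure set T -> \bar R}).

Lemma cintegrable_sqn (D : set T) (f : T -> R[i]) (g : T -> R) : measurable D -> cmeas D f ->
  m.-integrable D (EFin \o g) -> (forall x, D x -> 0 <= g x) ->
  (forall x, D x -> sqn (f x) <= g x ^+ 2) -> cintegrable m D f.
Proof.
move=> mD mf ig g0 fg; apply: (cintegrable_le mD mf ig) => x Dx.
by split; rewrite -ler_sqr ?nnegrE ?g0// real_normK ?num_real//;
  apply: le_trans (fg x Dx); rewrite /sqn ?lerDl ?lerDr sqr_ge0.
Qed.

Lemma cintegral_mkcond (D : set T) (f : T -> R[i]) :
  cintegral m D f = cintegral m setT (fun x => if x \in D then f x else 0).
Proof.
rewrite /cintegral /Rintegral; congr (_ +i* _); rewrite integral_mkcond; congr fine;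
  by apply: eq_integral => x _; rewrite /patch /=; case: ifP.
Qed.

Lemma cmeas_mkcond (D : set T) (f : T -> R[i]) : measurable D -> cmeas D f ->
  cmeas setT (fun x => if x \in D then f x else 0).
Proof.
move=> mD [f1 f2]; split.
  have := (measurable_restrictT _ mD).1 f1; apply: eq_measurable_fun => x _.
  by rewrite /patch /=; case: ifP.
have := (measurable_restrictT _ mD).1 f2; apply: eq_measurable_fun => x _.
by rewrite /patch /=; case: ifP.
Qed.

End cintegral_more.

Section plane_sigma_finite.
Variable R : realType.
Local Notation mu := (@lebesgue_measure R).
Local Notation mR := (measurableTypeR R).
(* The library's sigma-finite instance of a product measure is shadowed, hence this copy. *)
Definition mu2s : set (mR * mR)%type -> \bar R := @mu2 R.
HB.instance Definition _ := Measure.copy mu2s (mu \x mu)%E.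
Lemma mu2s_sigma_finite : sigma_finite setT mu2s.
Proof.
have box (n : nat) : measurable (`]- n%:R, n%:R[%classic : set mR) by exact: measurable_itv.
exists (fun n => (`]- n%:R, n%:R[%classic : set mR) `*` (`]- n%:R, n%:R[%classic : set mR)).
  apply/seteqP; split => // -[x y] _.
  exists (Num.truncn (`|x| + `|y|)).+1 => //=; rewrite !in_itv/= -!ltr_norml.
  have h := truncnS_gt (`|x| + `|y|).
  by split; apply: le_lt_trans h; rewrite ?lerDl ?lerDr.
move=> n; split; first exact: measurableX.
rewrite /mu2s /Defs.mu2 product_measure1E//.
have fin : (mu `](- n%:R)%R, n%:R%R[%classic < +oo)%E.
  by rewrite lebesgue_measure_itv/=; case: ifP => _; rewrite -?EFinB ltry.
by apply: lte_mul_pinfty; rewrite ?ge0_fin_numE.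
Qed.
HB.instance Definition _ := Measure_isSigmaFinite.Build _ _ _ mu2s mu2s_sigma_finite.
End plane_sigma_finite.

(** * Transposition of the chord transform *)

Section chord_adjoint.
Variable R : realType.
Local Notation C := R[i].
Local Notation mu := (@lebesgue_measure R).
Local Notation mu2 := (@mu2 R).

Lemma cpulls_chord (phi : R) (f : R * R -> C) : cmeas setT f ->
  cpulls mu2 mu2 setT setT (chord phi) (fun=> 1) f.
Proof.
have H (g : R * R -> R) : measurable_fun setT g -> pulls mu2 mu2 setT setT (chord phi) (fun=> 1) g.
  move=> mg h mh h0 _.
  have mhg : measurable_fun setT (fun z => (h (g z))%:E).
    by apply/measurable_EFinP; exact: measurableT_comp mh mg.
  have := ge0_integral_reflection (cos2Dsin2 phi) mhg (fun z => h0 _) => ->.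
  by apply: eq_integral => z _; rewrite mulr1.
by move=> [f1 f2]; split; exact: H.
Qed.

Variable gam : R.
Hypothesis gam1 : -1 < gam.
Variable F : R * R -> C.
Hypothesis LF : L2mem (@DH R) (wD gam) F.
Local Notation K := (cK gam F).
Local Notation aK := (aK gam F).
Local Notation wD := (wD gam).
Local Notation J := (chordT gam F).

Variables (A : R -> C) (P : R -> R) (M : R).
Hypotheses (mA : cmeas setT A) (A1 : forall x, sqn (A x) <= 1) (mP : measurable_fun setT P).
Hypothesis PM : forall y, -1 < y < 1 -> `|P y| <= M.

Let M0 : 0 <= M.
Proof. by apply: le_trans (PM (y := 0) _); rewrite ?normr_ge0// ltrN10 ltr01. Qed.

(** [A'] and [P1] are cut off to the cylinder, so that all Fubini arguments take place on full
    spaces; [A'] already carries the conjugation of the second factor. *)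
Let A' (x : R) : C := if x \in `]0, 2 * pi[%classic then (A x)^* else 0.
Let P1 (y : R) : R := if y \in `]-1, 1[%classic then P y else 0.
(** The height of the chord of normal angle [phi] through [Z]. *)
Let yc (phi : R) (Z : R * R) : R := Z.1 * cos phi + Z.2 * sin phi.

Let mA' : cmeas setT A'.
Proof.
apply: cmeas_mkcond; first exact: measurable_itv.
by apply: cmeas_conj; have [a b] := mA; split; exact: measurable_funTS.
Qed.

Let mP1 : measurable_fun setT P1.
Proof.
have := (measurable_restrictT P (measurable_itv `]-1, 1[)).1 (measurable_funTS mP).
by apply: eq_measurable_fun => x _; rewrite /patch.
Qed.

Let A'1 x : sqn (A' x) <= 1.
Proof. by rewrite /A'; case: ifP => _; rewrite ?sqn0// sqn_conj. Qed.

Let P1M y : P1 y ^+ 2 <= M ^+ 2.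
Proof.
rewrite /P1; case: ifP => [|_]; last by rewrite expr0n sqr_ge0.
rewrite inE/= in_itv/= => /PM h; rewrite -[leLHS]real_normK ?num_real// ler_sqr ?nnegrE//.
Qed.

Let ycK phi y s : yc phi (chord phi (y, s)) = y.
Proof.
rewrite /yc /chord /=.
transitivity (y * (cos phi ^+ 2 + sin phi ^+ 2)); first by ring.
by rewrite cos2Dsin2 mulr1.
Qed.

Let sqnK z : sqn (K z) <= (aK z + wD z) ^+ 2.
Proof.
rewrite /cK /aK sqnM sqnC -[in leRHS](mul1r (wD z)) mulrA mulr1 -mulrDl exprMn.
by apply: ler_wpM2r; [exact: sqr_ge0|have := sqn_ge0 (F z); nra].
Qed.

Let dom0 z : 0 <= aK z + wD z.
Proof. by rewrite addr_ge0 ?aK_ge0 ?wD_ge0. Qed.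

Let idom (c : R) : mu2.-integrable setT (EFin \o (fun z => c * (aK z + wD z))).
Proof. by have := integrableZl measurableT c (integrable_dom gam1 LF); apply: eq_integrable. Qed.

Let mK : cmeas setT K := cmeas_cK LF.

Let comp_cmeas (phi : R) (f : R * R -> C) : cmeas setT f -> cmeas setT (fun z => f (chord phi z)).
Proof.
by move=> [f1 f2]; split; [exact: measurableT_comp f1 (measurable_chord1 phi)|
  exact: measurableT_comp f2 (measurable_chord1 phi)].
Qed.

Let cintegral_chord phi (f : R * R -> C) : cmeas setT f ->
  cintegral mu2 setT f = cintegral mu2 setT (fun z => f (chord phi z)) /\
  (cintegrable mu2 setT f -> cintegrable mu2 setT (fun z => f (chord phi z))).
Proof.
move=> mf; have H := cpulls_chord phi mf.
have w0 : forall x : R * R, setT x -> 0 <= 1 :> R by [].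
split.
  rewrite (@cpulls_cintegral _ _ _ _ R mu2 mu2 setT setT (chord phi) (fun=> 1) w0 f H).
  by apply: eq_cintegral => z _; rewrite mulr1.
have mf' : cmeas setT (fun x => f (chord phi x) * (1 : R)%:C).
  by apply: cmeasM; [exact: comp_cmeas|exact: cmeas_cst].
move=> /(@cpulls_cintegrable _ _ _ _ R mu2 mu2 setT setT (chord phi) (fun=> 1) w0 f mf mf' H) h.
apply: (@eq_cintegrable _ _ R mu2 setT measurableT _ _ _ h) => z _.
by rewrite mulr1.
Qed.

Let G phi (Z : R * R) : C := (P1 (yc phi Z))%:C * K Z.

Let mG phi : cmeas setT (G phi).
Proof.
apply: cmeasM => //; apply: cmeasC; apply: (measurableT_comp mP1).
by apply: measurable_funD; apply: measurable_funM.
Qed.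

Let sqnG phi Z : sqn (G phi Z) <= (M * (aK Z + wD Z)) ^+ 2.
Proof. by rewrite /G sqnM sqnC exprMn ler_pM ?sqr_ge0 ?sqn_ge0. Qed.

Let iG phi : cintegrable mu2 setT (G phi).
Proof.
apply: (@cintegrable_sqn _ _ R mu2 setT (G phi) _ measurableT (mG phi) (idom M)) => z _.
  by rewrite mulr_ge0.
exact: sqnG.
Qed.

(** In the isometric coordinates [chord phi] the factor [P1] depends on the height alone, so it can
    be pulled out of the integral along the chord. *)
Let slice_integral phi :
  cintegrable mu setT (fun y => (P1 y)%:C * J (phi, y)) /\
  cintegral mu setT (fun y => (P1 y)%:C * J (phi, y)) = cintegral mu2 setT (G phi).
Proof.
have [EG IG] := cintegral_chord phi (mG phi).
have [_ IK] := cintegral_chord phi mK.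
have GE z : G phi (chord phi z) = (P1 z.1)%:C * K (chord phi z).
  by rewrite /G; case: z => y s; rewrite ycK.
have mKc : cmeas setT (fun z => K (chord phi z)) by exact: comp_cmeas.
have H := @cintegral_fubini _ _ _ _ R mu mu (fun z => K (chord phi z)) (fun y => (P1 y)%:C)
  (cmeasC mP1) (cmeas_cintegral mu mKc) (IK (cintegrable_cK gam1 LF)).
have {}H := H (@eq_cintegrable _ _ R mu2 setT measurableT _ _ (fun z _ => GE z) (IG (iG phi))).
split; first exact: H.1.
by rewrite EG; transitivity (cintegral mu2 setT (fun z => (P1 z.1)%:C * K (chord phi z)));
  [exact: H.2|apply: eq_cintegral => z _; rewrite GE].
Qed.

Let f0 (z : R * R) : C := A' z.1 * ((P1 z.2)%:C * J z).

Let mf0 : cmeas setT f0.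
Proof.
have [a b] := mA'; apply: cmeasM.
  by split; [exact: (measurableT_comp a measurable_fst)|exact: (measurableT_comp b measurable_fst)].
apply: cmeasM; last exact: cmeas_chordT.
by apply: cmeasC; exact: (measurableT_comp mP1 measurable_snd).
Qed.

(** Here [|J| <= |J|^2 / j + j] for the weight [j > 0], and both terms are integrable on the
    cylinder, the first by the L2 bound. *)
Let if0 : cintegrable mu2 setT f0.
Proof.
have mC : measurable (@Cyl R : set (measurableTypeR R * measurableTypeR R)%type) := @measurable_Cyl R.
pose j (z : R * R) := jw (gam + 2^-1) z.2.
have mj : measurable_fun setT j by exact: (measurableT_comp (measurable_jw _)).
have mji : measurable_fun setT (fun z => (j z)^-1).
  by apply: measurable_fun_ge0_inv => // z; exact: powR_ge0.
have mc := cmeas_chordT LF.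
have i1 : mu2.-integrable (@Cyl R) (EFin \o (fun z => (j z)^-1 * sqn (J z))).
  apply: (@ge0_integrable _ _ R mu2).
  - by apply: measurable_funTS; apply: measurable_funM => //; exact: measurable_sqn.
  - by move=> z _; rewrite mulr_ge0 ?sqn_ge0// invr_ge0 powR_ge0.
  - exact: chordT_L2.
have i2 : mu2.-integrable (@Cyl R) (EFin \o j).
  apply: (@ge0_integrable _ _ R mu2); first exact: measurable_funTS.
    by move=> z _; exact: powR_ge0.
  have [] := ge0_integral_rect (measurable_itv `]0, 2 * pi[) (measurable_itv `]-1, 1[)
    (G := fun z => (j z)%:E).
  - exact/measurable_EFinP.
  - by move=> z; rewrite lee_fin powR_ge0.
  - move=> E _; rewrite (_ : @Cyl R = (`]0%R, (2 * pi)%R[ `*` `](-1)%R, 1%R[)%classic); last first.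
      by apply/seteqP; split => -[x y]; rewrite /Cyl/= !in_itv/=.
    have a1 : -1 < gam + 2^-1 by move: gam1; lra.
    have iw := integrable_jw a1.
    have /integrableP[_] := @integrableZl _ _ _ mu `]-1, 1[ (measurable_itv _) (2 * pi) _ iw.
    apply: le_lt_trans; rewrite E le_eqVlt; apply/orP; left; apply/eqP.
    apply: eq_integral => y _.
    transitivity (\int[mu]_(x in `]0%R, (2 * pi)%R[) (cst (jw (gam + 2^-1) y)%:E x))%E; first by [].
    rewrite integral_cst//= lebesgue_measure_itv/= lte_fin.
    rewrite mulr_gt0 ?pi_gt0// sube0 muleC -EFinM ger0_norm// mulr_ge0 ?powR_ge0//.
    by rewrite mulr_ge0// pi_ge0.
have i12 : mu2.-integrable (@Cyl R) (EFin \o (fun z => M * ((j z)^-1 * sqn (J z) + j z))).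
  have := integrableZl mC M (integrableD mC i1 i2).
  exact: eq_integrable.
have H : cintegrable mu2 (@Cyl R) f0.
  apply: (@cintegrable_sqn _ _ R mu2 _ f0 _ (@measurable_Cyl R) _ i12).
  - by have [a b] := mf0; split; exact: measurable_funTS.
  - move=> z _; rewrite mulr_ge0// addr_ge0 ?powR_ge0// mulr_ge0 ?sqn_ge0//.
    by rewrite invr_ge0 powR_ge0.
  - move=> z [_ z2]; have jp : 0 < j z.
      by rewrite powR_gt0//; move: z2 => /andP[? ?]; nra.
    rewrite /f0 !sqnM sqnC exprMn; have c0 := sqn_ge0 (J z).
    have h : sqn (J z) <= ((j z)^-1 * sqn (J z) + j z) ^+ 2.
      rewrite -subr_ge0.
      have -> : ((j z)^-1 * sqn (J z) + j z) ^+ 2 - sqn (J z) =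
        ((j z)^-1 * sqn (J z)) ^+ 2 + sqn (J z) + j z ^+ 2 by field; rewrite gt_eqF.
      by rewrite !addr_ge0 ?sqr_ge0.
    rewrite -[leRHS]mul1r; apply: ler_pM; [exact: sqn_ge0| |exact: A'1|].
      by apply: mulr_ge0; [exact: sqr_ge0|exact: sqn_ge0].
    by apply: ler_pM; [exact: sqr_ge0|exact: sqn_ge0|exact: P1M|exact: h].
have f0out z : z \notin @Cyl R -> f0 z = 0.
  rewrite notin_setE /Cyl/= => zC; rewrite /f0 /A'; case: ifPn => [z1|_]; last by rewrite mul0r.
  have [z2|z2] := boolP (-1 < z.2 < 1); last by rewrite chordT_out ?mulr0//; exact/negP.
  by case: zC; split => //; move: z1; rewrite inE/= in_itv.
have [h1 h2] := H.
have E1 : EFin \o (@cRe R \o f0) = (EFin \o (@cRe R \o f0)) \_ (@Cyl R).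
  by apply/funext => z; rewrite /patch; case: ifPn => // /f0out /= ->.
have E2 : EFin \o (@cIm R \o f0) = (EFin \o (@cIm R \o f0)) \_ (@Cyl R).
  by apply/funext => z; rewrite /patch; case: ifPn => // /f0out /= ->.
split; [rewrite E1|rewrite E2].
  exact: ((integrable_mkcond _ mC).1 h1).
exact: ((integrable_mkcond _ mC).1 h2).
Qed.

Let L (x : R * (R * R)) : C := A' x.1 * G x.1 x.2.

Let mL : cmeas setT L.
Proof.
have mc : measurable_fun setT (fun x : R * (R * R) => cos x.1).
  apply: (@measurableT_comp _ _ _ _ _ _ (@cos R)) measurable_fst.
  by apply: continuous_measurable_fun; exact: continuous_cos.
have ms : measurable_fun setT (fun x : R * (R * R) => sin x.1).
  apply: (@measurableT_comp _ _ _ _ _ _ (@sin R)) measurable_fst.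
  by apply: continuous_measurable_fun; exact: continuous_sin.
have m21 : measurable_fun setT (fun x : R * (R * R) => x.2.1) by exact: measurableT_comp.
have m22 : measurable_fun setT (fun x : R * (R * R) => x.2.2) by exact: measurableT_comp.
have myc : measurable_fun setT (fun x : R * (R * R) => yc x.1 x.2).
  by apply: measurable_funD; [exact: measurable_funM m21 mc|exact: measurable_funM m22 ms].
have [a b] := mA'; have [k1 k2] := mK; apply: cmeasM.
  by split; [exact: (measurableT_comp a measurable_fst)|exact: (measurableT_comp b measurable_fst)].
apply: cmeasM; first by apply: cmeasC; exact: (measurableT_comp mP1 myc).
by split; [exact: (measurableT_comp k1 measurable_snd)|exact: (measurableT_comp k2 measurable_snd)].
Qed.

Let iL : cintegrable (mu \x @mu2s R)%E setT L.
Proof.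
pose g (x : R * (R * R)) : R := (\1_(`]0, 2 * pi[%classic) x.1) * (M * (aK x.2 + wD x.2)).
have g0 x : 0 <= g x by rewrite !mulr_ge0.
have mg : measurable_fun setT g.
  apply: measurable_funM.
    apply: (measurableT_comp _ measurable_fst); exact: measurable_indic.
  have /integrableP[/measurable_EFinP mm _] := idom M.
  exact: (measurableT_comp mm measurable_snd).
have ig : (mu \x @mu2s R)%E.-integrable setT (EFin \o g).
  apply/(@integrable12ltyP _ _ _ _ R mu (@mu2s R) (EFin \o g)); first exact/measurable_EFinP.
  have /integrableP[mm Iy] := idom M.
  have E (x : R) : (\int[mu2]_y `|(EFin \o g) (x, y)| =
      (\1_(`]0%R, (2 * pi)%R[%classic) x)%:E * \int[mu2]_y `|(M * (aK y + wD y))%:E|)%E.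
    rewrite -ge0_integralZl//; last by apply: measurableT_comp.
    by apply: eq_integral => y _; rewrite /= /g /= normrM EFinM (ger0_norm (_ : 0 <= \1__ x)).
  under eq_integral do rewrite E.
  rewrite ge0_integralZr//; last 2 first.
  - by apply/measurable_EFinP; exact: measurable_indic.
  - exact: integral_ge0.
  rewrite integral_indic ?setIT; [|exact: measurableT|exact: measurable_itv].
  have e : (mu `]0%R, (2 * pi)%R[%classic < +oo)%E.
    by rewrite lebesgue_measure_itv/= lte_fin mulr_gt0 ?pi_gt0// sube0 ltry.
  by apply: lte_mul_pinfty; [exact: measure_ge0|rewrite ge0_fin_numE//; exact: e|exact: Iy].
apply: (@cintegrable_sqn _ _ R (mu \x @mu2s R)%E setT L g measurableT mL ig) => // x _.
rewrite /L sqnM /g exprMn; have := sqnG x.1 x.2.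
rewrite indicE /A'; case: ifPn => xI.
  rewrite expr1n mul1r sqn_conj => h; apply: le_trans h.
  by rewrite ler_piMl ?sqn_ge0.
by rewrite sqn0 expr0n !mul0r.
Qed.

(* The transpose of the chord transform: [back] integrates over the lines through [Z]. *)
Definition back (Z : R * R) : C :=
  cintegral mu `]0, 2 * pi[ (fun phi => A phi * (P (Z.1 * cos phi + Z.2 * sin phi))%:C).

(** For each angle the pair (height, arc length) is replaced by the point [Z] of the plane; then the
    integrations over the angle and over [Z] are exchanged. *)
Lemma chordT_adjoint :
  cintegral mu2 (@Cyl R) (fun z => J z * (A z.1 * (P z.2)%:C)^*) =
  cintegral mu2 setT (fun Z => K Z * (back Z)^*).
Proof.
transitivity (cintegral mu2 setT f0).
  rewrite cintegral_mkcond; apply: eq_cintegral => z _; rewrite /f0 /A' /P1.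
  case: ifPn => [|].
    rewrite inE /Cyl/= => -[z1 z2]; rewrite !mem_set ?in_itv//=.
    by apply: cP; rewrite !cE; ring.
  rewrite notin_setE /Cyl/= => zC; case: ifPn => z1; last by rewrite mul0r.
  case: ifPn => z2; last by rewrite mul0r mulr0.
  by case: zC; split; [move: z1|move: z2]; rewrite inE/= in_itv.
have mf0c : cmeas setT (fun x => cintegral mu setT (fun y => f0 (x, y))).
  exact: cmeas_cintegral.
rewrite -[LHS](@cintegral_fubini1 _ _ _ _ R mu mu f0 mf0c if0).
transitivity (cintegral mu setT (fun phi => cintegral mu2 setT (fun Z => L (phi, Z)))).
  apply: eq_cintegral => phi _; have [s1 s2] := slice_integral phi.
  transitivity (A' phi * cintegral mu setT (fun y => (P1 y)%:C * J (phi, y))).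
    by rewrite -cintegralZ.
  by rewrite s2 -cintegralZ//; exact: iG.
have mLc : cmeas setT (fun x => cintegral mu2 setT (fun y => L (x, y))).
  exact: (@cmeas_cintegral _ _ _ _ R (@mu2s R) L mL).
rewrite (@cintegral_fubini1 _ _ _ _ R mu (@mu2s R) L mLc iL).
rewrite -(@cintegral_fubini2 _ _ _ _ R mu (@mu2s R) L iL).
apply: eq_cintegral => Z _.
have myc : measurable_fun setT (fun phi => yc phi Z).
  apply: measurable_funD; apply: measurable_funM => //;
    by apply: continuous_measurable_fun; first [exact: continuous_cos|exact: continuous_sin].
have mI : measurable (`]0, 2 * pi[%classic : set (measurableTypeR R)) by exact: measurable_itv.
have iM : mu.-integrable `]0, 2 * pi[ (EFin \o cst M).
  apply: ge0_integrable => //.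
  rewrite (eq_integral (cst M%:E))// integral_cst//= lebesgue_measure_itv/= lte_fin.
  by rewrite mulr_gt0 ?pi_gt0// sube0 -EFinM ltry.
have mAP : cmeas setT (fun phi => A' phi * (P1 (yc phi Z))%:C).
  by apply: cmeasM => //; apply: cmeasC; exact: (measurableT_comp mP1).
have iAP : cintegrable mu setT (fun phi => A' phi * (P1 (yc phi Z))%:C).
  have iM' := (integrable_mkcond (EFin \o cst M) mI).1 iM.
  have iM2 : mu.-integrable setT (EFin \o ((cst M : R -> R) \_ `]0, 2 * pi[%classic)).
    by apply: eq_integrable iM' => // x _; rewrite /= /patch; case: ifP.
  apply: (@cintegrable_sqn _ _ R mu setT _ _ measurableT mAP iM2) => x _; rewrite /patch; first by case: ifP.
  rewrite sqnM sqnC /A'; case: ifP => _; last by rewrite sqn0 mul0r expr0n.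
  by rewrite (sqn_conj (A x)) (le_trans _ (P1M (yc x Z)))// ler_piMl ?sqr_ge0.
transitivity (K Z * cintegral mu setT (fun phi => A' phi * (P1 (yc phi Z))%:C)).
  rewrite -cintegralZ//.
  by apply: eq_cintegral => phi _; rewrite /L /G; ring.
have [ZD|ZD] := boolP (nsq Z < 1); last by rewrite /cK /wD (negbTE ZD) mulr0 !mul0r.
(* All chords through a point of the disc have height in []-1, 1[], so the cut-off in [P1] is
   invisible there. *)
have y1 phi : -1 < yc phi Z < 1.
  have h : nsq Z - yc phi Z ^+ 2 = (Z.1 * sin phi - Z.2 * cos phi) ^+ 2.
    have -> : nsq Z = nsq Z * (cos phi ^+ 2 + sin phi ^+ 2) by rewrite cos2Dsin2 mulr1.
    by rewrite /nsq /yc; ring.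
  have := sqr_ge0 (Z.1 * sin phi - Z.2 * cos phi); rewrite -h => h0.
  by apply/andP; split; nra.
congr (_ * _).
have -> : Num.conj (back Z) = conjc (back Z) by [].
rewrite /back -cintegral_conj//; last first.
  apply: (@cintegrable_sqn _ _ R mu _ _ (cst M) mI _ iM) => //.
    have [a b] := cmeasM mA (cmeasC (measurableT_comp mP myc)).
    by split; exact: measurable_funTS.
  move=> x _; rewrite sqnM sqnC.
  have h : P (yc x Z) ^+ 2 <= M ^+ 2.
    have /PM h0 := y1 x; rewrite -[leLHS]real_normK ?num_real// ler_sqr ?nnegrE//.
  by rewrite (le_trans _ h)// ler_piMl ?sqr_ge0.
rewrite [RHS]cintegral_mkcond; apply: eq_cintegral => phi _; rewrite /A' /P1.
case: ifPn => _; last by rewrite mul0r.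
rewrite mem_set; last by rewrite /= in_itv /= y1.
by apply: cP; rewrite !cE /yc; ring.
Qed.

End chord_adjoint.

(** * Integrals of exponentials and of product functions on the cylinder *)

Section trigonometric_integrals.
Variable R : realType.
Local Notation C := R[i].
Local Notation mu := (@lebesgue_measure R).
Local Notation mu2 := (@mu2 R).

Let twopi : 0 < 2 * pi :> R. Proof. by rewrite mulr_gt0// pi_gt0. Qed.

Lemma integrable_bounded_itv (f : R -> R) (a b M : R) : measurable_fun setT f ->
  (forall x, a < x < b -> `|f x| <= M) -> mu.-integrable `]a, b[ (EFin \o f).
Proof.
move=> mf fM.
have [ab|ba] := ltP a b; last first.
  rewrite set_itv_ge -?leNgt ?bnd_simp//; exact: integrable_set0.
have M0 : 0 <= M.
  have : a < (a + b) / 2 < b by apply/andP; split; lra.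
  by move=> /fM; apply: le_trans.
apply: (@le_integrable _ _ _ mu `]a, b[ _ _ (EFin \o cst M)) => //.
- exact/measurable_EFinP/measurable_funTS.
- by move=> x /=; rewrite in_itv/= => xab; rewrite lee_fin (ger0_norm M0) fM.
apply: ge0_integrable => //; rewrite (eq_integral (cst M%:E))//.
by rewrite integral_cst//= lebesgue_measure_itv/= lte_fin ab -EFinB -EFinM ltry.
Qed.

Lemma measurable_mull (r : R) : measurable_fun setT (fun x : R => r * x).
Proof. exact: mulrl_measurable. Qed.

Lemma expi_int_2pi (r : int) : expi (r%:~R * (2 * pi)) = 1 :> C.
Proof.
have H (n : nat) : expi (n%:R * (2 * pi)) = 1 :> C.
  rewrite -expiX; have -> : expi (2 * pi) = 1 :> C.
    by rewrite mulr_natl /expi cos2pi sin2pi.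
  by rewrite expr1n.
case: r => n; first by rewrite -pmulrn H.
by rewrite NegzE mulrNz mulNr -expi_conj -pmulrn H conjc1.
Qed.

Lemma Rintegral_period_co (f : R -> R) : measurable_fun setT f ->
  Rintegral mu `]0, 2 * pi[ f = Rintegral mu `[0, 2 * pi[ f.
Proof.
move=> mf; rewrite /Rintegral; congr fine; apply: integral_itv_obnd_cbnd.
exact/measurable_EFinP/measurable_funTS.
Qed.

Lemma Rintegral_periodic (f : R -> R) (c : R) : measurable_fun setT f ->
  (forall x, f (x + 2 * pi) = f x) ->
  Rintegral mu `]0, 2 * pi[ f = Rintegral mu `]0, 2 * pi[ (fun x => f (x + c)).
Proof.
move=> mf fp.
have mfc : measurable_fun setT (fun x : R => f (x + c)).
  by apply: (measurableT_comp mf); exact: measurable_funD.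
rewrite !Rintegral_period_co//.
have H : pulls mu mu `[0, 2 * pi[ `[0, 2 * pi[ (fun x => x + c) (fun=> 1) f.
  move=> h mh h0 _.
  have mhf : measurable_fun setT (fun x => (h (f x))%:E).
    by apply/measurable_EFinP; exact: (measurableT_comp mh mf).
  have := @ge0_integral_periodic R (fun x => (h (f x))%:E) c mhf.
  move=> <-; [|by move=> x; rewrite lee_fin|by move=> x; rewrite fp].
  by apply: eq_integral => x _; rewrite mulr1.
rewrite (pulls_Rintegral _ H); last by [].
by apply: eq_Rintegral => x _; rewrite mulr1.
Qed.

(** For [r != 0] the shift by [pi / r] reverses the sign of the integrand and, by periodicity,
    preserves the integral. *)
Lemma cintegral_expi (r : int) :
  cintegral mu `]0, 2 * pi[ (fun x => expi (r%:~R * x)) = if r == 0 then (2 * pi)%:C else 0.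
Proof.
have mE : cmeas setT (fun x : R => expi (r%:~R * x)) by apply: cmeas_expi; exact: measurable_mull.
have mE' : cmeas `]0, 2 * pi[ (fun x : R => expi (r%:~R * x)).
  by have [a b] := mE; split; exact: measurable_funTS.
case: eqP => [->|/eqP r0].
  transitivity (cintegral mu `]0, 2 * pi[ (fun=> (1 : R)%:C)).
    by apply: eq_cintegral => x _; rewrite mul0r expi0.
  rewrite cintegralC; last exact: measurable_itv.
  congr (_%:C); rewrite /Rintegral integral_cst//= mul1e.
  by rewrite lebesgue_measure_itv/= lte_fin twopi sube0.
have r0' : r%:~R != 0 :> R by rewrite intr_eq0.
have per := Rintegral_periodic.
pose c : R := pi / r%:~R.
have shiftE x : expi (r%:~R * (x + c)) = - expi (r%:~R * x) :> C.
  rewrite mulrDr expiD; have -> : r%:~R * c = pi by rewrite /c mulrC divfK.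
  by rewrite /expi cospi sinpi; apply: cP; rewrite !cE /=; ring.
have pE x : expi (r%:~R * (x + 2 * pi)) = expi (r%:~R * x) :> C.
  by rewrite mulrDr expiD expi_int_2pi mulr1.
have z (f : R -> R) : measurable_fun setT f -> (forall x, f (x + 2 * pi) = f x) ->
    (forall x, f (x + c) = - f x) -> (forall x, `|f x| <= 1) -> Rintegral mu `]0, 2 * pi[ f = 0.
  move=> mf fp fc f1; have h := per f c mf fp.
  have h2 : Rintegral mu `]0, 2 * pi[ f = - Rintegral mu `]0, 2 * pi[ f.
    rewrite {1}h -mulN1r -RintegralZl//; last exact: (@integrable_bounded_itv _ _ _ 1).
    by apply: eq_Rintegral => x _; rewrite fc mulN1r.
  by move: h2; lra.
have b1 (y : R) : `|cos y| <= 1 by rewrite ler_norml cos_geN1 cos_le1.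
have b2 (y : R) : `|sin y| <= 1 by rewrite ler_norml sin_geN1 sin_le1.
have [m1 m2] := mE.
have z1 := z _ m1 (fun x => congr1 (@cRe R) (pE x))
  (fun x => etrans (congr1 (@cRe R) (shiftE x)) (cReN _)) (fun x => b1 _).
have z2 := z _ m2 (fun x => congr1 (@cIm R) (pE x))
  (fun x => etrans (congr1 (@cIm R) (shiftE x)) (cImN _)) (fun x => b2 _).
by apply: cP; [exact: z1|exact: z2].
Qed.

Lemma cintegral_prod (a : R -> C) (b : R -> R) : cmeas setT a -> (forall x, sqn (a x) <= 1) ->
  measurable_fun setT b -> mu.-integrable `]-1, 1[ (EFin \o b) ->
  cintegrable mu2 (@Cyl R) (fun z => a z.1 * (b z.2)%:C) /\
  cintegral mu2 (@Cyl R) (fun z => a z.1 * (b z.2)%:C) =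
  cintegral mu `]0, 2 * pi[ a * (Rintegral mu `]-1, 1[ b)%:C.
Proof.
move=> ma a1 mb ib.
have mI : measurable (`]-1, 1[%classic : set (measurableTypeR R)) := measurable_itv _.
have mI2 : measurable (`]0, 2 * pi[%classic : set (measurableTypeR R)) := measurable_itv _.
have mC : measurable (@Cyl R : set (measurableTypeR R * measurableTypeR R)%type) := @measurable_Cyl R.
have CE : @Cyl R = (`]0%R, (2 * pi)%R[ `*` `](-1)%R, 1%R[)%classic.
  by apply/seteqP; split => -[x y]; rewrite /Cyl/= !in_itv/=.
have mf : cmeas setT (fun z : R * R => a z.1 * (b z.2)%:C).
  apply: cmeasM; last by apply: cmeasC; exact: (measurableT_comp mb measurable_snd).
  by have [u v] := ma; split; [exact: (measurableT_comp u measurable_fst)|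
    exact: (measurableT_comp v measurable_fst)].
have mab : measurable_fun setT (fun z : R * R => `|b z.2|).
  exact: (measurableT_comp (@normr_measurable R setT) (measurableT_comp mb measurable_snd)).
have iab : mu2.-integrable (@Cyl R) (EFin \o (fun z => `|b z.2|)).
  apply: (@ge0_integrable _ _ R mu2 (@Cyl R)); first exact: measurable_funTS.
    by move=> z _.
  have [] := ge0_integral_rect (measurable_itv `]0, 2 * pi[) (measurable_itv `]-1, 1[)
    (G := fun z => (`|b z.2|)%:E).
  - exact/measurable_EFinP.
  - by move=> z; rewrite lee_fin.
  move=> E _; rewrite CE.
  have /integrableP[_] := @integrableZl _ _ _ mu `]-1, 1[ (measurable_itv _) (2 * pi) _ ib.
  apply: le_lt_trans; rewrite E le_eqVlt; apply/orP; left; apply/eqP.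
  apply: eq_integral => y _.
  transitivity (\int[mu]_(x in `]0%R, (2 * pi)%R[) (cst (`|b y|)%:E x))%E; first by [].
  rewrite integral_cst//= lebesgue_measure_itv/= lte_fin twopi sube0 muleC -EFinM.
  by rewrite normrM (ger0_norm (ltW twopi)).
have H : cintegrable mu2 (@Cyl R) (fun z => a z.1 * (b z.2)%:C).
  apply: (@cintegrable_sqn _ _ R mu2 _ _ _ mC _ iab) => //.
  - by have [u v] := mf; split; exact: measurable_funTS.
  - by move=> z _; rewrite sqnM sqnC real_normK ?num_real// ler_piMl ?sqr_ge0.
split => //.
pose a' x : C := if x \in `]0, 2 * pi[%classic then a x else 0.
pose b' y : R := if y \in `]-1, 1[%classic then b y else 0.
pose f (z : R * R) : C := a' z.1 * (b' z.2)%:C.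
have fE z : (if z \in @Cyl R then a z.1 * (b z.2)%:C else 0) = f z.
  rewrite /f /a' /b' CE in_setX; case: (_ \in `]0, _[%classic) => /=; last by rewrite mul0r.
  by case: (_ \in _) => /=; rewrite ?mulr0.
have if' : cintegrable mu2 setT f.
  have [h1 h2] := H; split.
    have := (integrable_mkcond _ mC).1 h1; apply: eq_integrable => // z _.
    by rewrite /= -fE /patch /=; case: ifP.
  have := (integrable_mkcond _ mC).1 h2; apply: eq_integrable => // z _.
  by rewrite /= -fE /patch /=; case: ifP.
have mf' : cmeas setT f.
  have [h1 h2] := if'; have /integrableP[/measurable_EFinP k1 _] := h1.
  by have /integrableP[/measurable_EFinP k2 _] := h2.
rewrite cintegral_mkcond.
transitivity (cintegral mu2 setT f); first by apply: eq_cintegral => z _; exact: fE.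
rewrite -[LHS](@cintegral_fubini1 _ _ _ _ R mu mu f (cmeas_cintegral mu mf') if').
have ib' : cintegrable mu setT (fun y => (b' y)%:C).
  split; last by apply: eq_integrable (integrable0 _ _).
  have := (integrable_mkcond _ mI).1 ib; apply: eq_integrable => // y _.
  by rewrite /= /patch /b'; case: ifP.
have ia : cintegrable mu `]0, 2 * pi[ a.
  have [u v] := ma; split; apply: (@integrable_bounded_itv _ _ _ 1) => // x _;
    rewrite -ler_sqr ?nnegrE// real_normK ?num_real// expr1n; apply: le_trans (a1 x);
    by rewrite /sqn /= ?lerDl ?lerDr sqr_ge0.
have BE : cintegral mu setT (fun y => (b' y)%:C) = (Rintegral mu `]-1, 1[ b)%:C.
  rewrite -cintegralC//.
  rewrite [RHS]cintegral_mkcond; apply: eq_cintegral => y _; rewrite /b'.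
  by case: ifP.
transitivity (cintegral mu setT (fun x => (Rintegral mu `]-1, 1[ b)%:C * a' x)).
  apply: eq_cintegral => x _; rewrite -BE mulrC -cintegralZ//.
rewrite mulrC -cintegralZ//.
rewrite [RHS]cintegral_mkcond; apply: eq_cintegral => x _; rewrite /a'.
by case: ifP => _; rewrite ?mulr0.
Qed.

End trigonometric_integrals.

(** * Chord transforms of monomials *)

Section moments.
Variable R : realType.
Local Notation C := R[i].
Local Notation mu := (@lebesgue_measure R).
Local Notation mu2 := (@mu2 R).

Lemma jint_odd (a : R) (k : nat) : -1 < a -> odd k -> jint a 'X^k = 0.
Proof.
move=> a1 ok.
have mf : measurable_fun setT (fun y : R => ('X^k : {poly R}).[y] * jw a y).
  by apply: measurable_funM; [exact: measurable_poly|exact: measurable_jw].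
have H : pulls mu mu `]-1, 1[ `]-1, 1[ (fun x => - x) (fun=> 1)
    (fun y => ('X^k : {poly R}).[y] * jw a y).
  move=> h mh h0 _.
  rewrite [LHS]integral_mkcond [RHS]integral_mkcond ge0_integral_opp.
  - apply: eq_integral => x _; rewrite /patch mulr1.
    congr (if _ then _ else _); rewrite !mem_setE !in_itv/=.
    by rewrite ltrN2 ltrNl andbC.
  - have mI : measurable (`](-1)%R, 1%R[%classic : set R) by exact: measurable_itv.
    have mhf : measurable_fun (`]-1, 1[ : set R) (fun y : R => (h (('X^k : {poly R}).[y] * jw a y))%:E).
      by apply/measurable_EFinP; apply: measurable_funTS; exact: (measurableT_comp mh mf).
    exact: ((measurable_restrictT _ mI).1 mhf).
  - by move=> x; rewrite /patch; case: ifP; rewrite ?lee_fin.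
have E : jint a 'X^k = - jint a 'X^k.
  rewrite {1}/jint (pulls_Rintegral _ H)//.
  have -> : - jint a 'X^k =
      Rintegral mu `]-1, 1[ (fun x => (-1) * (('X^k : {poly R}).[x] * jw a x)).
    by rewrite RintegralZl ?mulN1r//; exact: integrable_poly_jw.
  apply: eq_Rintegral => x _; rewrite mulr1 !hornerXn /jw sqrrN mulrA; congr (_ * _).
  by rewrite exprNn -signr_odd ok expr1.
by move: E; lra.
Qed.

Definition mono (i j : nat) (Z : R * R) : C := toC Z ^+ i * conjc (toC Z) ^+ j.

Lemma sqnX (x : C) n : sqn (x ^+ n) = sqn x ^+ n.
Proof. by elim: n => [|n IH]; rewrite ?sqn1// !exprS sqnM IH. Qed.

Lemma cmeas_exp d (T : measurableType d) (D : set T) (f : T -> C) n :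
  cmeas D f -> cmeas D (fun x => f x ^+ n).
Proof.
move=> mf; elim: n => [|n IH].
  by under [X in cmeas _ X]eq_fun do rewrite expr0; exact: cmeas_cst.
by under [X in cmeas _ X]eq_fun do rewrite exprS; exact: cmeasM.
Qed.

Lemma cmeas_toC : cmeas setT (@toC R).
Proof. by split; [exact: measurable_fst|exact: measurable_snd]. Qed.

Lemma cmeas_mono i j : cmeas setT (mono i j).
Proof.
by apply: cmeasM; apply: cmeas_exp; [|apply: cmeas_conj]; exact: cmeas_toC.
Qed.

Variable gam : R.
Hypothesis gam1 : -1 < gam.
Local Notation a0 := (gam + 2^-1).
Local Notation wD := (wD gam).
Let a01 : -1 < a0. Proof. by move: gam1; lra. Qed.

Lemma L2mem_bounded (F : R * R -> C) (M : R) : cmeas setT F ->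
  (forall z, DH z -> sqn (F z) <= M) -> L2mem (@DH R) wD F.
Proof.
move=> [f1 f2] FM; have mD := @measurable_DH R.
have mD2 : measurable (@DH R : set (measurableTypeR R * measurableTypeR R)%type) := mD.
have iw : mu2.-integrable (@DH R) (EFin \o (fun z => M * wD z)).
  have := integrableZl mD2 M (integrableS measurableT mD2 (@subsetT _ _) (integrable_wD gam1)).
  exact: eq_integrable.
apply: (L2mem_dom mD _ _ _ iw).
- by apply: measurable_funTS; exact: measurable_wD.
- by move=> z _; exact: wD_ge0.
- by split; exact: measurable_funTS.
- by move=> z Dz; rewrite ler_wpM2r ?wD_ge0// FM.
Qed.

Lemma L2mem_mono i j : L2mem (@DH R) wD (mono i j).
Proof.
apply: (@L2mem_bounded _ 1); first exact: cmeas_mono.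
move=> z; rewrite /DH/= => z1; rewrite /mono sqnM !sqnX sqn_conj.
have -> : sqn (toC z) = nsq z by [].
have z0 := nsq_ge0 z.
by rewrite mulr_ile1 ?exprn_ge0 ?exprn_ile1// ltW.
Qed.

(* The chord transform of [z^i conj(z)^j] is [e^{i(i-j)phi} (1 - y^2)^{gam + 1/2}] times
   this polynomial in [y]; expanding [(y - ics)^i (y + ics)^j], [c^2 = 1 - y^2], only the
   even powers of [s] contribute. *)
Definition rmono (i j : nat) : {poly R} :=
  \sum_(a < i.+1) \sum_(b < j.+1)
    (if odd (a + b) then 0 else
     ('C(i, a)%:R * 'C(j, b)%:R * (-1) ^+ a * jint gam 'X^(a + b)) *:
       ('X^(i + j - (a + b)) * ('X^2 - 1) ^+ (a + b)./2)).

Let monic_term i j a b : ~~ odd (a + b) -> (a + b <= i + j)%N ->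
  let q : {poly R} := 'X^(i + j - (a + b)) * ('X^2 - 1) ^+ (a + b)./2 in
  q \is monic /\ size q = (i + j).+1.
Proof.
move=> oab ab q.
have m1 : ('X^2 - 1 : {poly R}) \is monic.
  by rewrite -polyC1; apply: monicXnsubC.
have m2 : (('X^2 - 1) ^+ (a + b)./2 : {poly R}) \is monic by exact: monic_exp.
have mq : q \is monic by rewrite /q monicMl ?monicXn.
split => //; rewrite /q size_monicM ?monicXn ?monic_neq0//.
rewrite size_polyXn (polySpred (monic_neq0 m2)) size_exp -polyC1 size_XnsubC//=.
by move: oab ab => /even_halfK; rewrite -mul2n; lia.
Qed.

Let term_bound i j (a : 'I_i.+1) (b : 'I_j.+1) : (a + b <= i + j)%N.
Proof. by rewrite leq_add// -ltnS. Qed.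

Lemma size_rmono i j : (size (rmono i j) <= (i + j).+1)%N.
Proof.
rewrite /rmono; apply: (big_ind (fun q : {poly R} => (size q <= (i + j).+1)%N)) => //.
- by rewrite size_poly0.
- by move=> p q sp sq; rewrite (leq_trans (size_polyD _ _))// geq_max sp sq.
move=> a _; apply: (big_ind (fun q : {poly R} => (size q <= (i + j).+1)%N)) => //.
- by rewrite size_poly0.
- by move=> p q sp sq; rewrite (leq_trans (size_polyD _ _))// geq_max sp sq.
move=> b _; case: ifPn => oab; first by rewrite size_poly0.
rewrite (leq_trans (size_scale_leq _ _))//.
by have [_ ->] := monic_term oab (term_bound a b).
Qed.

(** Each factor multiplying a coefficient is monic of degree [i + j], so the top coefficient is the
    plain sum of the coefficients. By the binomial theorem this sum is the integral of
    [(1 + u)^j (1 - u)^i] against [(1 - u^2)^gam]. *)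
Lemma coef_rmono i j :
  (rmono i j)`_(i + j) = 2 `^ (2 * gam + 1 + (i + j)%:R) * BetaF (gam + 1 + j%:R) (gam + 1 + i%:R).
Proof.
rewrite addnC -jint_beta//.
have -> : ((1 + 'X) ^+ j * (1 - 'X) ^+ i : {poly R}) =
    \sum_(a < i.+1) \sum_(b < j.+1) ('C(i, a)%:R * 'C(j, b)%:R * (-1) ^+ a) *: 'X^(a + b).
  rewrite [(1 - 'X) ^+ i]exprBn [(1 + 'X) ^+ j]exprDn mulrC big_distrlr /=.
  apply: eq_bigr => a _; apply: eq_bigr => b _.
  rewrite !expr1n !mulr1 !mul1r exprD -mul_polyC !rmorphM /= !rmorph_nat rmorphXn /= rmorphN1.
  rewrite -[_ * _ *+ 'C(i, a)]mulr_natl -['X^b *+ _]mulr_natl !mulrA; congr (_ * _).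
  by rewrite -!mulrA; congr (_ * _); rewrite mulrA mulrC.
rewrite jint_sum// /rmono coef_sum; apply: eq_bigr => a _.
rewrite jint_sum// coef_sum; apply: eq_bigr => b _.
rewrite jintZ//; case: ifPn => oab; first by rewrite coef0 jint_odd ?mulr0.
have [mq sq] := monic_term oab (term_bound a b).
rewrite coefZ; set q := (_ * _ : {poly R}) in mq sq *.
have -> : q`_(j + i) = 1 by move/monicP: mq; rewrite /lead_coef sq addnC.
by rewrite mulr1.
Qed.

End moments.

Section chordT_monomials.
Variable R : realType.
Local Notation C := R[i].
Local Notation mu := (@lebesgue_measure R).
Variable gam : R.
Hypothesis gam1 : -1 < gam.
Local Notation a0 := (gam + 2^-1).

Let cconst (x y : R) : (x * y)%:C = x%:C * y%:C :> C. Proof. by rewrite rmorphM. Qed.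

Lemma chordT_mono i j (phi y : R) : -1 < y < 1 ->
  chordT gam (mono i j) (phi, y) =
  expi ((i%:R - j%:R) * phi) * (jw a0 y * (rmono gam i j).[y])%:C.
Proof.
move=> y1; have p1 : 0 < 1 - y ^+ 2 by move: y1 => /andP[? ?]; nra.
set c := Num.sqrt (1 - y ^+ 2); have c0 : 0 < c by rewrite sqrtr_gt0.
have c2 : c ^+ 2 = 1 - y ^+ 2 by rewrite sqr_sqrtr// ltW.
have LF := L2mem_mono gam1 i j.
pose f (s : R) : C := cK gam (mono i j) (chord phi (y, s)).
have mf : cmeas setT f.
  have [m1 m2] := cmeas_cK LF.
  have mc : measurable_fun setT (fun s : R => chord phi (y, s)).
    by apply: (measurableT_comp (measurable_chord1 phi)); exact: measurable_pair1.
  by split; [exact: (measurableT_comp m1 mc)|exact: (measurableT_comp m2 mc)].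
have fout s : ~ (- c < s < c) -> f s = 0.
  by move=> hs; rewrite /f /cK wD_chord wD0// mulr0.
have H : cpulls mu mu `]-1, 1[ setT (fun u => c * u) (fun=> c) f.
  split; apply: pulls_scale => //; [exact: mf.1| |exact: mf.2|];
    by move=> s hs; rewrite /= fout.
have -> : chordT gam (mono i j) (phi, y) = cintegral mu setT f by [].
rewrite (@cpulls_cintegral _ _ _ _ R mu mu _ _ _ _ _ f H); last first.
  by move=> u _; exact: ltW.
set E : C := expi ((i%:R - j%:R) * phi).
(* The coefficient of [u^(a + b)] after [s = c u]; the Jacobian [c] has been absorbed into
   [jw a0 y]. *)
pose K (a b : nat) : C := E * ('C(i, a)%:R * 'C(j, b)%:R * (y%:C ^+ (i - a) * y%:C ^+ (j - b)) *
   (-1) ^+ a * ('i * c%:C) ^+ (a + b)) * (jw a0 y)%:C.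
have fE u : -1 < u < 1 -> f (c * u) * c%:C =
    \sum_(a < i.+1) \sum_(b < j.+1) K a b * (('X^(a + b) : {poly R}).[u] * jw gam u)%:C.
  move=> u1; rewrite /f /cK wD_chord -mulrA -cconst wD_scale//.
  have zE : toC (chord phi (y, c * u)) = expi phi * (y%:C - 'i * c%:C * u%:C).
    by rewrite toC_chord; congr (_ * _); apply: cP; rewrite !cE /=; ring.
  have zE' : conjc (toC (chord phi (y, c * u))) = expi (- phi) * (y%:C + 'i * c%:C * u%:C).
    rewrite zE -expi_conj; apply: cP; rewrite !cE /=; ring.
  rewrite /mono zE' zE !exprMn !expiX.
  have -> : expi (i%:R * phi) * (y%:C - 'i * c%:C * u%:C) ^+ i *
      (expi (j%:R * - phi) * (y%:C + 'i * c%:C * u%:C) ^+ j) =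
      E * ((y%:C - 'i * c%:C * u%:C) ^+ i * (y%:C + 'i * c%:C * u%:C) ^+ j).
    by rewrite mulrACA -expiD; congr (expi _ * _); ring.
  rewrite exprBn exprDn big_distrlr /= mulr_sumr mulr_suml; apply: eq_bigr => a _.
  rewrite mulr_sumr mulr_suml; apply: eq_bigr => b _.
  rewrite hornerXn /K cconst [in RHS]cconst !exprD !exprMn.
  have -> : (u ^+ a * u ^+ b)%:C = u%:C ^+ a * u%:C ^+ b :> C by rewrite cconst !rmorphXn.
  rewrite -[_ *+ 'C(i, a)]mulr_natl -[_ *+ 'C(j, b)]mulr_natl.
  move: ((-1) ^+ a : C) (y%:C ^+ (i - a)) (y%:C ^+ (j - b)) ('i ^+ a : C) ('i ^+ b : C)
    (c%:C ^+ a) (c%:C ^+ b) (u%:C ^+ a) (u%:C ^+ b) ('C(i, a)%:R : C) ('C(j, b)%:R : C).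
  by move=> *; ring.
have sumE : cintegral mu `]-1, 1[ (fun u => f (c * u) * c%:C) =
    \sum_(a < i.+1) \sum_(b < j.+1) K a b * (jint gam 'X^(a + b))%:C.
  have mI : measurable (`]-1, 1[%classic : set (measurableTypeR R)) := measurable_itv _.
  have iX k : cintegrable mu `]-1, 1[ (fun u => (('X^k : {poly R}).[u] * jw gam u)%:C).
    split; first exact: (integrable_poly_jw gam1 'X^k).
    by apply: eq_integrable (integrable0 _ _).
  transitivity (cintegral mu `]-1, 1[ (fun u => \sum_(a < i.+1) \sum_(b < j.+1)
      K a b * (('X^(a + b) : {poly R}).[u] * jw gam u)%:C)).
    by apply: eq_cintegral => u /=; rewrite in_itv/=; exact: fE.
  rewrite cintegral_sum//; last first.
    by move=> a; apply: cintegrable_sum => // b; apply: cintegrableZ.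
  apply: eq_bigr => a _; rewrite cintegral_sum//; last by move=> b; apply: cintegrableZ.
  apply: eq_bigr => b _; rewrite cintegralZ//; congr (_ * _).
  by rewrite cintegralC.
rewrite sumE.
have -> : (rmono gam i j).[y] = \sum_(a < i.+1) \sum_(b < j.+1)
  (if odd (a + b) then 0 else 'C(i, a)%:R * 'C(j, b)%:R * (-1) ^+ a * jint gam 'X^(a + b) *
    (y ^+ (i + j - (a + b)) * (y ^+ 2 - 1) ^+ (a + b)./2)).
  rewrite /rmono horner_sum; apply: eq_bigr => a _; rewrite horner_sum; apply: eq_bigr => b _.
  case: ifP => _; first by rewrite horner0.
  by rewrite hornerZ hornerM hornerXn horner_exp !hornerE.
rewrite !cconst rmorph_sum /= mulr_sumr mulr_sumr; apply: eq_bigr => a _.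
rewrite rmorph_sum /= mulr_sumr mulr_sumr; apply: eq_bigr => b _.
have ai : (a <= i)%N by rewrite -ltnS.
have bj : (b <= j)%N by rewrite -ltnS.
case: ifPn => oab; first by rewrite jint_odd// rmorph0 !mulr0.
rewrite /K.
(* As [(i c)^2 = y^2 - 1], the surviving even powers are free of the square root. *)
have -> : ('i * c%:C) ^+ (a + b) = ((y ^+ 2 - 1) ^+ (a + b)./2)%:C :> C.
  have {1}-> : (a + b)%N = (2 * (a + b)./2)%N by rewrite mul2n even_halfK.
  rewrite exprM rmorphXn /=; congr (_ ^+ _); rewrite exprMn -rmorphXn /= c2.
  by apply: cP; rewrite !cE /=; ring.
have -> : y%:C ^+ (i - a) * y%:C ^+ (j - b) = (y ^+ (i + j - (a + b)))%:C :> C.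
  by rewrite -exprD rmorphXn /=; congr (_ ^+ _); lia.
have nE (k : nat) : (k%:R : C) = (k%:R : R)%:C by rewrite rmorph_nat.
have sE : ((-1) ^+ a : C) = ((-1) ^+ a : R)%:C by rewrite rmorphXn rmorphN1.
rewrite !nE sE -!cconst -!mulrA -!cconst; congr (_ * _%:C).
by move: ((-1) ^+ a : R) ('C(i, a)%:R : R) ('C(j, b)%:R : R) => *; ring.
Qed.

End chordT_monomials.

(** * Backprojection of the basis and its moments *)

Section backprojection.
Variable R : realType.
Local Notation C := R[i].
Local Notation mu := (@lebesgue_measure R).
Local Notation mu2 := (@mu2 R).

Let mI : measurable (`]0, 2 * pi[%classic : set (measurableTypeR R)) := measurable_itv _.

(** The sign [(-1)^m], kept as an exponential so that frequencies add. *)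
Definition sg (m : int) : C := expi (m%:~R * pi).
(** The angle in [psiE] is [beta + alpha + pi/2], which is [phi + pi] for the normal angle
    [phi = beta + alpha - pi/2]. *)
Definition Apsi (m : int) (x : R) : C := expi (m%:~R * (x + pi)).
Definition Zp (q : {poly R}) (m : int) : R * R -> C := back (Apsi m) (fun y => q.[y]).

Lemma ApsiE m x : Apsi m x = sg m * expi (m%:~R * x).
Proof. by rewrite /Apsi mulrDr expiD mulrC. Qed.

Lemma cmeas_Apsi m : cmeas setT (Apsi m).
Proof.
apply: cmeas_expi; apply: (measurableT_comp (measurable_mull _)).
exact: measurable_funD.
Qed.

Lemma sqn_Apsi m x : sqn (Apsi m x) = 1. Proof. exact: sqn_expi. Qed.

(** The coefficient of [z^(l - j) conj(z)^j] in [Zp q m]; the angular integral keeps only the terms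
    with [l - 2 j = m]. *)
Definition Zcoef (q : {poly R}) (m : int) (l j : nat) : C :=
  if m + 2 * j%:Z == l%:Z then sg m * (q`_l * 2^-1 ^+ l * 'C(l, j)%:R * (2 * pi))%:C else 0.

(** The height of the chord through [Z] is [(z e^(-i x) + conj(z) e^(i x)) / 2]; its powers are
    expanded binomially and integrated in [x]. *)
Lemma Zp_expand q m Z :
  Zp q m Z = \sum_(l < size q) \sum_(j < l.+1) Zcoef q m l j * mono (l - j) j Z.
Proof.
pose K (l j : nat) : C := sg m * (q`_l * 2^-1 ^+ l * 'C(l, j)%:R)%:C * mono (l - j) j Z.
have E x : Apsi m x * (q.[Z.1 * cos x + Z.2 * sin x])%:C =
    \sum_(l < size q) \sum_(j < l.+1) K l j * expi ((m + 2 * j%:Z - l%:Z)%:~R * x).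
  have yE : (Z.1 * cos x + Z.2 * sin x)%:C =
      (2^-1)%:C * (toC Z * expi (- x) + conjc (toC Z) * expi x) :> C.
    by apply: cP; rewrite !cE /toC /expi /= ?cosN ?sinN; field.
  rewrite horner_coef rmorph_sum /= mulr_sumr; apply: eq_bigr => l _.
  rewrite rmorphM rmorphXn /= yE exprMn exprDn !mulr_sumr; apply: eq_bigr => j _.
  have jl : (j <= l)%N by rewrite -ltnS.
  rewrite /K /mono -[_ *+ 'C(l, j)]mulr_natl !exprMn !expiX ApsiE.
  have -> : expi ((m + 2 * j%:Z - l%:Z)%:~R * x) =
      expi (m%:~R * x) * (expi ((l - j)%:R * - x) * expi (j%:R * x)) :> C.
    rewrite -!expiD; congr expi; rewrite rmorphB rmorphD rmorphM /= natrB//; ring.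
  rewrite !rmorphM /= rmorphXn rmorph_nat.
  move: (sg m) (expi (m%:~R * x)) (expi ((l - j)%:R * - x)) (expi (j%:R * x))
    (toC Z ^+ (l - j)) (conjc (toC Z) ^+ j) ((2^-1)%:C ^+ l : C) ('C(l, j)%:R : C) => *.
  by ring.
have iE (k : int) (c : C) : cintegrable mu `]0, 2 * pi[ (fun x => c * expi (k%:~R * x)).
  apply: cintegrableZ => //; split; apply: (@integrable_bounded_itv _ _ _ _ 1).
  - exact: (cmeas_expi (measurable_mull k%:~R)).1.
  - by move=> x _; rewrite ler_norml cos_geN1 cos_le1.
  - exact: (cmeas_expi (measurable_mull k%:~R)).2.
  - by move=> x _; rewrite ler_norml sin_geN1 sin_le1.
transitivity (cintegral mu `]0, 2 * pi[ (fun x => \sum_(l < size q) \sum_(j < l.+1)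
    K l j * expi ((m + 2 * j%:Z - l%:Z)%:~R * x))).
  by apply: eq_cintegral => x _; exact: E.
rewrite cintegral_sum//; last first.
  by move=> l; apply: cintegrable_sum => // j; exact: iE.
apply: eq_bigr => l _; rewrite cintegral_sum//; apply: eq_bigr => j _.
rewrite cintegralZ//; last by have := iE (m + 2 * j%:Z - l%:Z) 1; apply: eq_cintegrable => // x _; rewrite mul1r.
rewrite cintegral_expi subr_eq0 /Zcoef /K; case: eqP => _; last by rewrite mulr0 mul0r.
by rewrite rmorphM /=; ring.
Qed.

Variable gam : R.
Hypothesis gam1 : -1 < gam.
Local Notation a0 := (gam + 2^-1).
Let a01 : -1 < a0. Proof. by move: gam1; lra. Qed.
Variable p : nat -> {poly R}.
Hypothesis Hp : is_pgam gam p.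

Lemma size_p n : size (p n) = n.+1. Proof. by have [] := Hp n. Qed.

Lemma lead_p n : (p n)`_n != 0.
Proof.
have s := size_p n; have := lead_coefE (p n); rewrite s /= => <-.
by rewrite lead_coef_eq0 -size_poly_eq0 s.
Qed.

Lemma jint_p_orth n (q : {poly R}) : (size q <= n)%N -> jint a0 (p n * q) = 0.
Proof.
have [_ [c ->] _] := Hp n => sq.
by rewrite -scalerAl jintZ// jacobi_orth// mulr0.
Qed.

Lemma jint_p_sqr n : jint a0 (p n * p n) = (2 * pi)^-1.
Proof.
have [_ _ H] := Hp n; rewrite /jint /Rintegral.
have mf : measurable_fun setT (fun y : R => ((p n).[y] ^+ 2 * jw a0 y)%:E).
  apply/measurable_EFinP; apply: measurable_funM; last exact: measurable_jw.
  by apply: measurable_funX; exact: measurable_poly.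
have -> : (\int[mu]_(y in `](-1)%R, 1%R[) ((p n * p n).[y] * jw a0 y)%:E =
    \int[mu]_(y in `](-1)%R, 1%R[) ((p n).[y] ^+ 2 * jw a0 y)%:E)%E.
  by apply: eq_integral => y _; rewrite hornerM expr2.
rewrite integral_itv_obnd_cbnd ?integral_itv_bndo_bndc; last 2 first.
- exact: measurable_funTS.
- exact: measurable_funTS.
by have -> := H.
Qed.

(** Subtracting the multiple of [p n] with the same top coefficient leaves a polynomial of lower
    degree, orthogonal to [p n]. *)
Lemma jint_p n (q : {poly R}) : (size q <= n.+1)%N -> jint a0 (p n * q) = q`_n / (p n)`_n / (2 * pi).
Proof.
move=> sq; have l0 := lead_p n.
pose r := q - (q`_n / (p n)`_n) *: p n.
have sr : (size r <= n)%N.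
  apply/leq_sizeP => k; rewrite leq_eqVlt => /predU1P[<-|nk].
    by rewrite coefB coefZ divfK// subrr.
  rewrite coefB coefZ [q`_k]nth_default ?(leq_trans sq nk)// [(p n)`_k]nth_default ?size_p//.
  by rewrite mulr0 subr0.
have -> : q = (q`_n / (p n)`_n) *: p n + r by rewrite /r addrC subrK.
rewrite mulrDr jintD// (jint_p_orth sr) addr0 -scalerAr jintZ// jint_p_sqr.
rewrite coefD coefZ divfK// [r`_n]nth_default// addr0.
by [].
Qed.

Lemma poly_bound (q : {poly R}) (y : R) : -1 < y < 1 -> `|q.[y]| <= \sum_(l < size q) `|q`_l|.
Proof.
move=> /andP[y1 y2]; rewrite horner_coef (le_trans (ler_norm_sum _ _ _))// ler_sum// => l _.
rewrite normrM ler_piMr// normrX exprn_ile1// ler_norml.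
by rewrite !ltW.
Qed.

(** Transposition turns this into the chord transform of the monomial against a product function.
    The angular integral forces [i - j = m]; as [rmono] has degree at most [i + j <= n], the
    integral against [p n] sees only its coefficient of degree [n]. The angular [2 pi] cancels the
    normalisation of [p n]. *)
Lemma moment (i j n : nat) (m : int) : (i + j <= n)%N ->
  cintegral mu2 setT (fun Z => cK gam (mono i j) Z * (Zp (p n) m Z)^*) =
  if (i + j == n)%N && (i%:Z - j%:Z == m) then
    conjc (sg m) * ((rmono gam i j)`_(i + j) / (p n)`_n)%:C else 0.
Proof.
move=> ijn; have LF := L2mem_mono gam1 i j.
have A1 x : sqn (Apsi m x) <= 1 by rewrite sqn_Apsi.
have Pn : forall y, -1 < y < 1 -> `|(p n).[y]| <= \sum_(l < size (p n)) `|(p n)`_l|.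
  by move=> y; exact: poly_bound.
rewrite -(@chordT_adjoint R gam gam1 (mono i j) LF (Apsi m) (fun y => (p n).[y]) _ (cmeas_Apsi m)
  A1 (measurable_poly (p n)) Pn).
pose a x : C := conjc (sg m) * expi ((i%:Z - j%:Z - m)%:~R * x).
pose b y : R := (p n * rmono gam i j).[y] * jw a0 y.
transitivity (cintegral mu2 (@Cyl R) (fun z => a z.1 * (b z.2)%:C)).
  apply: eq_cintegral => -[x y] [_ /= y1]; rewrite chordT_mono// /a /b hornerM ApsiE.
  have -> : expi ((i%:Z - j%:Z - m)%:~R * x) =
      expi ((i%:R - j%:R) * x) * conjc (expi (m%:~R * x)) :> C.
    by rewrite expi_conj -expiD; congr expi; rewrite !rmorphB /=; ring.
  apply: cP; rewrite !cE; ring.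
have ma : cmeas setT a by apply: cmeasM; [exact: cmeas_cst|apply: cmeas_expi; exact: measurable_mull].
have a1 x : sqn (a x) <= 1 by rewrite /a sqnM sqn_conj !sqn_expi mulr1.
have mb : measurable_fun setT b.
  by apply: measurable_funM; [exact: measurable_poly|exact: measurable_jw].
have [_ ->] := cintegral_prod ma a1 mb (integrable_poly_jw a01 _).
have -> : Rintegral mu `]-1, 1[ b = jint a0 (p n * rmono gam i j) by [].
rewrite cintegralZ//; last first.
  split; apply: (@integrable_bounded_itv _ _ _ _ 1).
  - exact: (cmeas_expi (measurable_mull _)).1.
  - by move=> x _; rewrite ler_norml cos_geN1 cos_le1.
  - exact: (cmeas_expi (measurable_mull _)).2.
  - by move=> x _; rewrite ler_norml sin_geN1 sin_le1.
rewrite cintegral_expi subr_eq0 andbC; case: eqP => _; last by rewrite andFb mulr0 mul0r.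
rewrite andTb.
rewrite jint_p; last by apply: (@leq_trans (i + j).+1) => //; exact: size_rmono.
move: ijn; rewrite leq_eqVlt => /predU1P[->|ijn]; first rewrite eqxx.
  rewrite -mulrA; congr (_ * _); rewrite -rmorphM /=; congr (_%:C).
  by rewrite mulrC divfK// mulf_neq0 ?pnatr_eq0// gt_eqF// pi_gt0.
rewrite (ltn_eqF ijn) nth_default ?mul0r ?mulr0//.
by apply: leq_trans ijn; exact: size_rmono.
Qed.

End backprojection.

(** * The backprojected basis *)

Section backprojection_basis.
Variable R : realType.
Local Notation C := R[i].
Local Notation mu := (@lebesgue_measure R).
Local Notation mu2 := (@mu2 R).
Variable gam : R.
Hypothesis gam1 : -1 < gam.
Variable p : nat -> {poly R}.
Hypothesis Hp : is_pgam gam p.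
Local Notation wD := (wD gam).
Let mD := @measurable_DH R.
Let mwD : measurable_fun (@DH R) wD.
Proof. by apply: measurable_funTS; exact: measurable_wD. Qed.
Let wD0' z : DH z -> 0 <= wD z. Proof. by move=> _; exact: wD_ge0. Qed.

Lemma L2mem_Zp q m : L2mem (@DH R) wD (Zp q m).
Proof.
apply: (@eq_L2mem R (@DH R) wD mD (fun Z => \sum_(l < size q) \sum_(j < l.+1) Zcoef q m l j * mono (l - j) j Z)).
  by move=> Z _; rewrite Zp_expand.
apply: L2mem_sum => // l; apply: L2mem_sum => // j; apply: L2memZ => //.
exact: L2mem_mono.
Qed.

Lemma l2inner_cK (F G : R * R -> C) :
  l2inner (@DH R) wD F G = cintegral mu2 setT (fun Z => cK gam F Z * (G Z)^*).
Proof.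
rewrite l2innerE cintegral_mkcond; apply: eq_cintegral => z _; case: ifPn => zD.
  by rewrite /cK mulrAC.
rewrite /cK /wD; case: ifPn => [h|_]; last by rewrite mulr0 mul0r.
by move: zD; rewrite notin_setE.
Qed.

Lemma l2inner_mono_Zp (i j n : nat) (m : int) : (i + j <= n)%N ->
  l2inner (@DH R) wD (mono i j) (Zp (p n) m) =
  if (i + j == n)%N && (i%:Z - j%:Z == m) then
    conjc (sg R m) * ((rmono gam i j)`_(i + j) / (p n)`_n)%:C else 0.
Proof. by move=> ijn; rewrite l2inner_cK moment. Qed.

Lemma l2inner_Zp_expand q m (G : R * R -> C) : L2mem (@DH R) wD G ->
  l2inner (@DH R) wD (Zp q m) G =
  \sum_(l < size q) \sum_(j < l.+1) Zcoef q m l j * l2inner (@DH R) wD (mono (l - j) j) G.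
Proof.
move=> LG; have Lm i j := L2mem_mono gam1 i j.
transitivity (l2inner (@DH R) wD
    (fun Z => \sum_(l < size q) \sum_(j < l.+1) Zcoef q m l j * mono (l - j) j Z) G).
  by apply: eq_l2inner => // Z _; rewrite Zp_expand.
rewrite l2inner_suml//; last first.
  by move=> l; apply: L2mem_sum => // j; exact: L2memZ.
apply: eq_bigr => l _; rewrite l2inner_suml//; last by move=> j; exact: L2memZ.
by apply: eq_bigr => j _; rewrite l2innerZl.
Qed.

(** The factor of smaller degree is expanded in monomials; a nonzero moment requires total degree
    exactly [n] and frequency [m], which forces both indices to agree. *)
Lemma l2inner_Zp0 n' m' n m : (n' <= n)%N -> (n', m') != (n, m) ->
  l2inner (@DH R) wD (Zp (p n') m') (Zp (p n) m) = 0.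
Proof.
move=> n'n neq; rewrite l2inner_Zp_expand; last exact: L2mem_Zp.
rewrite (size_p Hp) big1// => l _; rewrite big1// => j _.
have jl : (j <= l)%N by rewrite -ltnS.
have ln : (l <= n)%N by rewrite (leq_trans _ n'n)// -ltnS.
rewrite l2inner_mono_Zp ?subnK// /Zcoef.
case: eqP => [e1|_]; last by rewrite mul0r.
case: eqP => [e2|_]; last by rewrite andFb mulr0.
case: eqP => [e3|_]; last by rewrite andbF mulr0.
exfalso; move: neq; rewrite xpair_eqE.
have -> : (n' == n) by have := ltn_ord l; lia.
by have -> : m' == m by lia.
Qed.

Lemma l2inner_Zp_neq n' m' n m : (n', m') != (n, m) ->
  l2inner (@DH R) wD (Zp (p n') m') (Zp (p n) m) = 0.
Proof.
move=> neq; have [n'n|/ltnW nn'] := leqP n' n; first exact: l2inner_Zp0.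
rewrite (@l2inner_conj _ _ _ mD mwD wD0' (Zp (p n) m)); [|exact: L2mem_Zp..].
by rewrite l2inner_Zp0 ?conjc0// eq_sym.
Qed.

(** A polynomial of degree [n] in the height has angular frequencies between [-n] and [n], while
    [|n - 2 k| > n] for these [k]. *)
Lemma Zp_eq0 n (k : int) Z : (k < 0) || (n%:Z < k) -> Zp (p n) (n%:Z - 2 * k) Z = 0.
Proof.
move=> kn; rewrite Zp_expand big1// => l _; rewrite big1// => j _.
have jl : (j <= l)%N by rewrite -ltnS.
have ln : (l <= n)%N by rewrite -ltnS -(size_p Hp n).
rewrite /Zcoef; case: eqP => [e|_]; last by rewrite mul0r.
by exfalso; lia.
Qed.

Lemma BetaFC (x y : R) : BetaF x y = BetaF y x.
Proof. by rewrite /BetaF [GammaF x * _]mulrC [x + y]addrC. Qed.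

Lemma BetaF_nat (n k : nat) : (k <= n)%N ->
  BetaF (n%:R - k%:R + 1) (k%:R + 1 : R) = ((n - k)`! * k`!)%:R / n.+1`!%:R.
Proof.
move=> kn; rewrite /BetaF -natrB// !GammaF_fact.
have -> : (n - k)%:R + 1 + (k%:R + 1) = n.+1%:R + 1 :> R.
  by rewrite -[n in RHS](subnK kn) -addn1 !natrD; ring.
by rewrite GammaF_fact natrM.
Qed.

(** Only the monomial [z^(n - k) conj(z)^k] has a nonzero moment, and the leading coefficient of
    [p n] cancels. There remains [2 pi 2^(-n) 'C(n, k)] times the top coefficient of [rmono]; the
    power [2^n] disappears, and the binomial is [1 / ((n + 1) B(n - k + 1, k + 1))]. *)
Lemma n2_Zp n k : (k <= n)%N ->
  n2 (@DH R) wD (Zp (p n) (n%:Z - 2 * k%:Z)) = sigma2 gam n k.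
Proof.
move=> kn; set m := n%:Z - 2 * k%:Z.
have := l2inner_n2 wD mD (Zp (p n) m).
rewrite l2inner_Zp_expand; last exact: L2mem_Zp.
rewrite (size_p Hp) big_ord_recr /= big1 ?add0r; last first.
  move=> l _; rewrite big1// => j _.
  have jl : (j <= l)%N by rewrite -ltnS.
  rewrite l2inner_mono_Zp ?subnK//; last by rewrite ltnW.
  by rewrite (ltn_eqF (ltn_ord l)) andFb mulr0.
have kn' : (k < n.+1)%N by [].
rewrite (bigD1 (Ordinal kn'))//= big1 ?addr0; last first.
  move=> j jk; have jl : (j <= n)%N by rewrite -ltnS.
  rewrite /Zcoef; case: eqP => [e|_]; last by rewrite mul0r.
  exfalso; move: jk; rewrite -val_eqE/= => /eqP; apply; move: e; rewrite /m; lia.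
rewrite l2inner_mono_Zp ?subnK// eqxx andTb /Zcoef.
have -> : m + 2 * k%:Z == n%:Z by rewrite /m; lia.
have -> : (n - k)%:Z - k%:Z == m by rewrite /m; lia.
have sgE : sg R m * conjc (sg R m) = 1 by rewrite /sg expi_conj -expiD subrr expi0.
have l0 := lead_p Hp n.
have -> : (rmono gam (n - k) k)`_n =
    2 `^ (2 * gam + 1 + n%:R) * BetaF (gam + 1 + k%:R) (gam + 1 + (n - k)%:R).
  by have := coef_rmono gam1 (n - k) k; rewrite subnK.
set L := 2 `^ _ * _.
have -> : sg R m * ((p n)`_n * 2^-1 ^+ n * 'C(n, k)%:R * (2 * pi))%:C *
    (conjc (sg R m) * (L / (p n)`_n)%:C) =
    ((p n)`_n * 2^-1 ^+ n * 'C(n, k)%:R * (2 * pi) * (L / (p n)`_n))%:C.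
  rewrite [in RHS]rmorphM /= mulrACA sgE mul1r; by [].
move=> /(congr1 (@cRe R)); rewrite !cReC => <-.
rewrite /L /sigma2 BetaF_nat//.
have -> : BetaF (gam + 1 + k%:R) (gam + 1 + (n - k)%:R) =
    BetaF (n%:R - k%:R + 1 + gam) (k%:R + 1 + gam).
  have -> : gam + 1 + k%:R = k%:R + 1 + gam by ring.
  have -> : gam + 1 + (n - k)%:R = n%:R - k%:R + 1 + gam by rewrite natrB//; ring.
  exact: BetaFC.
have p2 : (2 : R) `^ (2 * gam + 1 + n%:R) = 2 `^ (2 * gam + 2) / 2 * 2 ^+ n.
  have -> : 2 * gam + 1 + n%:R = (2 * gam + 2) + (-1) + n%:R :> R by ring.
  by rewrite !powRD ?pnatr_eq0 ?implybT// powR_mulrn// powR_inv1.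
have nf : n.+1`!%:R = (n%:R + 1) * ('C(n, k)%:R * ((n - k)`! * k`!)%:R) :> R.
  by rewrite factS natrM -natr1; congr (_ * _); rewrite -natrM; congr (_%:R); rewrite -(bin_fact kn) [(k`! * _)%N]mulnC.
rewrite p2 nf.
have f0 : ((n - k)`! * k`!)%:R != 0 :> R by rewrite pnatr_eq0 -lt0n muln_gt0 !fact_gt0.
have c0 : 'C(n, k)%:R != 0 :> R by rewrite pnatr_eq0 -lt0n bin_gt0.
have n0 : n%:R + 1 != 0 :> R by rewrite natr1 pnatr_eq0.
have v0 : (2 : R) ^+ n != 0 by rewrite expf_neq0// pnatr_eq0.
rewrite exprVn.
clear p2 nf; move: (n%:R + 1 : R) ((p n)`_n) ('C(n, k)%:R : R) (((n - k)`! * k`!)%:R : R) (2 ^+ n : R) (2 `^ _) (BetaF _ _)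
  n0 l0 c0 f0 v0 => *.
by field; do ?[apply/andP; split].
Qed.

(** A line of direction [theta = beta + pi + alpha] has normal angle [theta + pi/2] modulo [2 pi],
    and [sin alpha] is its height; a shift by [pi/2] over a full period then identifies the two
    integrals. *)
Lemma ZE_Zp n k z : DH z -> ZE gam p n k z = Zp (p n) (n%:Z - 2 * k%:Z) z.
Proof.
rewrite /DH/= => z1; set m := n%:Z - 2 * k%:Z.
pose G (x : R) : C := Apsi m x * ((p n).[z.1 * cos x + z.2 * sin x])%:C.
have E th : ((cos (alE z th)) `^ (- (2 * gam + 1)))%:C * psiE gam p n k (beE z th) (alE z th) =
    G (th + pi / 2).
  have alv : cIm (- expi th * conjc (entryPt z th)) = z.2 * cos th - z.1 * sin th.
    rewrite /entryPt; set s := _ + Num.sqrt _.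
    (* Moving along the line does not change its height, so the distance [s] to the entry point
       drops out. *)
    transitivity (z.2 * cos th - z.1 * sin th + 0 * s); last by rewrite mul0r addr0.
    rewrite /toC /expi !cE /=; ring.
  have v2 : (z.2 * cos th - z.1 * sin th) ^+ 2 < 1.
    have h : nsq z - (z.2 * cos th - z.1 * sin th) ^+ 2 = (z.1 * cos th + z.2 * sin th) ^+ 2.
      have -> : nsq z = nsq z * (cos th ^+ 2 + sin th ^+ 2) by rewrite cos2Dsin2 mulr1.
      by rewrite /nsq; ring.
    by have := sqr_ge0 (z.1 * cos th + z.2 * sin th); rewrite -h; lra.
  have alE' : alE z th = asin (z.2 * cos th - z.1 * sin th) by rewrite -alv.
  set v := z.2 * cos th - z.1 * sin th in alE' v2 *.
  have v1 : -1 <= v <= 1 by apply/andP; split; nra.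
  have cp : 0 < cos (alE z th).
    by rewrite alE' cos_asin// sqrtr_gt0 subr_gt0.
  have sv : sin (alE z th) = v by rewrite alE' asinK.
  rewrite /psiE sv /G !mulrA -rmorphM /= powRN mulVf ?gt_eqF ?powR_gt0// mul1r.
  congr (_ * _%:C); last by rewrite cosDpihalf sinDpihalf /v; congr (_.[_]); ring.
  rewrite /Apsi /beE.
  (* The two phases differ by a multiple of [2 pi]. *)
  have -> : (n%:R - 2 * k%:~R) * (th - pi - alE z th + alE z th + pi / 2) =
    m%:~R * (th + pi / 2 + pi) + (- m)%:~R * (2 * pi).
    by rewrite /m rmorphN rmorphB rmorphM /=; field.
  by rewrite expiD expi_int_2pi mulr1.
have mG : cmeas setT G.
  apply: cmeasM; first exact: cmeas_Apsi.
  apply: cmeasC; apply: (measurableT_comp (measurable_poly (p n))).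
  by apply: measurable_funD; apply: measurable_funM => //;
    apply: continuous_measurable_fun; first [exact: continuous_cos|exact: continuous_sin].
have pG x : G (x + 2 * pi) = G x.
  rewrite /G; congr (_ * _).
    rewrite /Apsi; have -> : m%:~R * (x + 2 * pi + pi) = m%:~R * (x + pi) + m%:~R * (2 * pi) by ring.
    by rewrite expiD expi_int_2pi mulr1.
  by rewrite mulr_natl cosD2pi sinD2pi.
have cc (f : R -> R) : measurable_fun setT f ->
    Rintegral mu `[0, 2 * pi] f = Rintegral mu `]0, 2 * pi[ f.
  move=> mf; rewrite /Rintegral; congr fine.
  by rewrite integral_itv_obnd_cbnd ?integral_itv_bndo_bndc//;
    apply: measurable_funTS; exact/measurable_EFinP.
have mGs : cmeas setT (fun x : R => G (x + pi / 2)).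
  have [a b] := mG; have ms : measurable_fun setT (fun x : R => x + pi / 2) by exact: measurable_funD.
  by split; [exact: (measurableT_comp a ms)|exact: (measurableT_comp b ms)].
rewrite /ZE /backprojE /cint /Zp /back -/G; apply: cP => /=.
  transitivity (Rintegral mu `[0, 2 * pi] (fun x => cRe (G (x + pi / 2)))).
    by apply: eq_Rintegral => x _; exact: (congr1 (@cRe R) (E x)).
  rewrite cc; last exact: mGs.1.
  rewrite -(@Rintegral_periodic R (@cRe R \o G))//; first exact: mG.1.
  by move=> x; exact: (congr1 (@cRe R) (pG x)).
transitivity (Rintegral mu `[0, 2 * pi] (fun x => cIm (G (x + pi / 2)))).
  by apply: eq_Rintegral => x _; exact: (congr1 (@cIm R) (E x)).
rewrite cc; last exact: mGs.2.
rewrite -(@Rintegral_periodic R (@cIm R \o G))//; first exact: mG.2.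
by move=> x; exact: (congr1 (@cIm R) (pG x)).
Qed.

End backprojection_basis.

Section linear_combinations.
Variable R : realType.
Local Notation C := R[i].
Variables (I : eqType) (e : I -> R * R -> C).

Definition lincomb (s : seq (I * C)) (z : R * R) : C := \sum_(x <- s) x.2 * e x.1 z.

(** The list may repeat an index, whereas the orthonormal expansions are over distinct ones;
    coefficients of equal indices are collected. *)
Lemma lincomb_comb (P : pred I) (s : seq (I * C)) : all (fun x => P x.1) s ->
  exists c, lincomb s =1 comb e P (undup (map fst s)) c.
Proof.
move=> /allP sP; exists (fun i => \sum_(x <- s | x.1 == i) x.2) => z.
rewrite /lincomb /comb; under [RHS]eq_bigr do rewrite big_distrl/=.
rewrite (exchange_big_dep xpredT)//= big_seq [RHS]big_seq; apply: eq_bigr => x xs.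
rewrite -big_filter (_ : [seq i <- _ | _] = [:: x.1]) ?big_seq1//.
apply: perm_small_eq => //; apply: uniq_perm => //; first by rewrite filter_uniq// undup_uniq.
move=> i; rewrite mem_filter mem_undup inE [in RHS]eq_sym.
apply/andP/eqP => [[/andP[_ /eqP]]//|<-]; rewrite sP// eqxx; split=> //.
exact: map_f.
Qed.

End linear_combinations.

(** * The orthonormal basis of L2 of the space of geodesics *)

Section cylinder_basis.
Variable R : realType.
Local Notation C := R[i].
Local Notation mu := (@lebesgue_measure R).
Local Notation mu2 := (@mu2 R).
Variable gam : R.
Hypothesis gam1 : -1 < gam.
Local Notation a0 := (gam + 2^-1).
Let a01 : -1 < a0. Proof. by move: gam1; lra. Qed.
Variable p : nat -> {poly R}.
Hypothesis Hp : is_pgam gam p.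

Definition wC (z : R * R) : R := jw a0 z.2.
Definition Chi (i : nat * int) (z : R * R) : C := Apsi i.2 z.1 * ((p i.1).[z.2])%:C.

Lemma wC_ge0 z : 0 <= wC z. Proof. exact: powR_ge0. Qed.

Lemma measurable_wC D : measurable_fun D wC.
Proof. by apply: measurable_funTS; exact: (measurableT_comp (@measurable_jw R a0) measurable_snd). Qed.

Let wC0 (z : R * R) : @Cyl R z -> 0 <= wC z. Proof. by move=> _; exact: wC_ge0. Qed.
Let mC := @measurable_Cyl R.
Let mC2 : measurable (@Cyl R : set (measurableTypeR R * measurableTypeR R)%type) := mC.

Lemma cmeas_trig (m : int) (q : {poly R}) D : cmeas D (fun z : R * R => Apsi m z.1 * (q.[z.2])%:C).
Proof.
apply: cmeasM.
  have [a b] := cmeas_Apsi R m.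
  by split; apply: measurable_funTS; [exact: (measurableT_comp a measurable_fst)|
    exact: (measurableT_comp b measurable_fst)].
by apply: cmeasC; apply: measurable_funTS; exact: (measurableT_comp (measurable_poly q) measurable_snd).
Qed.

Lemma integrable_wC : mu2.-integrable (@Cyl R) (EFin \o wC).
Proof.
have s1 (x : R) : sqn (1 : C) <= 1 by rewrite sqn1.
have [[h _] _] := @cintegral_prod R (fun=> 1) (jw a0) (cmeas_cst _ 1) s1
  (measurable_jw a0) (integrable_jw a01).
by apply: eq_integrable h => // z _; rewrite /= mul1r mul0r subr0.
Qed.

Lemma trig_product (m m' : int) (q q' : {poly R}) :
  l2inner (@Cyl R) wC (fun z => Apsi m z.1 * (q.[z.2])%:C) (fun z => Apsi m' z.1 * (q'.[z.2])%:C) =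
  if m == m' then (2 * pi * jint a0 (q * q'))%:C else 0.
Proof.
rewrite l2innerE.
transitivity (cintegral mu2 (@Cyl R) (fun z => Apsi (m - m') z.1 * ((q * q').[z.2] * jw a0 z.2)%:C)).
  apply: eq_cintegral => // z _.
  have -> : Apsi (m - m') z.1 = Apsi m z.1 * conjc (Apsi m' z.1).
    by rewrite /Apsi expi_conj -expiD; congr expi; rewrite rmorphB/=; ring.
  rewrite hornerM /wC (_ : Num.conj _ = conjc (Apsi m' z.1) * (q'.[z.2])%:C); last first.
    by apply: cP; rewrite !cE /= ?oppr0; ring.
  by apply: cP; rewrite !cE; ring.
have [_ ->] := @cintegral_prod R (Apsi (m - m')) (fun y => (q * q').[y] * jw a0 y) (cmeas_Apsi R _)
   (fun=> ltac:(by rewrite sqn_Apsi)) (measurable_funM (measurable_poly _) (measurable_jw a0))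
   (integrable_poly_jw a01 _).
have -> : cintegral mu `]0, 2 * pi[ (Apsi (m - m')) =
    sg R (m - m') * cintegral mu `]0, 2 * pi[ (fun x => expi ((m - m')%:~R * x)).
  rewrite -cintegralZ//; first by apply: eq_cintegral => // x _; rewrite ApsiE.
  apply: (@eq_cintegrable _ _ _ mu _ (measurable_itv _) (fun x => conjc (sg R (m - m')) * Apsi (m - m') x)).
    move=> x _; rewrite ApsiE mulrA (_ : conjc _ * _ = 1) ?mul1r//.
    by rewrite mulrC mul_conj sqn_expi.
  apply: cintegrableZ => //; have [a b] := cmeas_Apsi R (m - m').
  split; apply: (@integrable_bounded_itv R _ 0 (2 * pi) 1) => // x _ /=.
    by rewrite ler_norml cos_geN1 cos_le1.
  by rewrite ler_norml sin_geN1 sin_le1.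
rewrite cintegral_expi subr_eq0; case: eqP => [->|_]; last by rewrite mulr0 mul0r.
by rewrite subrr /sg mul0r expi0 mul1r -rmorphM.
Qed.

Lemma L2mem_trig (m : int) (q : {poly R}) : L2mem (@Cyl R) wC (fun z => Apsi m z.1 * (q.[z.2])%:C).
Proof.
set M := \sum_(l < size q) `|q`_l|.
apply: (@L2mem_dom R _ _ mC (@measurable_wC _) wC0 _ (fun z => M ^+ 2 * wC z)).
- exact: cmeas_trig.
- have := @integrableZl _ _ _ mu2 _ mC (M ^+ 2) _ integrable_wC.
  by apply: eq_integrable => // z _; rewrite /= EFinM.
- move=> z [_ z2]; rewrite sqnM sqn_Apsi mul1r sqnC ler_wpM2r ?wC_ge0//.
  by rewrite -(real_normK (num_real _)) lerXn2r ?nnegrE ?normr_ge0 ?sumr_ge0// poly_bound.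
Qed.

Lemma L2mem_Chi i : L2mem (@Cyl R) wC (Chi i). Proof. exact: L2mem_trig. Qed.

Lemma Chi_orthonormal i j : l2inner (@Cyl R) wC (Chi i) (Chi j) = (i == j)%:R.
Proof.
case: i => n m; case: j => n' m'; rewrite /Chi trig_product xpair_eqE /= [(n == n') && _]andbC.
case: eqP => //= _; case: (ltngtP n n') => h.
- by rewrite [p n * _]mulrC (jint_p_orth gam1 Hp) ?mulr0// (size_p Hp).
- by rewrite (jint_p_orth gam1 Hp) ?mulr0// (size_p Hp).
- by rewrite h (jint_p_sqr Hp) divff// mulf_neq0 ?pnatr_eq0// gt_eqF// pi_gt0.
Qed.

Definition TP (u : R * R -> C) := exists s, u =1 lincomb Chi s.

Lemma TP_eq u v : u =1 v -> TP u -> TP v.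
Proof. by move=> uv [s us]; exists s => z; rewrite -uv us. Qed.

Lemma TP_Chi i : TP (Chi i).
Proof. by exists [:: (i, 1)] => z; rewrite /lincomb big_seq1 mul1r. Qed.

Lemma TP_D u v : TP u -> TP v -> TP (fun z => u z + v z).
Proof. by move=> [s us] [t vt]; exists (s ++ t) => z; rewrite us vt /lincomb big_cat. Qed.

Lemma TP_Z c u : TP u -> TP (fun z => c * u z).
Proof.
move=> [s us]; exists [seq (x.1, c * x.2) | x <- s] => z.
by rewrite us /lincomb big_map mulr_sumr; apply: eq_bigr => x _; rewrite mulrA.
Qed.

Lemma TP_0 : TP (fun=> 0). Proof. by exists [::] => z; rewrite /lincomb big_nil. Qed.

Lemma TP_sum (I : Type) (r : seq I) (F : I -> R * R -> C) : (forall i, TP (F i)) ->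
  TP (fun z => \sum_(i <- r) F i z).
Proof.
move=> FP; elim: r => [|i r ih].
  by apply: TP_eq TP_0 => z; rewrite big_nil.
by apply: TP_eq (TP_D (FP i) ih) => z; rewrite big_cons.
Qed.

(** As [p l] has degree exactly [l], every polynomial in the height reduces by strong induction to
    the [p l]. This is what makes the span of [Chi] closed under multiplication. *)
Lemma TP_trig (m : int) (q : {poly R}) : TP (fun z => Apsi m z.1 * (q.[z.2])%:C).
Proof.
have [n] := ubnP (size q); elim: n q => // n ih q; rewrite ltnS => qn.
have [q0|q0] := eqVneq q 0.
  by apply: TP_eq TP_0 => z; rewrite q0 horner0 mulr0.
have sq : (0 < size q)%N by rewrite size_poly_gt0.
pose l := (size q).-1; pose c := lead_coef q / (p l)`_l.
have sl : size q = l.+1 by rewrite prednK.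
have lr : (size (q - c *: p l)%R < n)%N.
  apply: leq_trans qn; rewrite ltnNge -ltnNge sl ltnS; apply/leq_sizeP => j lj.
  rewrite coefB coefZ; case: (ltngtP l j) lj => // [lj _|<- _].
    by rewrite !nth_default ?mulr0 ?subrr// ?(size_p Hp) ?sl.
  by rewrite /c divfK ?(lead_p Hp)// lead_coefE -/l subrr.
apply: TP_eq (TP_D (ih _ lr) (TP_Z c%:C (TP_Chi (l, m)))) => z.
rewrite /Chi /= hornerD hornerN hornerZ; apply: cP; rewrite !cE; ring.
Qed.

Lemma TP_M u v : TP u -> TP v -> TP (fun z => u z * v z).
Proof.
move=> [s us] [t vt].
have P (i j : nat * int) : TP (fun z => Chi i z * Chi j z).
  apply: TP_eq (TP_trig (i.2 + j.2) (p i.1 * p j.1)) => z.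
  have -> : Apsi (i.2 + j.2) z.1 = Apsi i.2 z.1 * Apsi j.2 z.1 :> C.
    by rewrite /Apsi -expiD; congr expi; rewrite rmorphD/=; ring.
  by rewrite /Chi hornerM rmorphM /= mulrACA.
have Q : TP (fun z => \sum_(x <- s) \sum_(y <- t) x.2 * y.2 * (Chi x.1 z * Chi y.1 z)).
  by apply: TP_sum => x; apply: TP_sum => y; apply: TP_Z; exact: P.
apply: TP_eq Q => z; rewrite us vt /lincomb mulr_suml; apply: eq_bigr => x _.
by rewrite mulr_sumr; apply: eq_bigr => y _; rewrite mulrACA.
Qed.

Lemma TP_cst c : TP (fun=> c).
Proof.
apply: TP_eq (TP_Z c (TP_trig 0 1)) => z.
by rewrite /Apsi mul0r expi0 hornerC !mulr1.
Qed.

Lemma TP_snd : TP (fun z => z.2%:C).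
Proof. by apply: TP_eq (TP_trig 0 'X) => z; rewrite /Apsi mul0r expi0 hornerX mul1r. Qed.

Lemma TP_cos (d : R) : TP (fun z => (cos (z.1 - d))%:C).
Proof.
have h := TP_Z (2^-1)%:C (TP_D (TP_Z (expi (- (d + pi))) (TP_trig 1 1))
  (TP_Z (expi (d + pi)) (TP_trig (-1) 1))).
apply: TP_eq h => z; rewrite /Apsi hornerC !mulr1 -!expiD.
have -> : - (d + pi) + 1%:~R * (z.1 + pi) = z.1 - d by ring.
have -> : d + pi + (-1)%:~R * (z.1 + pi) = - (z.1 - d) by ring.
by apply: cP; rewrite !cE /= ?cosN ?sinN; field.
Qed.

Lemma TP_cmeas u D : TP u -> cmeas D u.
Proof.
move=> [s us]; rewrite (_ : u = lincomb Chi s); last exact/funext.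
by apply: cmeas_sum => x; apply: cmeasM; [exact: cmeas_cst|exact: cmeas_trig].
Qed.

Let A (u : R * R -> R) := TP (fun z => (u z)%:C).

Let A1 : A (fun=> 1). Proof. exact: TP_cst. Qed.
Let AD u v : A u -> A v -> A (fun x => u x + v x).
Proof. by move=> au av; apply: TP_eq (TP_D au av) => z; rewrite rmorphD. Qed.
Let AZ c u : A u -> A (fun x => c * u x).
Proof. by move=> au; apply: TP_eq (TP_Z c%:C au) => z; rewrite rmorphM. Qed.
Let AM u v : A u -> A v -> A (fun x => u x * v x).
Proof. by move=> au av; apply: TP_eq (TP_M au av) => z; rewrite rmorphM. Qed.
Let Am u : A u -> measurable_fun (@Cyl R) u.
Proof. by move=> /(@TP_cmeas _ (@Cyl R))[]. Qed.

(** The difference of cosines is [2 sin (x / 2) sin ((c - x) / 2)], whose sign on []0, 2 pi[] is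
    that of [c - x]. So a trigonometric polynomial has the interval []0, c[] as a sublevel set; the
    factor [1/4] and the shift [1/2] bring its values into [[0, 1]] with threshold [1/2]. *)
Let cos_sublevel (c x : R) : 0 <= c <= 2 * pi -> 0 < x < 2 * pi ->
  (x < c) = (2^-1 - 4^-1 * (cos (x - c / 2) - cos (c / 2)) < 2^-1).
Proof.
move=> /andP[c0 c2] /andP[x0 x2].
have -> : x - c / 2 = x / 2 - (c / 2 - x / 2) by field.
have -> : cos (c / 2) = cos (x / 2 + (c / 2 - x / 2)) by congr cos; ring.
set h := c / 2 - x / 2; have -> : cos (x / 2 - h) = cos (x / 2) * cos h + sin (x / 2) * sin h by rewrite cosB.
rewrite [cos (x / 2 + h)]cosD.
have s1 : 0 < sin (x / 2) by apply: sin_gt0_pi; apply/andP; split; lra.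
have -> : 2^-1 - 4^-1 * (cos (x / 2) * cos h + sin (x / 2) * sin h -
    (cos (x / 2) * cos h - sin (x / 2) * sin h)) = 2^-1 - 2^-1 * (sin (x / 2) * sin h) by field.
rewrite ltrBlDr ltrDl pmulr_rgt0// pmulr_rgt0//; apply/idP/idP => [xc|].
  by apply: sin_gt0_pi; rewrite /h; apply/andP; split; lra.
apply: contraTT; rewrite -!leNgt => cx; have [->|hn] := eqVneq h 0; first by rewrite sin0.
rewrite -oppr_ge0 -sinN ltW//; apply: sin_gt0_pi; apply/andP; split; last by rewrite /h; lra.
by rewrite oppr_gt0 lt_neqAle hn /h; lra.
Qed.

Let GA E : quadrants E -> L2_limit_of mu2 (@Cyl R) wC A (\1_E : R * R -> R).
Proof.
move=> [c [d ->]].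
(* Clamping the corner to the closure of the cylinder leaves the trace of the quadrant unchanged and
   keeps the test functions between 0 and 1. *)
pose c' := Num.max 0 (Num.min c (2 * pi)); pose d' := Num.max (-1) (Num.min d 1).
have pi0 : 0 <= pi :> R by exact: pi_ge0.
have cc : 0 <= c' <= 2 * pi.
  by rewrite /c' le_max lexx ge_max/= ge_min lexx orbT andbT mulr_ge0.
have dd : -1 <= d' <= 1.
  by rewrite /d' le_max lexx ge_max/= ge_min lexx orbT andbT; lra.
pose u (z : R * R) := 2^-1 - 4^-1 * (cos (z.1 - c' / 2) - cos (c' / 2)).
pose v (z : R * R) := 2^-1 + 4^-1 * (z.2 - d').
have Au : A u.
  have h := TP_D (TP_cst (2^-1 + 4^-1 * cos (c' / 2))%:C) (TP_Z (- 4^-1)%:C (TP_cos (c' / 2))).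
  by apply: TP_eq h => z; rewrite /u; apply: cP; rewrite !cE; ring.
have Av : A v.
  have h := TP_D (TP_cst (2^-1 - 4^-1 * d')%:C) (TP_Z (4^-1)%:C TP_snd).
  by apply: TP_eq h => z; rewrite /v; apply: cP; rewrite !cE; ring.
have := @L2_limit_sublevel2 _ (measurableTypeR R * measurableTypeR R)%type R mu2 (@Cyl R) wC mC2 (@measurable_wC _) wC0 integrable_wC _ Am A1 AD AZ AM _ _ Au Av.
have u01 z : @Cyl R z -> 0 <= u z <= 1.
  move=> _; have := cos_geN1 (z.1 - c' / 2); have := cos_le1 (z.1 - c' / 2).
  have := cos_geN1 (c' / 2); have := cos_le1 (c' / 2).
  by rewrite /u => *; apply/andP; split; lra.
have v01 z : @Cyl R z -> 0 <= v z <= 1.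
  by move=> [_ /andP[]]; case/andP: dd; rewrite /v => *; apply/andP; split; lra.
move=> /(_ u01 v01); apply: eq_L2_limit => // z [z1 z2].
rewrite /u -(cos_sublevel cc z1).
have -> : (v z < 2^-1) = (z.2 < d') by rewrite /v; apply/idP/idP => ?; lra.
have -> : (z.1 < c') = (z.1 < c).
  by rewrite /c' lt_max lt_min; case/andP: z1 => z1 ->; rewrite andbT ltNge (ltW z1).
have -> : (z.2 < d') = (z.2 < d).
  by rewrite /d' lt_max lt_min; case/andP: z2 => z2 ->; rewrite andbT ltNge (ltW z2).
rewrite indicE -natrM mulnb; congr ((nat_of_bool _)%:R).
by apply/idP/idP; rewrite inE /= !in_itv /= => /andP[].
Qed.

Lemma Chi_dense_real (g : R * R -> R) (eps : R) : L2mem (@Cyl R) wC (fun z => (g z)%:C) -> 0 < eps ->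
  exists2 s, n2 (@Cyl R) wC (fun z => (g z)%:C - lincomb Chi s z) < eps & True.
Proof.
move=> [mg _ ig] e0.
have ig' : mu2.-integrable (@Cyl R) (EFin \o (fun z => g z ^+ 2 * wC z)).
  by apply: eq_integrable ig => // z _; rewrite sqnC.
have [_ /(_ _ e0)[u [s us] h]] := @L2_limit_dense _ (measurableTypeR R * measurableTypeR R)%type R mu2 (@Cyl R) wC mC2 (@measurable_wC _) wC0 integrable_wC _ Am A1 AD AZ _
  (measurable_quadrants R) (@setI_closed_quadrants R) GA _ mg ig'.
exists s => //.
have -> : n2 (@Cyl R) wC (fun z => (g z)%:C - lincomb Chi s z) =
    fine (E2 mu2 (@Cyl R) wC (fun x => g x - u x)).
  rewrite /n2 /Rintegral /E2; congr fine; apply: eq_integral => z _.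
  by rewrite -us -rmorphB sqnC.
have E0 := @E2_ge0 _ (measurableTypeR R * measurableTypeR R)%type R mu2 (@Cyl R) wC wC0 (fun x => g x - u x).
by rewrite -lte_fin fineK// ge0_fin_numE// (lt_trans h)// ltry.
Qed.

Lemma Chi_dense (g : R * R -> C) (eps : R) : L2mem (@Cyl R) wC g -> 0 < eps ->
  exists s, n2 (@Cyl R) wC (fun z => g z - lincomb Chi s z) < eps.
Proof.
move=> Lg e0; have e4 : 0 < eps / 4 by rewrite divr_gt0.
have [m1 m2 ig] := Lg.
have dom (h : R * R -> R) : measurable_fun (@Cyl R) h -> (forall z, h z ^+ 2 <= sqn (g z)) ->
    L2mem (@Cyl R) wC (fun z => (h z)%:C).
  move=> mh hg; apply: (@L2mem_dom R _ _ mC (@measurable_wC _) wC0 _ (fun z => sqn (g z) * wC z)) => //.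
    exact: cmeasC.
  by move=> z _; rewrite sqnC ler_wpM2r ?wC_ge0.
have Lr := dom _ m1 (fun z => ltac:(by rewrite lerDl sqr_ge0)).
have Li := dom _ m2 (fun z => ltac:(by rewrite lerDr sqr_ge0)).
have [s hs _] := Chi_dense_real Lr e4; have [t ht _] := Chi_dense_real Li e4.
exists (s ++ [seq (x.1, 'i * x.2) | x <- t]).
have Ll r : L2mem (@Cyl R) wC (lincomb Chi r).
  by apply: L2mem_sum => // [|x]; [exact: @measurable_wC|apply: L2memZ => //;
    [exact: @measurable_wC|exact: L2mem_Chi]].
set f1 := (fun z => _ - lincomb Chi s z) in hs; set f2 := (fun z => _ - lincomb Chi t z) in ht.
have L1 : L2mem (@Cyl R) wC f1 by apply: L2memB => //; exact: @measurable_wC.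
have L2 : L2mem (@Cyl R) wC f2 by apply: L2memB => //; exact: @measurable_wC.
have L2' : L2mem (@Cyl R) wC (fun z => 'i * f2 z) by apply: L2memZ => //; exact: @measurable_wC.
have L2'' : L2mem (@Cyl R) wC (fun z => -1 * ('i * f2 z)) by apply: L2memZ => //; exact: @measurable_wC.
rewrite (@eq_n2 R _ _ _ (fun z => f1 z + 'i * f2 z)); last first.
  move=> z _; rewrite /lincomb big_cat big_map /= -/(lincomb Chi s z).
  have -> : \sum_(j <- t) 'i * j.2 * Chi j.1 z = 'i * lincomb Chi t z.
    by rewrite /lincomb mulr_sumr; apply: eq_bigr => x _; rewrite -mulrA.
  rewrite /f1 /f2; apply: cP; rewrite !cE /=; ring.
(* Parallelogram identity: the squared norms of [f1 + i f2] and [f1 - i f2] add up to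
   [2 n2 f1 + 2 n2 f2], and the second is nonnegative. *)
have P := n2_ge0 (@wC0) (fun z => f1 z + -1 * ('i * f2 z)).
have I1 : sqn ('i : C) = 1 by rewrite /sqn /= expr0n add0r expr1n.
have mw := @measurable_wC (@Cyl R).
move: P; rewrite (n2D mC mw (@wC0) L1 L2') (n2D mC mw (@wC0) L1 L2'').
rewrite (n2Z mC _ L2') (n2Z mC _ L2) I1 sqnN sqn1 !mul1r.
have -> : l2inner (@Cyl R) wC f1 (fun z => -1 * ('i * f2 z)) = - l2inner (@Cyl R) wC f1 (fun z => 'i * f2 z).
  rewrite (l2inner_conj mC mw (@wC0) L2'' L1) (l2innerZl mC mw (@wC0) _ L2' L1).
  by rewrite (l2inner_conj mC mw (@wC0) L1 L2'); apply: cP; rewrite !cE; ring.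
by rewrite cReN; lra.
Qed.

End cylinder_basis.

(** * The hyperbolic transform as a Euclidean chord transform *)

Section positive_scaling.
Context d (T : measurableType d) (R : realType) (m : {measure set T -> \bar R}).

(* No integrability is assumed: both sides are [0] when the integral of [f] is infinite. *)
Lemma Rintegral_pZ (D : set T) (r : R) (f : T -> R) : measurable D -> measurable_fun D f -> 0 < r ->
  Rintegral m D (fun x => r * f x) = r * Rintegral m D f.
Proof.
move=> mD mf r0; have mf' : measurable_fun D (EFin \o f) by exact/measurable_EFinP.
rewrite /Rintegral -[r in RHS]/(fine r%:E); set g := EFin \o f.
have -> : (\int[m]_(x in D) (r * f x)%:E = r%:E * \int[m]_(x in D) g x)%E.
  transitivity (\int[m]_(x in D) (r%:E * g x))%E; first by apply: eq_integral.
  rewrite [in LHS]integralE ge0_funeposM ?ltW// ge0_funenegM ?ltW//.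
  rewrite !ge0_integralZl_EFin ?ltW//; try exact: measurable_funepos; try exact: measurable_funeneg.
  rewrite [in RHS]integralE.
  have r1 : (r%:E * +oo = +oo :> \bar R)%E by rewrite mulry gtr0_sg// mul1e.
  have r2 : (r%:E * -oo = -oo :> \bar R)%E by rewrite mulrNy gtr0_sg// mul1e.
  have := @integral_ge0 _ _ _ m D _ (fun x _ => funepos_ge0 g x).
  have := @integral_ge0 _ _ _ m D _ (fun x _ => funeneg_ge0 g x).
  case: (integral _ _ g^\+%E) => [u||]//; case: (integral _ _ g^\-%E) => [v||]// _ _;
    rewrite ?r1 /= ?r1 ?r2//.
  by congr (_%:E); rewrite mulrDr mulrN.
case: (\int[m]_(x in D) g x)%E => [x||] //=.
  by rewrite mulry gtr0_sg// mul1e mulr0.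
by rewrite mulrNy gtr0_sg// mul1e mulr0.
Qed.

Lemma cintegral_pZ (D : set T) (r : R) (f : T -> R[i]) : measurable D -> cmeas D f -> 0 < r ->
  cintegral m D (fun x => r%:C * f x) = r%:C * cintegral m D f.
Proof.
move=> mD [mf1 mf2] r0; apply: cP; rewrite !cE /= mul0r ?subr0 ?addr0.
  rewrite -Rintegral_pZ//; apply: eq_Rintegral => x _ /=.
  by rewrite !cE mul0r subr0.
rewrite -Rintegral_pZ//; apply: eq_Rintegral => x _ /=.
by rewrite !cE mul0r addr0.
Qed.

End positive_scaling.

Section disc_transfer.
Variable R : realType.
Local Notation C := R[i].
Local Notation mu2 := (@mu2 R).
Variable gam : R.
Local Notation wD := (wD gam).
Local Notation w1 := (w1 gam).
Let mD := @measurable_DH R.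

Lemma wD_PhiHE (z : R * R) : DH z -> wD (PhiHE z) = xH z `^ (2 * gam).
Proof.
move=> zD; have x0 := xH_gt0 zD; have := DH_PhiHE zD; rewrite /Defs.DH/= => h.
by rewrite wDE// nsq_PhiHE -powR_mulrn ?ltW// -powRrM.
Qed.

(** Since [xH^3 cH^(-2)] is exactly the Jacobian of [PhiHE], composition with [PhiHE] is an isometry
    between the two weighted spaces. *)
Lemma w1E (z : R * R) : DH z -> w1 z = wD (PhiHE z) * jacPhi z.
Proof.
move=> zD; have x0 := xH_gt0 zD; rewrite wD_PhiHE// /Defs.w1.
rewrite powRD; last by rewrite (gt_eqF x0) implybT.
rewrite -mulrA; congr (_ * _); rewrite -[3]/(3%:R) powR_mulrn ?ltW//.
have z0 := nsq_ge0 z; have k0 : 1 + nsq z != 0 by rewrite gt_eqF// ltr_wpDr.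
have l0 : 1 - nsq z != 0 by rewrite gt_eqF// subr_gt0.
by rewrite /xH /volH /cH /jacPhi; field; rewrite k0.
Qed.

Definition pullPhi (f : R * R -> C) (Z : R * R) : C := f (PhiInv Z).

Lemma measurable_PhiInv : measurable_fun setT (@PhiInv R).
Proof.
have m : measurable_fun setT (fun z : R * R => (1 + Num.sqrt (1 - nsq z))^-1).
  apply: measurable_fun_ge0_inv.
    apply: measurable_funD => //; apply: (measurableT_comp (continuous_measurable_fun (@sqrt_continuous R))).
    by apply: measurable_funB => //; exact: measurable_nsq.
  by move=> z; rewrite addr_ge0// sqrtr_ge0.
by apply: measurable_fun_pair; apply: measurable_funM.
Qed.

Lemma DH_PhiInv (Z : R * R) : DH Z -> DH (PhiInv Z).
Proof.
rewrite /DH/= /PhiInv; set k := (_)^-1 => z1.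
have k01 : 0 <= k <= 1.
  have := sqrtr_ge0 (1 - nsq Z) => s0.
  by rewrite /k invr_ge0 addr_ge0//= invf_le1 ?ltr_wpDr// lerDl.
have z0 := nsq_ge0 Z; apply: le_lt_trans z1.
have -> : nsq (k * Z.1, k * Z.2) = k ^+ 2 * nsq Z by rewrite /nsq /=; ring.
by case/andP: k01 => k0 k1; rewrite -[leRHS]mul1r ler_wpM2r// expr_le1.
Qed.

Lemma cmeas_pullPhi (f : R * R -> C) : cmeas (@DH R) f -> cmeas (@DH R) (pullPhi f).
Proof.
move=> [a b]; have s : (@PhiInv R @` @DH R `<=` @DH R)%classic by move=> _ [Z ZD <-]; exact: DH_PhiInv.
have mP := measurable_funTS (D := @DH R) measurable_PhiInv.
by split; [exact: (measurable_comp mD s a mP)|exact: (measurable_comp mD s b mP)].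
Qed.

Lemma cmeas_PhiHE (f : R * R -> C) : cmeas (@DH R) f -> cmeas (@DH R) (f \o @PhiHE R).
Proof.
move=> [a b]; have s : (@PhiHE R @` @DH R `<=` @DH R)%classic by move=> _ [Z ZD <-]; exact: DH_PhiHE.
have mP := measurable_funTS (D := @DH R) (@measurable_PhiHE R).
by split; [exact: (measurable_comp mD s a mP)|exact: (measurable_comp mD s b mP)].
Qed.

Lemma pulls_PhiHE (h : R * R -> R) : measurable_fun setT h ->
  pulls mu2 mu2 (@DH R) (@DH R) (@PhiHE R) (@jacPhi R) h.
Proof.
move=> mh k mk k0 _.
rewrite (@ge0_integral_PhiHE R (fun z => (k (h z))%:E)).
- by apply: eq_integral => z _; rewrite EFinM.
- by apply/measurable_EFinP; exact: (measurableT_comp mk mh).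
- by move=> z; rewrite lee_fin.
Qed.

Let jac0 (z : R * R) : DH z -> 0 <= jacPhi z.
Proof.
move=> zD; have := nsq_ge0 z; rewrite /DH/= in zD => z0.
rewrite /jacPhi; apply: divr_ge0; last by rewrite exprn_ge0// addr_ge0.
by rewrite mulr_ge0// subr_ge0 ltW.
Qed.

Let integrable_sqn (G : R * R -> C) : cmeas (@DH R) G ->
  mu2.-integrable (@DH R) (fun Z => (sqn (G Z) * wD Z)%:E) <->
  mu2.-integrable (@DH R) (fun z => (sqn (G (PhiHE z)) * w1 z)%:E).
Proof.
move=> mG; have mh : measurable_fun setT (fun Z => sqn (G Z) * wD Z).
  by apply: measurable_mul_wD; exact: measurable_sqn.
have mj : measurable_fun (@DH R) (fun x => sqn (G (PhiHE x)) * wD (PhiHE x) * jacPhi x).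
  apply: measurable_funM; last by apply: measurable_funTS; exact: measurable_jacPhi.
  by apply: measurable_funTS; exact: (measurableT_comp mh (@measurable_PhiHE R)).
have := @pulls_integrable _ _ _ _ R mu2 mu2 _ _ _ _ jac0 _ (measurable_funTS (D := @DH R) mh) mj
  (pulls_PhiHE mh).
move=> [i1 i2]; split => [/i1|ig].
  by apply: eq_integrable => // z zD; rewrite /= w1E ?mulrA//; exact: set_mem zD.
by apply: i2; apply: eq_integrable ig => // z zD; rewrite /= w1E ?mulrA//; exact: set_mem zD.
Qed.

Lemma L2mem_PhiHE G : L2mem (@DH R) wD G -> L2mem (@DH R) w1 (G \o @PhiHE R).
Proof.
move=> [a b i]; have [a' b'] := cmeas_PhiHE (conj a b).
by split => //; apply/integrable_sqn.
Qed.

Lemma L2mem_pullPhi f : H1 gam f -> L2mem (@DH R) wD (pullPhi f).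
Proof.
move=> [a b i]; have [a' b'] := cmeas_pullPhi (conj a b).
split => //; apply/(integrable_sqn (conj a' b')).
by apply: eq_integrable i => // z zD; rewrite /= /pullPhi PhiHEK//; exact: set_mem zD.
Qed.

Lemma l2inner_PhiHE f G : cmeas (@DH R) f -> cmeas (@DH R) G ->
  l2inner (@DH R) w1 f (G \o @PhiHE R) = l2inner (@DH R) wD (pullPhi f) G.
Proof.
move=> mf mG; rewrite !l2innerE.
pose h Z := pullPhi f Z * (G Z)^* .
have mh : cmeas (@DH R) h by apply: cmeasM; [exact: cmeas_pullPhi|exact: cmeas_conj].
have ph : cpulls mu2 mu2 (@DH R) (@DH R) (@PhiHE R) (@jacPhi R) (fun Z => h Z * (wD Z)%:C).
  split; apply: pulls_PhiHE.
    rewrite (_ : _ \o _ = fun Z => cRe (h Z) * wD Z); first by apply: measurable_mul_wD; exact: mh.1.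
    by apply/funext => Z /=; rewrite !cE mulr0 subr0.
  rewrite (_ : _ \o _ = fun Z => cIm (h Z) * wD Z); first by apply: measurable_mul_wD; exact: mh.2.
  by apply/funext => Z /=; rewrite !cE mulr0 add0r.
rewrite (@cpulls_cintegral _ _ _ _ R mu2 mu2 _ _ _ _ jac0 _ ph); apply: eq_cintegral => // z zD.
by rewrite w1E// /h /pullPhi PhiHEK// rmorphM /= !mulrA.
Qed.

End disc_transfer.

Section geodesic_transform.
Variable R : realType.
Local Notation C := R[i].
Local Notation mu := (@lebesgue_measure R).
Variable gam : R.

Lemma measurable_geodS (a : R) : measurable_fun setT (geodS a).
Proof.
apply: continuous_measurable_fun => t; apply: differentiable_continuous.
by apply/derivable1_diffP; have [] := is_derive_geodS a t.
Qed.

(** Time is replaced by arc length through [xH^2 dt = cA ds]. The equality is pointwise in [q],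
    including chords along which the integrand fails to be integrable. *)
Lemma IHE (f : R * R -> C) q : H1 gam f ->
  IH gam f q = (cA q.2)%:C * chordT gam (pullPhi f) (tau q).
Proof.
move=> Hf; have LF := L2mem_pullPhi Hf; set F := pullPhi f in LF *.
pose a := q.2; pose ph := (tau q).1; pose y := sA a; have c0 := cA_gt0 a.
pose K (s : R) : C := cK gam F (chord ph (y, s)).
have mK : cmeas setT K.
  have [h1 h2] := cmeas_cK LF.
  have mc : measurable_fun setT (fun s : R => chord ph (y, s)).
    by apply: (measurableT_comp (measurable_chord1 ph)); exact: measurable_pair1.
  by split; [exact: (measurableT_comp h1 mc)|exact: (measurableT_comp h2 mc)].
have ms := measurable_geodS a.
have ms' : measurable_fun setT (geodS' a).
  by apply: continuous_measurable_fun; exact: continuous_geodS'.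
have mKs : cmeas setT (fun t => K (geodS a t) * (geodS' a t)%:C).
  apply: cmeasM; last exact: cmeasC.
  by split; [exact: (measurableT_comp mK.1 ms)|exact: (measurableT_comp mK.2 ms)].
transitivity (cintegral mu setT (fun t => (cA a)%:C * (K (geodS a t) * (geodS' a t)%:C))).
  rewrite /IH -/(cintegral mu setT _); apply: eq_cintegral => // t _.
  have gD := DH_geodH q.1 a t; set z := ofC (geodH q.1 a t) in gD *.
  have zE : PhiHE z = chord ph (y, geodS a t) by exact: PhiHE_geodH.
  rewrite /K /cK -zE wD_PhiHE// /F /pullPhi PhiHEK//.
  have -> : xH z `^ (2 + 2 * gam) = cA a * geodS' a t * xH z `^ (2 * gam).
    rewrite powRD; last by rewrite (gt_eqF (xH_gt0 gD)) implybT.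
    by rewrite powR_mulrn ?xH_geodH// ltW// xH_gt0.
  by apply: cP; rewrite !cE /=; ring.
rewrite cintegral_pZ//; congr (_ * _).
have g0 t : 0 <= geodS' a t.
  have e0 := expR_gt0 t; rewrite /geodS' divr_ge0 ?sqr_ge0// mulr_ge0 ?ltW//.
  by rewrite mulr_gt0// mulr_gt0 ?exprn_gt0// ltr_wpDr ?sqr_ge0.
have pK : cpulls mu mu setT `](- cA a), (cA a)[ (geodS a) (geodS' a) K.
  have P (h : R -> R) : measurable_fun setT h -> pulls mu mu setT `](- cA a), (cA a)[ (geodS a) (geodS' a) h.
    move=> mh k mk k0 _; rewrite (@ge0_integral_geodS R a (fun s => (k (h s))%:E)).
    - by apply: eq_integral => t _; rewrite EFinM.
    - by apply/measurable_EFinP; exact: (measurableT_comp mk mh).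
    - by move=> s; rewrite lee_fin.
  by split; apply: P; [exact: mK.1|exact: mK.2].
rewrite -(@cpulls_cintegral _ _ _ _ R mu mu _ _ _ _ (fun t _ => g0 t) _ pK).
rewrite cintegral_mkcond /chordT; apply: eq_cintegral => // s _.
case: ifPn => // sI; rewrite -/y -/ph /cK wD_chord.
rewrite wD0 ?mulr0//.
have -> : Num.sqrt (1 - y ^+ 2) = cA a.
  by rewrite -(cA2DsA2 a) addrK sqrtr_sqr gtr0_norm.
by move=> h; move/negP: sI; apply; rewrite inE/= in_itv.
Qed.

End geodesic_transform.

(** * The space of geodesics in chord coordinates and its invariant functions *)

Section geodesic_space.
Variable R : realType.
Local Notation C := R[i].
Local Notation mu2 := (@mu2 R).
Variable gam : R.
Hypothesis gam1 : -1 < gam.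
Local Notation a0 := (gam + 2^-1).
Local Notation w2 := (w2 gam).
Local Notation wC := (wC gam).
Let mG := @measurable_GH R.
Let mC := @measurable_Cyl R.
Let twopi : 0 < 2 * pi :> R. Proof. by rewrite mulr_gt0// pi_gt0. Qed.

Lemma w2_ge0 (q : R * R) : GH q -> 0 <= w2 q.
Proof. by move=> _; exact: powR_ge0. Qed.

Lemma measurable_w2 : measurable_fun (@GH R) w2.
Proof.
apply: measurable_funTS; rewrite (_ : w2 = (@powR R ^~ (- (2 * gam))) \o (@cA R \o snd)); last first.
  by apply/funext => q; rewrite /Defs.w2 muHE.
apply: measurableT_comp; first exact: measurable_powR.
exact: (measurableT_comp (@measurable_cA R) measurable_snd).
Qed.

(** The factor [mu_H(a) (cos alpha)^(2 gam + 1)] by which [psiH] differs from [Chi] in chord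
    coordinates. *)
Definition lam (a : R) : R := cA a * cA a `^ (2 * gam + 1).

Lemma lam_gt0 a : 0 < lam a.
Proof. by rewrite mulr_gt0 ?powR_gt0 ?cA_gt0. Qed.

Lemma measurable_lam : measurable_fun setT lam.
Proof.
apply: measurable_funM; first exact: measurable_cA.
exact: (measurableT_comp (measurable_powR _) (@measurable_cA R)).
Qed.

Lemma wC_tau q : wC (tau q) = cA q.2 `^ (2 * gam + 1).
Proof.
rewrite -[LHS]/(jw a0 _) /jw /tau /=.
have -> : 1 - sA q.2 ^+ 2 = cA q.2 ^+ 2 by rewrite -(cA2DsA2 q.2) addrK.
by rewrite -powR_mulrn ?(ltW (cA_gt0 _))// -powRrM; congr (_ `^ _); field.
Qed.

Lemma lam_w2 q : lam q.2 ^+ 2 * w2 q = cA q.2 ^+ 3 * wC (tau q).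
Proof.
rewrite wC_tau /Defs.w2 muHE /lam; set x := cA q.2.
have x0 : 0 < x by exact: cA_gt0.
have -> : x `^ (- (2 * gam)) = x * (x `^ (2 * gam + 1))^-1.
  transitivity (x `^ 1 * x `^ (- (2 * gam + 1))); last by rewrite powRN powRr1// ltW.
  by rewrite -powRD ?(gt_eqF x0) ?implybT//; congr (_ `^ _); ring.
have : x `^ (2 * gam + 1) != 0 by rewrite gt_eqF ?powR_gt0.
by move: (x `^ _) => y y0; field.
Qed.

Lemma pulls_tau (h : R * R -> R) : measurable_fun setT h -> periodic2 h ->
  pulls mu2 mu2 (@GH R) (@Cyl R) (@tau R) (fun q => cA q.2 ^+ 3) h.
Proof.
move=> mh ph k mk k0 _.
rewrite (@ge0_integral_tau R (fun z => (k (h z))%:E)).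
- by apply: eq_integral => z _; rewrite EFinM.
- by apply/measurable_EFinP; exact: (measurableT_comp mk mh).
- by move=> z; rewrite lee_fin.
- by move=> x y; rewrite ph.
Qed.

(* An isometry from [L2mem Cyl wC] onto the periodic part of [L2mem GH w2]. *)
Definition lift (T : R * R -> C) (q : R * R) : C := (lam q.2)%:C * T (tau q).

Lemma cmeas_lift (T : R * R -> C) D : cmeas setT T -> cmeas D (lift T).
Proof.
move=> [a b]; have mt := @measurable_tau R.
apply: cmeasM.
  by apply: cmeasC; apply: measurable_funTS; exact: (measurableT_comp measurable_lam measurable_snd).
by split; apply: measurable_funTS; [exact: (measurableT_comp a mt)|exact: (measurableT_comp b mt)].
Qed.

Let cA30 (q : R * R) : GH q -> 0 <= cA q.2 ^+ 3.
Proof. by move=> _; rewrite exprn_ge0// ltW// cA_gt0. Qed.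

Lemma l2inner_lift T1 T2 : cmeas setT T1 -> cmeas setT T2 -> periodic2 T1 -> periodic2 T2 ->
  l2inner (@GH R) w2 (lift T1) (lift T2) = l2inner (@Cyl R) wC T1 T2.
Proof.
move=> m1 m2 p1 p2; rewrite !l2innerE.
pose h z := T1 z * (T2 z)^* * (wC z)%:C.
have mh : cmeas setT h.
  apply: cmeasM; last by apply: cmeasC; exact: measurable_wC.
  by apply: cmeasM => //; exact: cmeas_conj.
have ph : periodic2 h by move=> x y; rewrite /h p1 p2.
have P : cpulls mu2 mu2 (@GH R) (@Cyl R) (@tau R) (fun q => cA q.2 ^+ 3) h.
  by split; apply: pulls_tau; [exact: mh.1|move=> x y /=; rewrite ph|exact: mh.2|move=> x y /=; rewrite ph].
rewrite -/h (@cpulls_cintegral _ _ _ _ R mu2 mu2 _ _ _ _ cA30 _ P).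
apply: eq_cintegral => // q _; rewrite /lift /h.
transitivity (T1 (tau q) * conjc (T2 (tau q)) * (lam q.2 ^+ 2 * w2 q)%:C).
  rewrite (_ : Num.conj _ = (lam q.2)%:C * conjc (T2 (tau q))); last first.
    by apply: cP; rewrite !cE /= ?oppr0; ring.
  by apply: cP; rewrite !cE; ring.
by rewrite lam_w2; apply: cP; rewrite !cE; ring.
Qed.

Lemma n2_lift T : cmeas setT T -> periodic2 T -> n2 (@GH R) w2 (lift T) = n2 (@Cyl R) wC T.
Proof.
move=> mT pT; have := l2inner_lift mT mT pT pT.
by rewrite (l2inner_n2 _ mG) (l2inner_n2 _ mC) => -[].
Qed.

Lemma L2mem_lift T : cmeas setT T -> periodic2 T ->
  L2mem (@GH R) w2 (lift T) <-> L2mem (@Cyl R) wC T.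
Proof.
move=> mT pT; pose h z := sqn (T z) * wC z.
have mh : measurable_fun setT h.
  by apply: measurable_funM; [exact: measurable_sqn|exact: measurable_wC].
have ph : periodic2 h by move=> x y; rewrite /h pT.
have mj : measurable_fun (@GH R) (fun q => h (tau q) * cA q.2 ^+ 3).
  apply: measurable_funTS; apply: measurable_funM.
    exact: (measurableT_comp mh (@measurable_tau R)).
  by apply: measurable_funX; exact: (measurableT_comp (@measurable_cA R) measurable_snd).
have [i1 i2] := @pulls_integrable _ _ _ _ R mu2 mu2 _ _ _ _ cA30 _ (measurable_funTS (D := @Cyl R) mh) mj
  (pulls_tau mh ph).
have E q : sqn (lift T q) * w2 q = h (tau q) * cA q.2 ^+ 3.
  by rewrite /lift sqnM sqnC mulrAC lam_w2 /h; ring.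
split=> [[_ _ ig]|[_ _ ig]].
  split; [exact: measurable_funTS mT.1|exact: measurable_funTS mT.2|].
  by apply: i2; apply: eq_integrable ig => // q _; rewrite /= E.
have [a b] := cmeas_lift (@GH R) mT; split => //.
by apply: eq_integrable (i1 ig) => // q _; rewrite /= E.
Qed.

(** The parameter [a] recovered from the height is [tan (asin y) = y / (1 - y^2)^(1/2)]. *)
Definition unlift (g : R * R -> C) (z : R * R) : C :=
  let a := z.2 / Num.sqrt (1 - z.2 ^+ 2) in
  ((lam a)^-1)%:C * g (z.1 - atan a + pi / 2, a).

Lemma unliftK g : lift (unlift g) = g.
Proof.
apply/funext => -[b a]; rewrite /lift /unlift /=.
have -> : sA a / Num.sqrt (1 - sA a ^+ 2) = a.
  rewrite -(cA2DsA2 a) addrK sqrtr_sqr gtr0_norm ?cA_gt0// sAE mulfK//.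
  by rewrite gt_eqF// cA_gt0.
rewrite mulrA -rmorphM divff ?mul1r; last by rewrite gt_eqF// lam_gt0.
by congr g; congr pair; rewrite -/(atan a); ring.
Qed.

Lemma periodic2_unlift g : periodic2 g -> periodic2 (unlift g).
Proof.
move=> pg x y; rewrite /unlift /=; congr (_ * _); rewrite -[RHS]pg; congr g.
by congr pair; ring.
Qed.

Let wrap (b : R) : R := b - 2 * pi * (Num.floor (b / (2 * pi)))%:~R.

Let measurable_wrap : measurable_fun setT wrap.
Proof.
apply: measurable_funB => //; apply: measurable_funM => //.
apply: nondecreasing_measurable => // x y xy.
by rewrite ler_int; apply: le_floor; rewrite ler_pM2r// invr_gt0.
Qed.

Let wrap_GH b : 0 <= wrap b < 2 * pi.
Proof.
have /andP[h1 h2] := floor_itv (b / (2 * pi)); rewrite /wrap.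
set k := Num.floor _ in h1 h2 *; move: h1 h2; rewrite intrD.
move: twopi => t0; rewrite ler_pdivlMr// ltr_pdivrMr//.
by move: (2 * pi) (k%:~R : R) => t l h1 h2; apply/andP; split; lra.
Qed.

(** A periodic function factors through the reduction of the angle modulo [2 pi], which is
    measurable and lands in [GH]. *)
Lemma cmeas_periodic (g : R * R -> C) : periodic2 g -> cmeas (@GH R) g -> cmeas setT g.
Proof.
move=> pg mg.
have E b a : g (b, a) = g (wrap b, a).
  rewrite /wrap; have nat_per (n : nat) x : g (x + n%:R * (2 * pi), a) = g (x, a).
    elim: n => [|n ih]; first by rewrite mul0r addr0.
    by rewrite -natr1 mulrDl mul1r addrA pg.
  case: (Num.floor _) => n.
    rewrite -[in LHS](subrK (2 * pi * n%:R) b) [2 * pi * _]mulrC nat_per.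
    by congr g; congr pair; rewrite [_ * n%:R]mulrC.
  rewrite NegzE rmorphN mulrN opprK [2 * pi * _]mulrC; by rewrite nat_per.
pose W (q : R * R) := (wrap q.1, q.2).
have mW : measurable_fun setT W.
  by apply: measurable_fun_pair => //; exact: (measurableT_comp measurable_wrap measurable_fst).
have -> : g = (fun x => if x \in @GH R then g x else 0) \o W.
  apply/funext => -[b a] /=; rewrite mem_set; first exact: E.
  exact: wrap_GH.
have [u v] := cmeas_mkcond mG mg.
by split; [exact: (measurableT_comp u mW)|exact: (measurableT_comp v mW)].
Qed.

Lemma cmeas_unlift (g : R * R -> C) : cmeas setT g -> cmeas setT (unlift g).
Proof.
move=> [u v]; pose al (z : R * R) : R := z.2 / Num.sqrt (1 - z.2 ^+ 2).
have ma : measurable_fun setT al.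
  apply: measurable_funM => //; apply: measurable_fun_ge0_inv; last by move=> z; exact: sqrtr_ge0.
  apply: (measurableT_comp (continuous_measurable_fun (@sqrt_continuous R))).
  by apply: measurable_funB => //; exact: measurable_funX.
have mp : measurable_fun setT (fun z : R * R => (z.1 - atan (al z) + pi / 2, al z)).
  apply: measurable_fun_pair => //; apply: measurable_funD => //; apply: measurable_funB => //.
  exact: (measurableT_comp (@measurable_atan R) ma).
apply: cmeasM.
  apply: cmeasC; apply: measurable_fun_ge0_inv; first exact: (measurableT_comp measurable_lam ma).
  by move=> z; rewrite ltW// lam_gt0.
by split; [exact: (measurableT_comp u mp)|exact: (measurableT_comp v mp)].
Qed.

Variable p : nat -> {poly R}.
Hypothesis Hp : is_pgam gam p.

(** Indexed by the angular frequency of either parity, hence a basis of all periodic L2 functions;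
    the [psiH] are those with frequency [n - 2 k]. *)
Definition Psi (i : nat * int) : R * R -> C := lift (Chi p i).

Lemma psiHE n k : psiH gam p n k = Psi (n, n%:Z - 2 * k).
Proof.
apply/funext => q; rewrite /Psi /lift /psiH /psiE /Chi /Apsi muHE /lam -/(cA q.2) -/(sA q.2) /=.
have -> : (n%:Z - 2 * k)%:~R * (q.1 + atan q.2 - pi / 2 + pi) =
    (n%:R - 2 * k%:~R) * (q.1 + atan q.2 + pi / 2) :> R.
  by rewrite rmorphB rmorphM /=; field.
by rewrite rmorphM /= !mulrA.
Qed.

Let periodic2_Chi i : periodic2 (Chi p i).
Proof.
move=> x y; rewrite /Chi /=; congr (_ * _); rewrite /Apsi.
have -> : i.2%:~R * (x + 2 * pi + pi) = i.2%:~R * (x + pi) + i.2%:~R * (2 * pi) by ring.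
by rewrite expiD expi_int_2pi mulr1.
Qed.

Let cmeas_Chi i : cmeas setT (Chi p i).
Proof. exact: cmeas_trig. Qed.

Lemma periodic2_Psi i : periodic2 (Psi i).
Proof.
move=> x y; rewrite /Psi /lift /tau /= (_ : _ - _ = x + atan y - pi / 2 + 2 * pi); last by ring.
by rewrite periodic2_Chi.
Qed.

Lemma L2mem_Psi i : L2mem (@GH R) w2 (Psi i).
Proof. by apply/L2mem_lift => //; exact: L2mem_Chi. Qed.

Lemma Psi_orthonormal i j : l2inner (@GH R) w2 (Psi i) (Psi j) = (i == j)%:R.
Proof. by rewrite l2inner_lift//; exact: Chi_orthonormal. Qed.

Lemma Psi_dense (g : R * R -> C) (eps : R) : periodic2 g -> L2mem (@GH R) w2 g -> 0 < eps ->
  exists s, n2 (@GH R) w2 (fun q => g q - lincomb Psi s q) < eps.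
Proof.
move=> pg Lg e0; have mg := cmeas_periodic pg (L2mem_cmeas Lg).
have mT := cmeas_unlift mg; have pT := periodic2_unlift pg.
have LT : L2mem (@Cyl R) wC (unlift g) by apply/L2mem_lift => //; rewrite unliftK.
have [s h] := Chi_dense gam1 Hp LT e0; exists s.
rewrite (_ : (fun q => _) = lift (fun z => unlift g z - lincomb (Chi p) s z)).
  rewrite n2_lift//.
    apply: cmeasD => //; have -> : (fun x => - lincomb (Chi p) s x) = (fun x => -1 * lincomb (Chi p) s x).
      by apply/funext => x; rewrite mulN1r.
    by apply: cmeasM; [exact: cmeas_cst|apply: cmeas_sum => x; apply: cmeasM => //; exact: cmeas_cst].
  move=> x y; rewrite pT /lincomb; congr (_ - _); apply: eq_bigr => i _.
  by rewrite periodic2_Chi.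
apply/funext => q; rewrite -[g in LHS]unliftK /lift mulrBr; congr (_ - _).
by rewrite /lincomb mulr_sumr; apply: eq_bigr => i _; rewrite /Psi /lift mulrCA.
Qed.

(** In chord coordinates [SAH] acts as [(phi, y) -> (phi + pi, - y)]; the exponential contributes
    [(-1)^m] and the parity of [p n] contributes [(-1)^n]. *)
Lemma Psi_SAH n k q : Psi (n, n%:Z - 2 * k) (SAH q) = Psi (n, n%:Z - 2 * k) q /\
  Psi (n, n%:Z - 2 * k - 1) (SAH q) = - Psi (n, n%:Z - 2 * k - 1) q.
Proof.
have pN (y : R) : (p n).[- y] = (-1) ^+ n * (p n).[y].
  have [_ [c ->] _] := Hp n.
  by rewrite !hornerZ jacobiN; ring.
have E m : Psi (n, m) (SAH q) = expi (m%:~R * pi) * (-1) ^+ n * Psi (n, m) q.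
  rewrite /Psi /lift /lam /SAH /tau /Chi /= cAN sAN atanN pN /Apsi.
  have -> : m%:~R * (q.1 + pi + 2 * atan q.2 + - atan q.2 - pi / 2 + pi) =
     m%:~R * pi + m%:~R * (q.1 + atan q.2 - pi / 2 + pi) :> R by ring.
  have -> : ((-1) ^+ n * (p n).[sA q.2])%:C = (-1) ^+ n * ((p n).[sA q.2])%:C :> C.
    by rewrite rmorphM rmorphXn rmorphN1.
  by rewrite expiD; ring.
have e1 : expi (pi : R) = -1 by apply: cP; rewrite !cE /= ?cospi ?sinpi ?oppr0.
have en : expi ((n%:Z - 2 * k)%:~R * pi : R) * (-1) ^+ n = 1.
  have -> : (n%:Z - 2 * k)%:~R * pi = n%:R * pi + (- k)%:~R * (2 * pi) :> R.
    by rewrite rmorphB rmorphM rmorphN /=; ring.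
  rewrite expiD expi_int_2pi mulr1 -expiX e1 -exprD.
  by rewrite addnn -signr_odd odd_double.
split; rewrite E; first by rewrite en mul1r.
have -> : (n%:Z - 2 * k - 1)%:~R * pi = (n%:Z - 2 * k)%:~R * pi - pi :> R.
  by rewrite rmorphB /=; ring.
have eN : expi (- pi : R) = -1 by apply: cP; rewrite !cE /= ?cosN ?sinN ?cospi ?sinpi ?oppr0.
rewrite expiD eN; set u := Psi _ _; transitivity (- (expi ((n%:Z - 2 * k)%:~R * pi) * (-1) ^+ n) * u).
  by ring.
by rewrite en mulN1r.
Qed.

Lemma H2_psiH n k : H2 gam (psiH gam p n k).
Proof.
rewrite psiHE; split; first by move=> b a; exact: periodic2_Psi.
  exact: L2mem_Psi.
by apply: aeW => q _; rewrite (Psi_SAH n k q).1.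
Qed.

Lemma w2_SAH q : w2 (SAH q) = w2 q.
Proof. by rewrite /Defs.w2 !muHE /SAH /= cAN. Qed.

Lemma pulls_SAH (h : R * R -> R) : measurable_fun setT h -> periodic2 h ->
  pulls mu2 mu2 (@GH R) (@GH R) (@SAH R) (fun=> 1) h.
Proof.
move=> mh ph k mk k0 _.
rewrite (@ge0_integral_SAH R (fun z => (k (h z))%:E)).
- by apply: eq_integral => z _; rewrite mulr1.
- by apply/measurable_EFinP; exact: (measurableT_comp mk mh).
- by move=> z; rewrite lee_fin.
- by move=> x y; rewrite ph.
Qed.

(** [SAH] preserves the measure on [GH] and reverses the sign of the integrand, almost everywhere
    since [g] is invariant only almost everywhere; so the integral equals its opposite. *)
Lemma l2inner_Psi_odd g n k : H2 gam g -> l2inner (@GH R) w2 g (Psi (n, n%:Z - 2 * k - 1)) = 0.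
Proof.
move=> [pg Lg ag]; have mg := cmeas_periodic pg (L2mem_cmeas Lg).
set i := (n, _); have mP : cmeas setT (Psi i) by exact: cmeas_lift.
have pP := periodic2_Psi i.
rewrite l2innerE; pose h q := g q * (Psi i q)^* * (w2 q)%:C; rewrite -/h.
have mw : measurable_fun setT w2.
  rewrite (_ : w2 = (@powR R ^~ (- (2 * gam))) \o (@cA R \o snd)).
    apply: measurableT_comp; first exact: measurable_powR.
    exact: (measurableT_comp (@measurable_cA R) measurable_snd).
  by apply/funext => q; rewrite /Defs.w2 muHE.
have mh : cmeas setT h.
  apply: cmeasM; last exact: cmeasC.
  by apply: cmeasM => //; exact: cmeas_conj.
have ph : periodic2 h by move=> x y; rewrite /h pP [g _]pg /Defs.w2.
have P : cpulls mu2 mu2 (@GH R) (@GH R) (@SAH R) (fun=> 1) h.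
  by split; apply: pulls_SAH; [exact: mh.1|move=> x y /=; rewrite ph|exact: mh.2|move=> x y /=; rewrite ph].
have hS q : g (SAH q) = g q -> h (SAH q) = - h q.
  by move=> gq; rewrite /h gq (Psi_SAH n k q).2 w2_SAH; apply: cP; rewrite !cE /=; ring.
have mw2 := measurable_w2; have w20 := w2_ge0.
have [i1 i2] := L2_cintegrable mG mw2 w20 Lg (L2mem_Psi i).
have ae (k' : R * R -> R) : measurable_fun setT k' ->
    (forall q, g (SAH q) = g q -> k' (SAH q) = - k' q) -> mu2.-integrable (@GH R) (EFin \o k') ->
    pulls mu2 mu2 (@GH R) (@GH R) (@SAH R) (fun=> 1) k' -> Rintegral mu2 (@GH R) k' = 0.
  move=> mk kN ik Pk.
  have A : measurable_fun (@GH R) (EFin \o (fun q : R * R => k' (SAH q) * 1)).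
    apply: measurableT_comp => //; apply: measurable_funTS; apply: measurable_funM => //.
    exact: (measurableT_comp mk (@measurable_SAH R)).
  have B : measurable_fun (@GH R) (EFin \o (fun q : R * R => -1 * k' q)).
    by apply: measurableT_comp => //; apply: measurable_funTS; apply: measurable_funM.
  suff : Rintegral mu2 (@GH R) k' = -1 * Rintegral mu2 (@GH R) k'.
    by rewrite mulN1r => /eqP; rewrite -addr_eq0 -mulr2n mulrn_eq0 => /eqP.
  rewrite [LHS](@pulls_Rintegral _ _ _ _ R mu2 mu2 _ _ _ _ (fun _ _ => ler01) _ Pk).
  rewrite -RintegralZl//; congr fine; apply: ae_eq_integral => //.
  move: ag; apply: (@negligibleS _ _ _ mu2) => q /= nq agq; apply: nq => qG.
  by rewrite kN ?agq// mulr1 mulN1r.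
apply: cP; apply: ae => //.
- exact: mh.1.
- by move=> q /hS /= ->; rewrite cReN.
- exact: P.1.
- exact: mh.2.
- by move=> q /hS /= ->; rewrite cImN.
- exact: P.2.
Qed.


End geodesic_space.

(** * The hyperbolic transform on the two bases *)

Section geodesic_operator.
Variable R : realType.
Local Notation C := R[i].
Local Notation mu := (@lebesgue_measure R).
Local Notation mu2 := (@mu2 R).
Variable gam : R.
Hypothesis gam1 : -1 < gam.
Local Notation wD := (wD gam).
Local Notation wC := (wC gam).
Local Notation w1 := (w1 gam).
Local Notation w2 := (w2 gam).
Let mG := @measurable_GH R.
Let mC := @measurable_Cyl R.
Let mD := @measurable_DH R.
Let mwD : measurable_fun (@DH R) wD.
Proof. by apply: measurable_funTS; exact: measurable_wD. Qed.
Let wD0 z : DH z -> 0 <= wD z. Proof. by move=> _; exact: wD_ge0. Qed.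
Let wC0 (z : R * R) : @Cyl R z -> 0 <= wC z. Proof. by move=> _; exact: wC_ge0. Qed.

Lemma chordT_periodic (F : R * R -> C) : periodic2 (chordT gam F).
Proof.
move=> x y; rewrite /chordT; apply: eq_cintegral => // s _.
by rewrite /chord /= mulr_natl cosD2pi sinD2pi.
Qed.

(** [(x + pi, - y)] describes the same line traversed backwards, so [s -> - s] identifies the
    integrals. This yields the invariance of [IH gam f] under [SAH]. *)
Lemma chordT_antipodal (F : R * R -> C) x y : cmeas setT (cK gam F) ->
  chordT gam F (x + pi, - y) = chordT gam F (x, y).
Proof.
move=> mK; pose h s := cK gam F (chord x (y, s)).
have mh : cmeas setT h.
  have mc : measurable_fun setT (fun s : R => chord x (y, s)).
    by apply: (measurableT_comp (measurable_chord1 x)); exact: measurable_pair1.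
  by split; [exact: (measurableT_comp mK.1 mc)|exact: (measurableT_comp mK.2 mc)].
have P (k : R -> R) : measurable_fun setT k -> pulls mu mu setT setT (-%R : R -> R) (fun=> 1) k.
  move=> mk u mu' u0 _; rewrite (@ge0_integral_opp R (fun s => (u (k s))%:E)).
  - by apply: eq_integral => s _; rewrite mulr1.
  - by apply/measurable_EFinP; exact: (measurableT_comp mu' mk).
  - by move=> s; rewrite lee_fin.
have Ph : cpulls mu mu setT setT (-%R : R -> R) (fun=> 1) h.
  by split; apply: P; [exact: mh.1|exact: mh.2].
rewrite /chordT -/h [RHS](@cpulls_cintegral _ _ _ _ R mu mu _ _ _ _ (fun _ _ => ler01) _ Ph).
apply: eq_cintegral => // s _; rewrite mulr1 /h; congr (cK _ _ _).
by rewrite /chord /= cosDpi sinDpi; congr pair; ring.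
Qed.

Definition IHcyl (f : R * R -> C) (z : R * R) : C := ((wC z)^-1)%:C * chordT gam (pullPhi f) z.

Lemma IH_lift f : H1 gam f -> IH gam f = lift gam (IHcyl f).
Proof.
move=> Hf; apply/funext => q; rewrite IHE// /lift /IHcyl wC_tau mulrA -rmorphM.
by rewrite /lam -mulrA divff ?mulr1// gt_eqF// powR_gt0// cA_gt0.
Qed.

Lemma wC_gt0 z : @Cyl R z -> 0 < wC z.
Proof.
move=> [_ /andP[z1 z2]]; rewrite powR_gt0// subr_gt0.
by nra.
Qed.

Section image_of_function.
Variable f : R * R -> C.
Hypothesis Hf : H1 gam f.
Let LF := L2mem_pullPhi Hf.

Lemma cmeas_IHcyl : cmeas setT (IHcyl f).
Proof.
apply: cmeasM; last exact: cmeas_chordT.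
apply: cmeasC; apply: measurable_fun_ge0_inv; last by move=> z; exact: wC_ge0.
exact: measurable_wC.
Qed.

Lemma periodic2_IHcyl : periodic2 (IHcyl f).
Proof. by move=> x y; rewrite /IHcyl chordT_periodic. Qed.

(** The factor [1 / wC] squared against the weight [wC] leaves the single [1 / wC] of the chord
    transform bound. *)
Lemma L2mem_IHcyl : L2mem (@Cyl R) wC (IHcyl f).
Proof.
have mJ : measurable_fun setT (fun z => (wC z)^-1 * sqn (chordT gam (pullPhi f) z)).
  apply: measurable_funM.
    by apply: measurable_fun_ge0_inv; [exact: measurable_wC|move=> z; exact: wC_ge0].
  by apply: measurable_sqn; exact: cmeas_chordT.
have [a b] := cmeas_IHcyl; split; [exact: measurable_funTS a|exact: measurable_funTS b|].
have pos z : @Cyl R z -> 0 <= (wC z)^-1 * sqn (chordT gam (pullPhi f) z).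
  by move=> _; rewrite mulr_ge0 ?sqn_ge0// invr_ge0 wC_ge0.
have i := @ge0_integrable _ (measurableTypeR R * measurableTypeR R)%type R mu2 (@Cyl R) _ (measurable_funTS (D := @Cyl R) mJ)
  pos (chordT_L2 gam1 LF).
apply: eq_integrable i => // z /set_mem/wC_gt0 z0.
by rewrite /= /IHcyl sqnM sqnC; congr EFin; field; rewrite gt_eqF.
Qed.

Lemma IH_SAH q : IH gam f (SAH q) = IH gam f q.
Proof.
rewrite !(IHE _ Hf).
have -> : tau (SAH q) = ((tau q).1 + pi, - (tau q).2).
  by rewrite /tau /SAH /= sAN atanN; congr pair; ring.
rewrite /SAH /= cAN chordT_antipodal; last exact: cmeas_cK.
reflexivity.
Qed.

Lemma H2_IH : H2 gam (IH gam f).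
Proof.
rewrite (IH_lift Hf); split.
- move=> b a; rewrite /lift /tau /= (_ : b + 2 * pi + _ - _ = b + atan a - pi / 2 + 2 * pi); last by ring.
  by rewrite periodic2_IHcyl.
- by apply/L2mem_lift; [exact: cmeas_IHcyl|exact: periodic2_IHcyl|exact: L2mem_IHcyl].
- by apply: aeW => q _; rewrite -(IH_lift Hf) IH_SAH.
Qed.

Variable p : nat -> {poly R}.
Hypothesis Hp : is_pgam gam p.

(** On the cylinder the weight cancels the factor [1 / wC] of [IHcyl], and transposition moves the
    chord transform to the other side. *)
Lemma l2inner_IH_Psi n m :
  l2inner (@GH R) w2 (IH gam f) (Psi gam p (n, m)) =
  l2inner (@DH R) wD (pullPhi f) (Zp (p n) m).
Proof.
rewrite (IH_lift Hf) l2inner_lift; first last.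
- move=> x y; rewrite /Chi /=; congr (_ * _); rewrite /Apsi.
  have -> : m%:~R * (x + 2 * pi + pi) = m%:~R * (x + pi) + m%:~R * (2 * pi) by ring.
  by rewrite expiD expi_int_2pi mulr1.
- exact: periodic2_IHcyl.
- exact: cmeas_trig.
- exact: cmeas_IHcyl.
rewrite l2innerE l2inner_cK /Zp.
rewrite -(@chordT_adjoint R gam gam1 (pullPhi f) LF (Apsi m) (fun y => (p n).[y])
  (\sum_(l < size (p n)) `|(p n)`_l|) (cmeas_Apsi R m)).
- apply: eq_cintegral => // z /wC_gt0 z0; rewrite /IHcyl /Chi /=.
  have : (wC z)%:C * ((wC z)^-1)%:C = 1 :> C by rewrite -rmorphM divff// gt_eqF.
  move: (wC z)%:C ((wC z)^-1)%:C (chordT _ _ _) (Num.conj _) => x y u v xy.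
  by transitivity ((x * y) * (u * v)); [ring|rewrite xy mul1r].
- by move=> x; rewrite sqn_Apsi.
- exact: measurable_poly.
- by move=> y; exact: poly_bound.
Qed.

End image_of_function.

Lemma PhiInvK (Z : R * R) : DH Z -> PhiHE (PhiInv Z) = Z.
Proof.
case: Z => x y; rewrite /DH/= /PhiHE /PhiInv /=; set r := Num.sqrt _ => z1.
have r0 : 0 <= r by exact: sqrtr_ge0.
have rE : r ^+ 2 = 1 - nsq (x, y) by rewrite sqr_sqrtr// subr_ge0 ltW.
have r1 : 1 + r != 0 by rewrite gt_eqF// ltr_wpDr.
have -> : nsq ((1 + r)^-1 * x, (1 + r)^-1 * y) = (1 + r) ^- 2 * (1 - r ^+ 2).
  by rewrite rE /nsq /=; field.
have -> : 2 / (1 + (1 + r) ^- 2 * (1 - r ^+ 2)) = 1 + r.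
  rewrite (_ : 1 + _ = 2 / (1 + r)); last by field.
  by rewrite invf_div mulrC divfK// pnatr_eq0.
by rewrite !mulrA divff// !mul1r.
Qed.

Variable p : nat -> {poly R}.
Hypothesis Hp : is_pgam gam p.
Local Notation PhiZ := (PhiZ gam p).
Local Notation psi := (psiH gam p).

Lemma PhiZE n k z : DH z -> PhiZ n k z = (Zp (p n) (n%:Z - 2 * k%:Z) \o @PhiHE R) z.
Proof. by move=> zD; rewrite /Defs.PhiZ /= ZE_Zp//; exact: DH_PhiHE. Qed.

Lemma L2mem_PhiZ n k : L2mem (@DH R) w1 (PhiZ n k).
Proof.
apply: (@eq_L2mem R _ _ mD (Zp (p n) (n%:Z - 2 * k%:Z) \o @PhiHE R)).
  by move=> z zD; rewrite PhiZE.
by apply: L2mem_PhiHE; exact: L2mem_Zp.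
Qed.

Lemma l2inner_PhiZ f n k : H1 gam f ->
  l2inner (@DH R) w1 f (PhiZ n k) = l2inner (@DH R) wD (pullPhi f) (Zp (p n) (n%:Z - 2 * k%:Z)).
Proof.
move=> Hf; rewrite -l2inner_PhiHE; first by apply: eq_l2inner => // z zD; exact: PhiZE.
  exact: L2mem_cmeas Hf.
exact: L2mem_cmeas (L2mem_Zp gam1 (p n) _).
Qed.

Lemma l2inner_IH_psi f n (k : nat) : H1 gam f ->
  l2inner (@GH R) w2 (IH gam f) (psi n k) = l2inner (@DH R) w1 f (PhiZ n k).
Proof. by move=> Hf; rewrite psiHE// l2inner_IH_Psi// l2inner_PhiZ. Qed.

Lemma l2inner_IH_psi0 f n (k : int) : H1 gam f -> (k < 0) || (n%:Z < k) ->
  l2inner (@GH R) w2 (IH gam f) (psi n k) = 0.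
Proof.
move=> Hf kn; rewrite psiHE// l2inner_IH_Psi// l2inner_cK.
rewrite -(cintegral0 mu2 (measurableT : measurable (setT : set (measurableTypeR R * measurableTypeR R)%type))).
by apply: eq_cintegral => // z _; rewrite (Zp_eq0 gam1 Hp)// conjC0 mulr0.
Qed.

Lemma PhiZ_orthogonal n k n' k' : (k <= n)%N -> (k' <= n')%N ->
  l2inner (@DH R) w1 (PhiZ n k) (PhiZ n' k') =
  if (n == n') && (k == k') then (sigma2 gam n k)%:C else 0.
Proof.
move=> kn kn'; rewrite l2inner_PhiZ; last exact: L2mem_PhiZ.
rewrite (@eq_l2inner R _ _ _ _ (Zp (p n) (n%:Z - 2 * k%:Z)) (Zp (p n') (n'%:Z - 2 * k'%:Z)))//; last first.
  by move=> z zD; rewrite /pullPhi PhiZE /= ?PhiInvK//; exact: DH_PhiInv.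
case: andP => [[/eqP <- /eqP <-]|h].
  by rewrite (l2inner_n2 _ mD) (n2_Zp gam1 Hp).
apply: (l2inner_Zp_neq gam1 Hp); apply/eqP => -[nn]; rewrite nn => e; apply: h.
by rewrite nn eqxx; split=> //; apply/eqP; lia.
Qed.

Lemma sigma2_gt0 n k : (k <= n)%N -> 0 < sigma2 gam n k.
Proof.
move=> kn; have B (x y : R) : 0 < x -> 0 < y -> 0 < BetaF x y.
  by move=> x0 y0; rewrite /BetaF divr_gt0 ?mulr_gt0 ?GammaF_gt0// addr_gt0.
have nk : 0 <= n%:R - k%:R :> R by rewrite subr_ge0 ler_nat.
have k0 : 0 <= k%:R :> R by [].
have n0 : 0 <= n%:R :> R by [].
rewrite /sigma2; apply: mulr_gt0; last by rewrite divr_gt0// B//; move: gam1 nk k0; lra.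
by rewrite divr_gt0 ?mulr_gt0 ?powR_gt0 ?pi_gt0// ltr_wpDl.
Qed.

Lemma n2_PhiZ n k : (k <= n)%N -> n2 (@DH R) w1 (PhiZ n k) = sigma2 gam n k.
Proof.
move=> kn; have := PhiZ_orthogonal kn kn; rewrite !eqxx (l2inner_n2 _ mD) /= => h.
by apply: (can_inj (@cReC R)) => /=; exact: h.
Qed.

End geodesic_operator.

Section approximation_by_orthogonal.
Variable R : realType.
Local Notation C := R[i].
Variables (D : set (R * R)) (w : R * R -> R).
Hypotheses (mD : measurable D) (mw : measurable_fun D w) (w0 : forall z, D z -> 0 <= w z).

(** Orthogonality to [u] is closed under L2 limits, by Cauchy-Schwarz applied to [g - h]. *)
Lemma l2inner_limit0 (g u : R * R -> C) : L2mem D w g -> L2mem D w u ->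
  (forall eps : R, 0 < eps -> exists h, [/\ L2mem D w h, l2inner D w h u = 0 &
     n2 D w (fun q => g q - h q) < eps]) -> l2inner D w g u = 0.
Proof.
move=> Lg Lu H; apply: sqn_eq0; apply/eqP; rewrite eq_le sqn_ge0 andbT.
apply/ler_addgt0Pl => eps e0; rewrite addr0.
have a0 := n2_ge0 w0 u; set a := n2 D w u in a0.
have a1 : 0 < a + 1 by rewrite ltr_wpDl.
have [h [Lh hu hg]] := H (eps / (a + 1)) (divr_gt0 e0 a1).
have Lgh : L2mem D w (fun q => g q - h q) by exact: L2memB.
have -> : l2inner D w g u = l2inner D w (fun q => g q - h q) u.
  by rewrite (l2innerBl mD mw w0 Lg Lh Lu) hu subr0.
apply: le_trans (l2inner_CS mD mw w0 Lgh Lu) _; rewrite -/a.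
apply: (@le_trans _ _ (eps / (a + 1) * a)); first by rewrite ler_wpM2r// ltW.
rewrite mulrAC ler_pdivrMr//; apply: ler_wpM2l; first exact: ltW.
by rewrite lerDl.
Qed.

Lemma l2inner_sym0 (g h : R * R -> C) : L2mem D w g -> L2mem D w h ->
  l2inner D w g h = 0 -> l2inner D w h g = 0.
Proof. by move=> Lg Lh gh; rewrite (l2inner_conj mD mw w0 Lg Lh) gh; apply: cP; rewrite /= ?oppr0. Qed.

End approximation_by_orthogonal.

(** * Kernel and singular values *)

Section singular_values.
Variable R : realType.
Local Notation C := R[i].
Local Notation mu2 := (@mu2 R).
Variable gam : R.
Hypothesis gam1 : -1 < gam.
Variable p : nat -> {poly R}.
Hypothesis Hp : is_pgam gam p.
Local Notation w2 := (w2 gam).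
Local Notation PhiZ := (PhiZ gam p).
Local Notation psi := (psiH gam p).
Local Notation IH := (IH gam).
Let mG := @measurable_GH R.
Let mD := @measurable_DH R.
Let mw2 : measurable_fun (@GH R) w2 := @measurable_w2 R gam.
Let w20 (q : R * R) : GH q -> 0 <= w2 q := @w2_ge0 R gam q.
Local Notation ip := (l2inner (@GH R) w2).
Local Notation nn := (n2 (@GH R) w2).

Let e (i : nat * int) : R * R -> C := psi i.1 i.2.

Let He i : H2 gam (e i). Proof. exact: H2_psiH. Qed.
Let Le i : L2mem (@GH R) w2 (e i). Proof. by have [] := He i. Qed.

Lemma psi_orthonormal i j : ip (e i) (e j) = (i == j)%:R.
Proof.
rewrite /e !psiHE// (Psi_orthonormal gam1 Hp); congr (_ %:R); congr (nat_of_bool _).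
case: i => n k; case: j => n' k'; rewrite /= !xpair_eqE.
by case: eqP => //= <-; apply/eqP/eqP => [|->//]; lia.
Qed.

Lemma H2D g h : H2 gam g -> H2 gam h -> H2 gam (fun q => g q + h q).
Proof.
move=> [pg Lg ag] [ph Lh ah]; split; first by move=> b a; rewrite pg ph.
  exact: L2memD.
apply: (@negligibleS _ _ _ mu2 _ _ _ (negligibleU ag ah)) => q /= nq.
apply: contrapT => /not_orP[/contrapT gq /contrapT hq]; apply: nq => qG.
by rewrite gq// hq.
Qed.

Lemma H2Z c g : H2 gam g -> H2 gam (fun q => c * g q).
Proof.
move=> [pg Lg ag]; split; first by move=> b a; rewrite pg.
  exact: L2memZ.
by move: ag; apply: (@negligibleS _ _ _ mu2) => q /= nq gq; apply: nq => qG; rewrite gq.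
Qed.

Lemma H2_0 : H2 gam (fun=> 0).
Proof. by split=> //; [exact: L2mem0|exact: aeW]. Qed.

Lemma H2B g h : H2 gam g -> H2 gam h -> H2 gam (fun q => g q - h q).
Proof.
move=> Hg Hh; rewrite (_ : (fun q => _) = (fun q => g q + -1 * h q)); first exact: H2D (H2Z _ Hh).
by apply/funext => q; rewrite mulN1r.
Qed.

Lemma H2_sum (I : Type) (s : seq I) (F : I -> R * R -> C) : (forall i, H2 gam (F i)) ->
  H2 gam (fun q => \sum_(i <- s) F i q).
Proof.
move=> HF; elim: s => [|i s ih].
  by rewrite (_ : (fun q => _) = fun=> 0); [exact: H2_0|apply/funext => q; rewrite big_nil].
rewrite (_ : (fun q => _) = fun q => F i q + \sum_(j <- s) F j q); first exact: H2D.
by apply/funext => q; rewrite big_cons.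
Qed.

Let H2_L2 g : H2 gam g -> L2mem (@GH R) w2 g. Proof. by case. Qed.

Let proj g (P : pred (nat * int)) (s : seq (nat * int)) := comb e P s (fun i => ip g (e i)).

Let H2_proj g P s : H2 gam (proj g P s).
Proof.
rewrite (_ : proj g P s = fun q => \sum_(i <- [seq i <- s | P i]) ip g (e i) * e i q).
  by apply: H2_sum => i; exact: H2Z.
by apply/funext => q; rewrite big_filter.
Qed.

(** Density of the [Psi] gives some approximation, and best approximation replaces its coefficients
    by Fourier ones. For invariant [g] the coefficients of the wrong parity vanish; the others are
    reindexed by [k]. *)
Lemma psi_approx g (eps : R) : H2 gam g -> 0 < eps -> exists s,
  uniq s /\ nn (fun q => g q - proj g predT s q) < eps.
Proof.
move=> Hg e0; have [pg Lg _] := Hg.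
have [s0 h0] := Psi_dense gam1 Hp pg Lg e0.
have [c hc] := @lincomb_comb R _ (Psi gam p) predT s0 (ltac:(by apply/allP)).
set t := undup _ in hc; have ut : uniq t by exact: undup_uniq.
have h1 : nn (fun q => g q - comb (Psi gam p) predT t (fun i => ip g (Psi gam p i)) q) < eps.
  apply: le_lt_trans h0; rewrite (@eq_n2 R _ _ (fun q => g q - lincomb (Psi gam p) s0 q)
    (fun q => g q - comb (Psi gam p) predT t c q)); last by move=> q _; rewrite hc.
  apply: (n2_best mG mw2 w20) => //; first by move=> i _; exact: L2mem_Psi.
  by move=> i j _ _; rewrite (Psi_orthonormal gam1 Hp).
(* The frequencies [m] with [n - m] even correspond to [k = (n - m) / 2]. *)
pose ev (i : nat * int) := (2 %| i.1%:Z - i.2)%Z.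
pose hf (i : nat * int) : nat * int := (i.1, ((i.1%:Z - i.2) %/ 2)%Z).
have hfE i : ev i -> (i.1, i.1%:Z - 2 * (hf i).2) = i.
  by case: i => n m; rewrite /ev /hf /= => d; congr pair; rewrite mulrC divzK//; lia.
exists [seq hf i | i <- t & ev i]; split.
  rewrite map_inj_in_uniq ?filter_uniq// => i j; rewrite !mem_filter => /andP[ei _] /andP[ej _] ij.
  by rewrite -(hfE i ei) -(hfE j ej) (congr1 fst ij : i.1 = j.1) ij.
rewrite (@eq_n2 R _ _ _ (fun q => g q - comb (Psi gam p) predT t (fun i => ip g (Psi gam p i)) q))//.
move=> q _; congr (_ - _); rewrite /proj /comb big_map big_filter [RHS](bigID ev) /=.
rewrite [X in _ = _ + X]big1 ?addr0.
  by apply: eq_bigr => i ei; rewrite /e psiHE// /hf /= -[(i.1, _)]/(i.1, i.1%:Z - 2 * (hf i).2) hfE.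
move=> [n m] /= odd_; have [k ->] : exists k : int, m = n%:Z - 2 * k - 1.
  by exists ((n%:Z - m) %/ 2)%Z; move: odd_; rewrite /ev /=; lia.
by rewrite (l2inner_Psi_odd gam1 Hp)// mul0r.
Qed.

Lemma psi_complete g : H2 gam g -> (forall i, ip g (e i) = 0) -> nn g = 0.
Proof.
move=> Hg g0; apply/eqP; rewrite eq_le n2_ge0// andbT.
apply/ler_addgt0Pl => eps e0; rewrite addr0.
have [s [_ h]] := psi_approx Hg e0; apply: ltW; apply: le_lt_trans h.
rewrite (@eq_n2 R _ _ _ (fun q => g q - proj g predT s q))// => q _.
by rewrite /proj /comb big1 ?subr0// => i _; rewrite g0 mul0r.
Qed.

Let S (i : nat * int) := (0 <= i.2) && (i.2 <= i.1%:Z).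

Let NS i : ~~ S i = (i.2 < 0) || (i.1%:Z < i.2).
Proof. by rewrite /S negb_and -!ltNge. Qed.

Let S_nat i : S i -> exists2 k : nat, i.2 = k%:Z & (k <= i.1)%N.
Proof. by case: i => n [k|k] //= kn; exists k => //; move: kn; rewrite /S /=; lia. Qed.

Let HPhiZ n k : H1 gam (PhiZ n k). Proof. exact: L2mem_PhiZ. Qed.

Let ip_IH f (i : nat * int) : H1 gam f -> ~~ S i -> ip (IH f) (e i) = 0.
Proof. by move=> Hf; rewrite NS; exact: l2inner_IH_psi0. Qed.

(** The identity between [IH (PhiZ n k)] and [sigma2 psi n k] is obtained almost everywhere, hence
    tested against [h]. Their difference has no coefficients: inside [S] by orthogonality of the
    [PhiZ], outside [S] because neither function has any, and completeness applies. *)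
Lemma IH_PhiZ n k h : (k <= n)%N -> H2 gam h ->
  ip (IH (PhiZ n k)) h = (sigma2 gam n k)%:C * ip (psi n k) h.
Proof.
move=> kn Hh; set f := PhiZ n k; have Hf : H1 gam f := HPhiZ n k.
set s := (sigma2 gam n k)%:C; have Hi : H2 gam (IH f) by exact: H2_IH.
pose u q := IH f q - s * psi n k q.
have Hs : H2 gam (fun q => s * psi n k q) by apply: H2Z; exact: (He (n, k%:Z)).
have Hu : H2 gam u by exact: H2B.
have u0 : nn u = 0.
  apply: psi_complete => // i.
  rewrite (l2innerBl mG mw2 w20 (H2_L2 Hi) (H2_L2 Hs) (Le i)).
  rewrite (l2innerZl mG mw2 w20 s (Le (n, k%:Z)) (Le i)) (psi_orthonormal (n, k%:Z)).
  have [Si|nSi] := boolP (S i); last first.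
    rewrite ip_IH// sub0r; case: eqP => [ie|_]; last by rewrite mulr0 oppr0.
    by move: nSi; rewrite -ie /S /=; lia.
  have [k' ik kn'] := S_nat Si; rewrite /e ik (l2inner_IH_psi gam1 p _ _ Hf).
  rewrite (PhiZ_orthogonal gam1 Hp kn kn') -pair_eqE /pair_eq /= ik eqz_nat -/s.
  by case: (_ && _); rewrite ?mulr1 ?mulr0 subrr.
apply/eqP; rewrite -subr_eq0 -(l2innerZl mG mw2 w20 s (Le (n, k%:Z)) (H2_L2 Hh)).
rewrite -(l2innerBl mG mw2 w20 (H2_L2 Hi) (H2_L2 Hs) (H2_L2 Hh)).
apply/eqP/sqn_eq0/eqP; rewrite eq_le sqn_ge0 andbT.
by apply: le_trans (l2inner_CS mG mw2 w20 (H2_L2 Hu) (H2_L2 Hh)) _; rewrite u0 mul0r.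
Qed.

(** Testing with [f = PhiZ n k] isolates one coefficient, multiplied by [sigma2 > 0]. Conversely [g]
    is then a limit of combinations of [e i] with [i] outside [S], to which every [IH f] is
    orthogonal. *)
Lemma kerAdjP g : H2 gam g -> kerAdj gam g <-> (forall i, S i -> ip g (e i) = 0).
Proof.
move=> Hg; have Lg := H2_L2 Hg; split=> [[_ g0] i Si|g0].
  have [k ik kn] := S_nat Si; apply: (l2inner_sym0 mG mw2 w20 (Le i) Lg).
  have := g0 _ (HPhiZ i.1 k); rewrite IH_PhiZ// /e ik => /eqP; rewrite mulf_eq0.
  case/orP => /eqP // /(congr1 (@cRe R)) /= s0.
  by have := sigma2_gt0 gam1 kn; rewrite s0 ltxx.
split=> // f Hf; have Hi := H2_IH gam1 Hf; have Li := H2_L2 Hi.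
apply: (l2inner_sym0 mG mw2 w20 Lg Li).
apply: (l2inner_limit0 mG mw2 w20 Lg Li) => eps e0.
have [s [us h]] := psi_approx Hg e0; exists (proj g predT s); split=> //; first exact: H2_L2.
rewrite /proj (l2inner_comb mG mw2 w20 (fun i _ => Le i))//.
rewrite big1// => i _; have [Si|nSi] := boolP (S i); first by rewrite g0// mul0r.
by rewrite (l2inner_sym0 mG mw2 w20 Li (Le i)) ?mulr0// ip_IH.
Qed.

Lemma kerAdj_span g : H2 gam g ->
  kerAdj gam g <-> inClosedSpanH gam p (fun n k => (k < 0) || (n%:Z < k)) g.
Proof.
move=> Hg; have Lg := H2_L2 Hg; rewrite kerAdjP//; split=> [g0 eps e0|sp i Si].
  (* [n2] is the square of the norm, hence [eps ^+ 2]; indices in [S] carry zero coefficients and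
     may be dropped. *)
  have [s [us h]] := psi_approx Hg (exprn_gt0 2 e0).
  exists [seq (i, ip g (e i)) | i <- s & ~~ S i]; split.
    by rewrite all_map; apply/allP => i; rewrite mem_filter /= NS => /andP[].
  rewrite l2normE -(ger0_norm (ltW e0)) -sqrtr_sqr ltr_sqrt ?exprn_gt0//.
  rewrite (@eq_n2 R _ _ _ (fun q => g q - proj g predT s q))// => q _; congr (_ - _).
  rewrite /proj /comb big_map big_filter [RHS](bigID S) /= [X in _ = X + _]big1 ?add0r// => i Si.
  by rewrite g0// mul0r.
apply: (l2inner_limit0 mG mw2 w20 Lg (Le i)) => eps e0.
have es : 0 < Num.sqrt eps by rewrite sqrtr_gt0.
have [s [sP h]] := sp _ es; exists (lincomb e s).
have Ll : L2mem (@GH R) w2 (lincomb e s).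
  by apply: L2mem_sum => // x; apply: L2memZ => //; exact: Le.
split=> //.
  rewrite /lincomb; under [fun q => _]funext do rewrite big_seq.
  rewrite (_ : (fun q => _) = fun q => \sum_(x <- s) (if x \in s then x.2 else 0) * e x.1 q); last first.
    apply/funext => q; rewrite [RHS]big_seq; apply: eq_bigr => x xs; by rewrite xs.
  rewrite (l2inner_suml mG mw2 w20)//; last by move=> x; apply: L2memZ.
  rewrite big_seq big1// => x xs; rewrite (l2innerZl mG mw2 w20)// psi_orthonormal.
  case: eqP => [xi|_]; last by rewrite mulr0.
  by move/allP: sP => /(_ _ xs); rewrite xi -NS Si.
by move: h; rewrite l2normE ltr_sqrt.
Qed.

Lemma kerAdj0 : kerAdj gam (fun=> 0).
Proof.
apply/kerAdjP; first exact: H2_0.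
by move=> i _; exact: l2inner0l.
Qed.

Let lbound_qnorm h : has_lbound [set l2norm (@GH R) w2 (fun q => h q - k q) | k in kerAdj gam].
Proof. by exists 0 => _ [k _ <-]; exact: sqrtr_ge0. Qed.

Lemma qnorm_bounds h : 0 <= qnorm gam h <= l2norm (@GH R) w2 h.
Proof.
apply/andP; split.
  apply: lb_le_inf; last by move=> _ [k _ <-]; exact: sqrtr_ge0.
  by exists (l2norm (@GH R) w2 (fun q => h q - 0)), (fun=> 0); [exact: kerAdj0|].
apply: ge_inf; first exact: lbound_qnorm.
exists (fun=> 0); first exact: kerAdj0.
by congr l2norm; apply/funext => q; rewrite subr0.
Qed.

(** For [h] orthogonal to the kernel, subtracting a kernel element can only increase the norm, by
    Pythagoras; the infimum is attained at 0. *)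
Lemma qnormE h : H2 gam h -> (forall k, kerAdj gam k -> ip h k = 0) ->
  qnorm gam h ^+ 2 = nn h.
Proof.
move=> Hh h0; suff -> : qnorm gam h = l2norm (@GH R) w2 h by exact: l2norm_sqr.
have /andP[_ ub] := qnorm_bounds h; apply/eqP; rewrite eq_le ub /=.
apply: lb_le_inf; first by exists (l2norm (@GH R) w2 (fun q => h q - 0)), (fun=> 0); [exact: kerAdj0|].
move=> _ [k kk <-]; have [Hk _] := kk; rewrite !l2normE ler_sqrt ?n2_ge0//.
have Lk : L2mem (@GH R) w2 (fun q => -1 * k q) by apply: L2memZ => //; exact: H2_L2.
rewrite [leRHS](@eq_n2 R _ _ _ (fun q => h q + -1 * k q)); last by move=> q _; rewrite mulN1r.
rewrite (n2D mG mw2 w20 (H2_L2 Hh) Lk) (l2inner_sym0 mG mw2 w20 Lk (H2_L2 Hh)).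
  by rewrite mulr0 addr0 lerDl n2_ge0.
rewrite (l2innerZl mG mw2 w20 _ (H2_L2 Hk) (H2_L2 Hh)).
by rewrite (l2inner_sym0 mG mw2 w20 (H2_L2 Hh) (H2_L2 Hk) (h0 _ kk)) mulr0.
Qed.

(** Combinations of [e i] and [e j] are orthogonal to the kernel and keep their norm in the
    quotient. Polarisation then becomes a sum over the fourth roots of unity, where [i^m] sums to 0
    and [i^m Re (i^m)] sums to 2. *)
Lemma qinner_psi i j : S i -> S j -> qinner gam (e i) (e j) = (i == j)%:R.
Proof.
move=> Si Sj; rewrite /qinner.
have ker0 i' k : S i' -> kerAdj gam k -> ip (e i') k = 0.
  move=> Si' kk; have [Hk _] := kk; apply: (l2inner_sym0 mG mw2 w20 (H2_L2 Hk) (Le i')).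
  by move/kerAdjP: kk => /(_ Hk); exact.
have Q (c : C) : qnorm gam (fun q => e i q + c * e j q) ^+ 2 =
    1 + sqn c + 2 * cRe (conjc c * (i == j)%:R).
  have Hc : H2 gam (fun q => c * e j q) by exact: H2Z.
  rewrite qnormE; [|exact: H2D|move=> k kk]; last first.
    have [Hk _] := kk; rewrite (l2innerDl mG mw2 w20 (Le i) (H2_L2 Hc) (H2_L2 Hk)).
    by rewrite (l2innerZl mG mw2 w20 c (Le j) (H2_L2 Hk)) !ker0// mulr0 addr0.
  have ne i' : nn (e i') = 1.
    have := psi_orthonormal i' i'; rewrite eqxx (l2inner_n2 _ mG) => /(congr1 (@cRe R)).
    by rewrite cReC.
  rewrite (n2D mG mw2 w20 (Le i) (H2_L2 Hc)) (n2Z mG c (Le j)) !ne mulr1; congr (_ + 2 * cRe _).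
  rewrite (l2inner_conj mG mw2 w20 (H2_L2 Hc) (Le i)) (l2innerZl mG mw2 w20 c (Le j) (Le i)).
  by rewrite psi_orthonormal eq_sym; case: (i == j); apply: cP; rewrite !cE /=; ring.
have cr (x : C) : cRe (conjc x * ((i == j)%:R : C)) = cRe x * (i == j)%:R.
  by case: (i == j); rewrite ?mulr1 ?mulr0 // cRe_conj.
transitivity ((4^-1)%:C * \sum_(m < 4) 'i ^+ m *
    (1 + sqn ('i ^+ m : C) + 2 * (cRe ('i ^+ m : C) * (i == j)%:R))%:C).
  by congr (_ * _); apply: eq_bigr => m _; rewrite Q cr.
have i2 : 'i ^+ 2 = -1 :> C by apply: cP; rewrite expr2 !cE /=; ring.
have i3 : 'i ^+ 3 = - 'i :> C by rewrite exprS i2 mulrN1.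
have I1 : sqn ('i : C) = 1 by rewrite /sqn /= expr0n add0r expr1n.
rewrite !big_ord_recr big_ord0 /= expr0 expr1 i2 i3 !sqnN sqn1 I1.
have -> : (i == j)%:R = ((i == j)%:R : R)%:C :> C by case: (i == j).
move: ((i == j)%:R : R) => r.
by apply: cP; rewrite !cE /=; field.
Qed.

(** The error is already small in the norm of [L^2_+], which bounds the quotient norm. In a finite
    index set approximating [IH f], the indices outside [S] have zero coefficients and the others
    lie in the triangle [L N] for large [N]; enlarging the index set of a Fourier sum cannot worsen
    it. *)
Lemma qnorm_cvg f : H1 gam f ->
  (fun N : nat => qnorm gam (fun q => IH f q -
     \sum_(n < N) \sum_(k < n.+1) ip (IH f) (psi n k) * psi n k q)) @ \oo --> (0 : R).
Proof.
move=> Hf; set g := IH f; have Hg : H2 gam g by exact: H2_IH.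
pose L N : seq (nat * int) := [seq (n, k%:Z) | n <- iota 0 N, k <- iota 0 n.+1].
have LE N q : \sum_(n < N) \sum_(k < n.+1) ip g (psi n k) * psi n k q = proj g predT (L N) q.
  rewrite /proj /comb /L big_allpairs_dep /= -(big_mkord predT (fun n => \sum_(k < n.+1) ip g (psi n k) * psi n k q)).
  rewrite /index_iota subn0; apply: eq_bigr => n _.
  by rewrite -(big_mkord predT (fun k => ip g (psi n k) * psi n k q)) /index_iota subn0.
have uL N : uniq (L N).
  apply: allpairs_uniq_dep; [exact: iota_uniq|by move=> n _; exact: iota_uniq|].
  by move=> [n k] [n' k'] _ _ /= [-> ->].
have memL N i : (i \in L N) = S i && (i.1 < N)%N.
  apply/idP/andP => [/allpairsPdep[n [k [nN kn ->]]]|[Si iN]].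
    by move: nN kn; rewrite !mem_iota /S /=; lia.
  have [k ik kn] := S_nat Si; apply/allpairsPdep; exists i.1, k.
  by rewrite !mem_iota -ik; split=> //; case: (i).
apply/cvgrPdist_lt => eps e0.
have [s [us h]] := psi_approx Hg (exprn_gt0 2 e0).
pose N0 := \max_(i <- s) i.1.+1.
exists N0 => // N /= NN; rewrite sub0r normrN.
set v := (fun q => _); have /andP[q0 q1] := qnorm_bounds v.
rewrite ger0_norm//; apply: le_lt_trans q1 _.
rewrite l2normE -(ger0_norm (ltW e0)) -sqrtr_sqr ltr_sqrt ?exprn_gt0//.
apply: le_lt_trans h.
have -> : nn v = nn (fun q => g q - proj g predT (L N) q).
  by apply: eq_n2 => q _; rewrite /v LE.
pose c i : C := if i \in s then ip g (e i) else 0.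
apply: le_trans (n2_best mG mw2 w20 (fun i _ => Le i) (fun i j _ _ => psi_orthonormal i j) c (uL N) (H2_L2 Hg)) _.
rewrite le_eqVlt; apply/orP; left; apply/eqP; apply: eq_n2 => q _; congr (_ - _).
rewrite /proj /comb /c.
transitivity (\sum_(i <- L N | i \in s) ip g (e i) * e i q).
  rewrite [RHS]big_mkcond; apply: eq_bigr => i _; by case: ifP; rewrite ?mul0r.
transitivity (\sum_(i <- s | i \in L N) ip g (e i) * e i q).
  rewrite -[LHS]big_filter -[RHS]big_filter; apply: perm_big.
  apply: uniq_perm; [exact/filter_uniq/uL|exact: filter_uniq|].
  by move=> i; rewrite !mem_filter andbC.
rewrite [RHS](bigID (mem (L N))) /= [X in _ = _ + X]big_seq_cond [X in _ = _ + X]big1 ?addr0// => i.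
case/andP => is_; rewrite memL negb_and => /orP[nS|]; first by rewrite ip_IH// mul0r.
have : (i.1.+1 <= N0)%N by exact: (@leq_bigmax_seq _ s predT (fun i : nat * int => i.1.+1)).
by move=> /leq_trans/(_ NN) ->.
Qed.

End singular_values.

(** The decomposition in (b) is expressed by two orthonormal systems together with convergence, for
    every [f], of the singular series of [IH gam f] in the quotient norm. [p] ranges over all
    admissible families, which differ by signs only. *)
Theorem theorem2p7 (R : realType) (gam : R) (p : nat -> {poly R}) :
  -1 < gam -> is_pgam gam p ->
  (* (a) kernel of the adjoint *)
  ((forall (n : nat) (k : int), (k < 0) || (n%:Z < k) -> H2 gam (psiH gam p n k)) /\
   (forall g : R * R -> R[i], H2 gam g ->
      (kerAdj gam g <->
       inClosedSpanH gam p (fun n k => (k < 0) || (n%:Z < k)) g)))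
  /\
  (* (b) singular value decomposition of I_0^H x^{2+2gam} :
         L^2(D_H, x^{2gam+3} dV_H) -> L^2_+ / ker (I_0^H x^{2+2gam})^*  *)
  ([/\ (forall n k : nat, (k <= n)%N -> H1 gam (PhiZhat gam p n k)),
       (forall n k n' k' : nat, (k <= n)%N -> (k' <= n')%N ->
          l2inner (@DH R) (w1 gam) (PhiZhat gam p n k) (PhiZhat gam p n' k') =
          (if (n == n') && (k == k') then 1 else 0)),
       (forall n k : nat, (k <= n)%N -> H2 gam (psiH gam p n k)),
       (forall n k n' k' : nat, (k <= n)%N -> (k' <= n')%N ->
          qinner gam (psiH gam p n k) (psiH gam p n' k') =
          (if (n == n') && (k == k') then 1 else 0)) &
       exists sigma : nat -> nat -> R,
         (forall n k : nat, (k <= n)%N ->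
            0 < sigma n k /\ sigma n k ^+ 2 = sigma2 gam n k) /\
         (forall f : R * R -> R[i], H1 gam f ->
            (fun N : nat => qnorm gam (fun q => IH gam f q -
               \sum_(n < N) \sum_(k < n.+1)
                  (sigma n k)%:C * l2inner (@DH R) (w1 gam) f (PhiZhat gam p n k) *
                  psiH gam p n k q)) @ \oo --> (0 : R))]).
Proof.
move=> gam1 Hp; split; first split.
- by move=> n k _; exact: H2_psiH.
- by move=> g Hg; exact: kerAdj_span.
have mD := @measurable_DH R; have [mw1 w10] : measurable_fun (@DH R) (w1 gam) /\
    (forall z, @DH R z -> 0 <= w1 gam z).
  split.
    apply: (@eq_measurable_fun _ _ _ _ _ (fun z => wD gam (PhiHE z) * jacPhi z)).
      by move=> z /set_mem zD; rewrite w1E.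
    apply: measurable_funTS; apply: measurable_funM; last exact: measurable_jacPhi.
    exact: (measurableT_comp (measurable_wD gam) (@measurable_PhiHE R)).
  by move=> z _; rewrite mulr_ge0 ?powR_ge0// invr_ge0 sqr_ge0.
(* The transform sends [PhiZ] to the multiple by its squared norm of [psiH], so normalising [PhiZ]
   leaves its norm as the singular value. *)
pose sigma n k := l2norm (@DH R) (w1 gam) (PhiZ gam p n k).
have sE n k : (k <= n)%N -> sigma n k = Num.sqrt (sigma2 gam n k).
  by move=> kn; rewrite /sigma l2normE n2_PhiZ.
have s0 n k : (k <= n)%N -> 0 < sigma n k.
  by move=> kn; rewrite sE// sqrtr_gt0 sigma2_gt0.
have s2 n k : (k <= n)%N -> sigma n k ^+ 2 = sigma2 gam n k.
  by move=> kn; rewrite sE// sqr_sqrtr// ltW// sigma2_gt0.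
have LZ n k : H1 gam (PhiZ gam p n k) by exact: L2mem_PhiZ.
have LZh n k : H1 gam (PhiZhat gam p n k) by exact: (L2memZ mD mw1 w10 _ (LZ n k)).
have ipZh f n k : H1 gam f -> l2inner (@DH R) (w1 gam) f (PhiZhat gam p n k) =
    ((sigma n k)^-1)%:C * l2inner (@DH R) (w1 gam) f (PhiZ gam p n k).
  move=> Hf; rewrite (l2inner_conj mD mw1 w10 (LZh n k) Hf) /PhiZhat -/(sigma n k).
  rewrite (l2innerZl mD mw1 w10 _ (LZ n k) Hf) (l2inner_conj mD mw1 w10 Hf (LZ n k)).
  by apply: cP; rewrite !cE; ring.
have normalize (b : bool) (x y s : R) : (b -> x = y) -> 0 < x -> x ^+ 2 = s ->
    (y^-1)%:C * ((x^-1)%:C * (if b then s%:C else 0)) = (if b then 1 else 0) :> R[i].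
  case: b => [/(_ isT) <- x0 <-|_ _ _]; last by rewrite mulr0 mulr0.
  by rewrite -rmorphM -rmorphM (_ : _ * _ = 1)//; field; rewrite gt_eqF.
split.
- by [].
- move=> n k n' k' kn kn'; rewrite ipZh// /PhiZhat -/(sigma n k).
  rewrite (l2innerZl mD mw1 w10 _ (LZ n k) (LZ n' k')) (PhiZ_orthogonal gam1 Hp)//.
  apply: normalize; [by move=> /andP[/eqP <- /eqP <-]|exact: s0|exact: s2].
- by move=> n k _; exact: H2_psiH.
- move=> n k n' k' kn kn'; rewrite (@qinner_psi R gam gam1 p Hp (n, k%:Z) (n', k'%:Z)).
  + by rewrite xpair_eqE eqz_nat; case: (_ && _).
  + by rewrite /=; lia.
  + by rewrite /=; lia.
exists sigma; split; first by move=> n k kn; split; [exact: s0|exact: s2].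
move=> f Hf.
(* Here [sigma <f, PhiZhat> = <f, PhiZ> = <IH f, psiH>], so the singular series is the Fourier
   series of [IH f]. *)
pose F (N : nat) : R := qnorm gam (fun q => IH gam f q - \sum_(n < N) \sum_(k < n.+1)
  l2inner (@GH R) (w2 gam) (IH gam f) (psiH gam p n k) * psiH gam p n k q).
have -> : (fun N : nat => qnorm gam (fun q => IH gam f q - \sum_(n < N) \sum_(k < n.+1)
    (sigma n k)%:C * l2inner (@DH R) (w1 gam) f (PhiZhat gam p n k) * psiH gam p n k q)) = F.
  apply/funext => N; rewrite /F; apply: (congr1 (qnorm gam)); apply/funext => q.
  apply: (congr1 (fun u => IH gam f q - u)); apply: eq_bigr => n _; apply: eq_bigr => k _.
  apply: (congr1 (fun u => u * psiH gam p n k q)).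
  rewrite (ipZh _ _ _ Hf) (l2inner_IH_psi gam1 p _ _ Hf) mulrA -rmorphM divff ?mul1r//.
  by rewrite gt_eqF// s0// -ltnS.
exact: (qnorm_cvg gam1 Hp Hf).
Qed.
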